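(* Let $S$ be a smooth simply connected surface. Consider a complex metric $g$ on $S$, with induced Levi-Civita connection $\nabla$ and curvature $K$, and a $g$-self-adjoint bundle homomorphism $\Psi\colon\mathbb CTS\to\mathbb CTS$. The pair $(g,\Psi)$ satisfies $$1)\ d^\nabla\Psi\equiv 0,\qquad 2)\ K=-1+\det(\Psi),$$ if and only if there exists an isometric immersion $\sigma\colon S\to SL(2,\mathbb C)$ whose corresponding shape operator is $\Psi$. Moreover, such $\sigma$ is unique up to post-composition with elements of $\mathrm{Isom}_0(SL(2,\mathbb C))=(SL(2,\mathbb C)\times SL(2,\mathbb C))/\{\pm(I_2,I_2)\}$.
   Context: $SL(2,\mathbb C)\subset Mat(2,\mathbb C)$ is endowed with the holomorphic Riemannian metric $\langle AV,AW\rangle_A=\frac12\mathrm{tr}(VW)$ for $A\in SL(2,\mathbb C)$, $V,W\in\mathfrak{sl}(2,\mathbb C)$ (a multiple of the Killing form, transported by translations); it is the restriction of the bilinear form $\langle M,N\rangle=\frac12(\mathrm{tr}(MN)-\mathrm{tr}(M)\mathrm{tr}(N))$ on $Mat(2,\mathbb C)$. Here $(A,B)\in SL(2,\mathbb C)\times SL(2,\mathbb C)$ acts isometrically by $C\mapsto ACB^{-1}$. Manifolds are connected; $\mathbb CTS=TS\otimes_{\mathbb R}\mathbb C$. A complex metric on $S$ is a smooth section $g$ of symmetric $\mathbb C$-bilinear forms on $\mathbb CTS$, non-degenerate at every point. Its Levi-Civita connection is the unique torsion-free, $g$-compatible connection $\nabla$ on $\mathbb CTS$; $R(X,Y)Z=\nabla_X\nabla_YZ-\nabla_Y\nabla_XZ-\nabla_{[X,Y]}Z$,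 and $K=\frac{-g(R(X,Y)X,Y)}{g(X,X)g(Y,Y)-g(X,Y)^2}$ for any basis $X,Y$ of $\mathbb CT_pS$. $(d^\nabla\Psi)(X,Y)=\nabla_X(\Psi(Y))-\nabla_Y(\Psi(X))-\Psi([X,Y])$. For an immersion $\sigma\colon S\to SL(2,\mathbb C)$, $d\sigma$ is extended $\mathbb C$-linearly to $\mathbb CTS$; $\sigma$ is isometric if $\langle d\sigma(X),d\sigma(Y)\rangle=g(X,Y)$ for all $X,Y\in\mathbb CTS$. A normal vector field is a section $\nu$ of $\sigma^*TSL(2,\mathbb C)$ with $\langle\nu,\nu\rangle=1$, orthogonal to $d\sigma(\mathbb CTS)$ (unique up to sign); the shape operator with respect to $\nu$ is the endomorphism with, viewing $\nu$ as a $Mat(2,\mathbb C)$-valued function, $d\nu(X)=-d\sigma(\Psi(X))$. Sign convention: fix one of the two smooth sections $\eta$ of $\Lambda^2\mathbb CT^*S$ with $\eta=\pm1$ on $g$-orthonormal frames, and let $\omega_0$ be the left-invariant complex 3-form on $SL(2,\mathbb C)$ equal to $1$ on $\left(\begin{pmatrix}1&0\\0&-1\end{pmatrix},\begin{pmatrix}0&1\\1&0\end{pmatrix},\begin{pmatrix}0&-i\\i&0\end{pmatrix}\right)$ at $I_2$; $\nu$ is chosen so that $\omega_0(d\sigma(X_1),d\sigma(X_2),\nu)=1$ whenever $(X_1,X_2)$ is $g$-orthonormal with $\eta(X_1,X_2)=1$. *)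

(* Defs.v *)
From HB Require Import structures.
From mathcomp Require Import all_boot all_order all_algebra.
From mathcomp Require Import complex.
From mathcomp Require Import all_classical all_reals all_analysis.
Import Order.TTheory GRing.Theory Num.Theory.
Import numFieldNormedType.Exports.

Set Implicit Arguments.
Unset Strict Implicit.
Unset Printing Implicit Defensive.

Local Open Scope classical_set_scope.
Local Open Scope ring_scope.
Local Open Scope complex_scope.

Section Plane.
Variable R : realType.

Definition partial (i : 'I_2) (f : 'cV[R]_2 -> R) : 'cV[R]_2 -> R :=
  fun x => 'D_(delta_mx i 0) f x.

(* C^oo on an open set U: every iterated partial derivative is differentiable
   at every point of U. The values of f outside U are irrelevant. *)
Definition smooth_on (U : set 'cV[R]_2) (f : 'cV[R]_2 -> R) : Prop :=
  forall (s : seq 'I_2) (x : 'cV[R]_2), U x ->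
    differentiable (foldr partial f s) x.

End Plane.

Record chart (R : realType) (S : topologicalType) := Chart {
  cdom : set S;
  cmap : S -> 'cV[R]_2;
  cinv : 'cV[R]_2 -> S;
  cdom_open : open cdom;
  cimg_open : open (cmap @` cdom);
  cmapK : forall p, cdom p -> cinv (cmap p) = p;
  cmap_cont : forall p, cdom p -> {for p, continuous cmap};
  cinv_cont : forall x, (cmap @` cdom) x -> {for x, continuous cinv} }.

(* [chart_at] selects, for each point, one chart of the atlas around it; it
   only serves to name tangent vectors by their components (see [tact]). *)
Record surface (R : realType) := Surface {
  spoint :> topologicalType;
  atlas : set (chart R spoint);
  chart_at : spoint -> chart R spoint;
  atlas_chart_at : forall p, atlas (chart_at p);
  cdom_chart_at : forall p, cdom (chart_at p) p;
  atlas_smooth : forall c d, atlas c -> atlas d -> forall i : 'I_2,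
    smooth_on (cmap c @` (cdom c `&` cdom d))
              (fun x => cmap d (cinv c x) i 0);
  surface_hausdorff : hausdorff_space spoint;
  surface_second_countable : @second_countable spoint;
  surface_nonempty : [set: spoint] !=set0;
  surface_connected : connected [set: spoint] }.

Definition simply_connected (R : realType) (S : surface R) : Prop :=
  (forall p q : S, exists gam : R -> S,
     [/\ {within `[0, 1], continuous gam}, gam 0 = p & gam 1 = q]) /\
  (forall gam : R -> S,
     {within `[0, 1], continuous gam} -> gam 0 = gam 1 ->
     exists H : R * R -> S,
       [/\ {within `[0, 1] `*` `[0, 1], continuous H},
           forall t, t \in `[0, 1] -> H (0, t) = gam t,
           forall t, t \in `[0, 1] -> H (1, t) = gam 0 &
           forall s, s \in `[0, 1] -> H (s, 0) = gam 0 /\ H (s, 1) = gam 0]).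

Section Calculus.
Variables (R : realType) (S : surface R).
Local Notation C := R[i].

Definition smooth_fun (U : set S) (f : S -> C) : Prop :=
  forall c, atlas c ->
    smooth_on (cmap c @` (U `&` cdom c)) (fun x => complex.Re (f (cinv c x))) /\
    smooth_on (cmap c @` (U `&` cdom c)) (fun x => complex.Im (f (cinv c x))).

(* The complexified tangent space at p is C^2: the column v stands for
   v_0 d/dx_0 + v_1 d/dx_1 in the coordinates x of [chart_at p]; real tangent
   vectors are the real columns. [tact p v f] is the derivative v(f). *)
Definition tact (p : S) (v : 'cV[C]_2) (f : S -> C) : C :=
  let c := chart_at p in
  \sum_(i < 2) v i 0 *
    (partial i (fun x => complex.Re (f (cinv c x))) (cmap c p)
     +i* partial i (fun x => complex.Im (f (cinv c x))) (cmap c p)).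

Definition field := S -> 'cV[C]_2.

Definition fact (X : field) (f : S -> C) : S -> C := fun p => tact p (X p) f.

Definition coord (c : chart R S) (i : 'I_2) : S -> C :=
  fun p => (cmap c p i 0)%:C.

(* X(x_i) is the i-th component of X in the chart c with coordinates x; the
   columns X p themselves refer to the varying charts [chart_at p]. *)
Definition smooth_field (U : set S) (X : field) : Prop :=
  forall c, atlas c -> forall i, smooth_fun (U `&` cdom c) (fact X (coord c i)).

(* [X, Y] f = X (Y f) - Y (X f), for f the coordinates of [chart_at p]. *)
Definition bracket (X Y : field) : field := fun p =>
  \col_i (tact p (X p) (fact Y (coord (chart_at p) i))
          - tact p (Y p) (fact X (coord (chart_at p) i))).

(* Bilinear forms and endomorphisms of the complexified tangent bundle are
   given by their matrices in the coordinates of [chart_at p]. *)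
Definition form (g : S -> 'M[C]_2) (p : S) (v w : 'cV[C]_2) : C :=
  (v^T *m g p *m w) 0 0.

Definition formf (g : S -> 'M[C]_2) (X Y : field) : S -> C :=
  fun p => form g p (X p) (Y p).

Definition homf (Psi : S -> 'M[C]_2) (X : field) : field :=
  fun p => Psi p *m X p.

Definition smooth_form (g : S -> 'M[C]_2) : Prop :=
  forall U X Y, open U -> smooth_field U X -> smooth_field U Y ->
    smooth_fun U (formf g X Y).

Definition bundle_hom (Psi : S -> 'M[C]_2) : Prop :=
  forall U X, open U -> smooth_field U X -> smooth_field U (homf Psi X).

Definition complex_metric (g : S -> 'M[C]_2) : Prop :=
  [/\ smooth_form g,
      forall p v w, form g p v w = form g p w v &
      forall p v, (forall w, form g p v w = 0) -> v = 0].

Definition self_adjoint (g Psi : S -> 'M[C]_2) : Prop :=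
  forall p v w, form g p (Psi p *m v) w = form g p v (Psi p *m w).

Definition orthonormal (g : S -> 'M[C]_2) (p : S) (v w : 'cV[C]_2) : Prop :=
  [/\ form g p v v = 1, form g p w w = 1 & form g p v w = 0].

Definition area_form (g eta : S -> 'M[C]_2) : Prop :=
  [/\ smooth_form eta,
      forall p v, form eta p v v = 0 &
      forall p v w, orthonormal g p v w ->
        form eta p v w = 1 \/ form eta p v w = -1].

(* The axioms are imposed on sections over arbitrary open sets; locality of
   nabla follows from the Leibniz rule applied to indicators of open sets. *)
Definition connection (nabla : field -> field -> field) : Prop :=
  forall U, open U -> forall X X' Y Y' f,
    smooth_field U X -> smooth_field U X' ->
    smooth_field U Y -> smooth_field U Y' -> smooth_fun U f ->
    smooth_field U (nabla X Y) /\
    forall p, U p ->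
      [/\ nabla (fun q => X q + X' q) Y p = nabla X Y p + nabla X' Y p,
          nabla (fun q => f q *: X q) Y p = f p *: nabla X Y p,
          nabla X (fun q => Y q + Y' q) p = nabla X Y p + nabla X Y' p &
          nabla X (fun q => f q *: Y q) p =
            fact X f p *: Y p + f p *: nabla X Y p].

Definition torsion_free (nabla : field -> field -> field) : Prop :=
  forall U X Y, open U -> smooth_field U X -> smooth_field U Y ->
    forall p, U p -> nabla X Y p - nabla Y X p = bracket X Y p.

Definition compatible (g : S -> 'M[C]_2) (nabla : field -> field -> field) :=
  forall U X Y Z, open U ->
    smooth_field U X -> smooth_field U Y -> smooth_field U Z ->
    forall p, U p ->
      fact X (formf g Y Z) p =
      form g p (nabla X Y p) (Z p) + form g p (Y p) (nabla X Z p).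

Definition levi_civita (g : S -> 'M[C]_2) (nabla : field -> field -> field) :=
  [/\ connection nabla, torsion_free nabla & compatible g nabla].

Definition riemann (nabla : field -> field -> field) (X Y Z : field) : field :=
  fun p => nabla X (nabla Y Z) p - nabla Y (nabla X Z) p
           - nabla (bracket X Y) Z p.

Definition curvature (g : S -> 'M[C]_2) (nabla : field -> field -> field)
    (K : S -> C) : Prop :=
  forall U X Y, open U -> smooth_field U X -> smooth_field U Y ->
    forall p, U p -> basis_of {: 'cV[C]_2} [:: X p; Y p] ->
      K p = - form g p (riemann nabla X Y X p) (Y p) /
            (form g p (X p) (X p) * form g p (Y p) (Y p)
             - form g p (X p) (Y p) ^+ 2).

(* d^nabla Psi (X, Y) *)
Definition ext_nabla (nabla : field -> field -> field) (Psi : S -> 'M[C]_2)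
    (X Y : field) : field :=
  fun p => nabla X (homf Psi Y) p - nabla Y (homf Psi X) p
           - homf Psi (bracket X Y) p.

Definition codazzi (nabla : field -> field -> field) (Psi : S -> 'M[C]_2) :=
  forall U X Y, open U -> smooth_field U X -> smooth_field U Y ->
    forall p, U p -> ext_nabla nabla Psi X Y p = 0.

Definition mat2 (a b c d : C) : 'M[C]_2 :=
  \matrix_(i, j) (if i == 0 then if j == 0 then a else b
                  else if j == 0 then c else d).

Definition SL2 : set 'M[C]_2 := [set A | \det A = 1].

Definition tangent_SL2 (A : 'M[C]_2) : set 'M[C]_2 :=
  [set M | \tr (invmx A *m M) = 0].

Definition sl_form (A M N : 'M[C]_2) : C :=
  2%:R^-1 * \tr ((invmx A *m M) *m (invmx A *m N)).

Definition pauli (k : 'I_3) : 'M[C]_2 :=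
  match val k with
  | 0%N => mat2 1 0 0 (-1)
  | 1%N => mat2 0 1 1 0
  | _ => mat2 0 (- 'i) 'i 0
  end.

(* As tr (pauli k *m pauli l) / 2 = (k == l)%:R, a traceless V has coordinates
   tr (V *m pauli k) / 2 in the basis [pauli]; hence omega0 A is the
   left-translated alternating form with value 1 on [pauli] at A = 1. *)
Definition omega0 (A M1 M2 M3 : 'M[C]_2) : C :=
  \det (\matrix_(k < 3, l < 3)
    (2%:R^-1 * \tr (invmx A *m nth 0 [:: M1; M2; M3] l *m pauli k))).

Definition smooth_map (F : S -> 'M[C]_2) : Prop :=
  forall i j, smooth_fun setT (fun p => F p i j).

(* dF at p, extended C-linearly to the complexified tangent space. *)
Definition dmap (F : S -> 'M[C]_2) (p : S) (v : 'cV[C]_2) : 'M[C]_2 :=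
  \matrix_(i, j) tact p v (fun q => F q i j).

Definition immersion (sigma : S -> 'M[C]_2) : Prop :=
  [/\ smooth_map sigma, forall p, SL2 (sigma p) &
      forall p (v : 'cV[R]_2),
        dmap sigma p (map_mx (real_complex R) v) = 0 -> v = 0].

Definition isometric_immersion (g : S -> 'M[C]_2) (sigma : S -> 'M[C]_2) :=
  immersion sigma /\
  forall p v w,
    sl_form (sigma p) (dmap sigma p v) (dmap sigma p w) = form g p v w.

Definition normal_field (sigma nu : S -> 'M[C]_2) : Prop :=
  [/\ smooth_map nu,
      forall p, tangent_SL2 (sigma p) (nu p),
      forall p, sl_form (sigma p) (nu p) (nu p) = 1 &
      forall p v, sl_form (sigma p) (nu p) (dmap sigma p v) = 0].

Definition oriented_normal (g eta : S -> 'M[C]_2) (sigma nu : S -> 'M[C]_2) :=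
  normal_field sigma nu /\
  forall p v w, orthonormal g p v w -> form eta p v w = 1 ->
    omega0 (sigma p) (dmap sigma p v) (dmap sigma p w) (nu p) = 1.

Definition shape_operator (g eta : S -> 'M[C]_2) (sigma Psi : S -> 'M[C]_2) :=
  exists nu, oriented_normal g eta sigma nu /\
    forall p v, dmap nu p v = - dmap sigma p (Psi p *m v).

End Calculus.

(* Main.v *)
From HB Require Import structures.
From mathcomp Require Import all_boot all_order all_algebra.
From mathcomp Require Import complex.
From mathcomp Require Import all_classical all_reals all_analysis.
From mathcomp Require Import ring lra.
Require Import Defs.
Import Order.TTheory GRing.Theory Num.Theory.
Import numFieldNormedType.Exports.
Set Implicit Arguments.
Unset Strict Implicit.
Unset Printing Implicit Defensive.
Local Open Scope classical_set_scope.
Local Open Scope ring_scope.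
Local Open Scope complex_scope.

(** The four entries of an immersion into matrices and of its unit normal satisfy
    one and the same linear system, and the theorem is the theory of that system.

    An isometric immersion sigma with normal nu and shape operator Psi satisfies
    the Gauss and Weingarten formulas: each entry f of sigma, with the same entry
    n of nu, satisfies
      X (Y f) - (nabla_X Y) f = g(Psi X, Y) n + g(X, Y) f,   X n = - (Psi X) f
    (solution). In a chart the jet J = (f, d_0 f, d_1 f, n) solves a first order
    system d_i J = B_i J (connection_mx), and the products of position, coordinate
    fields and normal in the quadratic space of matrices with the form -det are
    the entries of a matrix N built from g (metric_mx) with
    d_i N = B_i N + N B_i^T, because nabla is compatible with g and Psi is
    self-adjoint.

    Let F be the curvature of the system. Commuting the second derivatives of N
    makes F N antisymmetric, so that F is determined by few entries: they are the
    exterior derivative of Psi and the difference of the two sides of the Gauss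
    equation. Hence the system is flat if and only if the Codazzi equation holds
    and K = -1 + det Psi (integrableP).

    If the system is flat, the Frobenius theorem (frobenius) gives fundamental
    matrices near each point. Their ratios are locally constant, so that on a
    simply connected surface they can be continued to a global solution with any
    initial value (parallel_frame, global_frame). If J is a solution, the derivative
    of J^-1 N J^-T is zero; a solution that has the right Gram matrix and
    orientation at one point therefore has them everywhere, and its first row is
    the immersion (exists_immersion).

    Conversely, the defects d_i J - B_i J of the jet of an isometric immersion with
    shape operator Psi vanish, by the argument that proves the uniqueness of the
    Levi-Civita connection (jet_equation). So J is an invertible solution, and the
    existence of such a solution forces F = 0 (solution_of_immersion).

    Finally, the frames J and J' of two immersions with the same data have constant
    ratio J^-1 J', which preserves the form -det and has determinant 1. Every such
    linear map of the space of matrices is M |-> A M B^-1 with A and B in SL(2)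
    (so4_spin), whence the uniqueness (unique_immersion). *)

(** * Calculus in the plane *)

Lemma sum2 (M : nmodType) (F : 'I_2 -> M) : \sum_(j < 2) F j = F 0 + F 1.
Proof.
rewrite big_ord_recl big_ord1; congr (F _ + F _); exact/val_inj.
Qed.

Lemma ord2P (i : 'I_2) : i = 0 \/ i = 1.
Proof. by case: i => [[|[|//]] p]; [left|right]; exact/val_inj. Qed.

Lemma near0_lt (K : numFieldType) (W : normedModType K) (r : K) : 0 < r ->
  \forall h \near (0 : W), `|h| < r.
Proof.
by move=> r0; apply/nbhs_ballP; exists r => //= y; rewrite -ball_normE /ball_ /= sub0r normrN.
Qed.

Section RealCalculus.
Variable R : realType.
Local Notation V := 'cV[R]_2.
Implicit Types (f g h : V -> R) (U W : set V) (i j : 'I_2).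
Local Notation e_ i := (delta_mx i 0 : V).

(** All remainders below are controlled by explicit bounds in eps, so the
    differential is characterised by such a bound instead of a little-o. *)
Lemma differentiable_from (V' W' : normedModType R) (f : V' -> W') x
    (df : {linear V' -> W'}) : continuous df ->
  (forall eps, 0 < eps -> \forall h \near (0 : V'),
      `|f (h + x) - f x - df h| <= eps * `|h|) ->
  differentiable f x /\ 'd f x = df :> (V' -> W').
Proof.
move=> cdf H.
have E : f \o shift x = cst (f x) + df +o_ 0 id.
  apply/eqaddoP => eps e0; near=> h.
  rewrite /= !fctE opprD addrA; near: h; exact: H.
have D := diff_unique cdf E.
split => //; apply/diff_locallyP; rewrite D; split => //.
Unshelve. all: by end_near. Qed.

Lemma differentiable_small (V' W' : normedModType R) (f : V' -> W') x :
  differentiable f x ->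
  forall eps, 0 < eps -> \forall h \near (0 : V'),
      `|f (h + x) - f x - 'd f x h| <= eps * `|h|.
Proof.
move=> /diff_locallyP [cd E] eps e0.
have /(_ _ e0) := (eqaddoP _ _ _ _).1 E.
by apply: filterS => h; rewrite /= !fctE opprD addrA.
Qed.

Lemma near_eq_differentiable (V' W' : normedModType R) (f g : V' -> W') x :
  (\near x, f x = g x) -> differentiable g x -> differentiable f x.
Proof.
move=> fg dg.
have fgx : f x = g x := nbhs_singleton fg.
apply: (proj1 (differentiable_from (df := 'd g x) _ _)).
  exact: diff_continuous.
move=> eps e0; near=> h.
rewrite fgx (_ : f (h + x) = g (h + x)); first by near: h; exact: differentiable_small.
near: h.
have : (h + x @[h --> (0 : V')]) --> x.
  by rewrite -[X in _ --> X]add0r; apply: cvgD => //; exact: cvg_cst.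
by move/(_ _ fg).
Unshelve. all: by end_near. Qed.

Lemma open_near U x : open U -> U x -> \near x, U x.
Proof. by move=> oU Ux; apply: open_nbhs_nbhs. Qed.

Lemma partialE f x i : differentiable f x -> partial i f x = 'd f x (e_ i).
Proof. by move=> df; rewrite /partial deriveE. Qed.

Lemma partial_near f g x i : (\near x, f x = g x) -> partial i f x = partial i g x.
Proof. by move=> fg; rewrite /partial; apply: near_eq_derive. Qed.

Lemma smooth_onP U f : smooth_on U f <->
  (forall x, U x -> differentiable f x) /\ forall i, smooth_on U (partial i f).
Proof.
split=> [sf|[df sf] s].
  split=> [x|i s x Ux]; first exact: (sf [::]).
  by have := sf (rcons s i) x Ux; rewrite foldr_rcons.
case/lastP: s => [|s i] x Ux; first exact: df.
by rewrite foldr_rcons; exact: sf.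
Qed.

Lemma smooth_diff U f x : smooth_on U f -> U x -> differentiable f x.
Proof. by move=> /smooth_onP [df _]; exact: df. Qed.

Lemma smooth_partial U f i : smooth_on U f -> smooth_on U (partial i f).
Proof. by move=> /smooth_onP [_]. Qed.

(** Iterated partial derivatives of a member of such a class stay in the class.
    Smoothness of a function thus follows by exhibiting a class that contains
    it, without computing a higher derivative. *)
Lemma smooth_coind U (P : (V -> R) -> Prop) : open U ->
  (forall f, P f -> forall x, U x -> differentiable f x) ->
  (forall f i, P f -> exists2 g, P g & forall x, U x -> partial i f x = g x) ->
  forall f, P f -> smooth_on U f.
Proof.
move=> oU dP sP f Pf s.
suff [g Pg fg] : exists2 g, P g & forall x, U x -> foldr (@partial R) f s x = g x.
  move=> x Ux; apply: near_eq_differentiable (dP _ Pg _ Ux).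
  by apply: filterS (open_near oU Ux) => y; exact: fg.
elim: s => [|i s [g Pg fg]] /=; first by exists f.
have [h Ph gh] := sP _ i Pg; exists h => // x Ux.
rewrite -gh //; apply: partial_near.
by apply: filterS (open_near oU Ux) => y; exact: fg.
Qed.

Lemma smooth_eq U f g : open U -> (forall x, U x -> f x = g x) ->
  smooth_on U g -> smooth_on U f.
Proof.
move=> oU fg sg.
apply: (@smooth_coind U (fun f => exists2 g, smooth_on U g & forall x, U x -> f x = g x) oU);
  last by exists g.
  move=> {f fg} f [h sh fh] x Ux; apply: near_eq_differentiable (smooth_diff sh Ux).
  by apply: filterS (open_near oU Ux) => y; exact: fh.
move=> {f fg} f i [h sh fh]; exists (partial i h).
  by exists (partial i h) => //; exact: smooth_partial.
move=> x Ux; apply: partial_near.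
by apply: filterS (open_near oU Ux) => y; exact: fh.
Qed.

Lemma smooth_sub U W f : W `<=` U -> smooth_on U f -> smooth_on W f.
Proof. by move=> WU sf s x /WU; exact: sf. Qed.

Lemma smooth_loc U f : (forall x, U x -> exists2 W, W x & smooth_on W f) ->
  smooth_on U f.
Proof. by move=> H s x Ux; have [W Wx /(_ s x Wx)] := H x Ux. Qed.

Lemma partial_cst (a : R) i x : partial i (fun=> a) x = 0.
Proof. by rewrite /partial derive_cst. Qed.

Lemma partialD f g x i : differentiable f x -> differentiable g x ->
  partial i (fun y => f y + g y) x = partial i f x + partial i g x.
Proof.
move=> df dg; rewrite /partial -deriveD //; exact: diff_derivable.
Qed.

Lemma partialM f g x i : differentiable f x -> differentiable g x ->
  partial i (fun y => f y * g y) x = f x * partial i g x + g x * partial i f x.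
Proof.
move=> df dg; rewrite /partial.
have := @deriveM R _ f g x (e_ i) (@diff_derivable _ _ _ _ _ _ df) (@diff_derivable _ _ _ _ _ _ dg).
by move=> ->.
Qed.

Lemma partialV f x i : differentiable f x -> f x != 0 ->
  partial i (fun y => (f y)^-1) x = - (f x)^-1 * (f x)^-1 * partial i f x.
Proof.
move=> df f0; rewrite /partial deriveV //; last exact: diff_derivable.
by rewrite /GRing.scale /= expr2 invfM !mulNr.
Qed.

(** The polynomial expressions in smooth functions and in new functions B. By
    the Leibniz rule they are stable under partial derivatives as soon as those
    of the members of B are such expressions again: reciprocals, composites and
    solutions of linear systems are shown to be smooth in this way. *)
Inductive smooth_closure U (B : (V -> R) -> Prop) : (V -> R) -> Prop :=
| SC_base f : B f -> smooth_closure U B f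
| SC_cst a : smooth_closure U B (fun=> a)
| SC_smooth f : smooth_on U f -> smooth_closure U B f
| SC_add f g : smooth_closure U B f -> smooth_closure U B g ->
    smooth_closure U B (fun x => f x + g x)
| SC_mul f g : smooth_closure U B f -> smooth_closure U B g ->
    smooth_closure U B (fun x => f x * g x).

Lemma smooth_closureP U (B : (V -> R) -> Prop) : open U ->
  (forall f, B f -> forall x, U x -> differentiable f x) ->
  (forall f i, B f -> exists2 g, smooth_closure U B g &
     forall x, U x -> partial i f x = g x) ->
  forall f, smooth_closure U B f -> smooth_on U f.
Proof.
move=> oU dB pB.
have D f : smooth_closure U B f -> forall x, U x -> differentiable f x.
  elim=> {f} [f Bf|a|f sf|f g _ Hf _ Hg|f g _ Hf _ Hg] x Ux.
  - exact: dB.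
  - exact: differentiable_cst.
  - exact: smooth_diff Ux.
  - by apply: differentiableD; [exact: Hf|exact: Hg].
  - by apply: differentiableM; [exact: Hf|exact: Hg].
apply: smooth_coind => // f i.
elim=> {f} [f Bf|a|f sf|f g Bf [f' Bf' Hf] Bg [g' Bg' Hg]|f g Bf [f' Bf' Hf] Bg [g' Bg' Hg]].
- exact: pB.
- by exists (fun=> 0); [exact: SC_cst|move=> x _; rewrite partial_cst].
- by exists (partial i f) => //; apply: SC_smooth; exact: smooth_partial.
- exists (fun x => f' x + g' x); first exact: SC_add.
  by move=> x Ux; rewrite partialD ?Hf ?Hg //; exact: D Ux.
- exists (fun x => f x * g' x + g x * f' x).
    by apply: SC_add; exact: SC_mul.
  by move=> x Ux; rewrite partialM ?Hf ?Hg //; exact: D Ux.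
Qed.

Lemma smooth_cst U (a : R) : open U -> smooth_on U (fun=> a).
Proof.
by move=> oU; apply: (smooth_closureP (B := fun=> False)) => //; exact: SC_cst.
Qed.

Lemma smoothD U f g : open U -> smooth_on U f -> smooth_on U g ->
  smooth_on U (fun x => f x + g x).
Proof.
move=> oU sf sg; apply: (smooth_closureP (B := fun=> False)) => //.
by apply: SC_add; exact: SC_smooth.
Qed.

Lemma smoothM U f g : open U -> smooth_on U f -> smooth_on U g ->
  smooth_on U (fun x => f x * g x).
Proof.
move=> oU sf sg; apply: (smooth_closureP (B := fun=> False)) => //.
by apply: SC_mul; exact: SC_smooth.
Qed.

Lemma smoothN U f : open U -> smooth_on U f -> smooth_on U (fun x => - f x).
Proof.
move=> oU sf; apply: (smooth_eq (g := fun x => -1 * f x)) => //.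
  by move=> x _; rewrite mulN1r.
by apply: smoothM => //; exact: smooth_cst.
Qed.

Lemma smoothV U f : open U -> smooth_on U f -> (forall x, U x -> f x != 0) ->
  smooth_on U (fun x => (f x)^-1).
Proof.
move=> oU sf f0.
apply: (smooth_closureP (B := eq (fun x => (f x)^-1))) => //; last exact: SC_base.
  move=> _ <- x Ux; apply: differentiableV; [exact: smooth_diff Ux|exact: f0].
move=> _ i <-.
exists (fun x => (-1 * (f x)^-1) * (f x)^-1 * partial i f x).
  apply: SC_mul; last by apply: SC_smooth; exact: smooth_partial.
  apply: SC_mul; last exact: SC_base.
  by apply: SC_mul; [exact: SC_cst|exact: SC_base].
move=> x Ux; rewrite partialV ?mulN1r //; [exact: smooth_diff Ux|exact: f0].
Qed.

Lemma smooth_coord U i : open U -> smooth_on U (fun x : V => x i 0).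
Proof.
move=> oU; apply: (smooth_closureP (B := eq (fun x : V => x i 0))) => //; last exact: SC_base.
  by move=> _ <- x _; exact: differentiable_coord.
move=> _ j <-; exists (fun=> (i == j)%:R); first exact: SC_cst.
move=> x _; rewrite /partial.
have := derive_mx (M := fun y : V => y) (t := x) (v := e_ j).
rewrite derive_id => H; have /(_ _)/matrixP/(_ i 0) := H; rewrite !mxE eqxx andbT => -> //.
Qed.

Lemma partial_comp f (phi : V -> V) x i :
  (forall j, differentiable (fun y => phi y j 0) x) -> differentiable f (phi x) ->
  partial i (fun y => f (phi y)) x =
  \sum_(j < 2) partial j f (phi x) * partial i (fun y => phi y j 0) x.
Proof.
move=> dphi df.
pose G (j : 'I_2) : V -> V := fun y => phi y j 0 *: e_ j.
have dG j : differentiable (G j) x by exact: differentiableZl.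
have phiE : phi = \sum_(j < 2) G j.
  by apply/funext => y; rewrite {1}[phi y]matrix_sum_delta fct_sumE; apply: eq_bigr => j _;
    rewrite big_ord1.
have dp : differentiable phi x by rewrite phiE; exact: differentiable_sum.
have D : 'd phi x (e_ i) = \sum_(j < 2) partial i (fun y => phi y j 0) x *: e_ j.
  rewrite -deriveE // {1}phiE derive_sum; last by move=> j; exact: diff_derivable.
  apply: eq_bigr => j _; rewrite deriveE //.
  by rewrite (diffZl (e_ j) (dphi j)) (partialE _ (dphi j)).
rewrite partialE; last exact: differentiable_comp.
rewrite (_ : (fun y => f (phi y)) = f \o phi) // diff_comp //= D linear_sum.
by apply: eq_bigr => j _; rewrite linearZ /= (partialE _ df) [RHS]mulrC.
Qed.

Lemma differentiable_entries (phi : V -> V) x :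
  (forall j, differentiable (fun y => phi y j 0) x) -> differentiable phi x.
Proof.
move=> dphi.
pose G (j : 'I_2) : V -> V := fun y => phi y j 0 *: e_ j.
have -> : phi = \sum_(j < 2) G j.
  by apply/funext => y; rewrite {1}[phi y]matrix_sum_delta fct_sumE; apply: eq_bigr => j _;
    rewrite big_ord1.
by apply: differentiable_sum => j; exact: differentiableZl.
Qed.

Lemma smooth_comp U W f (phi : V -> V) : open U -> open W ->
  (forall j, smooth_on U (fun y => phi y j 0)) -> (forall x, U x -> W (phi x)) ->
  smooth_on W f -> smooth_on U (fun x => f (phi x)).
Proof.
move=> oU oW sphi UW sf.
pose B (h : V -> R) := exists2 f, smooth_on W f & h = fun x => f (phi x).
apply: (smooth_closureP (B := B)) => //; last by apply: SC_base; exists f.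
  move=> _ [h sh ->] x Ux.
  have dphi : differentiable phi x.
    by apply: differentiable_entries => j; exact: smooth_diff (sphi j) Ux.
  by apply: differentiable_comp => //; apply: smooth_diff sh _; exact: UW.
move=> _ i [h sh ->].
exists (fun x => \sum_(j < 2) partial j h (phi x) * partial i (fun y => phi y j 0) x).
  have -> : (fun x => \sum_(j < 2) partial j h (phi x) * partial i (fun y => phi y j 0) x) =
    fun x => partial 0 h (phi x) * partial i (fun y => phi y 0 0) x +
     partial 1 h (phi x) * partial i (fun y => phi y 1 0) x.
    by apply/funext => x; rewrite sum2.
  apply: SC_add; apply: SC_mul.
  - by apply: SC_base; exists (partial 0 h) => //; exact: smooth_partial.
  - by apply: SC_smooth; apply: smooth_partial; exact: sphi.
  - by apply: SC_base; exists (partial 1 h) => //; exact: smooth_partial.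
  - by apply: SC_smooth; apply: smooth_partial; exact: sphi.
move=> x Ux; rewrite partial_comp //.
  by move=> j; exact: smooth_diff (sphi j) Ux.
by apply: smooth_diff sh _; exact: UW.
Qed.

Lemma entry_le (h : V) i : `|h i 0| <= `|h|.
Proof.
rewrite [leRHS]/Num.Def.normr/= mx_normrE.
exact: (@le_bigmax _ _ _ 0 (fun ij : 'I_2 * 'I_1 => `|h ij.1 ij.2|) (i, 0)).
Qed.

Lemma norm_le (h : V) (r : R) : (forall i, `|h i 0| <= r) -> `|h| <= r.
Proof.
move=> H; rewrite [leLHS]/Num.Def.normr/= mx_normrE bigmax_le //=.
  by apply: le_trans (H 0).
by move=> [i k] _ /=; rewrite (ord1 k); exact: H.
Qed.

Lemma norm_e i : `|e_ i| <= 1.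
Proof.
apply: norm_le => j; rewrite mxE eqxx andbT; case: (_ == _); rewrite ?normr1 ?normr0 //.
Qed.

Lemma line_derive f (x v : V) (t : R) : derivable f (t *: v + x) v ->
  is_derive t 1 (fun s : R => f (s *: v + x)) ('D_v f (t *: v + x)).
Proof.
move=> df; have E : (fun k : R => k^-1 *: (((fun s : R => f (s *: v + x)) \o shift t) (k *: 1)
    - f (t *: v + x))) = (fun k => k^-1 *: ((f \o shift (t *: v + x)) (k *: v) - f (t *: v + x))).
  by apply/funext => k /=; rewrite [k *: 1]mulr1 scalerDl addrA.
by apply: DeriveDef; rewrite ?/derivable ?/derive E.
Qed.

(** The mean value theorem for phi(t) - t L, on the side of 0 where s lies. *)
Lemma mvt_bound (phi dphi : R -> R) (s L eps : R) :
  (forall t : R, `|t| <= `|s| -> is_derive t 1 phi (dphi t)) ->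
  (forall t : R, `|t| <= `|s| -> `|dphi t - L| <= eps) ->
  `|phi s - phi 0 - s * L| <= eps * `|s|.
Proof.
move=> D B.
have C (a b : R) : `|a| <= `|s| -> `|b| <= `|s| -> a < b ->
    `|phi b - phi a - (b - a) * L| <= eps * (b - a).
  move=> sa sb ab.
  have I t : t \in `[a, b] -> `|t| <= `|s|.
    rewrite in_itv /= => /andP[at_ tb]; move: sa sb; rewrite !ler_norml => /andP[? _] /andP[_ ?].
    by rewrite (le_trans _ at_) // (le_trans tb).
  have [||c cab ->] := @MVT R phi dphi a b ab.
  - by move=> t tab; apply: D; apply: I; exact: subset_itv_oo_cc tab.
  - apply: derivable_within_continuous => t tab.
    by apply: (@ex_derive _ _ _ _ _ _ _ (D _ (I _ tab))).
  rewrite mulrC -mulrBr normrM mulrC (gtr0_norm (_ : 0 < b - a)) ?subr_gt0 //.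
  apply: ler_pM => //; first by rewrite subr_ge0 ltW.
  by apply: B; apply: I; exact: subset_itv_oo_cc cab.
have [s0|s0|<-] := ltgtP 0 s; last by rewrite normr0 mulr0 mul0r subrr subr0 normr0.
  have := C 0 s; rewrite normr0 normr_ge0 lexx s0 !subr0 => /(_ isT isT isT).
  by rewrite (gtr0_norm s0).
have := C s 0; rewrite normr0 normr_ge0 lexx s0 !sub0r => /(_ isT isT isT).
rewrite (ltr0_norm s0) -normrN; congr (`|_| <= _); ring.
Qed.

Lemma line_bound f (x v : V) (s L eps : R) :
  (forall t : R, `|t| <= `|s| -> derivable f (t *: v + x) v) ->
  (forall t : R, `|t| <= `|s| -> `|'D_v f (t *: v + x) - L| <= eps) ->
  `|f (s *: v + x) - f x - s * L| <= eps * `|s|.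
Proof.
move=> D B.
have := @mvt_bound (fun t => f (t *: v + x)) (fun t => 'D_v f (t *: v + x)) s L eps.
rewrite scale0r add0r; apply => // t ts; apply: line_derive; exact: D.
Qed.

Lemma col2E (h : V) : h = h 0 0 *: e_ 0 + h 1 0 *: e_ 1.
Proof.
rewrite {1}[h]matrix_sum_delta sum2 !big_ord1 //.
Qed.

Lemma step_le i j (t s r : R) : i != j -> `|t| <= r -> `|s| <= r ->
  `|t *: e_ i + s *: e_ j| <= r.
Proof.
move=> ij tr sr; apply: norm_le => k; rewrite !mxE eqxx !andbT.
have [->|ki] := eqVneq k i.
  by rewrite (negPf ij) mulr1 mulr0 addr0.
case: (_ == _); rewrite mulr0 add0r ?mulr1 ?mulr0 ?normr0 //.
exact: le_trans tr.
Qed.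

Lemma step1_le i (t r : R) : `|t| <= r -> `|t *: e_ i| <= r.
Proof.
move=> tr; rewrite normrZ (le_trans _ tr) // ler_piMr //; exact: norm_e.
Qed.

Lemma ballV (x y : V) (r : R) : ball x r y = (`|y - x| < r) :> Prop.
Proof. by rewrite -ball_normE /ball_ /= distrC. Qed.

(** The point y is joined to the centre by one segment along each axis; both
    stay in the ball because the norm is the maximum of the coordinates. *)
Lemma partial0_const f (x : V) (r : R) :
  (forall y, `|y - x| < r -> differentiable f y /\ forall i, partial i f y = 0) ->
  forall y, `|y - x| < r -> f y = f x.
Proof.
move=> H y; move: (y - x) (subrK x y) => h <- {y} hr.
have L z i (s : R) : (forall t, `|t| <= `|s| -> `|t *: e_ i + z - x| < r) ->
    f (s *: e_ i + z) = f z.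
  move=> I; apply/eqP; rewrite -subr_eq0 -normr_le0.
  have := @line_bound f z (e_ i) s 0 0; rewrite mulr0 subr0 mul0r; apply => t ts.
    by apply: diff_derivable; apply: (H _ (I _ ts)).1.
  by have := (H _ (I _ ts)).2 i; rewrite /partial => ->; rewrite subr0 normr0.
rewrite (col2E h) -addrA L; last first.
  move=> t th; rewrite addrA addrK; apply: le_lt_trans hr; apply: step_le => //.
    exact: le_trans (entry_le h 0).
  exact: entry_le.
apply: L => t th; rewrite addrK; apply: le_lt_trans hr; apply: step1_le.
exact: le_trans (entry_le h 1).
Qed.

(** The increment is a step along e_1 followed by a step along e_0. On each
    step the mean value inequality compares it with the partial derivative at
    x. *)
Lemma C1_differentiable f (x : V) :
  (\near x, forall i, derivable f x (e_ i)) ->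
  (forall i, {for x, continuous (partial i f)}) -> differentiable f x.
Proof.
move=> /nbhs_ballP [r0 /= r00 D] C.
pose df : V -> R := fun h : V => h 0 0 * partial 0 f x + h 1 0 * partial 1 f x.
have lin_df : linear df.
  by move=> a u v; rewrite /df !mxE [a *: _]mulrDr; ring.
pose L := GRing.isLinear.Build _ _ _ _ df lin_df.
pose dfl : {linear V -> R} := HB.pack df L.
apply: (proj1 (differentiable_from (df := dfl) _ _)).
  move=> y; apply: differentiable_continuous.
  rewrite (_ : GRing.Linear.sort dfl = fun h : V => h 0 0 * partial 0 f x + h 1 0 * partial 1 f x) //.
  by apply: differentiableD; apply: differentiableM => //; exact: differentiable_coord.
move=> eps e0.
have e20 : 0 < eps / 2 by rewrite divr_gt0.
have near_i i : exists2 r : R, 0 < r & forall y, `|y - x| < r -> `|partial i f y - partial i f x| <= eps / 2.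
  have /cvgrPdist_le /(_ _ e20) /nbhs_ballP [r /= r1 H] := C i.
  by exists r => // y yr; rewrite distrC; apply: H; rewrite ballV.
have [r1 r10 H0] := near_i 0; have [r2 r20 H1] := near_i 1.
pose r := Num.min r0 (Num.min r1 r2).
have rp : 0 < r by rewrite !lt_min r00 r10.
have Dr y i : `|y - x| < r -> derivable f y (e_ i).
  by rewrite lt_min => /andP[yr _]; apply: D; rewrite ballV.
have Hr y i : `|y - x| < r -> `|partial i f y - partial i f x| <= eps / 2.
  by rewrite !lt_min => /and3P[_ ? ?]; case: (ord2P i) => ->; [exact: H0|exact: H1].
apply: filterS (near0_lt V rp) => h hr.
have B1 : `|f (h 1 0 *: e_ 1 + x) - f x - h 1 0 * partial 1 f x| <= eps / 2 * `|h 1 0|.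
  have I t : `|t| <= `|h 1 0| -> `|t *: e_ 1 + x - x| < r.
    move=> th; rewrite addrK; apply: le_lt_trans hr; apply: step1_le.
    exact: le_trans (entry_le h 1).
  by apply: line_bound => t /I; [exact: Dr|exact: Hr].
have B0 : `|f (h 0 0 *: e_ 0 + (h 1 0 *: e_ 1 + x)) - f (h 1 0 *: e_ 1 + x) - h 0 0 * partial 0 f x| <= eps / 2 * `|h 0 0|.
  have I t : `|t| <= `|h 0 0| -> `|t *: e_ 0 + (h 1 0 *: e_ 1 + x) - x| < r.
    move=> th; rewrite addrA addrK; apply: le_lt_trans hr; apply: step_le => //.
      exact: le_trans (entry_le h 0).
    exact: entry_le.
  by apply: line_bound => t /I; [exact: Dr|exact: Hr].
rewrite (_ : f (h + x) = f (h 0 0 *: e_ 0 + (h 1 0 *: e_ 1 + x))); last first.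
  by rewrite addrA -col2E.
rewrite (_ : _ - _ - _ = (f (h 0 0 *: e_ 0 + (h 1 0 *: e_ 1 + x)) - f (h 1 0 *: e_ 1 + x) - h 0 0 * partial 0 f x) +
  (f (h 1 0 *: e_ 1 + x) - f x - h 1 0 * partial 1 f x)); last by rewrite /= /df; ring.
rewrite (le_trans (ler_normD _ _)) // (le_trans (lerD B0 B1)) //.
have := entry_le h 0; have := entry_le h 1; nra.
Qed.

(** The second difference is the increment over [0, s] of t |-> f(x + t e_i + s
    e_j) - f(x + t e_i), whose derivative is s times the mixed derivative up to
    an error eps s, because the i-th partial derivative of f is differentiable
    at x. *)
Lemma second_difference U f (x : V) i j (eps : R) : open U -> U x -> smooth_on U f -> 0 < eps ->
  \forall s \near (0 : R), `|f (s *: e_ i + (s *: e_ j + x)) - f (s *: e_ j + x)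
     - (f (s *: e_ i + x) - f x) - s * (s * partial j (partial i f) x)| <= eps * `|s| * `|s|.
Proof.
move=> oU Ux sf e0.
have e40 : 0 < eps / 4 by rewrite divr_gt0.
set P := partial i f.
have dP : differentiable P x by apply: smooth_diff Ux; exact: smooth_partial.
have /nbhs_ballP [r1 /= r10 B] := differentiable_small dP e40.
have /nbhs_ballP [r2 /= r20 UB] := open_near oU Ux.
have Bk (k : V) : `|k| < r1 -> `|P (k + x) - P x - 'd P x k| <= eps / 4 * `|k|.
  by move=> kr; apply: B; rewrite ballV subr0.
have Uk (k : V) : `|k| < r2 -> U (k + x).
  by move=> kr; apply: UB; rewrite ballV addrK.
have r0 : 0 < Num.min r1 r2 / 2 by rewrite divr_gt0 // lt_min r10.
apply: filterS (near0_lt R^o r0) => s sr.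
have sr1 : `|s| + `|s| < r1.
  by rewrite (lt_le_trans (ltrD sr sr)) // -splitr ge_min lexx.
have sr2 : `|s| + `|s| < r2.
  by rewrite (lt_le_trans (ltrD sr sr)) // -splitr ge_min lexx orbT.
have N2 t : `|t| <= `|s| -> `|t *: e_ i + s *: e_ j| <= `|s| + `|s|.
  by move=> ts; rewrite (le_trans (ler_normD _ _)) // lerD // step1_le.
have N1 t : `|t| <= `|s| -> `|t *: e_ i| <= `|s| by move=> ts; exact: step1_le.
have s_ge0 := normr_ge0 s.
have := @mvt_bound (fun t => f (t *: e_ i + (s *: e_ j + x)) - f (t *: e_ i + x))
  (fun t => P (t *: e_ i + (s *: e_ j + x)) - P (t *: e_ i + x)) s (s * partial j P x) (eps * `|s|).
rewrite !scale0r !add0r.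
rewrite (_ : _ - _ - _ - _ = f (s *: e_ i + (s *: e_ j + x)) - f (s *: e_ j + x) -
   (f (s *: e_ i + x) - f x) - s * (s * partial j P x)); last by ring.
apply => t ts.
  apply: is_deriveB; apply: line_derive; apply: diff_derivable; apply: smooth_diff sf _.
    by rewrite addrA; apply: Uk; exact: le_lt_trans (N2 _ ts) sr2.
  by apply: Uk; apply: le_lt_trans sr2; rewrite (le_trans (N1 _ ts)) // lerDl.
rewrite addrA.
have K2 := Bk _ (le_lt_trans (N2 _ ts) sr1).
have K1 : `|P (t *: e_ i + x) - P x - 'd P x (t *: e_ i)| <= eps / 4 * `|t *: e_ i|.
  by apply: Bk; apply: le_lt_trans sr1; rewrite (le_trans (N1 _ ts)) // lerDl.
move: K2; rewrite linearD /= [X in _ - (_ + X)]linearZ /= -partialE // => K2.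
rewrite (_ : _ - _ - _ = (P (t *: e_ i + s *: e_ j + x) - P x -
  ('d P x (t *: e_ i) + s *: partial j P x)) - (P (t *: e_ i + x) - P x - 'd P x (t *: e_ i)));
  last by rewrite /GRing.scale /=; ring.
rewrite (le_trans (ler_normB _ _)) // (le_trans (lerD K2 K1)) //.
have := N2 _ ts; have := N1 _ ts; nra.
Qed.

(** The second difference of f is symmetric in i and j, and divided by s^2 it
    tends to either mixed derivative. *)
Lemma schwarz U f (x : V) i j : open U -> U x -> smooth_on U f ->
  partial i (partial j f) x = partial j (partial i f) x.
Proof.
move=> oU Ux sf; apply/eqP; rewrite -subr_eq0 -normr_le0; apply/ler_addgt0Pl => eps e0; rewrite addr0.
have e20 : 0 < eps / 2 by rewrite divr_gt0.
(* The values a, b, c, d are those of f at the corners of a square of side s,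
   and p, q the two mixed derivatives. *)
have gen (a b c d p q s e : R) : 0 < s ->
    `|a - b - (c - d) - s * (s * p)| <= e / 2 * `|s| * `|s| ->
    `|a - c - (b - d) - s * (s * q)| <= e / 2 * `|s| * `|s| -> `|q - p| <= e.
  move=> s0; rewrite (gtr0_norm s0) => H1 H2; rewrite -(ler_pM2r s0) -(ler_pM2r s0).
  have -> : `|q - p| * s * s = `|(q - p) * s * s| by rewrite !normrM (gtr0_norm s0).
  have -> : (q - p) * s * s = (a - b - (c - d) - s * (s * p)) - (a - c - (b - d) - s * (s * q)).
    by ring.
  rewrite (le_trans (ler_normB _ _)) // (le_trans (lerD H1 H2)) //.
  by rewrite le_eqVlt; apply/orP; left; apply/eqP; field.
have := second_difference j i oU Ux sf e20.
move/(filterI (second_difference i j oU Ux sf e20))/nbhs_ballP => [r /= r0] /(_ (r / 2)).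
have s0 : 0 < r / 2 by rewrite divr_gt0.
case; first by rewrite /ball /= /ball_ sub0r normrN gtr0_norm // ltr_pdivrMr // ltr_pMr // ltr1n.
rewrite [_ *: e_ i + (_ *: e_ j + x)]addrCA /=; exact: gen.
Qed.

End RealCalculus.

(** * Complex and matrix valued functions *)

Section ComplexCalculus.
Variable R : realType.
Local Notation V := 'cV[R]_2.
Local Notation C := R[i].
Local Notation Re := complex.Re.
Local Notation Im := complex.Im.
Implicit Types (F G : V -> C) (U W : set V) (i j : 'I_2).

Lemma cReD (a b : C) : Re (a + b) = Re a + Re b. Proof. by case: a b => ? ? []. Qed.
Lemma cImD (a b : C) : Im (a + b) = Im a + Im b. Proof. by case: a b => ? ? []. Qed.
Lemma cReM (a b : C) : Re (a * b) = Re a * Re b + - (Im a * Im b). Proof. by case: a b => ? ? []. Qed.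
Lemma cImM (a b : C) : Im (a * b) = Re a * Im b + Im a * Re b. Proof. by case: a b => ? ? []. Qed.
Lemma complexP (a b : C) : Re a = Re b -> Im a = Im b -> a = b.
Proof. by case: a b => ? ? [? ?] /= -> ->. Qed.

Definition smoothC U F :=
  smooth_on U (fun x => Re (F x)) /\ smooth_on U (fun x => Im (F x)).

Definition dC i F : V -> C := fun x =>
  partial i (fun y => Re (F y)) x +i* partial i (fun y => Im (F y)) x.

Lemma smoothC_eq U F G : open U -> (forall x, U x -> F x = G x) ->
  smoothC U G -> smoothC U F.
Proof.
by move=> oU FG [sr si]; split; [apply: smooth_eq sr|apply: smooth_eq si] => // x /FG ->.
Qed.

Lemma smoothC_sub U W F : W `<=` U -> smoothC U F -> smoothC W F.
Proof. by move=> WU [a b]; split; exact: smooth_sub WU _. Qed.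

Lemma smoothC_loc U F : (forall x, U x -> exists2 W, W x & smoothC W F) -> smoothC U F.
Proof.
by move=> H; split; apply: smooth_loc => x /H [W Wx [? ?]]; exists W.
Qed.

Lemma smoothC_real U (f : V -> R) : open U -> smooth_on U f -> smoothC U (fun x => (f x)%:C).
Proof. by move=> oU sf; split => //=; exact: smooth_cst. Qed.

Lemma smoothC_cst U (a : C) : open U -> smoothC U (fun=> a).
Proof. by move=> oU; split; exact: smooth_cst. Qed.

Lemma smoothCD U F G : open U -> smoothC U F -> smoothC U G -> smoothC U (fun x => F x + G x).
Proof.
move=> oU [Fr Fi] [Gr Gi]; split.
  by apply: (smooth_eq _ _ (smoothD oU Fr Gr)) => // x _; rewrite cReD.
by apply: (smooth_eq _ _ (smoothD oU Fi Gi)) => // x _; rewrite cImD.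
Qed.

Lemma smoothCM U F G : open U -> smoothC U F -> smoothC U G -> smoothC U (fun x => F x * G x).
Proof.
move=> oU [Fr Fi] [Gr Gi]; split.
  apply: (smooth_eq _ _ (smoothD oU (smoothM oU Fr Gr) (smoothN oU (smoothM oU Fi Gi)))) => //.
  by move=> x _; rewrite cReM.
apply: (smooth_eq _ _ (smoothD oU (smoothM oU Fr Gi) (smoothM oU Fi Gr))) => //.
by move=> x _; rewrite cImM.
Qed.

Lemma smoothCN U F : open U -> smoothC U F -> smoothC U (fun x => - F x).
Proof.
move=> oU sF; apply: (smoothC_eq (G := fun x => -1 * F x)) => //.
  by move=> x _; rewrite mulN1r.
by apply: smoothCM => //; exact: smoothC_cst.
Qed.

Lemma smoothC_sum (I : Type) (r : seq I) (P : pred I) U (F : I -> V -> C) : open U ->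
  (forall k, P k -> smoothC U (F k)) -> smoothC U (fun x => \sum_(k <- r | P k) F k x).
Proof.
move=> oU sF; elim: r => [|k r IH].
  by apply: smoothC_eq (smoothC_cst 0 oU) => // x _; rewrite big_nil.
case Pk: (P k).
  by apply: (smoothC_eq _ _ (smoothCD oU (sF k Pk) IH)) => // x _; rewrite big_cons Pk.
by apply: (smoothC_eq _ _ IH) => // x _; rewrite big_cons Pk.
Qed.

Lemma smoothC_prod (I : Type) (r : seq I) (P : pred I) U (F : I -> V -> C) : open U ->
  (forall k, P k -> smoothC U (F k)) -> smoothC U (fun x => \prod_(k <- r | P k) F k x).
Proof.
move=> oU sF; elim: r => [|k r IH].
  by apply: smoothC_eq (smoothC_cst 1 oU) => // x _; rewrite big_nil.
case Pk: (P k).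
  by apply: (smoothC_eq _ _ (smoothCM oU (sF k Pk) IH)) => // x _; rewrite big_cons Pk.
by apply: (smoothC_eq _ _ IH) => // x _; rewrite big_cons Pk.
Qed.

Lemma smoothCV U F : open U -> smoothC U F -> (forall x, U x -> F x != 0) ->
  smoothC U (fun x => (F x)^-1).
Proof.
move=> oU [Fr Fi] F0.
pose N x := Re (F x) * Re (F x) + Im (F x) * Im (F x).
have sN : smooth_on U N by apply: smoothD => //; exact: smoothM.
have N0 x : U x -> N x != 0.
  move=> /F0; apply: contra_neq; rewrite /N -!expr2 => /eqP.
  rewrite paddr_eq0 ?sqr_ge0 // !sqrf_eq0 => /andP[/eqP a /eqP b].
  exact: complexP.
have sV := smoothV oU sN N0.
apply: (smoothC_eq (G := fun x => (Re (F x) * (N x)^-1) +i* (- Im (F x) * (N x)^-1))) => //.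
  by move=> x _; rewrite /N; case: (F x) => a b /=; rewrite -!expr2 mulNr.
by split => /=; apply: smoothM => //; exact: smoothN.
Qed.

Lemma smoothC_comp U W F (phi : V -> V) : open U -> open W ->
  (forall j, smooth_on U (fun y => phi y j 0)) -> (forall x, U x -> W (phi x)) ->
  smoothC W F -> smoothC U (fun x => F (phi x)).
Proof.
by move=> oU oW sp UW [Fr Fi]; split;
  [apply: (smooth_comp oU oW sp UW Fr)|apply: (smooth_comp oU oW sp UW Fi)].
Qed.

Lemma smoothC_dC U F i : smoothC U F -> smoothC U (dC i F).
Proof. by move=> [a b]; split; exact: smooth_partial. Qed.

Lemma dC_near F G i x : (\near x, F x = G x) -> dC i F x = dC i G x.
Proof.
by move=> FG; congr (_ +i* _); apply: partial_near; apply: filterS FG => y ->.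
Qed.

Lemma dC_cst (a : C) i x : dC i (fun=> a) x = 0.
Proof. by rewrite /dC !partial_cst. Qed.

Lemma dC_real (f : V -> R) i x : dC i (fun y => (f y)%:C) x = (partial i f x)%:C.
Proof. by rewrite /dC /= partial_cst. Qed.

Lemma dCD U F G i x : U x -> smoothC U F -> smoothC U G ->
  dC i (fun y => F y + G y) x = dC i F x + dC i G x.
Proof.
move=> Ux [Fr Fi] [Gr Gi]; rewrite /dC.
under eq_fun do rewrite cReD; under [in X in _ +i* X = _]eq_fun do rewrite cImD.
by rewrite !partialD //; apply: smooth_diff Ux.
Qed.

Lemma dCM U F G i x : open U -> U x -> smoothC U F -> smoothC U G ->
  dC i (fun y => F y * G y) x = dC i F x * G x + F x * dC i G x.
Proof.
move=> oU Ux [Fr Fi] [Gr Gi]; rewrite /dC.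
have D f : smooth_on U f -> differentiable f x by move=> sf; exact: smooth_diff Ux.
have -> : (fun y => Re (F y * G y)) = fun y => Re (F y) * Re (G y) + -1 * (Im (F y) * Im (G y)).
  by apply/funext => y; rewrite cReM mulN1r.
under [in X in _ +i* X = _]eq_fun do rewrite cImM.
have s1 : smooth_on U (fun=> -1 : R) by exact: smooth_cst.
rewrite (partialD _ (D _ (smoothM oU Fr Gr)) (D _ (smoothM oU s1 (smoothM oU Fi Gi)))).
rewrite (partialD _ (D _ (smoothM oU Fr Gi)) (D _ (smoothM oU Fi Gr))).
rewrite (partialM _ (D _ s1) (D _ (smoothM oU Fi Gi))) partial_cst.
rewrite (partialM _ (D _ Fr) (D _ Gr)) (partialM _ (D _ Fi) (D _ Gi)).
rewrite (partialM _ (D _ Fr) (D _ Gi)) (partialM _ (D _ Fi) (D _ Gr)).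
move: (partial _ _ _) (partial _ _ _) (partial _ _ _) (partial _ _ _) => a b c d.
case: (F x) (G x) => p q [r s] /=.
by apply: complexP => /=; ring.
Qed.

Lemma dC_sum (I : Type) (r : seq I) (P : pred I) U (F : I -> V -> C) i x : open U -> U x ->
  (forall k, P k -> smoothC U (F k)) ->
  dC i (fun x => \sum_(k <- r | P k) F k x) x = \sum_(k <- r | P k) dC i (F k) x.
Proof.
move=> oU Ux sF; elim: r => [|k r IH].
  rewrite big_nil; have -> : (fun y => \sum_(k <- [::] | P k) F k y) = fun=> 0.
    by apply/funext => y; rewrite big_nil.
  exact: dC_cst.
rewrite big_cons -IH; case Pk: (P k).
  rewrite -(dCD i Ux (sF k Pk) (smoothC_sum _ oU sF)).
  by congr (dC _ _ x); apply/funext => y; rewrite big_cons Pk.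
by congr (dC _ _ x); apply/funext => y; rewrite big_cons Pk.
Qed.

Lemma dC_comp W F (phi : V -> V) i x : open W ->
  (forall j, differentiable (fun y => phi y j 0) x) -> W (phi x) -> smoothC W F ->
  dC i (fun y => F (phi y)) x =
  \sum_(j < 2) (partial i (fun y => phi y j 0) x)%:C * dC j F (phi x).
Proof.
move=> oW dphi Wx [Fr Fi]; rewrite /dC.
rewrite (partial_comp _ dphi (smooth_diff Fr Wx)) (partial_comp _ dphi (smooth_diff Fi Wx)) !sum2.
do 6![move: (partial _ _ _) => ?].
by apply: complexP => /=; ring.
Qed.

Lemma schwarzC U F x i j : open U -> U x -> smoothC U F ->
  dC i (dC j F) x = dC j (dC i F) x.
Proof.
move=> oU Ux [Fr Fi]; rewrite /dC /=.
by rewrite (schwarz i j oU Ux Fr) (schwarz i j oU Ux Fi).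
Qed.

Lemma dC0_const F (x : V) (r : R) : smoothC (ball x r) F ->
  (forall y i, `|y - x| < r -> dC i F y = 0) ->
  forall y, `|y - x| < r -> F y = F x.
Proof.
move=> [Fr Fi] H y yr; apply: complexP.
  apply: (@partial0_const R (fun y => Re (F y)) x r _ y yr) => z zr; split; first by apply: smooth_diff Fr _; rewrite ballV.
  by move=> i; have [] := H z i zr.
apply: (@partial0_const R (fun y => Im (F y)) x r _ y yr) => z zr; split; first by apply: smooth_diff Fi _; rewrite ballV.
by move=> i; have [] := H z i zr.
Qed.

Definition smoothMx U m n (F : V -> 'M[C]_(m, n)) :=
  forall a b, smoothC U (fun x => F x a b).

Fact dM_key : unit. Proof. exact: tt. Qed.
(** Locked: unfolding it down to real partial derivatives would make
    unification in the sequel intractable. *)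
Definition dM i m n (F : V -> 'M[C]_(m, n)) : V -> 'M[C]_(m, n) :=
  locked_with dM_key (fun x => \matrix_(a, b) dC i (fun y => F y a b) x).

Lemma dME i m n (F : V -> 'M[C]_(m, n)) x a b :
  dM i F x a b = dC i (fun y => F y a b) x.
Proof. by rewrite /dM unlock mxE. Qed.

Lemma dM_near m n (F G : V -> 'M[C]_(m, n)) i x :
  (\near x, F x = G x) -> dM i F x = dM i G x.
Proof.
by move=> FG; apply/matrixP => a b; rewrite !dME; apply: dC_near; apply: filterS FG => y ->.
Qed.

Lemma smoothMxM U m n p (F : V -> 'M[C]_(m, n)) (G : V -> 'M[C]_(n, p)) : open U ->
  smoothMx U F -> smoothMx U G -> smoothMx U (fun x => F x *m G x).
Proof.
move=> oU sF sG a b; apply: (smoothC_eq (G := fun x => \sum_k F x a k * G x k b)) => //.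
  by move=> x _; rewrite mxE.
by apply: smoothC_sum => // k _; exact: smoothCM.
Qed.

Lemma smoothC_det U n (F : V -> 'M[C]_n) : open U ->
  smoothMx U F -> smoothC U (fun x => \det (F x)).
Proof.
move=> oU sF; apply: smoothC_sum => // s _; apply: smoothCM => //; first exact: smoothC_cst.
by apply: smoothC_prod.
Qed.

(** By the formula for the entries of the inverse as quotients of determinants. *)
Lemma smoothMx_inv U n (F : V -> 'M[C]_n) : open U ->
  smoothMx U F -> (forall x, U x -> F x \in unitmx) -> smoothMx U (fun x => invmx (F x)).
Proof.
move=> oU sF uF a b.
apply: (smoothC_eq (G := fun x => (\det (F x))^-1 * ((-1) ^+ (b + a) *
   \det (row' b (col' a (F x)))))) => //.
  by move=> x Ux; rewrite /invmx uF // !mxE.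
apply: smoothCM => //.
  apply: (smoothCV oU (smoothC_det oU sF)) => x /uF.
  by rewrite unitmxE unitfE.
apply: smoothCM => //; first exact: smoothC_cst.
apply: smoothC_det => // k l; apply: (smoothC_eq _ _ (sF (lift b k) (lift a l))) => //.
by move=> x _; rewrite !mxE.
Qed.

Lemma dMM U m n p (F : V -> 'M[C]_(m, n)) (G : V -> 'M[C]_(n, p)) i x : open U -> U x ->
  smoothMx U F -> smoothMx U G ->
  dM i (fun x => F x *m G x) x = dM i F x *m G x + F x *m dM i G x.
Proof.
move=> oU Ux sF sG; apply/matrixP => a b; rewrite !mxE dME -big_split /=.
have -> : (fun y => (F y *m G y) a b) = fun y => \sum_k F y a k * G y k b.
  by apply/funext => y; rewrite mxE.
rewrite (dC_sum _ _ oU Ux) => [|k _]; last exact: smoothCM.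
by apply: eq_bigr => k _; rewrite (dCM i oU Ux (sF a k) (sG k b)) !dME.
Qed.

Lemma dMD U m n (F G : V -> 'M[C]_(m, n)) i x : U x ->
  smoothMx U F -> smoothMx U G -> dM i (fun x => F x + G x) x = dM i F x + dM i G x.
Proof.
move=> Ux sF sG; apply/matrixP => a b; rewrite mxE !dME -(dCD i Ux (sF a b) (sG a b)).
by congr (dC _ _ x); apply/funext => y; rewrite mxE.
Qed.

Lemma dM_cst m n (A : 'M[C]_(m, n)) i x : dM i (fun=> A) x = 0.
Proof. by apply/matrixP => a b; rewrite dME mxE dC_cst. Qed.

Lemma dM_tr m n (F : V -> 'M[C]_(m, n)) i x : dM i (fun x => (F x)^T) x = (dM i F x)^T.
Proof.
apply/matrixP => a b; rewrite mxE !dME.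
by congr (dC _ _ x); apply/funext => y; rewrite mxE.
Qed.

(** Differentiation of the product of F with its inverse. *)
Lemma dM_inv U n (F : V -> 'M[C]_n) i x : open U -> U x ->
  smoothMx U F -> (forall x, U x -> F x \in unitmx) ->
  dM i (fun x => invmx (F x)) x = - (invmx (F x) *m dM i F x *m invmx (F x)).
Proof.
move=> oU Ux sF uF; have sI := smoothMx_inv oU sF uF.
have : dM i (fun x => F x *m invmx (F x)) x = 0.
  rewrite -(dM_cst (1%:M : 'M[C]_n) i x); apply: dM_near.
  by apply: filterS (open_near oU Ux) => y /uF; exact: mulmxV.
rewrite (dMM i oU Ux sF sI) => /eqP; rewrite addrC addr_eq0 => /eqP E.
move: (dM i (fun x => invmx (F x)) x) (dM i F x) E => D A E.
rewrite -(mulKmx (uF _ Ux) D) E.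
by rewrite mulmxN mulmxA.
Qed.

Lemma dM0_const m n (F : V -> 'M[C]_(m, n)) (x : V) (r : R) : smoothMx (ball x r) F ->
  (forall y i, `|y - x| < r -> dM i F y = 0) ->
  forall y, `|y - x| < r -> F y = F x.
Proof.
move=> sF H y yr; apply/matrixP => a b.
apply: (dC0_const (F := fun x => F x a b) (sF a b) _ yr) => z i zr.
by have /matrixP/(_ a b) := H z i zr; rewrite dME mxE.
Qed.

End ComplexCalculus.

(** * Antiderivatives depending on parameters *)

Lemma near_norm_lt (K : numFieldType) (W : normedModType K) (t : W) (r : K) :
  `|t| < r -> \near t, `|t| < r.
Proof.
move=> tr; apply/nbhs_ballP; exists (r - `|t|); first by rewrite /= subr_gt0.
move=> s; rewrite -ball_normE /ball_ /= => ts.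
have -> : s = t - (t - s) by rewrite opprB addrC subrK.
by rewrite (le_lt_trans (ler_normB _ _)) // -ltrBrDl.
Qed.

Section Antiderivative.
Variable R : realType.

(** The integral over [-2, x], normalised to vanish at 0. The range |x| <= 1
    suffices, as all domains are shrunk to radius at most 1. *)
Lemma prim_ex (f : R -> R) : continuous f ->
  exists F : R -> R, F 0 = 0 /\ forall x : R, `|x| <= 1 -> is_derive x 1 F (f x).
Proof.
move=> cf.
pose G (x : R) : R := (\int[@lebesgue_measure R]_(t in [set` `[-2, x]]) f t)%R.
have I : (@lebesgue_measure R).-integrable `[-2, 2] (EFin \o f).
  apply: continuous_compact_integrable; first exact: segment_compact.
  exact: continuous_subspaceT.
exists (fun x => G x - G 0); split; first by rewrite subrr.
move=> x; rewrite ler_norml => /andP[x1 x2].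
have [||D E] := @continuous_FTC1_closed R f (-2) x 2 _ I _ (cf x).
- by rewrite (le_lt_trans x2) // ltr1n.
- by rewrite (lt_le_trans _ x1) // ltrN2 ltr1n.
have DG : is_derive x 1 G (f x).
  by apply: (DeriveDef D); rewrite -derive1E; exact: E.
by have := is_deriveB DG (is_derive_cst (G 0) x 1); rewrite subr0.
Qed.

Definition prim (f : R -> R) : R -> R :=
  if pselect (continuous f) is left cf then sval (cid (prim_ex cf)) else fun=> 0.

Lemma prim0 f : prim f 0 = 0.
Proof. by rewrite /prim; case: pselect => //= cf; case: cid => F /= []. Qed.

Lemma prim_derive f (x : R) : continuous f -> `|x| <= 1 -> is_derive x 1 (prim f) (f x).
Proof. by rewrite /prim; case: pselect => //= cf _; case: cid => F /= [_]; apply. Qed.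

Lemma prim_bound (f g : R -> R) (s L eps : R) : continuous f -> continuous g -> `|s| <= 1 ->
  (forall t, `|t| <= `|s| -> `|f t - g t - L| <= eps) ->
  `|prim f s - prim g s - s * L| <= eps * `|s|.
Proof.
move=> cf cg s1 B.
have := @mvt_bound R (fun t => prim f t - prim g t) (fun t => f t - g t) s L eps.
rewrite !prim0 subrr subr0; apply => // t ts.
by apply: is_deriveB; apply: prim_derive => //; exact: le_trans s1.
Qed.

Lemma prim_bound1 (f : R -> R) (s eps : R) : continuous f -> `|s| <= 1 ->
  (forall t, `|t| <= `|s| -> `|f t| <= eps) -> `|prim f s| <= eps * `|s|.
Proof.
move=> cf s1 B.
have := @mvt_bound R (prim f) f s 0 eps.
rewrite prim0 subr0 mulr0 subr0; apply => // t ts.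
  by apply: prim_derive => //; exact: le_trans s1.
by rewrite subr0; exact: B.
Qed.

(** The difference of two functions with the same derivative has increment 0 by
    the mean value inequality. *)
Lemma prim_unique (f F : R -> R) (s : R) : continuous f -> `|s| <= 1 ->
  (forall t : R, `|t| <= `|s| -> is_derive t 1 F (f t)) -> prim f s = F s - F 0.
Proof.
move=> cf s1 D; apply/eqP; rewrite -subr_eq0 -normr_le0.
have := @mvt_bound R (fun t => prim f t - F t) (fun=> 0) s 0 0.
rewrite prim0 mulr0 mul0r !subr0 sub0r => H.
rewrite (_ : _ - _ = prim f s - F s - - F 0); last by ring.
apply: H => t ts; last by rewrite normr0.
have Dp : is_derive t 1 (prim f) (f t) by apply: prim_derive => //; exact: le_trans s1.
have DF := D t ts.
by have := is_deriveB Dp DF; rewrite subrr.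
Qed.

Lemma primB (f g h : R -> R) (s : R) : continuous f -> continuous g -> continuous h -> `|s| <= 1 ->
  (forall t, h t = f t - g t) -> prim h s = prim f s - prim g s.
Proof.
move=> cf cg ch s1 hE.
have := @prim_unique h (fun t => prim f t - prim g t) s ch s1.
rewrite !prim0 subrr subr0; apply => t ts; rewrite hE.
by apply: is_deriveB; apply: prim_derive => //; exact: le_trans s1.
Qed.

(** The retraction of the line onto [-r, r]. Composition with it turns
    functions and integrals defined near 0 into continuous functions on the
    whole line, so that no domain has to be carried along. *)
Definition clamp (r t : R) : R := Num.max (- r) (Num.min t r).

Lemma clamp_le r t : 0 <= r -> `|clamp r t| <= r.
Proof.
move=> r0; rewrite ler_norml /clamp le_max lexx /= ge_max ge_min lexx orbT andbT.
by rewrite ge0_cp.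
Qed.

Lemma clamp_id r t : `|t| <= r -> clamp r t = t.
Proof.
by rewrite ler_norml /clamp => /andP[a b]; rewrite (min_idPl b) (max_idPr a).
Qed.

Lemma clamp_continuous r : continuous (clamp r).
Proof.
move=> t; rewrite /clamp.
apply: (@continuous_max R R (fun=> - r) (fun t => Num.min t r)); first exact: cst_continuous.
by apply: (@continuous_min R R id (fun=> r)); [exact: id|exact: cst_continuous].
Qed.

End Antiderivative.

Lemma continuous_slice (X Y Z : topologicalType) (f : X * Y -> Z) (x : X) :
  continuous f -> continuous (fun y => f (x, y)).
Proof.
move=> cf y A /cf [[B1 B2] /= [nB1 nB2] H].
by apply: filterS nB2 => s B2s; apply: (H (x, s)); split => //=; exact: nbhs_singleton nB1.
Qed.

Section Parametric.
Variables (R : realType) (P : topologicalType).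

(** By compactness of [-r, r], continuity in q is uniform in t. *)
Lemma tube (psi : P * R -> R) (p : P) (r eps : R) : continuous psi -> 0 < eps ->
  \forall q \near p, forall t, `|t| <= r -> `|psi (q, t) - psi (p, t)| <= eps.
Proof.
move=> cpsi e0.
have /compact_near_coveringP cK := @segment_compact R (- r) r.
have H : \forall q \near p, `[- r, r]%classic `<=` (fun t => `|psi (q, t) - psi (p, t)| <= eps).
  apply: cK => t _.
  have e20 : 0 < eps / 2 by rewrite divr_gt0.
  have /cvgrPdist_le /(_ _ e20) := cpsi (p, t).
  have /cvgrPdist_le /(_ _ e20) := @continuous_slice _ _ _ psi p cpsi t.
  move=> A [[B1 B2] /= [nB1 nB2] B].
  exists ([set t' | `|psi (p, t) - psi (p, t')| <= eps / 2] `&` B2, B1) => /=.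
    by split => //; exact: filterI.
  move=> [t' q] /= [[At B2t] B1q].
  have := B (q, t') (conj B1q B2t) => /= Bq.
  rewrite (_ : _ - _ = (psi (p, t) - psi (p, t')) - (psi (p, t) - psi (q, t'))); last by ring.
  by rewrite (le_trans (ler_normB _ _)) // (splitr eps) lerD.
apply: filterS H => q H t tr; apply: H => /=.
by rewrite in_itv /= -ler_norml.
Qed.

Lemma prim_continuous (psi : P * R -> R) (r : R) : r <= 1 -> 0 <= r -> continuous psi ->
  continuous (fun x : P * R => prim (fun t => psi (x.1, t)) (clamp r x.2)).
Proof.
move=> r1 r0 cpsi [p t].
have c1 q : continuous (fun t => psi (q, t)) by exact: continuous_slice.
apply/cvgrPdist_le => eps e0.
have e20 : 0 < eps / 2 by rewrite divr_gt0.
have K s : `|clamp r s| <= 1 by apply: le_trans r1; exact: clamp_le.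
have cg : {for t, continuous (fun s => prim (fun t => psi (p, t)) (clamp r s))}.
  apply: (@continuous_comp _ _ _ (clamp r) (prim (fun t => psi (p, t)))).
    exact: clamp_continuous.
  apply: differentiable_continuous; apply/derivable1_diffP.
  exact: (@ex_derive _ _ _ _ _ _ _ (prim_derive (c1 p) (K t))).
have /cvgrPdist_le /(_ _ e20) Ht := cg.
have Hp := tube p r cpsi e20.
exists ([set q | forall t, `|t| <= r -> `|psi (q, t) - psi (p, t)| <= eps / 2],
  [set s | `|prim (fun t => psi (p, t)) (clamp r t) - prim (fun t => psi (p, t)) (clamp r s)| <= eps / 2]).
  by split.
move=> [q s] /= [Hq Hs].
rewrite (_ : _ - _ = (prim (fun t => psi (p, t)) (clamp r t) - prim (fun t => psi (p, t)) (clamp r s))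
 - (prim (fun t => psi (q, t)) (clamp r s) - prim (fun t => psi (p, t)) (clamp r s))); last by ring.
rewrite (le_trans (ler_normB _ _)) // (splitr eps) lerD //.
have := @prim_bound R _ _ (clamp r s) 0 (eps / 2) (c1 q) (c1 p) (K s).
rewrite mulr0 subr0 => H; apply: le_trans (H _) _.
  by move=> t' /le_trans t'r; rewrite subr0; apply: Hq; apply: t'r; exact: clamp_le.
by rewrite ler_piMr // ltW.
Qed.

End Parametric.

(** * Linear differential equations with parameters *)

Section Geometric.
Variable R : realType.

Lemma pow2_small (K eps : R) : 0 < eps -> exists m : nat, K / 2 ^+ m < eps.
Proof.
move=> e0; have [K0|K0] := leP K 0.
  by exists 0; rewrite expr0 divr1 (le_lt_trans K0).
have Ke : 0 <= K / eps by rewrite divr_ge0 // ltW.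
exists (Num.bound (K / eps)).
rewrite ltr_pdivrMr ?exprn_gt0 // -ltr_pdivrMl // mulrC.
apply: lt_le_trans (archi_boundP Ke) _.
by rewrite -natrX ler_nat ltnW // ltn_expl.
Qed.

(** The increments telescope below a geometric series, so the sequence is
    Cauchy and the bound on its tails passes to the limit. *)
Lemma geometric_limit (w : nat -> R) (K : R) :
  (forall m, `|w m.+1 - w m| <= K / 2 ^+ m) ->
  forall m, `|lim (w @ \oo) - w m| <= K * 2 / 2 ^+ m.
Proof.
move=> H.
have T m k : `|w (m + k)%N - w m| <= K * 2 / 2 ^+ m - K * 2 / 2 ^+ (m + k).
  elim: k => [|k IH]; first by rewrite addn0 !subrr normr0.
  rewrite (_ : _ - w m = (w (m + k).+1 - w (m + k)%N) + (w (m + k)%N - w m)); last by rewrite addnS; ring.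
  rewrite (le_trans (ler_normD _ _)) // (le_trans (lerD (H _) IH)) //.
  rewrite addnS exprS le_eqVlt; apply/orP; left; apply/eqP; field.
  by rewrite !expf_neq0.
have K0 : 0 <= K by have := le_trans (normr_ge0 _) (H 0); rewrite expr0 divr1.
have Tle m k : `|w (m + k)%N - w m| <= K * 2 / 2 ^+ m.
  by rewrite (le_trans (T m k)) // gerBl divr_ge0 ?mulr_ge0 // exprn_ge0.
have cvgw : cvgn w.
  apply/cauchy_cvgP/cauchy_exP => eps e0.
  have [m mE] := pow2_small (K * 2) e0.
  exists (w m); exists m => // k /= mk.
  rewrite -ball_normE /ball_ /= distrC -(subnKC mk).
  exact: le_lt_trans (Tle _ _) mE.
move=> m; apply/ler_addgt0Pl => eps e0.
have /cvgrPdist_le /(_ _ e0) [N _ HN] := cvgw.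
have := HN (m + N)%N (leq_addl _ _) => /= HN'.
rewrite (_ : _ - w m = (lim (w @ \oo) - w (m + N)%N) + (w (m + N)%N - w m)); last by ring.
by rewrite (le_trans (ler_normD _ _)) // lerD.
Qed.

End Geometric.

Lemma sum_continuous_at (R : realType) (T : topologicalType) (I : Type) (s : seq I) (F : I -> T -> R) x :
  (forall i, F i y @[y --> x] --> F i x) ->
  (\sum_(i <- s) F i y) @[y --> x] --> \sum_(i <- s) F i x.
Proof.
move=> cF; elim: s => [|i s IH].
  by rewrite big_nil; under eq_fun do rewrite big_nil; exact: cvg_cst.
by rewrite big_cons; under eq_fun do rewrite big_cons; apply: cvgD.
Qed.

Lemma sum_continuous (R : realType) (T : topologicalType) (I : Type) (s : seq I) (F : I -> T -> R) :
  (forall i, continuous (F i)) -> continuous (fun x => \sum_(i <- s) F i x).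
Proof. by move=> cF x; apply: sum_continuous_at => i; exact: cF. Qed.

Section LinearODE.
Variables (R : realType) (P : topologicalType) (n : nat).
Variables (A : 'I_n -> 'I_n -> P * R -> R) (c : 'I_n -> P -> R) (r M Cb : R).
Hypothesis cA : forall k l, continuous (A k l).
Hypothesis bA : forall k l x, `|A k l x| <= M.
Hypothesis r0 : 0 <= r.
Hypothesis r1 : r <= 1.
Hypothesis rM : r * (n%:R * M) <= 1 / 2.
Hypothesis cc : forall k, continuous (c k).
Hypothesis bc : forall k p, `|c k p| <= Cb.
Implicit Types u v : 'I_n -> P * R -> R.

Let app u k x := \sum_l A k l x * u l x.
Let step u k x := c k x.1 + prim (fun t => app u k (x.1, t)) (clamp r x.2).
Let picard m := iter m step (fun k x => c k x.1).

Let app_cont u k : (forall l, continuous (u l)) -> continuous (app u k).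
Proof.
move=> cu; apply: sum_continuous => l x.
by apply: cvgM; [exact: cA|exact: cu].
Qed.

Let app_bound u k x (d : R) : (forall l, `|u l x| <= d) -> `|app u k x| <= n%:R * M * d.
Proof.
move=> du; apply: le_trans (ler_norm_sum _ _ _) _.
apply: le_trans (_ : \sum_(l < n) M * d <= _).
  by apply: ler_sum => l _; rewrite normrM ler_pM.
by rewrite sumr_const card_ord -mulrA mulr_natl.
Qed.

Let step_cont u k : (forall l, continuous (u l)) -> continuous (step u k).
Proof.
move=> cu x; apply: cvgD.
  by apply: (@continuous_comp _ _ _ fst (c k)); [exact: cvg_fst|exact: cc].
by apply: prim_continuous => //; exact: app_cont.
Qed.

Let prim_app u k (p : P) t (d : R) : (forall l, continuous (u l)) -> 0 <= d ->
  (forall l x, `|u l x| <= d) -> `|prim (fun t => app u k (p, t)) (clamp r t)| <= d / 2.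
Proof.
move=> cu d0 du.
have ct : `|clamp r t| <= r by exact: clamp_le.
have := @prim_bound1 R (fun t => app u k (p, t)) (clamp r t) (n%:R * M * d)
  (continuous_slice (x := p) (app_cont (k:=k) cu)) (le_trans ct r1).
move=> H; apply: le_trans (H _) _; first by move=> *; exact: app_bound.
have nM0 : 0 <= n%:R * M * d by apply: le_trans (app_bound k (x := (p, 0)) (fun l => du l (p, 0))).
apply: le_trans (ler_wpM2l nM0 ct) _.
have := ler_wpM2r d0 rM; lra.
Qed.

Let step_contr u v k x (d : R) : (forall l, continuous (u l)) -> (forall l, continuous (v l)) ->
  0 <= d -> (forall l x, `|u l x - v l x| <= d) -> `|step u k x - step v k x| <= d / 2.
Proof.
move=> cu cv d0 duv.
have cuv l : continuous (fun x => u l x - v l x) by move=> y; apply: cvgB; [exact: cu|exact: cv].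
rewrite (_ : step u k x - step v k x = prim (fun t => app (fun l x => u l x - v l x) k (x.1, t)) (clamp r x.2)).
  exact: prim_app.
have ct : `|clamp r x.2| <= 1 by apply: le_trans r1; exact: clamp_le.
rewrite /step opprD addrACA subrr add0r.
symmetry; apply: primB => //.
- exact: (continuous_slice (x := x.1) (app_cont (k:=k) cu)).
- exact: (continuous_slice (x := x.1) (app_cont (k:=k) cv)).
- exact: (continuous_slice (x := x.1) (app_cont (k:=k) cuv)).
by move=> t; rewrite /app -sumrB; apply: eq_bigr => l _; rewrite mulrBr.
Qed.

Let picard_cont m k : continuous (picard m k).
Proof.
elim: m k => [|m IH] k; last exact: step_cont.
by move=> x; apply: (@continuous_comp _ _ _ fst (c k)); [exact: cvg_fst|exact: cc].
Qed.

Let picard_diff m k x : `|picard m.+1 k x - picard m k x| <= Cb / 2 / 2 ^+ m.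
Proof.
have Cb0 : 0 <= Cb by exact: le_trans (bc k x.1).
elim: m k x => [|m IH] k x.
  rewrite /= /step addrAC subrr add0r expr0 divr1; apply: prim_app => //.
  exact: (@picard_cont 0%N).
rewrite exprSr invfM mulrA.
have e0 : 0 <= Cb / 2 / 2 ^+ m by rewrite !divr_ge0 // exprn_ge0.
exact: (@step_contr (picard m.+1) (picard m) k x _ (@picard_cont m.+1) (@picard_cont m) e0 IH).
Qed.

(** The limit of the Picard iterates. With the time variable clamped and r
    small, the integral operator halves distances in the uniform norm over all
    parameters, so the limit is continuous in time and parameter jointly. *)
Definition flow k x := lim (picard m k x @[m --> \oo]).

Let flow_picard m k x : `|flow k x - picard m k x| <= Cb / 2 ^+ m.
Proof.
have := @geometric_limit R (fun m => picard m k x) (Cb / 2) (fun m => picard_diff m k x) m.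
by rewrite divfK.
Qed.

Lemma flow_bound k x : `|flow k x| <= 2 * Cb.
Proof.
have := flow_picard 0 k x; rewrite expr0 divr1 /= => H.
rewrite -(subrK (c k x.1) (flow k x)) (le_trans (ler_normD _ _)) //.
rewrite mulr_natl mulr2n; exact: lerD.
Qed.

Lemma flow_continuous k : continuous (flow k).
Proof.
move=> x; apply/cvgrPdist_le => eps e0.
have e30 : 0 < eps / 3 by rewrite divr_gt0.
have [m mE] := pow2_small Cb e30.
have /cvgrPdist_le /(_ _ e30) := @picard_cont m k x.
apply: filterS => y Hy.
rewrite (_ : _ - _ = (flow k x - picard m k x) + (picard m k x - picard m k y) - (flow k y - picard m k y));
  last by ring.
rewrite (le_trans (ler_normB _ _)) //.
have := flow_picard m k x; have := flow_picard m k y; have := ler_normD (flow k x - picard m k x) (picard m k x - picard m k y).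
move: Hy mE; lra.
Qed.

Lemma flow_fixed k x : flow k x = step flow k x.
Proof.
have Cb0 : 0 <= Cb by exact: le_trans (bc k x.1).
apply/eqP; rewrite -subr_eq0 -normr_le0; apply/ler_addgt0Pl => eps e0; rewrite addr0.
have e20 : 0 < eps / 2 by rewrite divr_gt0.
have [m mE] := pow2_small Cb e20.
have H1 := flow_picard m.+1 k x.
have H2 : `|picard m.+1 k x - step flow k x| <= Cb / 2 ^+ m / 2.
  have d0 : 0 <= Cb / 2 ^+ m by rewrite divr_ge0 // exprn_ge0.
  apply: (@step_contr (picard m) flow k x _ (@picard_cont m) flow_continuous d0).
  by move=> l y; rewrite distrC; exact: flow_picard.
rewrite (_ : _ - _ = (flow k x - picard m.+1 k x) + (picard m.+1 k x - step flow k x)); last by ring.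
rewrite (le_trans (ler_normD _ _)) // (le_trans (lerD H1 H2)) //.
have -> : Cb / 2 ^+ m.+1 = Cb / 2 ^+ m / 2 by rewrite exprSr invfM mulrA.
have : 0 <= Cb / 2 ^+ m by rewrite divr_ge0 // exprn_ge0.
move: mE; lra.
Qed.

Lemma flow0 k p : flow k (p, 0) = c k p.
Proof. by rewrite flow_fixed /step /= clamp_id ?normr0 // prim0 addr0. Qed.

Lemma flow_derive k p (t : R) : `|t| < r ->
  is_derive t 1 (fun s => flow k (p, s)) (\sum_l A k l (p, t) * flow l (p, t)).
Proof.
move=> tr; have t1 : `|t| <= 1 by rewrite (le_trans (ltW tr)).
have D := prim_derive (continuous_slice (x := p) (app_cont (k:=k) flow_continuous)) t1.
have := is_deriveD (is_derive_cst (c k p) t 1) D.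
rewrite add0r; apply: near_eq_is_derive; apply: filterS (_ : \near t, `|t| < r).
  by move=> s sr; rewrite [RHS]flow_fixed /step /= clamp_id // ltW.
exact: near_norm_lt.
Qed.

End LinearODE.

(** * Frobenius integrability *)

Lemma SC_sum (R : realType) (U : set 'cV[R]_2) B (I : Type) (s : seq I) (F : I -> 'cV[R]_2 -> R) :
  (forall k, smooth_closure U B (F k)) -> smooth_closure U B (fun x => \sum_(k <- s) F k x).
Proof.
move=> sF; elim: s => [|k s IH].
  rewrite (_ : (fun x => _) = fun=> 0); first exact: SC_cst.
  by apply/funext => x; rewrite big_nil.
rewrite (_ : (fun x => _) = fun x => F k x + \sum_(k <- s) F k x); first exact: SC_add.
by apply/funext => x; rewrite big_cons.
Qed.

Lemma near_eq_continuous (T U : topologicalType) (f g : T -> U) (x : T) :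
  (\near x, f x = g x) -> {for x, continuous g} -> {for x, continuous f}.
Proof.
move=> fg cg A; rewrite (nbhs_singleton fg) => /cg H.
have N : nbhs x (f @^-1` A) by apply: filterS2 fg H => y /= ->.
exact: N.
Qed.

Lemma pair_continuous (T U W : topologicalType) (f : T -> U) (g : T -> W) :
  continuous f -> continuous g -> continuous (fun x => (f x, g x)).
Proof.
move=> cf cg x A [[B1 B2] /= [n1 n2] H].
have N : nbhs x (f @^-1` B1 `&` g @^-1` B2) by apply: filterI; [exact: cf|exact: cg].
rewrite -[X in X A]/(fun B => nbhs x ((fun x => (f x, g x)) @^-1` B)) /=.
by apply: filterS N => y [b1 b2]; exact: (H (f y, g y)).
Qed.

Lemma fst_continuous (T U : topologicalType) : continuous (@fst T U).
Proof. by move=> x; exact: cvg_fst. Qed.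

Lemma snd_continuous (T U : topologicalType) : continuous (@snd T U).
Proof. by move=> x; exact: cvg_snd. Qed.

Lemma id_continuous (T : topologicalType) : continuous (fun x : T => x).
Proof. by move=> x; exact: cvg_id. Qed.

Section Frobenius.
Variable R : realType.
Local Notation V := 'cV[R]_2.
Local Notation e_ i := (delta_mx i 0 : V).

Lemma is_derive_from (f : R -> R) (b L : R) :
  (forall eps, 0 < eps -> \forall h \near (0 : R), `|f (h + b) - f b - h * L| <= eps * `|h|) ->
  is_derive b 1 f L.
Proof.
move=> H.
pose df : R -> R := fun h => h * L.
have lin_df : linear df by move=> a u v; rewrite /df mulrDl scalerAl.
pose dfl : {linear R -> R} := HB.pack df (GRing.isLinear.Build _ _ _ _ df lin_df).
have cdf : continuous dfl.
  by move=> y; apply: cvgM; [exact: cvg_id|exact: cvg_cst].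
have [D E] := @differentiable_from R R R f b dfl cdf H.
apply: DeriveDef; first exact/derivable1_diffP.
by rewrite deriveE // E /= /df mul1r.
Qed.

Lemma is_derive_small (f : R -> R) (b L : R) : is_derive b 1 f L ->
  forall eps, 0 < eps -> \forall h \near (0 : R), `|f (h + b) - f b - h * L| <= eps * `|h|.
Proof.
move=> D eps e0.
have d : differentiable f b by apply/derivable1_diffP; exact: (@ex_derive _ _ _ _ _ _ _ D).
have := differentiable_small d e0; apply: filterS => h.
rewrite (_ : 'd f b h = h * L) //.
by rewrite (diff1E d) /= derive1E (@derive_val _ _ _ _ _ _ _ D).
Qed.

Lemma is_deriveM_real (f g : R -> R) (b df dg : R) : is_derive b 1 f df -> is_derive b 1 g dg ->
  is_derive b 1 (fun x => f x * g x) (df * g b + f b * dg).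
Proof.
move=> Df Dg; rewrite addrC (mulrC df); exact: (is_deriveM Df Dg).
Qed.

(** Differentiation under the integral sign: by the mean value inequality and
    the uniformity of the tube lemma, the difference quotients of the integrand
    converge uniformly on the interval of integration. *)
Lemma prim_diff (psi dpsi : R * R -> R) (r a b : R) : r <= 1 ->
  continuous psi -> continuous dpsi -> `|a| <= r -> `|b| < r ->
  (forall b' : R, `|b'| < r -> forall s : R, `|s| <= r -> is_derive b' 1 (fun b => psi (b, s)) (dpsi (b', s))) ->
  is_derive b 1 (fun b => prim (fun s => psi (b, s)) a) (prim (fun s => dpsi (b, s)) a).
Proof.
move=> r1 cpsi cdpsi ar br D; apply: is_derive_from => eps e0.
have [d d0 T] := (nbhs_ballP _ _).1 (tube b r cdpsi e0).
have brp : 0 < r - `|b| by rewrite subr_gt0.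
pose del := Num.min d (r - `|b|).
have del0 : 0 < del by rewrite lt_min d0.
apply: filterS (near0_lt R^o del0) => h; rewrite lt_min => /andP[hd hr].
have a1 : `|a| <= 1 by exact: le_trans r1.
have c1 q : continuous (fun s => psi (q, s)) by exact: (continuous_slice (x := q)).
have c2 q : continuous (fun s => dpsi (q, s)) by exact: (continuous_slice (x := q)).
have c3 : continuous (fun s => psi (h + b, s) - psi (b, s)).
  by move=> y; apply: cvgB; [exact: (c1 (h + b))|exact: c1].
have c4 : continuous (fun s => h * dpsi (b, s)).
  by move=> y; apply: cvgM; [exact: cvg_cst|exact: c2].
rewrite -(primB (c1 (h + b)) (c1 b) c3 a1) //.
have -> : h * prim (fun s => dpsi (b, s)) a = prim (fun s => h * dpsi (b, s)) a.
  have := @prim_unique R _ (fun s => h * prim (fun s => dpsi (b, s)) s) _ c4 a1.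
  rewrite prim0 mulr0 subr0 => HH; symmetry; apply: HH => t ta.
  exact: (is_deriveZ h (prim_derive (c2 b) (le_trans ta a1))).
have := @prim_bound R _ _ a 0 (eps * `|h|) c3 c4 a1.
rewrite mulr0 subr0 => H; apply: le_trans (H _) _; last first.
  by rewrite ler_piMr // mulr_ge0 // ltW.
move=> s sa; rewrite subr0.
have := @mvt_bound R (fun t => psi (t + b, s)) (fun t => dpsi (t + b, s)) h (dpsi (b, s)) eps.
rewrite add0r; apply => t th.
  have tb : `|t + b| < r.
    rewrite (le_lt_trans (ler_normD _ _)) // (le_lt_trans (_ : _ <= `|h| + `|b|)) ?lerD2r //.
    by rewrite -ltrBrDr.
  have := is_derive_shift t 1 b; rewrite /shift => Ds.
  have := D _ tb s (le_trans sa ar).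
  move=> D1; apply: is_derive_from => e e1.
  have := is_derive_small D1 e1; apply: filterS => k.
  by rewrite addrA.
apply: T; last exact: le_trans sa ar.
rewrite -ball_normE /ball_ /= opprD addrCA subrr addr0 normrN; exact: le_lt_trans th hd.
Qed.

Definition pt (a b : R) : V := a *: e_ 0 + b *: e_ 1.

Lemma ptE (x : V) : x = pt (x 0 0) (x 1 0). Proof. exact: col2E. Qed.
Lemma pt_le a b r : `|a| <= r -> `|b| <= r -> `|pt a b| <= r.
Proof. exact: step_le. Qed.

Lemma continuous_pt (T : topologicalType) (f g : T -> R) (t : T) :
  {for t, continuous f} -> {for t, continuous g} -> {for t, continuous (fun s => pt (f s) (g s))}.
Proof.
by move=> cf cg; apply: cvgD; apply: cvgZr_tmp.
Qed.

Lemma is_derive_dir0 (J : R * R -> R) (x : V) (L : R) :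
  is_derive (x 0 0) 1 (fun s => J (s, x 1 0)) L -> is_derive x (e_ 0) (fun y : V => J (y 0 0, y 1 0)) L.
Proof.
move=> [d E].
have EE : (fun h : R => h^-1 *: (((fun y : V => J (y 0 0, y 1 0)) \o shift x) (h *: e_ 0) -
   J (x 0 0, x 1 0))) = (fun h => h^-1 *: (((fun s => J (s, x 1 0)) \o shift (x 0 0)) (h *: 1) - J (x 0 0, x 1 0))).
  apply/funext => h /=; rewrite !mxE /= !mulr0 add0r /GRing.scale /= //.
by apply: DeriveDef; rewrite /derivable /derive EE.
Qed.

Lemma is_derive_dir1 (J : R * R -> R) (x : V) (L : R) :
  is_derive (x 1 0) 1 (fun s => J (x 0 0, s)) L -> is_derive x (e_ 1) (fun y : V => J (y 0 0, y 1 0)) L.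
Proof.
move=> [d E].
have EE : (fun h : R => h^-1 *: (((fun y : V => J (y 0 0, y 1 0)) \o shift x) (h *: e_ 1) -
   J (x 0 0, x 1 0))) = (fun h => h^-1 *: (((fun s => J (x 0 0, s)) \o shift (x 1 0)) (h *: 1) - J (x 0 0, x 1 0))).
  apply/funext => h /=; rewrite !mxE /= !mulr0 add0r /GRing.scale /= //.
by apply: DeriveDef; rewrite /derivable /derive EE.
Qed.

Section Local.
Variables (n : nat) (B : 'I_2 -> 'I_n -> 'I_n -> V -> R) (Om : set V) (r M : R) (v : 'I_n -> R).
Hypothesis oOm : open Om.
Hypothesis sB : forall i k l, smooth_on Om (B i k l).
Hypothesis r0 : 0 < r.
Hypothesis r1 : r <= 1.
Hypothesis rM : r * (n%:R * M) <= 1 / 4.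
Hypothesis QOm : forall x, `|x| <= r -> Om x.
Hypothesis QB : forall x i k l, `|x| <= r -> `|B i k l x| <= M.
Hypothesis QdB : forall x k l, `|x| <= r -> `|partial 0 (B 1 k l) x| <= M.
Hypothesis flat : forall x k l, Om x ->
  partial 0 (B 1 k l) x + \sum_m B 1 k m x * B 0 m l x =
  partial 1 (B 0 k l) x + \sum_m B 0 k m x * B 1 m l x.

(* The coefficients are extended from the square of radius r to the plane by
   clamping both coordinates. *)
Let kap (x : R * R) : V := pt (clamp r x.1) (clamp r x.2).

Let kap_le x : `|kap x| <= r.
Proof. by apply: pt_le; apply: clamp_le; exact: ltW. Qed.

Let kap_cont : continuous kap.
Proof.
move=> x; apply: (@continuous_pt _ (fun x : R * R => clamp r x.1) (fun x => clamp r x.2)).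
  by apply: (@continuous_comp _ _ _ fst (clamp r)); [exact: cvg_fst|exact: clamp_continuous].
by apply: (@continuous_comp _ _ _ snd (clamp r)); [exact: cvg_snd|exact: clamp_continuous].
Qed.

Let cont_kap (T : topologicalType) f (g : T -> R * R) : smooth_on Om f -> continuous g ->
  continuous (fun x => f (kap (g x))).
Proof.
move=> sf cg x; apply: (@continuous_comp _ _ _ (fun x => kap (g x)) f).
  by apply: (@continuous_comp _ _ _ g kap); [exact: cg|exact: kap_cont].
apply: differentiable_continuous; apply: smooth_diff sf _; exact: QOm.
Qed.

Let c21 : continuous (fun x : R * R => (x.2, x.1)).
Proof. by apply: pair_continuous; [exact: snd_continuous|exact: fst_continuous]. Qed.

Let c20 : continuous (fun x : R * R => (x.2, 0 : R)).
Proof. by apply: pair_continuous; [exact: snd_continuous|exact: cst_continuous]. Qed.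

Let cid_ : continuous (fun x : R * R => x).
Proof. exact: id_continuous. Qed.

Let Cv := \sum_k `|v k|.
Let vCv k : `|v k| <= Cv.
Proof. by rewrite /Cv (bigD1 k) //= lerDl sumr_ge0. Qed.

Let nM0 : 0 <= n%:R * M.
Proof.
have H (k : 'I_n) : 0 <= M by apply: le_trans (QB 0 k k (_ : `|0| <= r)); rewrite ?normr0 // ltW.
case: (n) H => [|m] H; first by rewrite mul0r.
by rewrite mulr_ge0 //; exact: (H ord0).
Qed.

Let rM2 : r * (n%:R * M) <= 1 / 2.
Proof. by apply: le_trans rM _; lra. Qed.

Let A0 k l (x : R * R) := B 0 k l (kap (x.2, 0)).
Let A1 k l (x : R * R) := B 1 k l (kap x).
Let cA0 k l : continuous (A0 k l). Proof. exact: cont_kap. Qed.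
Let cA1 k l : continuous (A1 k l). Proof. exact: cont_kap. Qed.
Let bA0 k l x : `|A0 k l x| <= M. Proof. exact: QB. Qed.
Let bA1 k l x : `|A1 k l x| <= M. Proof. exact: QB. Qed.

(* Integration along a cross: w solves the equation in direction 0 on the first
   axis, and J solves the equation in direction 1 issued from w. It remains to
   see that J solves the equation in direction 0. To this end Jt integrates B_0
   J in direction 0 from the second axis; as Jt has the right derivative, it
   suffices that E = Jt - J vanishes. It does so on the first axis, and by
   flatness d_1 E is B_1 E minus the integral of (d_0 B_1) E; for small r this
   linear equation has only the zero solution. *)
Let w k (s : R) : R := flow A0 (fun k (p : R) => v k) r k (0, s).
Let cw k : continuous (w k).
Proof.
apply: (continuous_slice (x := 0 : R)); apply: (flow_continuous cA0 bA0 (ltW r0) r1 rM2) => //.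
by move=> l; exact: cst_continuous.
Qed.
Let bw k s : `|w k s| <= 2 * Cv.
Proof.
apply: (flow_bound cA0 bA0 (ltW r0) r1 rM2) => //.
by move=> l; exact: cst_continuous.
Qed.
Let w0 k : w k 0 = v k.
Proof.
apply: (flow0 cA0 bA0 (ltW r0) r1 rM2 _ (Cb := Cv)) => //.
by move=> l; exact: cst_continuous.
Qed.
Let dw k (s : R) : `|s| < r -> is_derive s 1 (w k) (\sum_l B 0 k l (pt s 0) * w l s).
Proof.
move=> sr.
have E l : B 0 k l (pt s 0) = A0 k l (0, s).
  by rewrite /A0 /kap /= !clamp_id ?normr0 // ltW.
rewrite (eq_bigr (fun l => A0 k l (0, s) * w l s)); last by move=> l _; rewrite E.
by apply: (flow_derive cA0 bA0 (ltW r0) r1 rM2 _ (Cb := Cv)) => // l; exact: cst_continuous.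
Qed.

Let J k : R * R -> R := flow A1 w r k.
Let cJ k : continuous (J k).
Proof. exact: (flow_continuous cA1 bA1 (ltW r0) r1 rM2 cw bw). Qed.
Let bJ k x : `|J k x| <= 2 * (2 * Cv).
Proof. exact: (flow_bound cA1 bA1 (ltW r0) r1 rM2 cw bw). Qed.
Let J0 k (a : R) : J k (a, 0) = w k a.
Proof. exact: (flow0 cA1 bA1 (ltW r0) r1 rM2 cw bw). Qed.
Let dJ k (a b : R) : `|b| < r -> is_derive b 1 (fun s => J k (a, s)) (\sum_l B 1 k l (kap (a, b)) * J l (a, b)).
Proof. exact: (flow_derive cA1 bA1 (ltW r0) r1 rM2 cw bw). Qed.

Let kapE (a b : R) : `|a| <= r -> `|b| <= r -> kap (a, b) = pt a b.
Proof. by move=> ar br; rewrite /kap /= !clamp_id. Qed.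

Let dline0 f (a b : R) : smooth_on Om f -> `|a| <= r -> `|b| <= r ->
  is_derive a 1 (fun s => f (pt s b)) (partial 0 f (pt a b)).
Proof.
move=> sf ar br; have := @line_derive R f (b *: e_ 1) (e_ 0) a.
apply; apply: diff_derivable; apply: smooth_diff sf _; apply: QOm; exact: pt_le.
Qed.

Let dline1 f (a b : R) : smooth_on Om f -> `|a| <= r -> `|b| <= r ->
  is_derive b 1 (fun s => f (pt a s)) (partial 1 f (pt a b)).
Proof.
move=> sf ar br; have := @line_derive R f (a *: e_ 0) (e_ 1) b.
rewrite /pt [a *: _ + _]addrC; under eq_fun do rewrite addrC.
apply; apply: diff_derivable; apply: smooth_diff sf _; apply: QOm; rewrite addrC; exact: pt_le.
Qed.

Let psi k (y : R * R) := \sum_l B 0 k l (kap (y.2, y.1)) * J l (y.2, y.1).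
Let dpsi k (y : R * R) :=
  \sum_l (partial 1 (B 0 k l) (kap (y.2, y.1)) * J l (y.2, y.1) +
    B 0 k l (kap (y.2, y.1)) * \sum_m B 1 l m (kap (y.2, y.1)) * J m (y.2, y.1)).

Let cJ21 l : continuous (fun y : R * R => J l (y.2, y.1)).
Proof. by move=> y; apply: (@continuous_comp _ _ _ (fun y : R * R => (y.2, y.1)) (J l)); [exact: c21|exact: cJ]. Qed.

Let cpsi k : continuous (psi k).
Proof.
by apply: sum_continuous => l y; apply: cvgM; [exact: (@cont_kap _ _ (fun y : R * R => (y.2, y.1)))|exact: cJ21].
Qed.

Let cdpsi k : continuous (dpsi k).
Proof.
apply: sum_continuous => l y; apply: cvgD; apply: cvgM.
- by apply: (@cont_kap _ _ (fun y : R * R => (y.2, y.1))) => //; exact: smooth_partial.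
- exact: cJ21.
- exact: (@cont_kap _ _ (fun y : R * R => (y.2, y.1))).
- by move: y; apply: sum_continuous => m y; apply: cvgM; [exact: (@cont_kap _ _ (fun y : R * R => (y.2, y.1)))|exact: cJ21].
Qed.

Let dpsiP k (b : R) : `|b| < r -> forall s : R, `|s| <= r ->
  is_derive b 1 (fun b => psi k (b, s)) (dpsi k (b, s)).
Proof.
move=> br s sr; rewrite /dpsi /=.
have E : (fun b => psi k (b, s)) = \sum_l (fun b => B 0 k l (kap (s, b)) * J l (s, b)).
  by apply/funext => y; rewrite fct_sumE.
rewrite E; apply: is_derive_sum => l.
have D1 : is_derive b 1 (fun b => B 0 k l (kap (s, b))) (partial 1 (B 0 k l) (pt s b)).
  apply: near_eq_is_derive (dline1 (sB 0 k l) sr (ltW br)).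
  by apply: filterS (near_norm_lt (W := R^o) br) => t tr; rewrite kapE // ltW.
rewrite -(kapE sr (ltW br)) in D1; exact: is_deriveM_real D1 (dJ l s br).
Qed.

Let Jt k (x : R * R) := J k (0, x.2) + prim (fun s => psi k (x.2, s)) (clamp r x.1).

Let Jt_0 k (b : R) : Jt k (0, b) = J k (0, b).
Proof. by rewrite /Jt /= clamp_id ?normr0 ?ltW // prim0 addr0. Qed.

Let cpsi1 k (b : R) : continuous (fun s => psi k (b, s)).
Proof. exact: (continuous_slice (x := b) (@cpsi k)). Qed.
Let cdpsi1 k (b : R) : continuous (fun s => dpsi k (b, s)).
Proof. exact: (continuous_slice (x := b) (@cdpsi k)). Qed.

Let lt_1 (a : R) : `|a| <= r -> `|a| <= 1. Proof. by move=> ar; exact: le_trans r1. Qed.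

Let Jt_b0 k (a : R) : `|a| < r -> Jt k (a, 0) = J k (a, 0).
Proof.
move=> ar; rewrite /Jt /= clamp_id ?ltW // !J0.
have -> : prim (fun s => psi k (0, s)) a = w k a - w k 0; last by rewrite addrC subrK.
apply: prim_unique; [exact: cpsi1|exact: lt_1 (ltW ar)|move=> t ta].
have tr : `|t| < r by exact: le_lt_trans ar.
have := dw k tr; congr (is_derive _ _ _ _).
by rewrite /psi /=; apply: eq_bigr => l _; rewrite J0 kapE ?normr0 // ltW.
Qed.

Let dJt0 k (a b : R) : `|a| < r -> `|b| <= r -> is_derive a 1 (fun s => Jt k (s, b)) (psi k (b, a)).
Proof.
move=> ar br.
have D : is_derive a 1 (prim (fun s => psi k (b, s))) (psi k (b, a)).
  by apply: prim_derive; [exact: cpsi1|exact: lt_1 (ltW ar)].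
have := is_deriveD (is_derive_cst (J k (0, b)) a 1) D; rewrite add0r.
apply: near_eq_is_derive; apply: filterS (near_norm_lt (W := R^o) ar) => t tr.
by rewrite /Jt /= clamp_id // ltW.
Qed.

Let cJt k (b : R) : continuous (fun s => Jt k (s, b)).
Proof.
rewrite (_ : (fun s => Jt k (s, b)) = fun s => J k (0, b) + prim (fun s => psi k (b, s)) (clamp r s)) //.
move=> s; apply: cvgD; first exact: cvg_cst.
apply: (@continuous_comp _ _ _ (clamp r) (prim (fun s => psi k (b, s)))).
  exact: clamp_continuous.
apply: differentiable_continuous; apply/derivable1_diffP.
apply: (@ex_derive _ _ _ _ _ _ _ (prim_derive (cpsi1 (b := b)) (lt_1 (clamp_le _ (ltW r0))))).
Qed.

Let E k (x : R * R) := Jt k x - J k x.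
Let chi k (b s : R) := \sum_l partial 0 (B 1 k l) (kap (s, b)) * E l (s, b).

Let cE k (b : R) : continuous (fun s => E k (s, b)).
Proof.
move=> s; apply: cvgB; first exact: cJt.
by apply: (@continuous_comp _ _ _ (fun s => (s, b)) (J k)); [apply: pair_continuous; [exact: id_continuous|exact: cst_continuous]|exact: cJ].
Qed.

Let cchi k (b : R) : continuous (chi k b).
Proof.
apply: sum_continuous => l s; apply: cvgM; last exact: cE.
apply: (@cont_kap _ _ (fun s : R => (s, b))); first exact: smooth_partial.
by apply: pair_continuous; [exact: id_continuous|exact: cst_continuous].
Qed.

Let G k (b s : R) := \sum_l B 1 k l (kap (s, b)) * Jt l (s, b).

Let prim_dpsi k (a b : R) : `|a| < r -> `|b| < r ->
  prim (fun s => dpsi k (b, s)) a = G k b a - G k b 0 - prim (chi k b) a.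
Proof.
move=> ar br; have a1 := lt_1 (ltW ar).
have cS : continuous (fun s => dpsi k (b, s) + chi k b s).
  by move=> s; apply: cvgD; [exact: cdpsi1|exact: cchi].
have H1 : prim (fun s => dpsi k (b, s) + chi k b s) a = G k b a - G k b 0.
  apply: prim_unique => // t ta; have tr : `|t| < r by exact: le_lt_trans ar.
  have EG : G k b = \sum_l (fun s => B 1 k l (kap (s, b)) * Jt l (s, b)).
    by apply/funext => y; rewrite fct_sumE.
  have DG : is_derive t 1 (G k b) (\sum_l (partial 0 (B 1 k l) (pt t b) * Jt l (t, b)
      + B 1 k l (kap (t, b)) * psi l (b, t))).
    rewrite EG; apply: is_derive_sum => l; apply: is_deriveM_real.
      have := dline0 (sB 1 k l) (ltW tr) (ltW br).
      apply: near_eq_is_derive; apply: filterS (near_norm_lt (W := R^o) tr) => s sr.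
      by rewrite kapE // ltW.
    exact: dJt0 (ltW br).
  move: DG; congr (is_derive _ _ _ _).
  rewrite /dpsi /chi /E /psi /= kapE ?ltW //.
  have Omx : Om (pt t b) by apply: QOm; apply: pt_le; exact: ltW.
  (* Flatness identifies the derivative of B_0 J in direction 1, up to the term
     in E, with that of B_1 Jt in direction 0. *)
  have fl l : partial 1 (B 0 k l) (pt t b) + \sum_m B 0 k m (pt t b) * B 1 m l (pt t b)
     = partial 0 (B 1 k l) (pt t b) + \sum_m B 1 k m (pt t b) * B 0 m l (pt t b) by rewrite flat.
  have swap (P Q : 'I_n -> 'I_n -> R) (j : 'I_n -> R) :
      \sum_l P k l * (\sum_m Q l m * j m) = \sum_l (\sum_m P k m * Q m l) * j l.
    under eq_bigr do rewrite mulr_sumr.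
    rewrite exchange_big /=; apply: eq_bigr => l _; rewrite mulr_suml.
    by apply: eq_bigr => m _; rewrite mulrA.
  rewrite !big_split /=.
  rewrite (swap (fun k l => B 1 k l (pt t b)) (fun k l => B 0 k l (pt t b)) (fun l => J l (t, b))).
  rewrite (swap (fun k l => B 0 k l (pt t b)) (fun k l => B 1 k l (pt t b)) (fun l => J l (t, b))).
  rewrite -!big_split /=; apply: eq_bigr => l _.
  rewrite -mulrDl fl; ring.
rewrite -H1; apply: (primB cS (@cchi k b) (@cdpsi1 k b) a1).
by move=> t; rewrite addrK.
Qed.

Let dE k (a b : R) : `|a| < r -> `|b| < r ->
  is_derive b 1 (fun s => E k (a, s)) (\sum_l B 1 k l (kap (a, b)) * E l (a, b) - prim (chi k b) a).
Proof.
move=> ar br.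
have D := prim_diff r1 (@cpsi k) (@cdpsi k) (ltW ar) br (@dpsiP k).
have := is_deriveB (is_deriveD (dJ k 0 br) D) (dJ k a br).
rewrite prim_dpsi //.
have -> : (fun s => E k (a, s)) = (fun s => J k (0, s)) + (fun s => prim (fun t => psi k (s, t)) a) - (fun s => J k (a, s)).
  by apply/funext => s; rewrite /E /Jt /= clamp_id ?ltW.
congr (is_derive _ _ _ _); rewrite /G /E.
under [in LHS]eq_bigr do rewrite -Jt_0.
under [in RHS]eq_bigr do rewrite mulrBr.
rewrite sumrB; do 3![move: (\sum_i _) => ?]; move: (prim _ _) => ?; ring.
Qed.

(* Both terms of d_1 E are at most n M m, where |E| <= m; the choice of r makes
   2 r n M at most 1 / 2. *)
Let E_half (m : R) : 0 <= m -> (forall k (a b : R), `|a| < r -> `|b| < r -> `|E k (a, b)| <= m) ->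
  forall k (a b : R), `|a| < r -> `|b| < r -> `|E k (a, b)| <= m / 2.
Proof.
move=> m0 Hm k a b ar br.
have := @mvt_bound R (fun s => E k (a, s)) (fun s => \sum_l B 1 k l (kap (a, s)) * E l (a, s) - prim (chi k s) a)
   b 0 (2 * (n%:R * M) * m).
have -> : E k (a, 0) = 0 by rewrite /E Jt_b0 // subrr.
rewrite mulr0 !subr0 => H.
have sum_le (P : 'I_n -> R) (c b' : R) : `|c| < r -> `|b'| < r -> (forall l, `|P l| <= M) ->
    `|\sum_l P l * E l (c, b')| <= n%:R * M * m.
  move=> cr b'r HP; apply: le_trans (ler_norm_sum _ _ _) _.
  apply: le_trans (_ : \sum_(l < n) M * m <= _).
    by apply: ler_sum => l _; rewrite normrM ler_pM // Hm.
  by rewrite sumr_const card_ord -mulrA mulr_natl.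
apply: le_trans (H _ _) _.
- by move=> t tb; apply: dE => //; exact: le_lt_trans br.
- move=> t tb; have tr : `|t| < r by exact: le_lt_trans br.
  rewrite subr0 (le_trans (ler_normB _ _)) //.
  rewrite (_ : 2 * _ * m = n%:R * M * m + n%:R * M * m); last by ring.
  apply: lerD; first by apply: sum_le => // l; exact: QB.
  apply: le_trans (prim_bound1 (@cchi k t) (lt_1 (ltW ar)) _) _.
    move=> s sa; apply: sum_le => //; first exact: le_lt_trans ar.
    by move=> l; exact: QdB.
  by apply: ler_piMr; [exact: mulr_ge0|exact: lt_1 (ltW ar)].
- have br' := ltW br; have mm : 0 <= n%:R * M * m by rewrite mulr_ge0.
  have := ler_wpM2l mm br'; have := ler_wpM2r m0 rM; lra.
Qed.

Let E0 k (a b : R) : `|a| < r -> `|b| < r -> E k (a, b) = 0.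
Proof.
pose m0 := 2 * (2 * Cv) + n%:R * M * (2 * (2 * Cv)) + 2 * (2 * Cv).
have Cv0 : 0 <= Cv by exact: sumr_ge0.
have c4 : 0 <= 2 * (2 * Cv) by rewrite !mulr_ge0.
have m00 : 0 <= m0 by rewrite !addr_ge0 // mulr_ge0.
have Eb : forall k (a b : R), `|a| < r -> `|b| < r -> `|E k (a, b)| <= m0.
  move=> {a b} {}k a b ar br.
  rewrite /E /Jt /= (le_trans (ler_normB _ _)) // lerD // (le_trans (ler_normD _ _)) // lerD //.
  rewrite (clamp_id (ltW ar)).
  apply: le_trans (prim_bound1 (eps := n%:R * M * (2 * (2 * Cv))) (cpsi1 (b := b)) (lt_1 (ltW ar)) _) _.
    move=> t _; apply: le_trans (ler_norm_sum _ _ _) _.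
    apply: le_trans (_ : \sum_(l < n) M * (2 * (2 * Cv)) <= _).
      by apply: ler_sum => l _; rewrite normrM ler_pM //; exact: QB.
    by rewrite sumr_const card_ord -mulrA [leRHS]mulr_natl.
  by apply: ler_piMr; [exact: mulr_ge0|exact: lt_1 (ltW ar)].
have En N : forall k (a b : R), `|a| < r -> `|b| < r -> `|E k (a, b)| <= m0 / 2 ^+ N.
  elim: N => [|N IH] ; first by rewrite expr0 divr1.
  have p0 : 0 <= m0 / 2 ^+ N by rewrite divr_ge0 // exprn_ge0.
  by rewrite exprSr invfM mulrA; exact: E_half p0 IH.
move=> ar br; apply/eqP; rewrite -normr_le0; apply/ler_addgt0Pl => eps e0; rewrite addr0.
have [N NE] := pow2_small m0 e0; apply: le_trans (ltW NE); exact: En.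
Qed.

Definition local_solution k (x : V) : R := J k (x 0 0, x 1 0).

Lemma local_solution_origin k : local_solution k 0 = v k.
Proof. by rewrite /local_solution !mxE J0 w0. Qed.

Let in_ball (x : V) : `|x| < r -> `|x 0 0| < r /\ `|x 1 0| < r.
Proof. by move=> xr; split; apply: le_lt_trans xr; exact: entry_le. Qed.

Let sol_derive i k (x : V) : `|x| < r ->
  is_derive x (e_ i) (local_solution k) (\sum_l B i k l x * local_solution l x).
Proof.
move=> xr; have [x0 x1] := in_ball xr.
have kE : kap (x 0 0, x 1 0) = x by rewrite kapE; [rewrite -ptE|exact: ltW|exact: ltW].
case: (ord2P i) => ->.
  apply: is_derive_dir0.
  have Dt := dJt0 k x0 (ltW x1).
  rewrite /psi /= kE in Dt.
  apply: near_eq_is_derive Dt; apply: filterS (near_norm_lt (W := R^o) x0) => t tr.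
  by apply/eqP; rewrite -subr_eq0 -/(E k (t, x 1 0)) E0.
by apply: is_derive_dir1; have := dJ k (x 0 0) x1; rewrite kE.
Qed.

Lemma local_solution_partial i k (x : V) : `|x| < r ->
  partial i (local_solution k) x = \sum_l B i k l x * local_solution l x.
Proof. by move=> /(sol_derive i k) D; rewrite /partial (@derive_val _ _ _ _ _ _ _ D). Qed.

Let sol_cont k : continuous (local_solution k).
Proof.
move=> x; apply: (@continuous_comp _ _ _ (fun x : V => (x 0 0, x 1 0)) (J k)); last exact: cJ.
by apply: pair_continuous => y; apply: differentiable_continuous; exact: differentiable_coord.
Qed.

(** The partial derivatives of the solution are sums of products of the
    coefficients and the solution itself. They are therefore continuous, and
    the class of polynomial expressions in the solution is stable under
    derivation. *)
Lemma local_solution_smooth k : smooth_on [set x | `|x| < r] (local_solution k).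
Proof.
have oball : open [set x : V | `|x| < r].
  rewrite (_ : [set x | _] = ball 0 r); first exact: ball_open.
  by apply/funext => x /=; rewrite ballV subr0.
apply: (smooth_closureP (B := fun f => exists k, f = local_solution k)) => //.
- move=> _ [l ->] x xr; apply: C1_differentiable.
    apply: filterS (near_norm_lt xr) => y yr i.
    exact: (@ex_derive _ _ _ _ _ _ _ (sol_derive i l yr)).
  move=> i.
  have cS : {for x, continuous (fun x => \sum_m B i l m x * local_solution m x)}.
    have QOx : Om x by apply: QOm; exact: ltW.
    apply: sum_continuous_at => m.
    exact: (continuousM (differentiable_continuous (smooth_diff (sB i l m) QOx)) (@sol_cont m x)).
  apply: near_eq_continuous cS.
  by apply: filterS (near_norm_lt xr) => y yr; rewrite local_solution_partial.
- move=> _ i [l ->]; exists (fun x => \sum_m B i l m x * local_solution m x).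
    apply: SC_sum => m; apply: SC_mul.
      apply: SC_smooth; apply: smooth_sub (sB i l m) => x /= xr; apply: QOm; exact: ltW.
    by apply: SC_base; exists m.
  by move=> x xr; exact: local_solution_partial.
- by apply: SC_base; exists k.
Qed.

End Local.

Lemma partial_shift (f : V -> R) (x0 y : V) i :
  partial i (fun y => f (y + x0)) y = partial i f (y + x0).
Proof.
rewrite /partial /derive.
have -> : (fun h : R => h^-1 *: (((fun y => f (y + x0)) \o shift y) (h *: e_ i) - f (y + x0))) =
  (fun h => h^-1 *: ((f \o shift (y + x0)) (h *: e_ i) - f (y + x0))).
  by apply/funext => h /=; rewrite addrA.
by [].
Qed.

Lemma open_shift (U : set V) (x0 : V) : open U -> open [set y | U (y + x0)].
Proof.
move=> oU; apply: (@open_comp _ _ (fun y : V => y + x0) U) => // y _.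
by apply: continuousD; [exact: id_continuous|exact: cst_continuous].
Qed.

Lemma smooth_shift (U : set V) (f : V -> R) (x0 : V) : open U ->
  smooth_on U f -> smooth_on [set y | U (y + x0)] (fun y => f (y + x0)).
Proof.
move=> oU sf; have oU' := open_shift (x0 := x0) oU.
apply: (smooth_comp (W := U)) => // j.
apply: (smooth_eq (g := fun y : V => y j 0 + x0 j 0)) => //; first by move=> y _; rewrite mxE.
by apply: smoothD => //; [exact: smooth_coord|exact: smooth_cst].
Qed.

Lemma smooth_bounded_near (U : set V) (f : V -> R) : open U -> U 0 -> smooth_on U f ->
  \forall x \near (0 : V), `|f x| <= `|f 0| + 1.
Proof.
move=> oU U0 sf.
have /cvgrPdist_le /(_ _ ltr01) := differentiable_continuous (smooth_diff sf U0).
apply: filterS => x fx; rewrite -(subrK (f 0) (f x)) addrC (le_trans (ler_normD _ _)) //.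
by rewrite lerD2l distrC.
Qed.

Lemma frobenius_origin n (B : 'I_2 -> 'I_n -> 'I_n -> V -> R) (Om : set V) :
  open Om -> Om 0 -> (forall i k l, smooth_on Om (B i k l)) ->
  (forall x k l, Om x ->
    partial 0 (B 1 k l) x + \sum_m B 1 k m x * B 0 m l x =
    partial 1 (B 0 k l) x + \sum_m B 0 k m x * B 1 m l x) ->
  exists2 r : R, 0 < r & (forall x, `|x| < r -> Om x) /\
    forall v : 'I_n -> R, exists u : 'I_n -> V -> R,
      [/\ forall k, u k 0 = v k, forall k, smooth_on [set x | `|x| < r] (u k) &
          forall i k x, `|x| < r -> partial i (u k) x = \sum_l B i k l x * u l x].
Proof.
move=> oO O0 sB flat.
(* The radius r depends on the bound M of the coefficients near the origin
   only, not on the initial value v. *)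
pose M : R := 1 + \sum_k \sum_l (\sum_i `|B i k l 0| + `|partial 0 (B 1 k l) 0|).
have M0 : 0 <= M.
  rewrite addr_ge0 // sumr_ge0 // => k _; rewrite sumr_ge0 // => l _.
  by rewrite addr_ge0 // sumr_ge0.
have bM k l : \sum_i `|B i k l 0| + `|partial 0 (B 1 k l) 0| + 1 <= M.
  rewrite [leRHS]addrC lerD2r (bigD1 k) //= (bigD1 l) //= -addrA lerDl addr_ge0 //.
    by rewrite sumr_ge0 // => j _; rewrite addr_ge0 // sumr_ge0.
  rewrite sumr_ge0 // => j _; rewrite sumr_ge0 // => j' _; by rewrite addr_ge0 // sumr_ge0.
pose bounded (ikl : 'I_2 * 'I_n * 'I_n) (x : V) : Prop :=
    `|B ikl.1.1 ikl.1.2 ikl.2 x| <= M /\ `|partial 0 (B 1 ikl.1.2 ikl.2) x| <= M.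
have nB1 ikl : \forall x \near (0 : V), bounded ikl x.
  case: ikl => -[i k] l.
  have H1 := smooth_bounded_near oO O0 (sB i k l).
  have H2 := smooth_bounded_near oO O0 (smooth_partial 0 (sB 1 k l)).
  apply: filterS2 H1 H2 => x a b; split.
    apply: le_trans a _; apply: le_trans (bM k l); rewrite lerD2r (bigD1 i) //= -addrA lerDl.
    by rewrite addr_ge0 // sumr_ge0.
  by apply: le_trans b _; apply: le_trans (bM k l); rewrite lerD2r lerDr sumr_ge0.
have nB : \forall x \near (0 : V), forall ikl, bounded ikl x.
  have := @filter_forall V _ bounded (nbhs (0 : V)) _ nB1; exact.
have nO : nbhs (0 : V) (Om `&` [set x | forall ikl, bounded ikl x]).
  by apply: filterI nB; exact: open_near.
have [d /= d0 Hd] := (nbhs_ballP _ _).1 nO.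
pose r := Num.min (d / 2) (Num.min 1 ((4 * (n%:R * M + 1))^-1)).
have nM1 : 0 < n%:R * M + 1 by rewrite ltr_wpDl // mulr_ge0.
have r0 : 0 < r by rewrite !lt_min divr_gt0 //= ltr01 invr_gt0 mulr_gt0.
have r1 : r <= 1 by rewrite !ge_min lexx orbT.
have rd : r < d.
  rewrite gt_min; apply/orP; left; rewrite ltr_pdivrMr // ltr_pMr // ltr1n //.
have rM : r * (n%:R * M) <= 1 / 4.
  apply: le_trans (_ : (4 * (n%:R * M + 1))^-1 * (n%:R * M + 1) <= _).
    apply: ler_pM => //; [exact: ltW|by rewrite mulr_ge0|by rewrite !ge_min lexx !orbT|by rewrite lerDl].
  by rewrite invfM -mulrA mulVf ?gt_eqF // mulr1 mul1r.
have inO x : `|x| <= r -> Om x /\ forall ikl, bounded ikl x.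
  by move=> xr; apply: Hd; rewrite ballV subr0; exact: le_lt_trans rd.
have QO x : `|x| <= r -> Om x by move=> /inO[].
have QB x i k l : `|x| <= r -> `|B i k l x| <= M by move=> /inO[_ H]; have [] := H (i, k, l).
have QdB x k l : `|x| <= r -> `|partial 0 (B 1 k l) x| <= M by move=> /inO[_ H]; have [] := H (0, k, l).
exists r => //; split; first by move=> x /ltW/QO.
move=> v; exists (local_solution B r v); split.
- by move=> k; exact: local_solution_origin sB r0 r1 rM QO QB k.
- by move=> k; exact: local_solution_smooth sB r0 r1 rM QO QB QdB flat k.
- by move=> i k x; exact: local_solution_partial sB r0 r1 rM QO QB QdB flat i k x.
Qed.

Lemma frobenius_real n (B : 'I_2 -> 'I_n -> 'I_n -> V -> R) (Om : set V) (x0 : V) :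
  open Om -> Om x0 -> (forall i k l, smooth_on Om (B i k l)) ->
  (forall x k l, Om x ->
    partial 0 (B 1 k l) x + \sum_m B 1 k m x * B 0 m l x =
    partial 1 (B 0 k l) x + \sum_m B 0 k m x * B 1 m l x) ->
  exists2 r : R, 0 < r & (forall x, ball x0 r x -> Om x) /\
    forall v : 'I_n -> R, exists u : 'I_n -> V -> R,
      [/\ forall k, u k x0 = v k, forall k, smooth_on (ball x0 r) (u k) &
          forall i k x, ball x0 r x -> partial i (u k) x = \sum_l B i k l x * u l x].
Proof.
move=> oO O0 sB flat.
have [] := @frobenius_origin n (fun i k l y => B i k l (y + x0)) [set y | Om (y + x0)].
- exact: open_shift.
- by rewrite /= add0r.
- by move=> i k l; exact: smooth_shift.
- by move=> x k l Ox; rewrite !partial_shift; exact: flat.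
move=> r r0 [rO sol]; exists r => //; split.
  by move=> x; rewrite ballV => /rO /=; rewrite subrK.
move=> v; have [u [u0 su du]] := sol v.
exists (fun k x => u k (x - x0)); split.
- by move=> k; rewrite subrr.
- move=> k; have oB : open [set x : V | `|x| < r].
    rewrite (_ : [set x | _] = ball 0 r); first exact: ball_open.
    by apply/funext => x /=; rewrite ballV subr0.
  have := smooth_shift (x0 := - x0) oB (su k); apply: smooth_sub => x.
  by rewrite ballV.
- move=> i k x; rewrite ballV => xr; rewrite (partial_shift (u k) (- x0)) du //.
  by apply: eq_bigr => l _; rewrite subrK.
Qed.

End Frobenius.

Section FrobeniusComplex.
Variable R : realType.
Local Notation V := 'cV[R]_2.
Local Notation C := R[i].
Local Notation Re := complex.Re.
Local Notation Im := complex.Im.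

(** The real matrix of size 2n of a complex linear map, in the splitting into
    real and imaginary parts. *)
Definition realify n (A : 'M[C]_n) (k l : 'I_(n + n)) : R :=
  match fintype.split k, fintype.split l with
  | inl a, inl b => Re (A a b)
  | inl a, inr b => - Im (A a b)
  | inr a, inl b => Im (A a b)
  | inr a, inr b => Re (A a b)
  end.

Lemma split_lshift n (k : 'I_n) : fintype.split (lshift n k) = inl k.
Proof. exact: (unsplitK (inl k)). Qed.
Lemma split_rshift n (k : 'I_n) : fintype.split (rshift n k) = inr k.
Proof. exact: (unsplitK (inr k)). Qed.

Lemma Re_sum (I : Type) (s : seq I) (F : I -> C) : Re (\sum_(k <- s) F k) = \sum_(k <- s) Re (F k).
Proof. by elim: s => [|k s IH]; rewrite ?big_nil ?big_cons ?cReD ?IH. Qed.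

Lemma Im_sum (I : Type) (s : seq I) (F : I -> C) : Im (\sum_(k <- s) F k) = \sum_(k <- s) Im (F k).
Proof. by elim: s => [|k s IH]; rewrite ?big_nil ?big_cons ?cImD ?IH. Qed.

Lemma Re_mulmx m n p (A : 'M[C]_(m, n)) (A' : 'M[C]_(n, p)) a c :
  Re ((A *m A') a c) = \sum_k Re (A a k) * Re (A' k c) + \sum_k - (Im (A a k) * Im (A' k c)).
Proof. by rewrite mxE Re_sum -big_split; apply: eq_bigr => k _; rewrite cReM. Qed.

Lemma Im_mulmx m n p (A : 'M[C]_(m, n)) (A' : 'M[C]_(n, p)) a c :
  Im ((A *m A') a c) = \sum_k Re (A a k) * Im (A' k c) + \sum_k Im (A a k) * Re (A' k c).
Proof. by rewrite mxE Im_sum -big_split; apply: eq_bigr => k _; rewrite cImM. Qed.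

Lemma realifyD n (A A' : 'M[C]_n) k l : realify (A + A') k l = realify A k l + realify A' k l.
Proof.
rewrite /realify; case: fintype.split => a; case: fintype.split => b; rewrite mxE ?cReD ?cImD //.
by rewrite opprD.
Qed.

Lemma realifyM n (A A' : 'M[C]_n) k l : realify (A *m A') k l = \sum_m realify A k m * realify A' m l.
Proof.
rewrite big_split_ord /= /realify.
under [X in _ = X + _]eq_bigr do rewrite split_lshift.
under [X in _ = _ + X]eq_bigr do rewrite split_rshift.
case: fintype.split => a; case: fintype.split => b; rewrite ?Re_mulmx ?Im_mulmx.
- by congr (_ + _); apply: eq_bigr => m _; rewrite mulNr.
- by rewrite opprD -!sumrN; congr (_ + _); apply: eq_bigr => m _; rewrite ?mulNr ?mulrN.
- by rewrite addrC.
- by rewrite addrC; congr (_ + _); apply: eq_bigr => m _; rewrite mulrN.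
Qed.

Lemma realify_partial n (F : V -> 'M[C]_n) (U : set V) i x k l : U x -> smoothMx U F ->
  partial i (fun y => realify (F y) k l) x = realify (dM i F x) k l.
Proof.
move=> Ux sF; rewrite /realify; case: fintype.split => a; case: fintype.split => b; rewrite dME //=.
by rewrite /partial deriveN //; apply: diff_derivable; apply: smooth_diff Ux; have [_] := sF a b.
Qed.

(** Splitting into real and imaginary parts turns the system into a real one
    with twice as many unknowns, which is flat as well because realification is
    a ring morphism commuting with derivatives. The columns of Th are the
    solutions with the standard basis as initial values. *)
Theorem frobenius n (B : 'I_2 -> V -> 'M[C]_n) (Om : set V) (x0 : V) :
  open Om -> Om x0 -> (forall i, smoothMx Om (B i)) ->
  (forall x, Om x -> dM 0 (B 1) x + B 1 x *m B 0 x = dM 1 (B 0) x + B 0 x *m B 1 x) ->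
  exists2 r : R, 0 < r & (ball x0 r `<=` Om) /\
    exists Th : V -> 'M[C]_n,
      [/\ Th x0 = 1%:M, smoothMx (ball x0 r) Th &
          forall i x, ball x0 r x -> dM i Th x = B i x *m Th x].
Proof.
move=> oO O0 sB flat.
pose b i k l x := realify (B i x) k l.
have sb i k l : smooth_on Om (b i k l).
  rewrite /b /realify; case: fintype.split => a; case: fintype.split => c; try exact: (sB i a c).1; try exact: (sB i a c).2.
  by apply: smoothN => //; exact: (sB i a c).2.
have [] := @frobenius_real R (n + n) b Om x0 oO O0 sb.
  move=> x k l Ox; rewrite /b !(realify_partial _ _ _ Ox (sB _)) -!realifyM -!realifyD.
  by rewrite flat.
move=> r r0 [rO sol]; exists r => //; split => //.
pose v (c : 'I_n) (k : 'I_(n + n)) : R := if fintype.split k is inl a then (a == c)%:R else 0.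
have [u Hu] := choice (fun c => sol (v c)).
exists (fun x => \matrix_(k, c) (u c (lshift n k) x +i* u c (rshift n k) x)); split.
- apply/matrixP => k c; have [h _ _] := Hu c; rewrite !mxE !h /v split_lshift split_rshift.
  by case: (k == c).
- move=> k c; have [_ h _] := Hu c; split; apply: smooth_eq (h _); try exact: ball_open;
  by move=> x _; rewrite mxE.
- move=> i x xr; apply/matrixP => k c; have [_ _ h] := Hu c; rewrite dME /dC.
  have -> : (fun y => Re ((\matrix_(k, c) (u c (lshift n k) y +i* u c (rshift n k) y)) k c)) = u c (lshift n k).
    by apply/funext => y; rewrite mxE.
  have -> : (fun y => Im ((\matrix_(k, c) (u c (lshift n k) y +i* u c (rshift n k) y)) k c)) = u c (rshift n k).
    by apply/funext => y; rewrite mxE.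
  rewrite !h // !big_split_ord /=; apply: complexP; rewrite ?Re_mulmx ?Im_mulmx /=.
    congr (_ + _); apply: eq_bigr => m _;
    by rewrite /b /realify !split_lshift ?split_rshift !mxE ?mulNr.
  rewrite addrC; congr (_ + _); apply: eq_bigr => m _;
  by rewrite /b /realify !split_rshift ?split_lshift !mxE.
Qed.

End FrobeniusComplex.

(** * Paths and monodromy *)

(** The set where F takes a given value is open, and so is its complement. *)
Lemma locally_constant (X : topologicalType) (T : Type) (A : set X) (F : X -> T) :
  connected A -> (forall x, A x -> \forall y \near x, F y = F x) ->
  forall x y, A x -> A y -> F x = F y.
Proof.
move=> cA lF x y Ax Ay.
pose E := [set z | F z = F x].
have : A `&` E^° = A.
  apply: cA.
  - by exists x; split => //; exact: lF.
  - by exists (E^°) => //; exact: open_interior.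
  - exists (~` (~` E)^°); first by apply: open_closedC; exact: open_interior.
    apply/seteqP; split => z [Az] H; split => //.
      by move=> /interior_subset; apply; exact: interior_subset H.
    have [Fz|Fz] := pselect (F z = F x).
      by have := lF z Az; apply: filterS => w; rewrite /E /= Fz.
    by exfalso; apply: H; have := lF z Az; apply: filterS => w Fw; rewrite /E /= Fw.
move=> AE; have [_ /interior_subset ->] : (A `&` E^°) y by rewrite AE.
by [].
Qed.

Lemma connected_real (R : realType) : connected [set: R].
Proof. by apply/connected_intervalP => x y /= _ _ z _. Qed.

Section Paths.
Variables (R : realType) (S : topologicalType).

Definition clamp01 (t : R) : R := Num.max 0 (Num.min t 1).

Lemma clamp01_itv t : clamp01 t \in `[0, 1].
Proof. by rewrite in_itv /= /clamp01 le_max lexx /= ge_max ler01 ge_min lexx orbT. Qed.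
Lemma clamp01_le0 t : t <= 0 -> clamp01 t = 0.
Proof.
move=> t0; rewrite /clamp01; apply/max_idPl; rewrite ge_min t0 //.
Qed.
Lemma clamp01_ge1 t : 1 <= t -> clamp01 t = 1.
Proof. by move=> t0; rewrite /clamp01 (min_idPr t0); apply/max_idPr. Qed.
Lemma clamp01_id t : 0 <= t <= 1 -> clamp01 t = t.
Proof. by move=> /andP[t0 t1]; rewrite /clamp01 (min_idPl t1); apply/max_idPr. Qed.
Lemma clamp01_continuous : continuous clamp01.
Proof.
move=> t; rewrite /clamp01.
apply: (@continuous_max R R (fun=> 0) (fun t => Num.min t 1)); first exact: cst_continuous.
by apply: (@continuous_min R R id (fun=> 1)); [exact: id|exact: cst_continuous].
Qed.

Definition is_path (g : R -> S) (a b : S) :=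
  [/\ continuous g, forall t, t <= 0 -> g t = a & forall t, 1 <= t -> g t = b].

Lemma within_comp (X Y : topologicalType) (A : set X) (f : X -> S) (k : Y -> X) :
  {within A, continuous f} -> continuous k -> (forall y, A (k y)) -> continuous (fun y => f (k y)).
Proof.
move=> /subspace_continuousP cf ck kA y B nB.
have H := cf _ (kA y) _ nB.
have N : nbhs y ((fun y => f (k y)) @^-1` B).
  have H' : nbhs (k y) [set x | A x -> B (f x)] := H.
  have N2 : nbhs y (k @^-1` [set x | A x -> B (f x)]) := ck y _ H'.
  by apply: filterS N2 => z; apply.
exact: N.
Qed.

Lemma path_extend (g : R -> S) : {within `[0, 1], continuous g} ->
  is_path (fun t => g (clamp01 t)) (g 0) (g 1).
Proof.
move=> cg; split; last 2 first.
- by move=> t t0; rewrite clamp01_le0.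
- by move=> t t0; rewrite clamp01_ge1.
apply: (within_comp cg clamp01_continuous) => t; exact: clamp01_itv.
Qed.

(** Paths are parametrised by the whole line and constant outside [0, 1]; the
    two halves are run through at double speed. *)
Definition concat (g b : R -> S) (t : R) : S :=
  if t <= 1 / 2 then g (2 * t) else b (2 * t - 1).

Lemma concat_path g b p q r : is_path g p q -> is_path b q r -> is_path (concat g b) p r.
Proof.
move=> [cg g0 g1] [cb b0 b1]; split; last 2 first.
- move=> t t0; rewrite /concat ifT; last by lra.
  by apply: g0; lra.
- move=> t t1; rewrite /concat ifF; first by apply: b1; lra.
  by apply/negbTE; rewrite -ltNge; lra.
have c1 : continuous (fun t : R => g (2 * t)).
  move=> t; apply: (@continuous_comp _ _ _ (fun t : R => 2 * t) g); last exact: cg.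
  by apply: continuousM; [exact: cst_continuous|exact: id_continuous].
have c2 : continuous (fun t : R => b (2 * t - 1)).
  move=> t; apply: (@continuous_comp _ _ _ (fun t : R => 2 * t - 1) b); last exact: cb.
  apply: continuousB; last exact: cst_continuous.
  by apply: continuousM; [exact: cst_continuous|exact: id_continuous].
move=> t; have [th|th|->] := ltgtP t (1 / 2).
- apply: near_eq_continuous (c1 t); have : \forall s \near t, s < 1 / 2 by exact: lt_nbhsl.
  by apply: filterS => s sh; rewrite /concat ltW.
- apply: near_eq_continuous (c2 t); have : \forall s \near t, 1 / 2 < s by exact: lt_nbhsr.
  by apply: filterS => s sh; rewrite /concat leNgt sh.
move=> A; rewrite /concat lexx => nA.
have e1 : g (2 * (1 / 2)) = q by apply: g1; lra.
have e2 : b (2 * (1 / 2) - 1) = q by apply: b0; lra.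
have N1 : nbhs (1 / 2 : R) ((fun t : R => g (2 * t)) @^-1` A) by exact: c1 nA.
have N2 : nbhs (1 / 2 : R) ((fun t : R => b (2 * t - 1)) @^-1` A) by apply: (c2 (1 / 2)); rewrite e2 -e1.
have N : nbhs (1 / 2 : R) (concat g b @^-1` A).
  by apply: filterS2 N1 N2 => s /= s1 s2; rewrite /concat; case: ifP.
exact: N.
Qed.

Lemma reverse_path g p q : is_path g p q -> is_path (fun t => g (1 - t)) q p.
Proof.
move=> [cg g0 g1]; split; last 2 first.
- by move=> t t0; apply: g1; lra.
- by move=> t t0; apply: g0; lra.
move=> t; apply: (@continuous_comp _ _ _ (fun t : R => 1 - t) g); last exact: cg.
by apply: continuousB; [exact: cst_continuous|exact: id_continuous].
Qed.

End Paths.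

Section Monodromy.
Variables (R : realType) (S : topologicalType) (K : fieldType) (n : nat).
Variables (I : Type) (U : I -> set S) (th : I -> S -> 'M[K]_n).
Hypothesis oU : forall c, open (U c).
Hypothesis covU : forall p, exists c, U c p.
Hypothesis uth : forall c p, U c p -> th c p \in unitmx.
Hypothesis compat : forall c d q, U c q -> U d q ->
  \forall q' \near q, invmx (th c q') *m th d q' = invmx (th c q) *m th d q.

Section Parallel.
Variables (X : topologicalType).
Implicit Types (g : X -> S) (phi : X -> 'M[K]_n).

(** A family of local frames th c whose ratios are locally constant is a flat
    connection. A frame phi along g is parallel when it is locally a constant
    combination of some th c, hence of every th d. *)
Definition parallel g phi x := exists2 c, U c (g x) &
  \forall y \near x, invmx (th c (g y)) *m phi y = invmx (th c (g x)) *m phi x.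

(** The ratio of th d and th c is locally constant. *)
Lemma parallel_any g phi x d : {for x, continuous g} -> parallel g phi x -> U d (g x) ->
  \forall y \near x, invmx (th d (g y)) *m phi y = invmx (th d (g x)) *m phi x.
Proof.
move=> cg [c Uc P] Ud.
have N1 : nbhs x (g @^-1` [set q' | invmx (th d q') *m th c q' = invmx (th d (g x)) *m th c (g x)]).
  by apply: cg; exact: compat.
have N2 : nbhs x (g @^-1` U c) by apply: cg; exact: open_nbhs_nbhs.
apply: filterS3 P N1 N2 => y Py /= y1 y2.
by rewrite -[phi y](mulKVmx (uth y2)) Py mulmxA y1 mulmxA -!mulmxA [X in _ *m X](mulKVmx (uth Uc)).
Qed.

(** The coincidence set of two parallel frames is open, and so is its
    complement: near any point both have constant coordinates in one local
    frame. *)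
Lemma parallel_unique g phi psi : connected [set: X] -> continuous g ->
  (forall x, parallel g phi x) -> (forall x, parallel g psi x) ->
  forall x0, phi x0 = psi x0 -> forall x, phi x = psi x.
Proof.
move=> cX cg P Q x0 e x.
suff : (phi x = psi x) = (phi x0 = psi x0) by move=> ->.
apply: (@locally_constant X Prop setT (fun x => phi x = psi x)) => // {x e} x _.
have [c Uc] := covU (g x).
have H1 := parallel_any (cg x) (P x) Uc; have H2 := parallel_any (cg x) (Q x) Uc.
have H3 : nbhs x (g @^-1` U c) by apply: cg; exact: open_nbhs_nbhs.
apply: filterS3 H3 H1 H2 => y /= Uy y1 y2.
apply/propext; split => e.
  by rewrite -(mulKVmx (uth Uc) (phi x)) -y1 e y2 mulKVmx // uth.
by rewrite -(mulKVmx (uth Uy) (phi y)) y1 e -y2 mulKVmx // uth.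
Qed.

End Parallel.

Lemma parallel_comp (X Y : topologicalType) (g : X -> S) (phi : X -> 'M[K]_n) (k : Y -> X) y :
  {for y, continuous k} -> parallel g phi (k y) -> parallel (fun y => g (k y)) (fun y => phi (k y)) y.
Proof. by move=> ck [c Uc P]; exists c => //; exact: ck P. Qed.

Lemma parallel_near (X : topologicalType) (g : X -> S) (phi psi : X -> 'M[K]_n) x :
  (\forall y \near x, phi y = psi y) -> parallel g psi x -> parallel g phi x.
Proof.
move=> e [c Uc P]; exists c => //; rewrite (nbhs_singleton e).
by apply: filterS2 e P => y -> .
Qed.

Lemma interval_connected (a b : R) : connected [set t : R | a < t < b].
Proof.
apply/connected_intervalP => x y /= /andP[ax _] /andP[_ yb] z /andP[xz zy].
by rewrite (lt_le_trans ax xz) (le_lt_trans zy yb).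
Qed.

Lemma near_interval (P : set R) (t : R) : nbhs t P ->
  exists2 d : R, 0 < d & forall s, t - d < s < t + d -> P s.
Proof.
move=> /nbhs_ballP [d /= d0 H]; exists d => // s sd; apply: H.
by rewrite /ball /= /ball_ ltr_distlC.
Qed.

Lemma interval_near (t a b : R) : a < t < b -> \forall s \near t, a < s < b.
Proof. by move=> /andP[at_ tb]; apply: filterS2 (lt_nbhsr at_) (lt_nbhsl tb) => s -> ->. Qed.

(** Whether a lift exists up to time t is a locally constant property of t:
    near t the path stays in the domain of one local frame, along which a lift
    extends with constant coordinates. *)
Lemma lift_path (g : R -> S) p q (v : 'M[K]_n) : is_path g p q ->
  exists2 phi : R -> 'M[K]_n, phi 0 = v & forall t, parallel g phi t.
Proof.
move=> [cg g0 g1].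
pose Good t := exists phi : R -> 'M[K]_n,
  (forall s, s < t -> s <= 0 -> phi s = v) /\ forall s, s < t -> parallel g phi s.
have G0 : Good 0.
  exists (fun=> v); split => // s s0; have [c Uc] := covU (g s); exists c => //.
  have := lt_nbhsl s0; apply: filterS => y y0.
  by rewrite !g0 // ltW.
have step (t1 t2 s0 : R) c : Good t1 -> s0 < t1 -> (forall s, s0 <= s < t2 -> U c (g s)) -> Good t2.
  move=> [phi [phi0 P]] st Uc.
  have [st2|st2] := leP t2 s0.
    exists phi; split => s ss.
      by apply: phi0; lra.
    by apply: P; lra.
  have Us0 : U c (g s0) by apply: Uc; rewrite lexx.
  (* The lift is continued beyond s0 with its coordinates at s0 in the local
     frame. *)
  pose psi s := if s <= s0 then phi s else th c (g s) *m (invmx (th c (g s0)) *m phi s0).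
  exists psi; split => s ss.
    rewrite /psi; case: ifP => [ss0 s_le0|/negbT]; first by apply: phi0 => //; lra.
    rewrite -ltNge => ss0 s_le0.
    have e1 : g s = p by exact: g0.
    have e2 : g s0 = p by apply: g0; lra.
    have e3 : phi s0 = v by apply: phi0 => //; lra.
    by rewrite e1 -e2 mulKVmx ?uth // e3.
  have [s_lt|s_gt|->] := ltgtP s s0.
  - apply: parallel_near (P s (lt_trans s_lt st)).
    by have := lt_nbhsl s_lt; apply: filterS => y ys; rewrite /psi ltW.
  - exists c; first by apply: Uc; rewrite ltW.
    have := interval_near (t := s) (a := s0) (b := t2); rewrite s_gt ss => /(_ isT).
    apply: filterS => y /andP[y1 y2]; rewrite /psi leNgt y1 leNgt s_gt /=.
    have Uy : U c (g y) by apply: Uc; rewrite y2 ltW.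
    have Us : U c (g s) by apply: Uc; rewrite ss ltW.
    by rewrite !mulKmx // uth.
  - exists c => //; have := interval_near (t := s0) (a := s0 - 1) (b := t2).
    rewrite st2 gtrBl ltr01 => /(_ isT); apply: filterS2 (parallel_any (cg s0) (P _ st) Us0).
    move=> y Py /andP[y1 y2]; rewrite /psi lexx; case: ifP => // /negbT; rewrite -ltNge => ys.
    have Uy : U c (g y) by apply: Uc; rewrite y2 ltW.
    by rewrite mulKmx // uth.
have G2 : Good 2.
  suff -> : Good 2 = Good 0 by [].
  apply: (@locally_constant R Prop setT Good) => //; first exact: connected_real.
  move=> t _; have [c Uc] := covU (g t).
  have N : nbhs t (g @^-1` U c) by apply: cg; exact: open_nbhs_nbhs.
  have [d d0 H] := near_interval N.
  have := interval_near (t := t) (a := t - d / 2) (b := t + d / 2).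
  rewrite gtrBl ltrDl divr_gt0 // => /(_ isT); apply: filterS => s /andP[s1 s2].
  have Ut (w : R) : w <= t + d / 2 -> forall s : R, t - d / 2 <= s < w -> U c (g s).
    by move=> wd s' /andP[a1 a2]; apply: H; lra.
  apply/propext; split => G; apply: (step _ _ (t - d / 2) c G); try lra; apply: Ut; lra.
move: G2 => [phi [phi0 P]].
exists (fun t => phi (clamp01 t)); first by rewrite clamp01_le0 // phi0.
move=> t; have gE : g = fun t => g (clamp01 t).
  apply/funext => s; have [s0|s0] := leP s 0; first by rewrite clamp01_le0 // !g0.
  have [s1|s1] := leP 1 s; first by rewrite clamp01_ge1 // !g1.
  by rewrite clamp01_id // !ltW.
rewrite {1}gE; apply: parallel_comp; first exact: clamp01_continuous.
by apply: P; have := clamp01_itv t; rewrite in_itv /= => /andP[_]; lra.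
Qed.

Lemma lift_in_chart (g phi : R -> _) (A : set R) c : connected A -> continuous g ->
  (forall t, parallel g phi t) -> (forall t, A t -> U c (g t)) ->
  forall s t, A s -> A t -> invmx (th c (g s)) *m phi s = invmx (th c (g t)) *m phi t.
Proof.
move=> cA cg P UA; apply: (locally_constant (F := fun s => invmx (th c (g s)) *m phi s)) => //.
by move=> s As; exact: (parallel_any (@cg s) (P s) (UA _ As)).
Qed.

(** Every stage of the homotopy is lifted from the same initial value. These
    lifts are parallel in both variables jointly, so that their endpoints
    depend on the stage in a locally constant way; the last stage is a constant
    path, whose lift is constant. *)
Lemma lift_homotopy (H : R * R -> S) p (phi : R -> 'M[K]_n) :
  continuous H -> (forall s t, t <= 0 -> H (s, t) = p) -> (forall s t, 1 <= t -> H (s, t) = p) ->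
  (forall t, H (1, t) = p) -> (forall t, parallel (fun t => H (0, t)) phi t) ->
  phi 1 = phi 0.
Proof.
move=> cH H0 H1 Hp P.
have cHs s : continuous (fun t => H (s, t)) by exact: continuous_slice.
have pathH s : is_path (fun t => H (s, t)) p p.
  by split => // t t0; [exact: H0|exact: H1].
have L s : exists2 f : R -> 'M[K]_n, f 0 = phi 0 & forall t, parallel (fun t => H (s, t)) f t.
  exact: lift_path (pathH s).
pose f s := sval (cid2 (L s)).
have f0 s : f s 0 = phi 0 by rewrite /f; case: cid2.
have fP s t : parallel (fun t => H (s, t)) (f s) t by rewrite /f; case: cid2.
have -> : phi 1 = f 0 1.
  by apply: (parallel_unique (@connected_real R) (cHs 0) P (fP 0) (x0 := 0)); rewrite f0.
have -> : f 0 1 = f 1 1; last first.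
  rewrite -(f0 1); have e : (fun t => H (1, t)) = fun=> p by apply/funext.
  have [c Uc] := covU p.
  have := @lift_in_chart (fun t => H (1, t)) (f 1) setT c (@connected_real R) (cHs 1) (fP 1).
  have UH t : [set: R] t -> U c (H (1, t)) by move=> _; rewrite Hp.
  move=> /(_ UH 1 0 Logic.I Logic.I); rewrite !Hp => /(congr1 (mulmx (th c p))).
  by rewrite !mulKVmx // uth.
apply: (locally_constant (A := setT) (F := fun s => f s 1)) => //; first exact: connected_real.
move=> s _.
(* Joint parallelism at (s, t) holds at t = 0 because all lifts start at the
   same value, and it propagates in t because it is a locally constant
   property. *)
pose Q t := exists2 c, U c (H (s, t)) &
  \forall z \near ((s, t) : R * R), invmx (th c (H z)) *m f z.1 z.2 = invmx (th c (H (s, t))) *m f s t.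
have QE t : Q t <-> parallel H (fun z => f z.1 z.2) (s, t) by [].
suff Q1 : Q 1.
  have [c Uc N] := Q1.
  have := parallel_comp (k := fun s' : R => (s', 1 : R)) (y := s) _ Q1.
  have ck : {for s, continuous (fun s' : R => (s', 1 : R))}.
    by apply: pair_continuous; [exact: id_continuous|exact: cst_continuous].
  move=> /(_ ck) [d]; rewrite /= H1 // => Ud; apply: filterS => y; rewrite !H1 //.
  by move=> /(congr1 (mulmx (th d p))); rewrite !mulKVmx // uth.
have box t : exists c, exists2 d : R, 0 < d &
    forall s' t' : R, s - d < s' < s + d -> t - d < t' < t + d -> U c (H (s', t')).
  have [c Uc] := covU (H (s, t)); exists c.
  have [[B1 B2] /= [n1 n2] B] : nbhs ((s, t) : R * R) (H @^-1` U c).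
    by apply: cH; exact: open_nbhs_nbhs.
  have [d1 d10 D1] := near_interval n1; have [d2 d20 D2] := near_interval n2.
  exists (Num.min d1 d2); first by rewrite lt_min d10.
  move=> s' t' /andP[a1 a2] /andP[a3 a4]; apply: (B (s', t')); split => /=.
    apply: D1; apply/andP; split.
      by apply: le_lt_trans a1; rewrite lerB // ge_min lexx.
    by apply: lt_le_trans a2 _; rewrite lerD // ge_min lexx.
  apply: D2; apply/andP; split.
    by apply: le_lt_trans a3; rewrite lerB // ge_min lexx orbT.
  by apply: lt_le_trans a4 _; rewrite lerD // ge_min lexx orbT.
have near2 (d : R) (t : R) : 0 < d -> nbhs (s, t) [set z : R * R | s - d < z.1 < s + d /\ t - d < z.2 < t + d].
  move=> d0; exists ([set s' | s - d < s' < s + d], [set t' | t - d < t' < t + d]) => /=.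
    by split; apply: interval_near; rewrite gtrBl ltrDl d0.
  by move=> [? ?] [].
suff -> : Q 1 = Q 0.
  have [c [d d0 D]] := box 0; have dd : 0 - d < 0 < 0 + d by rewrite gtrBl ltrDl d0.
  have sd : s - d < s < s + d by rewrite gtrBl ltrDl d0.
  exists c; first exact: D.
  apply: filterS (near2 d 0 d0) => -[s' t'] /= [s'd t'd]; rewrite (H0 s 0) // f0.
  rewrite (@lift_in_chart (fun t => H (s', t)) (f s') [set t | 0 - d < t < 0 + d] c (@interval_connected _ _) (cHs s') (fP s') _ t' 0) //.
    by rewrite (H0 s' 0) // f0.
  by move=> t /=; exact: D.
apply: (@locally_constant R Prop setT Q) => //; first exact: connected_real.
move=> t _; have [c [d d0 D]] := box t.
have dd : t - d < t < t + d by rewrite gtrBl ltrDl d0.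
have sd : s - d < s < s + d by rewrite gtrBl ltrDl d0.
have trans t1 t2 : t - d < t1 < t + d -> t - d < t2 < t + d -> Q t1 -> Q t2.
  move=> td1 td2 Q1; exists c; first exact: D.
  have Lc s' : s - d < s' < s + d -> forall t1 t2 : R, t - d < t1 < t + d -> t - d < t2 < t + d ->
      invmx (th c (H (s', t1))) *m f s' t1 = invmx (th c (H (s', t2))) *m f s' t2.
    move=> s'd t3 t4 td3 td4.
    apply: (@lift_in_chart (fun t => H (s', t)) (f s') [set t' | t - d < t' < t + d] c (@interval_connected _ _) (cHs s') (fP s')) => //.
    by move=> w /=; exact: D.
  have [[B1 B2] /= [n1 n2] B] := parallel_any (X := (R * R)%type) (phi := fun z => f z.1 z.2) (d := c) (cH _) Q1 (D _ _ sd td1).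
  exists (B1 `&` [set s' | s - d < s' < s + d], [set t' | t - d < t' < t + d]) => /=.
    by split; [apply: filterI => //|]; apply: interval_near.
  move=> [s' t'] /= [[B1s s'd] t'd].
  have /= e := B (s', t1) (conj B1s (nbhs_singleton n2)).
  by rewrite (Lc s' s'd t' t1) // e (Lc s sd t1 t2).
apply: filterS (interval_near dd) => t' t'd; apply/propext; split; exact: trans.
Qed.

Hypothesis path_connected : forall p q, exists g : R -> S, is_path g p q.
Hypothesis null_homotopic : forall p (g : R -> S), is_path g p p ->
  exists H : R * R -> S, [/\ continuous H, forall s t, t <= 0 -> H (s, t) = p,
    forall s t, 1 <= t -> H (s, t) = p, forall t, H (0, t) = g t & forall t, H (1, t) = p].
Hypothesis locally_path_connected : forall c q, U c q ->
  \forall q' \near q, exists2 g : R -> S, is_path g q q' & forall t, U c (g t).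

Lemma path_clamp (g : R -> S) p q t : is_path g p q -> g (clamp01 t) = g t.
Proof.
move=> [_ g0 g1]; have [t0|t0] := leP t 0; first by rewrite clamp01_le0 // !g0.
have [t1|t1] := leP 1 t; first by rewrite clamp01_ge1 // !g1.
by rewrite clamp01_id // !ltW.
Qed.

Lemma half_clamp_continuous : continuous (fun t : R => clamp01 t / 2).
Proof.
move=> t; apply: continuousM; last exact: cst_continuous.
exact: clamp01_continuous.
Qed.

Lemma lift_concat_left (g b : R -> S) p q r (psi : R -> 'M[K]_n) : is_path g p q -> is_path b q r ->
  (forall t, parallel (concat g b) psi t) ->
  forall t, parallel g (fun t => psi (clamp01 t / 2)) t.
Proof.
move=> pg pb P t.
have gE : g = fun t => concat g b (clamp01 t / 2).
  apply/funext => s; have := clamp01_itv s; rewrite in_itv /= => /andP[_ c1].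
  rewrite /concat ifT; last by lra.
  by rewrite (_ : 2 * (clamp01 s / 2) = clamp01 s) ?(path_clamp s pg) //; field.
by rewrite {1}gE; apply: parallel_comp; [exact: half_clamp_continuous|exact: P].
Qed.

Lemma lift_concat_right (g b : R -> S) p q r (psi : R -> 'M[K]_n) : is_path g p q -> is_path b q r ->
  (forall t, parallel (concat g b) psi t) ->
  forall t, parallel b (fun t => psi (1 / 2 + clamp01 t / 2)) t.
Proof.
move=> pg pb P t.
have bE : b = fun t => concat g b (1 / 2 + clamp01 t / 2).
  apply/funext => s; have := clamp01_itv s; rewrite in_itv /= => /andP[c0 c1].
  rewrite /concat; case: ifP => cs.
    have e : clamp01 s = 0 by lra.
    rewrite -(path_clamp s pb) e; case: pg pb => _ _ g1 [_ b0 _].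
    by rewrite b0 // g1 //; lra.
  have e : 2 * (1 / 2 + clamp01 s / 2) - 1 = clamp01 s by field.
  by rewrite e (path_clamp s pb).
rewrite {1}bE; apply: (parallel_comp (k := fun t => 1 / 2 + clamp01 t / 2)) (P _).
apply: continuousD; first exact: cst_continuous.
exact: half_clamp_continuous.
Qed.

Lemma loop_lift (g : R -> S) p phi : is_path g p p -> (forall t, parallel g phi t) -> phi 1 = phi 0.
Proof.
move=> pg P; have [H [cH H0 H1 Hg Hp]] := null_homotopic pg.
apply: (lift_homotopy cH H0 H1 Hp) => t.
by rewrite (_ : (fun t => H (0, t)) = g) //; apply/funext.
Qed.

Lemma lift_endpoint (g g' : R -> S) p q phi phi' : is_path g p q -> is_path g' p q ->
  (forall t, parallel g phi t) -> (forall t, parallel g' phi' t) -> phi 0 = phi' 0 -> phi 1 = phi' 1.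
Proof.
move=> pg pg' P P' e; have pr := reverse_path pg'.
have pd := concat_path pg pr; have [psi psi0 Q] := lift_path (phi 0) pd.
have Q1 := lift_concat_left pg pr Q; have Q2 := lift_concat_right pg pr Q.
have := loop_lift pd Q.
have cR := @connected_real R.
have E1 : phi 1 = psi (1 / 2).
  have [cg _ _] := pg.
  rewrite (parallel_unique cR cg P Q1 (x0 := 0)); first by rewrite clamp01_ge1.
  by rewrite clamp01_le0 // mul0r psi0.
have Q3 t : parallel g' (fun t => psi (1 / 2 + clamp01 (1 - t) / 2)) t.
  have gE : g' = fun t => g' (1 - (1 - t)) by apply/funext => s; congr g'; ring.
  rewrite {1}gE.
  have ck : {for t, continuous (fun t : R => 1 - t)}.
    by apply: continuousB; [exact: cst_continuous|exact: id_continuous].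
  exact: (parallel_comp ck (Q2 (1 - t))).
move=> e1; have [cg' _ _] := pg'.
rewrite E1 (parallel_unique cR cg' P' Q3 (x0 := 0)).
  by rewrite clamp01_le0 ?subrr // mul0r addr0.
rewrite subr0 clamp01_ge1 // -e -psi0 -e1; congr psi; by field.
Qed.

(** The value at q is the endpoint of a lift along any path from p0 to q. It
    does not depend on the path: two of them form a loop, which is
    null-homotopic, so its lift closes up. Near q, paths are prolonged inside
    the domain of one local frame, and coordinates in it do not change. *)
Theorem parallel_frame p0 (v : 'M[K]_n) : exists2 Phi : S -> 'M[K]_n,
  Phi p0 = v & forall q, parallel id Phi q.
Proof.
have L q : exists phi : R -> 'M[K]_n, exists g : R -> S,
    [/\ is_path g p0 q, phi 0 = v & forall t, parallel g phi t].
  have [g pg] := path_connected p0 q; have [phi phi0 P] := lift_path v pg.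
  by exists phi, g.
have [phi Hphi] := choice L.
exists (fun q => phi q 1).
  by have [g [pg <- P]] := Hphi p0; exact: loop_lift pg P.
move=> q; have [c Uc] := covU q; exists c => //.
have [g [pg phi0 P]] := Hphi q.
apply: filterS (locally_path_connected Uc) => q' [b pb Ub].
have [g' [pg' phi0' P']] := Hphi q'.
have pd := concat_path pg pb; have [psi psi0 Q] := lift_path v pd.
have -> : phi q' 1 = psi 1.
  by apply: lift_endpoint pg' pd P' Q _; rewrite phi0' psi0.
have Q1 := lift_concat_left pg pb Q; have Q2 := lift_concat_right pg pb Q.
have -> : phi q 1 = psi (1 / 2).
  have [cg _ _] := pg.
  rewrite (parallel_unique (@connected_real R) cg P Q1 (x0 := 0)); first by rewrite clamp01_ge1.
  by rewrite clamp01_le0 // mul0r phi0 psi0.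
have [cb b0 b1] := pb.
have := @lift_in_chart b _ setT c (@connected_real R) cb Q2 (fun t _ => Ub t) 1 0 Logic.I Logic.I.
rewrite b1 // b0 // clamp01_ge1 // clamp01_le0 // mul0r addr0 => <-.
by rewrite (_ : 1 / 2 + 1 / 2 = 1) //; field.
Qed.

End Monodromy.

Section SimplyConnected.
Variables (R : realType) (S : surface R).
Hypothesis sc : simply_connected S.

Lemma simply_connected_path (p q : S) : exists g : R -> S, is_path g p q.
Proof.
by have [/(_ p q) [g [cg <- <-]] _] := sc; exists (fun t => g (clamp01 t)); exact: path_extend.
Qed.

Lemma simply_connected_null (p : S) (g : R -> S) : is_path g p p ->
  exists H : R * R -> S, [/\ continuous H, forall s t, t <= 0 -> H (s, t) = p,
    forall s t, 1 <= t -> H (s, t) = p, forall t, H (0, t) = g t & forall t, H (1, t) = p].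
Proof.
move=> pg; have [cg g0 g1] := pg; have [_ /(_ g)] := sc; case.
- exact: continuous_subspaceT.
- by rewrite g0 // g1.
move=> H [cH H0 H1 Hb].
have p0 : g 0 = p by rewrite g0.
have c0 : (0 : R) \in `[0, 1] by rewrite in_itv /= lexx ler01.
have c1 : (1 : R) \in `[0, 1] by rewrite in_itv /= lexx ler01.
exists (fun z => H (clamp01 z.1, clamp01 z.2)); split.
- apply: (within_comp cH).
    apply: pair_continuous.
      by move=> z; apply: (@continuous_comp _ _ _ fst (@clamp01 R)); [exact: cvg_fst|exact: clamp01_continuous].
    by move=> z; apply: (@continuous_comp _ _ _ snd (@clamp01 R)); [exact: cvg_snd|exact: clamp01_continuous].
  by move=> z; split; exact: clamp01_itv.
- by move=> s t t0; rewrite /= (clamp01_le0 t0) (Hb _ (clamp01_itv s)).1.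
- by move=> s t t1; rewrite /= (clamp01_ge1 t1) (Hb _ (clamp01_itv s)).2.
- by move=> t; rewrite /= clamp01_le0 // H0 ?clamp01_itv // (path_clamp t pg).
- by move=> t; rewrite /= clamp01_ge1 // H1 ?clamp01_itv.
Qed.

End SimplyConnected.

(** * Functions and vector fields on a surface *)

Section Charts.
Variables (R : realType) (S : surface R).
Local Notation V := 'cV[R]_2.
Local Notation C := R[i].
Implicit Types (c d : chart R S) (p q : S) (U W : set S) (f h : S -> C) (X Y : field S).

Definition chart_img c U : set V := cmap c @` (U `&` cdom c).

Lemma cinvK c x : (cmap c @` cdom c) x -> cmap c (cinv c x) = x.
Proof. by move=> [p cp <-]; rewrite cmapK. Qed.

Lemma cinv_dom c x : (cmap c @` cdom c) x -> cdom c (cinv c x).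
Proof. by move=> [p cp <-]; rewrite cmapK. Qed.

Lemma chart_imgP c U x : chart_img c U x <-> (cmap c @` cdom c) x /\ U (cinv c x).
Proof.
split=> [[p [Up cp] <-]|[cx Ux]]; first by rewrite cmapK //; split=> //; exists p.
by exists (cinv c x); [split=> //; exact: cinv_dom|exact: cinvK].
Qed.

Lemma chart_img_mem c U p : U p -> cdom c p -> chart_img c U (cmap c p).
Proof. by move=> Up cp; exists p. Qed.

Lemma chart_img_open c U : open U -> open (chart_img c U).
Proof.
move=> oU; rewrite openE => x /chart_imgP[cx Ux].
have N1 : nbhs x (cmap c @` cdom c) by apply: open_nbhs_nbhs; split=> //; exact: cimg_open.
have N2 : nbhs x (cinv c @^-1` U) by apply: (cinv_cont cx); exact: open_nbhs_nbhs.
by apply: filterS2 N1 N2 => y cy Uy; apply/chart_imgP.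
Qed.

Lemma chart_img_sub c U W : U `<=` W -> chart_img c U `<=` chart_img c W.
Proof. by move=> UW x [p [Up cp] <-]; exists p => //; split=> //; exact: UW. Qed.

Lemma openIdom U c : open U -> open (U `&` cdom c).
Proof. by move=> oU; apply: openI => //; exact: cdom_open. Qed.

Definition in_chart c f : V -> C := fun x => f (cinv c x).

Lemma smooth_funP U f : smooth_fun U f <-> forall c, atlas c -> smoothC (chart_img c U) (in_chart c f).
Proof. by []. Qed.

Lemma smooth_fun_eq U f h : open U -> (forall p, U p -> f p = h p) -> smooth_fun U h -> smooth_fun U f.
Proof.
move=> oU fh sh c Ac; apply: smoothC_eq (sh c Ac); first exact: chart_img_open.
by move=> x /chart_imgP[_ Ux]; exact: fh.
Qed.

Lemma smooth_fun_sub U W f : W `<=` U -> smooth_fun U f -> smooth_fun W f.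
Proof. by move=> WU sf c Ac; apply: smoothC_sub (sf c Ac); exact: chart_img_sub. Qed.

Lemma smooth_fun_loc U f : (forall p, U p -> exists2 W, W p & smooth_fun W f) -> smooth_fun U f.
Proof.
move=> H c Ac; apply: smoothC_loc => _ [p [Up cp] <-].
have [W Wp sW] := H p Up; exists (chart_img c W); first exact: chart_img_mem.
exact: sW.
Qed.

Lemma smooth_fun_cst U (a : C) : open U -> smooth_fun U (fun=> a).
Proof. by move=> oU c Ac; apply: smoothC_cst; exact: chart_img_open. Qed.

Lemma smooth_funD U f h : open U -> smooth_fun U f -> smooth_fun U h -> smooth_fun U (fun p => f p + h p).
Proof. by move=> oU sf sh; apply/smooth_funP => c Ac; exact: (smoothCD (chart_img_open (c := c) oU) (sf c Ac) (sh c Ac)). Qed.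

Lemma smooth_funM U f h : open U -> smooth_fun U f -> smooth_fun U h -> smooth_fun U (fun p => f p * h p).
Proof. by move=> oU sf sh; apply/smooth_funP => c Ac; exact: (smoothCM (chart_img_open (c := c) oU) (sf c Ac) (sh c Ac)). Qed.

Lemma smooth_funN U f : open U -> smooth_fun U f -> smooth_fun U (fun p => - f p).
Proof. by move=> oU sf; apply/smooth_funP => c Ac; exact: (smoothCN (chart_img_open (c := c) oU) (sf c Ac)). Qed.

Lemma smooth_fun_sum (I : Type) (r : seq I) U (F : I -> S -> C) : open U ->
  (forall k, smooth_fun U (F k)) -> smooth_fun U (fun p => \sum_(k <- r) F k p).
Proof.
move=> oU sF; apply/smooth_funP => c Ac; apply: (@smoothC_sum R I r xpredT _ (fun k => in_chart c (F k)) (chart_img_open (c := c) oU)).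
by move=> k _; exact: (sF k c Ac).
Qed.

Lemma transition_smooth c d (i : 'I_2) : atlas c -> atlas d ->
  smooth_on (chart_img c (cdom d)) (fun x => cmap d (cinv c x) i 0).
Proof. by move=> Ac Ad; rewrite /chart_img setIC; exact: atlas_smooth. Qed.

(** A single chart suffices, since transition maps are smooth. *)
Lemma smooth_fun_chart c W f : atlas c -> open W -> W `<=` cdom c ->
  smoothC (chart_img c W) (in_chart c f) -> smooth_fun W f.
Proof.
move=> Ac oW Wc sf d Ad.
apply: (smoothC_eq (G := fun x => in_chart c f (cmap c (cinv d x)))); first exact: chart_img_open.
  by move=> x /chart_imgP[_ Wx]; rewrite /in_chart cmapK //; exact: Wc.
apply: (smoothC_comp (W := chart_img c W)) => //; try exact: chart_img_open.
  move=> j; apply: smooth_sub (transition_smooth j Ad Ac).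
  by move=> x /chart_imgP[dx Wx]; apply/chart_imgP; split=> //; exact: Wc.
by move=> x /chart_imgP[dx Wx]; apply: chart_img_mem => //; exact: Wc.
Qed.

Lemma coord_smooth c i : atlas c -> smooth_fun (cdom c) (coord c i).
Proof.
move=> Ac; apply: (smooth_fun_chart Ac) => //; first exact: cdom_open.
have oc : open (chart_img c (cdom c)) by apply: chart_img_open; exact: cdom_open.
apply: smoothC_real => //; apply: smooth_eq (smooth_coord i oc) => // x /chart_imgP[cx _].
by rewrite cinvK.
Qed.

Definition cpart c i f : S -> C := fun p => dC i (in_chart c f) (cmap c p).

Lemma in_chart_near c p (P : set S) : cdom c p -> nbhs p P ->
  \forall x \near cmap c p, P (cinv c x).
Proof.
move=> cp NP; have cx : (cmap c @` cdom c) (cmap c p) by exists p.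
by apply: (cinv_cont cx); rewrite cmapK.
Qed.

Lemma cpart_near c i f h p : cdom c p -> (\near p, f p = h p) -> cpart c i f p = cpart c i h p.
Proof. by move=> cp fh; apply: dC_near; exact: in_chart_near fh. Qed.

Lemma dom_near c p : cdom c p -> \near p, cdom c p.
Proof. by move=> cp; apply: open_nbhs_nbhs; split=> //; exact: cdom_open. Qed.

Lemma img_near c p : cdom c p -> \forall x \near cmap c p, (cmap c @` cdom c) x.
Proof. by move=> cp; apply: open_nbhs_nbhs; split; [exact: cimg_open|exists p]. Qed.

Lemma in_chart_cpart c i f x : (cmap c @` cdom c) x -> in_chart c (cpart c i f) x = dC i (in_chart c f) x.
Proof. by move=> cx; rewrite /in_chart /cpart cinvK. Qed.

Lemma cpart_smooth c i f U : atlas c -> open U -> smooth_fun U f -> smooth_fun (U `&` cdom c) (cpart c i f).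
Proof.
move=> Ac oU sf; have oW := openIdom c oU.
apply: (smooth_fun_chart Ac oW); first by move=> ? [].
apply: (smoothC_eq (G := dC i (in_chart c f))); first exact: chart_img_open.
  by move=> x /chart_imgP[cx _]; rewrite in_chart_cpart.
apply: smoothC_dC; apply: smoothC_sub (sf c Ac); apply: chart_img_sub; by move=> ? [].
Qed.

Lemma cpart_change c d i f p U : atlas c -> atlas d -> open U -> U p -> smooth_fun U f ->
  cdom c p -> cdom d p ->
  cpart c i f p = \sum_(j < 2) (partial i (fun x => cmap d (cinv c x) j 0) (cmap c p))%:C * cpart d j f p.
Proof.
move=> Ac Ad oU Up sf cp dp.
have -> : cpart c i f p = dC i (fun x => in_chart d f (cmap d (cinv c x))) (cmap c p).
  apply: dC_near; apply: filterS (in_chart_near cp (dom_near dp)) => x dx.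
  by rewrite /in_chart cmapK.
rewrite (dC_comp (W := chart_img d U)) ?cmapK //.
- exact: chart_img_open.
- move=> j; apply: smooth_diff (transition_smooth j Ac Ad) _.
  exact: chart_img_mem.
- exact: chart_img_mem.
- exact: sf.
Qed.

Lemma tact_def p v f : tact p v f = \sum_(i < 2) v i 0 * cpart (chart_at p) i f p.
Proof. by []. Qed.

Lemma tactD p v w f : tact p (v + w) f = tact p v f + tact p w f.
Proof. by rewrite !tact_def -big_split; apply: eq_bigr => i _; rewrite mxE mulrDl. Qed.

Lemma tactZ p a v f : tact p (a *: v) f = a * tact p v f.
Proof. by rewrite !tact_def mulr_sumr; apply: eq_bigr => i _; rewrite mxE mulrA. Qed.

Lemma tact0 p f : tact p 0 f = 0.
Proof. by rewrite -(scale0r 0) tactZ mul0r. Qed.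

Lemma tact_near p v f h : (\near p, f p = h p) -> tact p v f = tact p v h.
Proof.
move=> fh; rewrite !tact_def; apply: eq_bigr => i _; congr (_ * _).
by apply: cpart_near fh; exact: cdom_chart_at.
Qed.

Lemma cpart_coord c d i j p : cpart c i (coord d j) p =
  (partial i (fun x => cmap d (cinv c x) j 0) (cmap c p))%:C.
Proof. by rewrite /cpart /in_chart /coord dC_real. Qed.

(** The derivative along a tangent vector is defined in the chart that names
    the vector; by the chain rule it has the same expression in every other
    chart. *)
Lemma tactE c p v f U : atlas c -> cdom c p -> open U -> U p -> smooth_fun U f ->
  tact p v f = \sum_(j < 2) tact p v (coord c j) * cpart c j f p.
Proof.
move=> Ac cp oU Up sf; rewrite tact_def.
under eq_bigr do rewrite (cpart_change _ (atlas_chart_at p) Ac oU Up sf (cdom_chart_at p) cp) mulr_sumr.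
rewrite exchange_big; apply: eq_bigr => j _ /=.
rewrite tact_def mulr_suml; apply: eq_bigr => i _.
by rewrite cpart_coord mulrA.
Qed.

Lemma cpart_own c i j p : cdom c p -> cpart c i (coord c j) p = (i == j)%:R.
Proof.
move=> cp; rewrite /cpart.
have -> : dC i (in_chart c (coord c j)) (cmap c p) = dC i (fun x : V => (x j 0)%:C) (cmap c p).
  by apply: dC_near; apply: filterS (img_near cp) => x cx; rewrite /in_chart /coord cinvK.
rewrite dC_real.
have -> : partial i (fun x : V => x j 0) (cmap c p) = (i == j)%:R.
  have := derive_mx (M := fun y : V => y) (t := cmap c p) (v := delta_mx i 0).
  rewrite derive_id /partial => H; have /(_ _)/matrixP/(_ j 0) := H.
  by rewrite !mxE eqxx andbT eq_sym => ->.
by rewrite rmorph_nat.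
Qed.

(** The coordinate vector field d/dx_j of c. Its components at p are
    derivatives of the coordinates that name tangent vectors at p. *)
Definition cfield c j : field S := fun p => \col_k (cpart c j (coord (chart_at p) k) p).

Lemma tact_cfield c j p f U : atlas c -> cdom c p -> open U -> U p -> smooth_fun U f ->
  tact p (cfield c j p) f = cpart c j f p.
Proof.
move=> Ac cp oU Up sf.
rewrite (cpart_change _ Ac (atlas_chart_at p) oU Up sf cp (cdom_chart_at p)) tact_def.
by apply: eq_bigr => k _; rewrite mxE cpart_coord.
Qed.

Lemma tact_chart_at p v k : tact p v (coord (chart_at p) k) = v k 0.
Proof.
rewrite tact_def (bigD1 k) //= big1 ?addr0 => [|i ik].
  by rewrite cpart_own ?eqxx ?mulr1 //; exact: cdom_chart_at.
by rewrite cpart_own ?(negPf ik) ?mulr0 //; exact: cdom_chart_at.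
Qed.

Lemma tact_cfield_coord c j k p : atlas c -> cdom c p -> tact p (cfield c j p) (coord c k) = (j == k)%:R.
Proof.
move=> Ac cp; rewrite (tact_cfield _ Ac cp (@cdom_open _ _ c) cp (coord_smooth k Ac)).
exact: cpart_own.
Qed.

Lemma cfield_expand c p v : atlas c -> cdom c p ->
  v = \sum_(j < 2) tact p v (coord c j) *: cfield c j p.
Proof.
move=> Ac cp; apply/colP => k; rewrite summxE -{1}(tact_chart_at p v k).
rewrite (tactE v Ac cp (@cdom_open _ _ _) (cdom_chart_at p) (coord_smooth k (atlas_chart_at p))).
by apply: eq_bigr => j _; rewrite !mxE.
Qed.

Lemma cpartD c i f h p U : atlas c -> cdom c p -> U p -> smooth_fun U f -> smooth_fun U h ->
  cpart c i (fun q => f q + h q) p = cpart c i f p + cpart c i h p.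
Proof.
by move=> Ac cp Up sf sh; apply: (dCD i (chart_img_mem Up cp) (sf c Ac) (sh c Ac)).
Qed.

Lemma cpartM c i f h p U : atlas c -> cdom c p -> open U -> U p -> smooth_fun U f -> smooth_fun U h ->
  cpart c i (fun q => f q * h q) p = cpart c i f p * h p + f p * cpart c i h p.
Proof.
move=> Ac cp oU Up sf sh.
have := dCM i (chart_img_open (c := c) oU) (chart_img_mem Up cp) (sf c Ac) (sh c Ac).
by rewrite /in_chart cmapK.
Qed.

Lemma tactD_fun p v f h U : U p -> smooth_fun U f -> smooth_fun U h ->
  tact p v (fun q => f q + h q) = tact p v f + tact p v h.
Proof.
move=> Up sf sh; rewrite !tact_def -big_split; apply: eq_bigr => i _.
by rewrite (cpartD i (atlas_chart_at p) (cdom_chart_at p) Up sf sh) mulrDr.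
Qed.

Lemma tactM_fun p v f h U : open U -> U p -> smooth_fun U f -> smooth_fun U h ->
  tact p v (fun q => f q * h q) = tact p v f * h p + f p * tact p v h.
Proof.
move=> oU Up sf sh; rewrite !tact_def mulr_suml mulr_sumr -big_split; apply: eq_bigr => i _.
rewrite (cpartM i (atlas_chart_at p) (cdom_chart_at p) oU Up sf sh) mulrDr /=; ring.
Qed.

Lemma cpart_cst c i (a : C) p : cpart c i (fun=> a) p = 0.
Proof. exact: dC_cst. Qed.

Lemma tact_cst p v (a : C) : tact p v (fun=> a) = 0.
Proof. by rewrite tact_def big1 // => i _; rewrite /cpart /in_chart dC_cst mulr0. Qed.

Lemma fact_smooth U X f : open U -> smooth_field U X -> smooth_fun U f -> smooth_fun U (fact X f).
Proof.
move=> oU sX sf; apply: smooth_fun_loc => p Up.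
pose c := chart_at p; have Ac : atlas c := atlas_chart_at p; have oW := openIdom c oU.
exists (U `&` cdom c); first by split=> //; exact: cdom_chart_at.
apply: (smooth_fun_eq (h := fun q => \sum_(j < 2) fact X (coord c j) q * cpart c j f q)) => //.
  by move=> q [Uq cq]; exact: (tactE _ Ac cq oU Uq sf).
by apply: smooth_fun_sum => // j; apply: smooth_funM => //; [exact: sX|exact: cpart_smooth].
Qed.

Lemma cfield_smooth c j : atlas c -> smooth_field (cdom c) (cfield c j).
Proof.
move=> Ac d Ad i.
have oW : open (cdom c `&` cdom d) by apply: openI; exact: cdom_open.
apply: (smooth_fun_eq (h := cpart c j (coord d i))) => //.
  move=> p [cp dp]; exact: (tact_cfield _ Ac cp (@cdom_open _ _ d) dp (coord_smooth i Ad)).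
by rewrite setIC; apply: cpart_smooth => //; [exact: cdom_open|exact: coord_smooth].
Qed.

Lemma smooth_field_sub U W X : W `<=` U -> smooth_field U X -> smooth_field W X.
Proof.
by move=> WU sX c Ac i; apply: smooth_fun_sub (sX c Ac i) => p [/WU].
Qed.

Lemma smooth_field_eq U X Y : open U -> (forall p, U p -> X p = Y p) -> smooth_field U Y -> smooth_field U X.
Proof.
move=> oU XY sY c Ac i; apply: smooth_fun_eq (sY c Ac i); first exact: openIdom.
by move=> p [Up _]; rewrite /fact XY.
Qed.

Lemma smooth_fieldD U X Y : open U -> smooth_field U X -> smooth_field U Y ->
  smooth_field U (fun p => X p + Y p).
Proof.
move=> oU sX sY c Ac i; have oW := openIdom c oU.
apply: (smooth_fun_eq (h := fun p => fact X (coord c i) p + fact Y (coord c i) p)) => //.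
  by move=> p _; rewrite /fact tactD.
by apply: smooth_funD => //; [exact: sX|exact: sY].
Qed.

Lemma smooth_fieldZ U f X : open U -> smooth_fun U f -> smooth_field U X ->
  smooth_field U (fun p => f p *: X p).
Proof.
move=> oU sf sX c Ac i; have oW := openIdom c oU.
apply: (smooth_fun_eq (h := fun p => f p * fact X (coord c i) p)) => //.
  by move=> p _; rewrite /fact tactZ.
by apply: smooth_funM => //; [apply: smooth_fun_sub sf => ? []|exact: sX].
Qed.

Lemma fact_cfield_near c j f p U : atlas c -> cdom c p -> open U -> U p -> smooth_fun U f ->
  \near p, fact (cfield c j) f p = cpart c j f p.
Proof.
move=> Ac cp oU Up sf; have N1 : nbhs p U by exact: open_nbhs_nbhs.
by apply: filterS2 (dom_near cp) N1 => q cq Uq; exact: (tact_cfield _ Ac cq oU Uq sf).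
Qed.

(** The theorem of Schwarz in the chart. *)
Lemma cpart_cpart c i j f p U : atlas c -> cdom c p -> open U -> U p -> smooth_fun U f ->
  cpart c i (cpart c j f) p = cpart c j (cpart c i f) p.
Proof.
move=> Ac cp oU Up sf; rewrite {1 3}/cpart.
have E k l : dC k (in_chart c (cpart c l f)) (cmap c p) = dC k (dC l (in_chart c f)) (cmap c p).
  by apply: dC_near; apply: filterS (img_near cp) => x cx; rewrite in_chart_cpart.
rewrite (E i j) (E j i); exact: (schwarzC i j (chart_img_open (c := c) oU) (chart_img_mem Up cp) (sf c Ac)).
Qed.

(** Second partial derivatives commute. *)
Lemma bracket_cfield c i j p : atlas c -> cdom c p -> bracket (cfield c i) (cfield c j) p = 0.
Proof.
move=> Ac cp; apply/colP => k; rewrite !mxE.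
have Ad := atlas_chart_at p; have dp := cdom_chart_at p.
have sk := coord_smooth k Ad; have od := @cdom_open _ _ (chart_at p).
have E a b : tact p (cfield c a p) (fact (cfield c b) (coord (chart_at p) k)) =
    cpart c a (cpart c b (coord (chart_at p) k)) p.
  rewrite (tact_near _ (fact_cfield_near b Ac cp od dp sk)).
  apply: (tact_cfield a Ac cp (openIdom c od)); first by split.
  exact: cpart_smooth.
rewrite -> (E i j), (E j i), (cpart_cpart i j Ac cp od dp sk); exact: subrr.
Qed.

End Charts.

Opaque tact cfield coord cpart.

Local Notation o0 := (@ord0 1).
Local Notation o1 := (@ord_max 1).

(** * Tensors and connections *)

Lemma sum_ord2 (T : nmodType) (F : 'I_2 -> T) : \sum_(i < 2) F i = F o0 + F o1.
Proof. by rewrite sum2; congr (F _ + F _); exact: val_inj. Qed.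

Lemma cfield_expand2 (R : realType) (S : surface R) (c : chart R S) (p : S) v : atlas c -> cdom c p ->
  v = tact p v (coord c o0) *: cfield c o0 p + tact p v (coord c o1) *: cfield c o1 p.
Proof. by move=> Ac cp; rewrite -(sum_ord2 (fun j => tact p v (coord c j) *: cfield c j p)); exact: cfield_expand. Qed.

Lemma tactE2 (R : realType) (S : surface R) (c : chart R S) (p : S) v f U :
  atlas c -> cdom c p -> open U -> U p -> smooth_fun U f ->
  tact p v f = tact p v (coord c o0) * cpart c o0 f p + tact p v (coord c o1) * cpart c o1 f p.
Proof.
move=> Ac cp oU Up sf; rewrite -(sum_ord2 (fun j => tact p v (coord c j) * cpart c j f p)).
exact: (tactE _ Ac cp oU Up sf).
Qed.

Section Tensors.
Variables (R : realType) (S : surface R).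
Local Notation C := R[i].
Implicit Types (c d : chart R S) (p q : S) (U W : set S) (f h : S -> C) (X Y : field S).

(** The indicator of an open set is smooth on it. Multiplication by it makes
    fields that agree on the set equal everywhere, so linearity over smooth
    functions implies locality without any cut-off function. *)
Definition indicator W : S -> C := fun p => if pselect (W p) then 1 else 0.

Lemma indicator_in W p : W p -> indicator W p = 1.
Proof. by rewrite /indicator; case: pselect. Qed.

Lemma indicator_smooth W : open W -> smooth_fun W (indicator W).
Proof.
move=> oW; apply: (smooth_fun_eq (h := fun=> 1)) => //; last exact: smooth_fun_cst.
by move=> p Wp; rewrite indicator_in.
Qed.

Lemma indicator_scale W X Y : (forall p, W p -> X p = Y p) ->
  (fun p => indicator W p *: X p) = (fun p => indicator W p *: Y p).
Proof.
move=> XY; apply/funext => p; rewrite /indicator; case: pselect => [Wp|nWp]; first by rewrite XY.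
by rewrite !scale0r.
Qed.

Variable Z : lmodType C.

(** Bilinearity over smooth functions. It is required over every open subset of
    W, since the argument fields are only smooth there. *)
Definition tensorial W (T : field S -> field S -> S -> Z) :=
  forall U, open U -> U `<=` W -> forall X X' Y Y' f,
    smooth_field U X -> smooth_field U X' -> smooth_field U Y -> smooth_field U Y' ->
    smooth_fun U f -> forall p, U p ->
    [/\ T (fun q => X q + X' q) Y p = T X Y p + T X' Y p,
        T (fun q => f q *: X q) Y p = f p *: T X Y p,
        T X (fun q => Y q + Y' q) p = T X Y p + T X Y' p &
        T X (fun q => f q *: Y q) p = f p *: T X Y p].

Lemma tensorial_local W T U X X' Y Y' p : tensorial W T -> open U -> U `<=` W ->
  smooth_field U X -> smooth_field U X' -> smooth_field U Y -> smooth_field U Y' ->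
  (forall q, U q -> X q = X' q) -> (forall q, U q -> Y q = Y' q) -> U p ->
  T X Y p = T X' Y' p.
Proof.
move=> tT oU UW sX sX' sY sY' XX YY Up; have sI := indicator_smooth oU.
have Ix A B : smooth_field U A -> smooth_field U B ->
    T (fun q => indicator U q *: A q) B p = T A B p.
  move=> sA sB; have [_ -> _ _] := tT U oU UW A A B B _ sA sA sB sB sI p Up.
  by rewrite indicator_in // scale1r.
have Iy A B : smooth_field U A -> smooth_field U B ->
    T A (fun q => indicator U q *: B q) p = T A B p.
  move=> sA sB; have [_ _ _ ->] := tT U oU UW A A B B _ sA sA sB sB sI p Up.
  by rewrite indicator_in // scale1r.
rewrite -(Ix X Y) // (indicator_scale XX) Ix // -(Iy X' Y) // (indicator_scale YY) Iy //.
Qed.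

(** Near p both fields are combinations of the coordinate fields with smooth
    coefficients, and T is local. *)
Lemma tensorial_expand W T U X Y c p : tensorial W T -> open U -> U `<=` W ->
  smooth_field U X -> smooth_field U Y -> U p -> atlas c -> cdom c p ->
  T X Y p =
    (tact p (X p) (coord c o0) * tact p (Y p) (coord c o0)) *: T (cfield c o0) (cfield c o0) p +
    (tact p (X p) (coord c o0) * tact p (Y p) (coord c o1)) *: T (cfield c o0) (cfield c o1) p +
    ((tact p (X p) (coord c o1) * tact p (Y p) (coord c o0)) *: T (cfield c o1) (cfield c o0) p +
    (tact p (X p) (coord c o1) * tact p (Y p) (coord c o1)) *: T (cfield c o1) (cfield c o1) p).
Proof.
move=> tT oU UW sX sY Up Ac cp.
pose U' := U `&` cdom c; have oU' : open U' by exact: openIdom.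
have U'W : U' `<=` W by move=> q [/UW].
have U'p : U' p by split.
have sE j : smooth_field U' (cfield c j) by apply: smooth_field_sub (cfield_smooth j Ac) => q [].
have sub A : smooth_field U A -> smooth_field U' A by apply: smooth_field_sub => q [].
have cs A i : smooth_field U A -> smooth_fun U' (fact A (coord c i)) by move=> sA; exact: sA.
have sZ A i : smooth_field U A -> smooth_field U' (fun q => fact A (coord c i) q *: cfield c i q).
  by move=> sA; apply: smooth_fieldZ => //; exact: cs.
have sC A : smooth_field U A ->
    smooth_field U' (fun q => fact A (coord c o0) q *: cfield c o0 q + fact A (coord c o1) q *: cfield c o1 q).
  by move=> sA; apply: smooth_fieldD => //; exact: sZ.
have eC A q : U' q -> A q = fact A (coord c o0) q *: cfield c o0 q + fact A (coord c o1) q *: cfield c o1 q.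
  by move=> [_ cq]; exact: cfield_expand2.
have EX B : smooth_field U' B -> T X B p =
    fact X (coord c o0) p *: T (cfield c o0) B p + fact X (coord c o1) p *: T (cfield c o1) B p.
  move=> sB; have := tensorial_local tT oU' U'W (sub X sX) (sC X sX) sB sB (eC X) (fun _ _ => erefl) U'p.
  move=> EQ; apply: (etrans EQ) => {EQ}.
  have [EQ _ _ _] := tT U' oU' U'W _ _ _ _ _ (sZ X o0 sX) (sZ X o1 sX) sB sB (cs X o0 sX) p U'p.
  apply: (etrans EQ) => {EQ}; congr (_ + _).
    by have [_ EQ _ _] := tT U' oU' U'W _ _ _ _ _ (sE o0) (sE o0) sB sB (cs X o0 sX) p U'p.
  by have [_ EQ _ _] := tT U' oU' U'W _ _ _ _ _ (sE o1) (sE o1) sB sB (cs X o1 sX) p U'p.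
have EY A : smooth_field U' A -> T A Y p =
    fact Y (coord c o0) p *: T A (cfield c o0) p + fact Y (coord c o1) p *: T A (cfield c o1) p.
  move=> sA; have := tensorial_local tT oU' U'W sA sA (sub Y sY) (sC Y sY) (fun _ _ => erefl) (eC Y) U'p.
  move=> EQ; apply: (etrans EQ) => {EQ}.
  have [_ _ EQ _] := tT U' oU' U'W _ _ _ _ _ sA sA (sZ Y o0 sY) (sZ Y o1 sY) (cs Y o0 sY) p U'p.
  apply: (etrans EQ) => {EQ}; congr (_ + _).
    by have [_ _ _ EQ] := tT U' oU' U'W _ _ _ _ _ sA sA (sE o0) (sE o0) (cs Y o0 sY) p U'p.
  by have [_ _ _ EQ] := tT U' oU' U'W _ _ _ _ _ sA sA (sE o1) (sE o1) (cs Y o1 sY) p U'p.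
rewrite -> (EX Y (sub Y sY)), (EY _ (sE o0)), (EY _ (sE o1)).
by rewrite -> !scalerDr, !scalerA.
Qed.

End Tensors.

Section Forms.
Variables (R : realType) (S : surface R) (g : S -> 'M[R[i]]_2).
Local Notation C := R[i].

Lemma formDl p v v' w : form g p (v + v') w = form g p v w + form g p v' w.
Proof. by rewrite /form linearD /= !mulmxDl mxE. Qed.
Lemma formDr p v w w' : form g p v (w + w') = form g p v w + form g p v w'.
Proof. by rewrite /form mulmxDr mxE. Qed.
Lemma formZl p a v w : form g p (a *: v) w = a * form g p v w.
Proof. by rewrite /form linearZ /= -!scalemxAl mxE. Qed.
Lemma formZr p a v w : form g p v (a *: w) = a * form g p v w.
Proof. by rewrite /form -scalemxAr mxE. Qed.

Lemma form_lin p a a' b b' v v' w w' :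
  form g p (a *: v + a' *: v') (b *: w + b' *: w') =
  a * b * form g p v w + a * b' * form g p v w' + a' * b * form g p v' w + a' * b' * form g p v' w'.
Proof. rewrite !formDl !formDr !formZl !formZr.
move: (form g p v w) (form g p v' w) (form g p v w') (form g p v' w') => *; ring. Qed.

Lemma form_expand c p v w : atlas c -> cdom c p ->
  form g p v w =
    tact p v (coord c o0) * tact p w (coord c o0) * form g p (cfield c o0 p) (cfield c o0 p) +
    tact p v (coord c o0) * tact p w (coord c o1) * form g p (cfield c o0 p) (cfield c o1 p) +
    tact p v (coord c o1) * tact p w (coord c o0) * form g p (cfield c o1 p) (cfield c o0 p) +
    tact p v (coord c o1) * tact p w (coord c o1) * form g p (cfield c o1 p) (cfield c o1 p).
Proof.
move=> Ac cp; have Ev := cfield_expand2 v Ac cp; have Ew := cfield_expand2 w Ac cp.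
by rewrite -form_lin; apply: f_equal2.
Qed.

End Forms.

Lemma form_mx (R : realType) (S : surface R) (g : S -> 'M[R[i]]_2) p v w : form g p v w = (v^T *m g p *m w) 0 0.
Proof. by []. Qed.

Lemma form_entries (R : realType) (S : surface R) (g : S -> 'M[R[i]]_2) p v w : form g p v w =
  v ord0 0 * w ord0 0 * g p ord0 ord0 + v ord0 0 * w ord_max 0 * g p ord0 ord_max +
  v ord_max 0 * w ord0 0 * g p ord_max ord0 + v ord_max 0 * w ord_max 0 * g p ord_max ord_max.
Proof.
rewrite /form mxE sum_ord2 !mxE !sum_ord2 !mxE.
move: (g p _ _) (g p _ _) (g p _ _) (g p _ _) (v _ _) (v _ _) (w _ _) (w _ _) => *; ring.
Qed.

Opaque form.

Section Connection.
Variables (R : realType) (S : surface R) (g Psi : S -> 'M[R[i]]_2).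
Variable nabla : field S -> field S -> field S.
Local Notation C := R[i].
Hypothesis hg : complex_metric g.
Hypothesis hnabla : levi_civita g nabla.
Hypothesis hPsi : bundle_hom Psi.
Hypothesis hadj : self_adjoint g Psi.
Implicit Types (c d : chart R S) (p q : S) (U W : set S) (f h : S -> C) (X Y : field S).

Lemma nabla_smooth U X Y : open U -> smooth_field U X -> smooth_field U Y -> smooth_field U (nabla X Y).
Proof.
move=> oU sX sY; have [cn _ _] := hnabla.
by have [] := cn U oU X X Y Y (fun=> 0) sX sX sY sY (smooth_fun_cst 0 oU).
Qed.

Lemma nablaDl U X X' Y p : open U -> smooth_field U X -> smooth_field U X' -> smooth_field U Y -> U p ->
  nabla (fun q => X q + X' q) Y p = nabla X Y p + nabla X' Y p.
Proof.
move=> oU sX sX' sY Up; have [cn _ _] := hnabla.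
by have [_ /(_ p Up) []] := cn U oU X X' Y Y (fun=> 0) sX sX' sY sY (smooth_fun_cst 0 oU).
Qed.

Lemma nablaZl U f X Y p : open U -> smooth_fun U f -> smooth_field U X -> smooth_field U Y -> U p ->
  nabla (fun q => f q *: X q) Y p = f p *: nabla X Y p.
Proof.
move=> oU sf sX sY Up; have [cn _ _] := hnabla.
by have [_ /(_ p Up) []] := cn U oU X X Y Y f sX sX sY sY sf.
Qed.

Lemma nablaDr U X Y Y' p : open U -> smooth_field U X -> smooth_field U Y -> smooth_field U Y' -> U p ->
  nabla X (fun q => Y q + Y' q) p = nabla X Y p + nabla X Y' p.
Proof.
move=> oU sX sY sY' Up; have [cn _ _] := hnabla.
by have [_ /(_ p Up) []] := cn U oU X X Y Y' (fun=> 0) sX sX sY sY' (smooth_fun_cst 0 oU).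
Qed.

Lemma nablaZr U f X Y p : open U -> smooth_fun U f -> smooth_field U X -> smooth_field U Y -> U p ->
  nabla X (fun q => f q *: Y q) p = fact X f p *: Y p + f p *: nabla X Y p.
Proof.
move=> oU sf sX sY Up; have [cn _ _] := hnabla.
by have [_ /(_ p Up) []] := cn U oU X X Y Y f sX sX sY sY sf.
Qed.

(** Multiplication by the indicator of U: its derivative vanishes on U. *)
Lemma nabla_local U X X' Y Y' p : open U -> U p ->
  smooth_field U X -> smooth_field U Y -> smooth_field U X' -> smooth_field U Y' ->
  (forall q, U q -> X q = X' q) -> (forall q, U q -> Y q = Y' q) -> nabla X Y p = nabla X' Y' p.
Proof.
move=> oU Up sX sY sX' sY' XX YY; have sI := indicator_smooth oU.
have Ix A B : smooth_field U A -> smooth_field U B ->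
    nabla (fun q => indicator U q *: A q) B p = nabla A B p.
  by move=> sA sB; rewrite (nablaZl oU sI sA sB Up) indicator_in // scale1r.
have Iy A B : smooth_field U A -> smooth_field U B ->
    nabla A (fun q => indicator U q *: B q) p = nabla A B p.
  move=> sA sB; rewrite (nablaZr oU sI sA sB Up) indicator_in // scale1r.
  rewrite /fact (@tact_near _ _ _ _ _ (fun=> 1)) ?tact_cst ?scale0r ?add0r //.
  by have : nbhs p U by [exact: open_nbhs_nbhs]; apply: filterS => q; exact: indicator_in.
rewrite -(Ix X Y) // (indicator_scale XX) Ix // -(Iy X' Y) // (indicator_scale YY) Iy //.
Qed.

(** Valued in the ground field seen as a module over itself, as tensors take
    values in a module. *)
Definition hessian f X Y : S -> C^o := fun p => fact X (fact Y f) p - tact p (nabla X Y p) f.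

Lemma hessian_tensorial W f : smooth_fun W f -> tensorial W (hessian f).
Proof.
move=> sf U oU UW X X' Y Y' h sX sX' sY sY' sh p Up.
have sfU : smooth_fun U f by exact: smooth_fun_sub sf.
rewrite /hessian; split.
- by rewrite (nablaDl oU sX sX' sY Up) /fact !tactD opprD addrACA.
- by rewrite (nablaZl oU sh sX sY Up) /fact !tactZ /GRing.scale /= mulrBr.
- rewrite (nablaDr oU sX sY sY' Up) tactD.
  have -> : fact (fun q => Y q + Y' q) f = fun q => fact Y f q + fact Y' f q.
    by apply/funext => q; rewrite /fact tactD.
  by rewrite {1}/fact (tactD_fun _ Up (fact_smooth oU sY sfU) (fact_smooth oU sY' sfU)) opprD addrACA.
- rewrite (nablaZr oU sh sX sY Up) tactD !tactZ.
  have -> : fact (fun q => h q *: Y q) f = fun q => h q * fact Y f q.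
    by apply/funext => q; rewrite /fact tactZ.
  rewrite {1}/fact (tactM_fun _ oU Up sh (fact_smooth oU sY sfU)) /GRing.scale /= /fact; ring.
Qed.

(** The covariant derivative (nabla_X Psi) Y. As the torsion vanishes, its
    antisymmetric part is the exterior derivative of Psi. *)
Definition nablaPsi X Y : S -> 'cV[C]_2 := fun p => nabla X (homf Psi Y) p - homf Psi (nabla X Y) p.

Lemma homfD X Y : homf Psi (fun q => X q + Y q) = fun q => homf Psi X q + homf Psi Y q.
Proof. by apply/funext => q; rewrite /homf mulmxDr. Qed.

Lemma homfZ f X : homf Psi (fun q => f q *: X q) = fun q => f q *: homf Psi X q.
Proof. by apply/funext => q; rewrite /homf scalemxAr. Qed.

Lemma nablaPsi_tensorial : tensorial setT nablaPsi.
Proof.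
move=> U oU _ X X' Y Y' h sX sX' sY sY' sh p Up.
have sP A : smooth_field U A -> smooth_field U (homf Psi A) by exact: hPsi.
rewrite /nablaPsi; split.
- rewrite (nablaDl oU sX sX' (sP _ sY) Up) /homf (nablaDl oU sX sX' sY Up) mulmxDr.
  by rewrite opprD addrACA.
- by rewrite (nablaZl oU sh sX (sP _ sY) Up) /homf (nablaZl oU sh sX sY Up) -scalemxAr scalerBr.
- rewrite homfD (nablaDr oU sX (sP _ sY) (sP _ sY') Up) /homf (nablaDr oU sX sY sY' Up) mulmxDr.
  by rewrite opprD addrACA.
- rewrite homfZ (nablaZr oU sh sX (sP _ sY) Up) /homf (nablaZr oU sh sX sY Up) mulmxDr -!scalemxAr.
  by rewrite opprD addrACA subrr add0r scalerBr.
Qed.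

(** The Gauss-Weingarten system, satisfied by any matrix entry f of the
    immersion together with the same entry n of its normal. The second
    fundamental form is g(Psi X, Y), and the term g(X, Y) f is due to the
    curvature of the quadric of matrices of determinant 1. *)
Definition solution W f n := [/\ smooth_fun W f, smooth_fun W n &
  forall U X Y, open U -> U `<=` W -> smooth_field U X -> smooth_field U Y -> forall p, U p ->
    hessian f X Y p = form g p (Psi p *m X p) (Y p) * n p + form g p (X p) (Y p) * f p /\
    fact X n p = - tact p (Psi p *m X p) f].

Definition metric_coef c i j p := form g p (cfield c i p) (cfield c j p).
Definition second_coef c i j p := form g p (Psi p *m cfield c i p) (cfield c j p).
Definition christoffel c i j k p := tact p (nabla (cfield c i) (cfield c j) p) (coord c k).
Definition shape_coef c i k p := tact p (Psi p *m cfield c i p) (coord c k).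

Definition chart_solution c f n p :=
  (forall i j, cpart c i (cpart c j f) p =
     christoffel c i j o0 p * cpart c o0 f p + christoffel c i j o1 p * cpart c o1 f p +
     (second_coef c i j p * n p + metric_coef c i j p * f p)) /\
  (forall i, cpart c i n p = - (shape_coef c i o0 p * cpart c o0 f p + shape_coef c i o1 p * cpart c o1 f p)).

Lemma hessian_cfield c i j f W p : atlas c -> cdom c p -> open W -> W p -> smooth_fun W f ->
  hessian f (cfield c i) (cfield c j) p =
  cpart c i (cpart c j f) p - (christoffel c i j o0 p * cpart c o0 f p + christoffel c i j o1 p * cpart c o1 f p).
Proof.
move=> Ac cp oW Wp sf; rewrite /hessian /fact; congr (_ - _).
  rewrite (tact_near _ (fact_cfield_near j Ac cp oW Wp sf)).
  apply: (tact_cfield i Ac cp (openIdom c oW)); first by split.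
  exact: cpart_smooth.
exact: (tactE2 _ Ac cp oW Wp sf).
Qed.

Lemma solution_chart W f n c p : open W -> solution W f n -> atlas c -> W p -> cdom c p ->
  chart_solution c f n p.
Proof.
move=> oW [sf sn H] Ac Wp cp; have oU := openIdom c oW.
have UW : W `&` cdom c `<=` W by move=> q [].
have sE i : smooth_field (W `&` cdom c) (cfield c i).
  by apply: smooth_field_sub (cfield_smooth i Ac) => q [].
have Up : (W `&` cdom c) p by [].
split=> [i j|i].
  have [H1 _] := H _ _ _ oU UW (sE i) (sE j) p Up.
  move: H1; rewrite (hessian_cfield i j Ac cp oW Wp sf) => H1.
  by apply/eqP; rewrite addrC -subr_eq; apply/eqP.
have [_ H2] := H _ _ _ oU UW (sE i) (sE o0) p Up.
rewrite -(tact_cfield i Ac cp oW Wp sn); apply: (etrans H2); congr (- _).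
exact: (tactE2 _ Ac cp oW Wp sf).
Qed.

Lemma shape_expand c k p v : atlas c -> cdom c p -> tact p (Psi p *m v) (coord c k) =
  tact p v (coord c o0) * shape_coef c o0 k p + tact p v (coord c o1) * shape_coef c o1 k p.
Proof.
move=> Ac cp; rewrite /shape_coef -!tactZ -tactD !scalemxAr -mulmxDr.
by congr (tact p (_ *m _) _); exact: cfield_expand2.
Qed.

Lemma metric_expand c p v w : atlas c -> cdom c p ->
  form g p v w =
    tact p v (coord c o0) * tact p w (coord c o0) * metric_coef c o0 o0 p +
    tact p v (coord c o0) * tact p w (coord c o1) * metric_coef c o0 o1 p +
    tact p v (coord c o1) * tact p w (coord c o0) * metric_coef c o1 o0 p +
    tact p v (coord c o1) * tact p w (coord c o1) * metric_coef c o1 o1 p.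
Proof. exact: form_expand. Qed.

Lemma second_coefE c i j p : atlas c -> cdom c p ->
  second_coef c i j p = shape_coef c i o0 p * metric_coef c o0 j p + shape_coef c i o1 p * metric_coef c o1 j p.
Proof.
move=> Ac cp; rewrite /metric_coef -!formZl -formDl /second_coef.
by apply: (f_equal (fun v => form g p v (cfield c j p))); exact: cfield_expand2.
Qed.

(** Both sides of the equations are tensors in X and Y, so that coordinate
    fields suffice. *)
Lemma chart_solution_solution W f n c : open W -> atlas c -> W `<=` cdom c ->
  smooth_fun W f -> smooth_fun W n -> (forall p, W p -> chart_solution c f n p) -> solution W f n.
Proof.
move=> oW Ac Wc sf sn H; split=> // U X Y oU UW sX sY p Up.
have Wp := UW _ Up; have cp := Wc _ Wp; have [H1 H2] := H p Wp.
have E i j : hessian f (cfield c i) (cfield c j) p = second_coef c i j p * n p + metric_coef c i j p * f p.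
  by rewrite (hessian_cfield i j Ac cp oW Wp sf) H1 addrAC subrr add0r.
split.
  have HT := tensorial_expand (hessian_tensorial sf) oU UW sX sY Up Ac cp.
  rewrite HT; rewrite -> (E o0 o0), (E o0 o1), (E o1 o0), (E o1 o1).
  rewrite (metric_expand (X p) (Y p) Ac cp) (metric_expand (Psi p *m X p) (Y p) Ac cp).
  rewrite (shape_expand o0 (X p) Ac cp) (shape_expand o1 (X p) Ac cp).
  rewrite (second_coefE o0 o0 Ac cp) (second_coefE o0 o1 Ac cp) (second_coefE o1 o0 Ac cp) (second_coefE o1 o1 Ac cp).
  have scE (a : C) (b : C^o) : a *: b = a * b by [].
  move: scE; clear; move: (tact p (X p) (coord c o0)) (tact p (X p) (coord c o1)) (tact p (Y p) (coord c o0))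
    (tact p (Y p) (coord c o1)) (shape_coef c o0 o0 p) (shape_coef c o0 o1 p) (shape_coef c o1 o0 p)
    (shape_coef c o1 o1 p) (metric_coef c o0 o0 p) (metric_coef c o0 o1 p) (metric_coef c o1 o0 p)
    (metric_coef c o1 o1 p) (f p) (n p) => ? ? ? ? ? ? ? ? ? ? ? ? ? ? scE; rewrite !scE; ring.
rewrite /fact (tactE2 _ Ac cp oW Wp sn) (tactE2 _ Ac cp oW Wp sf).
rewrite (H2 o0) (H2 o1) (shape_expand o0 (X p) Ac cp) (shape_expand o1 (X p) Ac cp); clear.
move: (tact p (X p) (coord c o0)) (tact p (X p) (coord c o1)) (shape_coef c o0 o0 p) (shape_coef c o0 o1 p)
  (shape_coef c o1 o0 p) (shape_coef c o1 o1 p) (cpart c o0 f p) (cpart c o1 f p) => *; ring.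
Qed.

End Connection.

(** * The linear system for jets and its curvature *)

Local Notation k0 := (@Ordinal 4 0 isT).
Local Notation k1 := (@Ordinal 4 1 isT).
Local Notation k2 := (@Ordinal 4 2 isT).
Local Notation k3 := (@Ordinal 4 3 isT).

Lemma ord2_ind (P : 'I_2 -> Prop) : P o0 -> P o1 -> forall i, P i.
Proof. by move=> P0 P1 [[|[|//]] H]; [move: P0|move: P1]; congr P; exact: val_inj. Qed.

Lemma ord4_ind (P : 'I_4 -> Prop) : P k0 -> P k1 -> P k2 -> P k3 -> forall a, P a.
Proof.
move=> P0 P1 P2 P3 [[|[|[|[|//]]]] H]; [move: P0|move: P1|move: P2|move: P3]; congr P; exact: val_inj.
Qed.

Lemma sum4 (T : nmodType) (F : 'I_4 -> T) : \sum_(a < 4) F a = F k0 + F k1 + F k2 + F k3.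
Proof.
rewrite !big_ord_recr big_ord0 /= add0r; congr (F _ + F _ + F _ + F _); exact: val_inj.
Qed.

Section Algebra.

(** Here D01 stands for d_0 B_1 and D10 for d_1 B_0, so that F is the curvature
    of the connection B. If N is symmetric and d_i N = B_i N + N B_i^T, the
    second hypothesis says that the second derivatives of N commute, which
    amounts to F N + N F^T = 0. *)
Lemma flat_antisymmetric (K : comPzRingType) n (B0 B1 D01 D10 N F : 'M[K]_n) :
  F = D01 + B1 *m B0 - D10 - B0 *m B1 -> N^T = N ->
  D01 *m N + B1 *m (B0 *m N + N *m B0^T) + ((B0 *m N + N *m B0^T) *m B1^T + N *m D01^T) =
  D10 *m N + B0 *m (B1 *m N + N *m B1^T) + ((B1 *m N + N *m B1^T) *m B0^T + N *m D10^T) ->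
  F *m N + (F *m N)^T = 0.
Proof.
move=> -> NT /eqP; rewrite -subr_eq0 => /eqP E.
have trB (A B : 'M[K]_n) : (A - B)^T = A^T - B^T by apply/matrixP => i j; rewrite !mxE.
have trD (A B : 'M[K]_n) : (A + B)^T = A^T + B^T by apply/matrixP => i j; rewrite !mxE.
rewrite trmx_mul NT !trB !trD !trmx_mul.
rewrite !mulmxDl !mulmxDr !mulmxA in E; rewrite !mulmxDl !mulmxDr !mulNmx !mulmxN !mulmxA.
move: (D01 *m N) (D10 *m N) (N *m D01^T) (N *m D10^T) (B1 *m B0 *m N) (B0 *m B1 *m N)
  (B1 *m N *m B0^T) (B0 *m N *m B1^T) (N *m B0^T *m B1^T) (N *m B1^T *m B0^T) E.
move=> a a' b b' x1 x2 y1 y2 z1 z2 <-; apply/matrixP => i j; rewrite !mxE.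
ring.
Qed.

(** With the same notation, an invertible solution of d_i J = B_i J forces F =
    0 because its second derivatives commute. *)
Lemma flat_of_frame (K : fieldType) n (B0 B1 D01 D10 J : 'M[K]_n) : J \in unitmx ->
  D01 *m J + B1 *m (B0 *m J) = D10 *m J + B0 *m (B1 *m J) ->
  D01 + B1 *m B0 - D10 - B0 *m B1 = 0.
Proof.
move=> uJ E; rewrite -[LHS](mulmxK uJ).
have -> : (D01 + B1 *m B0 - D10 - B0 *m B1) *m J = 0; last by rewrite mul0mx.
rewrite !mulmxDl !mulNmx -!mulmxA E.
by rewrite -addrA -opprD subrr.
Qed.

Lemma antisymmetric4_0 (K : numFieldType) (M : 'M[K]_4) : M + M^T = 0 ->
  (forall b, M k0 b = 0) -> M k3 k1 = 0 -> M k3 k2 = 0 -> M k1 k2 = 0 -> M = 0.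
Proof.
move=> MT M0 M31 M32 M12.
have A a b : M b a = - M a b.
  have /matrixP/(_ b a) := MT; rewrite !mxE => /eqP; rewrite addr_eq0 => /eqP -> //.
have D a : M a a = 0.
  have := A a a; move/eqP; rewrite -addr_eq0 -mulr2n mulrn_eq0 /= => /eqP //.
apply/matrixP => a b; rewrite [RHS]mxE; move: a b; apply: ord4_ind; apply: ord4_ind => //;
  rewrite ?D // A ?M0 ?M31 ?M32 ?M12 ?oppr0 //.
Qed.

Definition mx4 (K : nmodType) (r : seq (seq K)) : 'M[K]_4 := \matrix_(a, b) nth 0 (nth [::] r a) b.

Lemma nth_map2 (A B : Type) (f : A -> B) (x : A) (r : seq (seq A)) a b :
  nth (f x) (nth [::] (map (map f) r) a) b = f (nth x (nth [::] r a) b).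
Proof.
have -> : nth [::] (map (map f) r) a = map f (nth [::] r a) by elim: r a => [|s r IH] [|a] //=.
by elim: (nth [::] r a) b => [|y s IHs] [|b] //=.
Qed.

(** The system on the vector (f, d_0 f, d_1 f, n): the rows give the derivative
    of f, then the second derivatives by the Gauss formula with Christoffel
    symbols t, metric coefficients g and second fundamental form h, then the
    Weingarten formula with shape coefficients s. *)
Definition structure_mx (K : pzRingType) (d0 d1 g0 g1 h0 h1 t00 t01 t10 t11 s0 s1 : K) : 'M[K]_4 :=
  mx4 [:: [:: 0; d0; d1; 0]; [:: g0; t00; t01; h0]; [:: g1; t10; t11; h1]; [:: 0; - s0; - s1; 0]].

(** The products of position, coordinate fields and normal. *)
Definition gram_mx (K : pzRingType) (u g00 g01 g10 g11 w : K) : 'M[K]_4 :=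
  mx4 [:: [:: u; 0; 0; 0]; [:: 0; g00; g01; 0]; [:: 0; g10; g11; 0]; [:: 0; 0; 0; w]].

(** The hypotheses are h = g(Psi ., .) and the expansion of g in the frame. The
    mixed entries of the two terms cancel: g enters the Gauss formula with the
    sign opposite to that of the square -1 of the position, and h enters the
    Gauss and Weingarten formulas with opposite signs. *)
Lemma gram_derivative (K : comPzRingType) (d0 d1 g0 g1 h0 h1 t00 t01 t10 t11 s0 s1 g00 g01 g10 g11 : K) :
  g0 = d0 * g00 + d1 * g10 -> g1 = d0 * g01 + d1 * g11 -> g10 = g01 ->
  h0 = s0 * g00 + s1 * g10 -> h1 = s0 * g01 + s1 * g11 ->
  structure_mx d0 d1 g0 g1 h0 h1 t00 t01 t10 t11 s0 s1 *m gram_mx (-1) g00 g01 g10 g11 1 +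
  gram_mx (-1) g00 g01 g10 g11 1 *m (structure_mx d0 d1 g0 g1 h0 h1 t00 t01 t10 t11 s0 s1)^T =
  gram_mx 0 (t00 * g00 + t01 * g10 + (t00 * g00 + t01 * g01))
            (t00 * g01 + t01 * g11 + (t10 * g00 + t11 * g01))
            (t10 * g00 + t11 * g10 + (t00 * g10 + t01 * g11))
            (t10 * g01 + t11 * g11 + (t10 * g10 + t11 * g11)) 0.
Proof.
move=> -> -> -> -> ->; apply/matrixP => a b; rewrite !mxE !sum4 !mxE.
by move: a b; apply: ord4_ind; apply: ord4_ind => /=; ring.
Qed.

Lemma gram_mx_tr (K : pzRingType) (u g00 g01 g10 g11 w : K) : g10 = g01 ->
  (gram_mx u g00 g01 g10 g11 w)^T = gram_mx u g00 g01 g10 g11 w.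
Proof. by move=> ->; apply/matrixP => a b; rewrite !mxE; move: a b; apply: ord4_ind; apply: ord4_ind. Qed.

Lemma gram_mx_unit (K : fieldType) (g00 g01 g10 g11 : K) : g10 = g01 -> g00 * g11 - g01 ^+ 2 != 0 ->
  gram_mx (-1) g00 g01 g10 g11 1 \in unitmx.
Proof.
move=> -> D0; set D := _ - _ in D0.
have /mulmx1_unit [] // : gram_mx (-1) g00 g01 g01 g11 1 *m
    gram_mx (-1) (g11 / D) (- g01 / D) (- g01 / D) (g00 / D) 1 = 1%:M.
apply/matrixP => a b; rewrite !mxE !sum4 !mxE.
by move: a b; apply: ord4_ind; apply: ord4_ind => /=; rewrite /D in D0 *; field.
Qed.

Lemma gram_antisymmetric_0 (K : numFieldType) (F : 'M[K]_4) (g00 g01 g10 g11 : K) :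
  let N := gram_mx (-1) g00 g01 g10 g11 1 in
  N \in unitmx -> F *m N + (F *m N)^T = 0 -> (forall b, F k0 b = 0) ->
  F k3 k1 = 0 -> F k3 k2 = 0 -> (F *m N) k1 k2 = 0 -> F = 0.
Proof.
move=> N uN FNt F0 F1 F2 F3.
have FN0 : F *m N = 0; last by rewrite -[LHS](mulmxK uN) FN0 mul0mx.
apply: antisymmetric4_0 => // [b||]; first by rewrite mxE sum4 !F0 !mul0r !addr0.
  by rewrite mxE sum4 F1 F2 !mxE /= !mulr0 !mul0r !addr0.
by rewrite mxE sum4 F1 F2 !mxE /= !mulr0 !mul0r !addr0.
Qed.

Lemma det2 (K : comPzRingType) (A : 'M[K]_2) : \det A = A o0 o0 * A o1 o1 - A o0 o1 * A o1 o0.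
Proof.
rewrite (expand_det_row _ o0) sum_ord2 /cofactor !det_mx11 !mxE /=.
rewrite expr0 expr1 mul1r mulN1r mulrN.
by congr (_ * A _ _ - _ * A _ _); exact: val_inj.
Qed.

(** The matrices s and A represent the same endomorphism in two bases. *)
Lemma det_frame (K : fieldType) (A s t : 'M[K]_2) (e : 'I_2 -> 'cV[K]_2) :
  (forall j, delta_mx j 0 = t o0 j *: e o0 + t o1 j *: e o1) ->
  (forall j, A *m e j = s o0 j *: e o0 + s o1 j *: e o1) -> \det A = \det s.
Proof.
move=> te Ae; pose T : 'M[K]_2 := \matrix_(k, j) e j k 0.
have Tt : T *m t = 1%:M.
  apply/matrixP => a b; rewrite !mxE sum_ord2 !mxE.
  have /colP/(_ a) := te b; rewrite !mxE eqxx andbT => ->.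
  by rewrite mulrC [X in _ + X]mulrC.
have [uT _] := mulmx1_unit Tt.
have AT : A *m T = T *m s.
  apply/matrixP => a b; rewrite !mxE !sum_ord2 !mxE.
  have /colP/(_ a) := Ae b; rewrite !mxE !sum_ord2 => ->.
  by rewrite mulrC [X in _ + X]mulrC.
have := congr1 determinant AT; rewrite !det_mulmx mulrC.
by have dT : \det T != 0; [move: uT; rewrite unitmxE unitfE|move/(mulfI dT)].
Qed.

Section CurvatureEntries.
Variables (K : comPzRingType).
Variables (g00 g01 g10 g11 h00 h01 h10 h11 : K).
(* t i j k : Christoffel symbol of d_i d_j along d_k; s i k : shape coefficients *)
Variables (t000 t001 t010 t011 t100 t101 t110 t111 s00 s01 s10 s11 : K).
Variables (dg10 dg11 dh10 dh11 dt100 dt101 dt110 dt111 ds10 ds11 : K).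
Variables (dg00 dg01 dh00 dh01 dt000 dt001 dt010 dt011 ds00 ds01 : K).
Let B0 := structure_mx 1 0 g00 g01 h00 h01 t000 t001 t010 t011 s00 s01.
Let B1 := structure_mx 0 1 g10 g11 h10 h11 t100 t101 t110 t111 s10 s11.
Let D01 := structure_mx 0 0 dg10 dg11 dh10 dh11 dt100 dt101 dt110 dt111 ds10 ds11.
Let D10 := structure_mx 0 0 dg00 dg01 dh00 dh01 dt000 dt001 dt010 dt011 ds00 ds01.
Let F := D01 + B1 *m B0 - D10 - B0 *m B1.

Lemma curvature_row0 : g10 = g01 -> h10 = h01 -> t100 = t010 -> t101 = t011 -> forall b, F k0 b = 0.
Proof.
move=> eg eh et0 et1 b; rewrite /F /B0 /B1 eg eh et0 et1 !mxE !sum4 !mxE.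
by move: b; apply: ord4_ind => /=; ring.
Qed.

Lemma curvature_entries :
  [/\ F k3 k1 = - (ds10 + (s10 * t000 + s11 * t010) - (ds00 + (s00 * t100 + s01 * t110))),
      F k3 k2 = - (ds11 + (s10 * t001 + s11 * t011) - (ds01 + (s00 * t101 + s01 * t111))),
      F k1 k1 = dt100 + (t100 * t000 + t101 * t010) - (dt000 + (t000 * t100 + t001 * t110)) + g10 - h10 * s00 + h00 * s10 &
      F k1 k2 = dt101 + (t100 * t001 + t101 * t011) - (dt001 + (t000 * t101 + t001 * t111)) - g00 - h10 * s01 + h00 * s11].
Proof. by split; rewrite !mxE !sum4 !mxE /=; ring. Qed.

Lemma curvature_gauss : g10 = g01 -> h10 = h01 ->
  h01 = s00 * g01 + s01 * g11 -> h11 = s10 * g01 + s11 * g11 ->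
  (F *m gram_mx (-1) g00 g01 g10 g11 1) k1 k2 =
  (dt100 + (t100 * t000 + t101 * t010) - (dt000 + (t000 * t100 + t001 * t110))) * g01 +
  (dt101 + (t100 * t001 + t101 * t011) - (dt001 + (t000 * t101 + t001 * t111))) * g11 -
  (g00 * g11 - g01 ^+ 2 - (h00 * h11 - h01 ^+ 2)).
Proof.
move=> e1 e2 e3 e4; have [_ _ F11 F12] := curvature_entries.
rewrite mxE sum4 F11 F12 !mxE /= e1 e2 e4 e3; ring.
Qed.

End CurvatureEntries.

End Algebra.

Section MatrixFunctions.
Variables (R : realType) (S : surface R).
Local Notation C := R[i].
Implicit Types (c : chart R S) (p q : S) (U W : set S).

Definition smooth_mx U m n (M : S -> 'M[C]_(m, n)) := forall a b, smooth_fun U (fun p => M p a b).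

Definition mpart c i m n (M : S -> 'M[C]_(m, n)) : S -> 'M[C]_(m, n) :=
  fun p => dM i (fun x => M (cinv c x)) (cmap c p).

Lemma mpartE c i m n (M : S -> 'M[C]_(m, n)) p a b : mpart c i M p a b = cpart c i (fun q => M q a b) p.
Proof. by rewrite /mpart dME. Qed.

Lemma smooth_mx_chart U c m n (M : S -> 'M[C]_(m, n)) : atlas c -> smooth_mx U M ->
  smoothMx (chart_img c U) (fun x => M (cinv c x)).
Proof. by move=> Ac sM a b; exact: sM. Qed.

Lemma dM_mpart c i m n (M : S -> 'M[C]_(m, n)) x : (cmap c @` cdom c) x ->
  dM i (fun x => M (cinv c x)) x = mpart c i M (cinv c x).
Proof. by move=> cx; rewrite /mpart cinvK. Qed.

Lemma mpart_near c i m n (M N : S -> 'M[C]_(m, n)) p : cdom c p -> (\near p, M p = N p) ->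
  mpart c i M p = mpart c i N p.
Proof. by move=> cp MN; apply: dM_near; exact: in_chart_near MN. Qed.

Lemma smooth_mxM U m n l (M : S -> 'M[C]_(m, n)) (N : S -> 'M[C]_(n, l)) : open U ->
  smooth_mx U M -> smooth_mx U N -> smooth_mx U (fun p => M p *m N p).
Proof.
move=> oU sM sN a b; apply: (smooth_fun_eq (h := fun p => \sum_k M p a k * N p k b)) => //.
  by move=> p _; rewrite mxE.
by apply: smooth_fun_sum => // k; exact: smooth_funM.
Qed.

Lemma smooth_mx_tr U m n (M : S -> 'M[C]_(m, n)) : open U -> smooth_mx U M -> smooth_mx U (fun p => (M p)^T).
Proof.
by move=> oU sM a b; apply: (smooth_fun_eq (h := fun p => M p b a)) => // p _; rewrite mxE.
Qed.

Lemma mpartM U c i m n l (M : S -> 'M[C]_(m, n)) (N : S -> 'M[C]_(n, l)) p : open U -> atlas c -> U p -> cdom c p ->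
  smooth_mx U M -> smooth_mx U N ->
  mpart c i (fun p => M p *m N p) p = mpart c i M p *m N p + M p *m mpart c i N p.
Proof.
move=> oU Ac Up cp sM sN.
have := dMM i (chart_img_open (c := c) oU) (chart_img_mem Up cp) (smooth_mx_chart Ac sM) (smooth_mx_chart Ac sN).
by rewrite cmapK.
Qed.

Lemma mpartD U c i m n (M N : S -> 'M[C]_(m, n)) p : atlas c -> U p -> cdom c p ->
  smooth_mx U M -> smooth_mx U N ->
  mpart c i (fun p => M p + N p) p = mpart c i M p + mpart c i N p.
Proof.
move=> Ac Up cp sM sN.
exact: (dMD i (chart_img_mem Up cp) (smooth_mx_chart Ac sM) (smooth_mx_chart Ac sN)).
Qed.

Lemma mpart_tr c i m n (M : S -> 'M[C]_(m, n)) p : mpart c i (fun p => (M p)^T) p = (mpart c i M p)^T.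
Proof. exact: dM_tr. Qed.

Lemma mpart_cst c i m n (M : 'M[C]_(m, n)) p : mpart c i (fun=> M) p = 0.
Proof. exact: dM_cst. Qed.

Lemma mpart_smooth U c i m n (M : S -> 'M[C]_(m, n)) : open U -> atlas c -> smooth_mx U M ->
  smooth_mx (U `&` cdom c) (mpart c i M).
Proof.
move=> oU Ac sM a b; have := cpart_smooth i Ac oU (sM a b).
by apply: smooth_fun_eq => [|p _]; [exact: openIdom|rewrite mpartE].
Qed.

Lemma mpart_schwarz U c i j m n (M : S -> 'M[C]_(m, n)) p : open U -> atlas c -> U p -> cdom c p ->
  smooth_mx U M -> mpart c i (mpart c j M) p = mpart c j (mpart c i M) p.
Proof.
move=> oU Ac Up cp sM; apply/matrixP => a b.
apply: (etrans (mpartE c i _ p a b)); apply: (etrans _ (esym (mpartE c j _ p a b))).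
have E k : (fun q => mpart c k M q a b) = cpart c k (fun q => M q a b).
  by apply/funext => q; rewrite mpartE.
rewrite -> (E i), (E j); exact: (cpart_cpart i j Ac cp oU Up (sM a b)).
Qed.

Definition mx4_fun (r : seq (seq (S -> C))) p : 'M[C]_4 := mx4 (map (map (fun f => f p)) r).

Lemma mx4_funE r p a b : mx4_fun r p a b = nth (fun=> 0) (nth [::] r a) b p.
Proof. by rewrite mxE; exact: (nth_map2 (fun f : S -> C => f p) (fun=> 0)). Qed.

Lemma mx4_smooth U r : open U ->
  (forall a b : 'I_4, smooth_fun U (nth (fun=> 0) (nth [::] r a) b)) -> smooth_mx U (mx4_fun r).
Proof. by move=> oU sr a b; apply: (smooth_fun_eq _ _ (sr a b)) => // p _; exact: mx4_funE. Qed.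

Lemma mpart_mx4 c j r p : mpart c j (mx4_fun r) p = mx4 (map (map (fun f => cpart c j f p)) r).
Proof.
apply/matrixP => a b; apply: (etrans (mpartE _ _ _ _ _ _)); rewrite [RHS]mxE.
have -> : (fun q => mx4_fun r q a b) = nth (fun=> 0) (nth [::] r a) b.
  by apply/funext => q; exact: mx4_funE.
by rewrite -(nth_map2 (fun f => cpart c j f p)) cpart_cst.
Qed.

End MatrixFunctions.

Opaque mpart.

Section Structure.
Variables (R : realType) (S : surface R) (g Psi : S -> 'M[R[i]]_2).
Variable nabla : field S -> field S -> field S.
Local Notation C := R[i].
Hypothesis hg : complex_metric g.
Hypothesis hnabla : levi_civita g nabla.
Hypothesis hPsi : bundle_hom Psi.
Hypothesis hadj : self_adjoint g Psi.
Variable c : chart R S.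
Hypothesis Ac : atlas c.
Local Notation E := (cfield c).
Local Notation G := (metric_coef g c).
Local Notation h := (second_coef g Psi c).
Local Notation Gam := (christoffel nabla c).
Local Notation Sh := (shape_coef Psi c).
Implicit Types (p q : S) (i j k l : 'I_2).
Let oc : open (cdom c) := @cdom_open _ _ c.
Let sE i : smooth_field (cdom c) (E i) := cfield_smooth i Ac.

Lemma metric_sym i j p : G i j p = G j i p.
Proof. by have [_ sym _] := hg; exact: sym. Qed.

Lemma second_sym i j p : h i j p = h j i p.
Proof. by have [_ sym _] := hg; exact: (etrans (hadj _ _ _) (sym _ _ _)). Qed.

Lemma christoffel_sym i j k p : cdom c p -> Gam i j k p = Gam j i k p.
Proof.
move=> cp; have [_ tf _] := hnabla.
have := tf _ _ _ oc (sE i) (sE j) p cp; rewrite (bracket_cfield i j Ac cp) => /eqP.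
by rewrite subr_eq0 => /eqP; rewrite /christoffel => ->.
Qed.

Lemma metric_smooth i j : smooth_fun (cdom c) (G i j).
Proof. by have [sg _ _] := hg; exact: sg. Qed.

Lemma second_smooth i j : smooth_fun (cdom c) (h i j).
Proof. by have [sg _ _] := hg; apply: (sg _ (homf Psi (E i)) (E j)) => //; exact: hPsi. Qed.

Lemma coord_field_smooth X i : smooth_field (cdom c) X -> smooth_fun (cdom c) (fact X (coord c i)).
Proof. by move=> sX; rewrite -[X in smooth_fun X _]setIid; exact: sX. Qed.

Lemma christoffel_smooth i j k : smooth_fun (cdom c) (Gam i j k).
Proof. by apply: coord_field_smooth; exact: (nabla_smooth hnabla). Qed.

Lemma shape_smooth i k : smooth_fun (cdom c) (Sh i k).
Proof. by apply: (coord_field_smooth (X := homf Psi (E i))); exact: hPsi. Qed.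

Lemma form_cfield p v j : cdom c p -> form g p v (E j p) =
  tact p v (coord c o0) * G o0 j p + tact p v (coord c o1) * G o1 j p.
Proof.
move=> cp; rewrite /metric_coef -!formZl -formDl.
by apply: (f_equal (fun v => form g p v (E j p))); exact: cfield_expand2.
Qed.

(** Compatibility of the connection, on coordinate fields. *)
Lemma metric_compat k i j p : cdom c p -> cpart c k (G i j) p =
  Gam k i o0 p * G o0 j p + Gam k i o1 p * G o1 j p + (Gam k j o0 p * G i o0 p + Gam k j o1 p * G i o1 p).
Proof.
move=> cp; have [_ sym _] := hg; have [_ _ cm] := hnabla.
have := cm _ _ _ _ oc (sE k) (sE i) (sE j) p cp.
rewrite {1}/fact (tact_cfield k Ac cp oc cp (metric_smooth i j)) => H.
apply: (etrans H); apply: f_equal2; first exact: form_cfield.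
apply: (etrans (sym _ _ _)); apply: (etrans (form_cfield _ i cp)).
by rewrite -> (metric_sym o0 i p), (metric_sym o1 i p).
Qed.

(** The field Z is expanded on coordinate fields, to which the Leibniz rule
    applies. *)
Lemma nabla_coord i Z l p : smooth_field (cdom c) Z -> cdom c p ->
  tact p (nabla (E i) Z p) (coord c l) =
  cpart c i (fact Z (coord c l)) p +
  (fact Z (coord c o0) p * Gam i o0 l p + fact Z (coord c o1) p * Gam i o1 l p).
Proof.
move=> sZ cp; have sc k := coord_field_smooth k sZ.
have sZE k : smooth_field (cdom c) (fun q => fact Z (coord c k) q *: E k q) by exact: smooth_fieldZ.
have sZ' := smooth_fieldD oc (sZE o0) (sZE o1).
have -> : nabla (E i) Z p =
    nabla (E i) (fun q => fact Z (coord c o0) q *: E o0 q + fact Z (coord c o1) q *: E o1 q) p.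
  by apply: (nabla_local hnabla oc cp) => // q cq; exact: cfield_expand2.
rewrite (nablaDr hnabla oc (sE i) (sZE o0) (sZE o1) cp).
rewrite -> (nablaZr hnabla oc (sc o0) (sE i) (sE o0) cp), (nablaZr hnabla oc (sc o1) (sE i) (sE o1) cp).
have D k : fact (E i) (fact Z (coord c k)) p = cpart c i (fact Z (coord c k)) p.
  exact: (tact_cfield i Ac cp oc cp (sc k)).
rewrite -> (D o0), (D o1).
rewrite -> !tactD; rewrite -> !tactZ; rewrite -> (tact_cfield_coord o0 l Ac cp), (tact_cfield_coord o1 l Ac cp).
change (tact p (nabla (E i) (E o0) p) (coord c l)) with (Gam i o0 l p).
change (tact p (nabla (E i) (E o1) p) (coord c l)) with (Gam i o1 l p).
clear D; move: l; apply: ord2_ind.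
  have [-> ->] : (o0 == o0)%:R = 1 :> C /\ (o1 == o0)%:R = 0 :> C by [].
  move: (cpart _ _ _ _) (cpart _ _ _ _) (fact _ _ _) (fact _ _ _) (Gam _ _ _ _) (Gam _ _ _ _) => *; ring.
have [-> ->] : (o0 == o1)%:R = 0 :> C /\ (o1 == o1)%:R = 1 :> C by [].
move: (cpart _ _ _ _) (cpart _ _ _ _) (fact _ _ _) (fact _ _ _) (Gam _ _ _ _) (Gam _ _ _ _) => *; ring.
Qed.

Definition connection_mx i p : 'M[C]_4 :=
  structure_mx (i == o0)%:R (i == o1)%:R (G i o0 p) (G i o1 p) (h i o0 p) (h i o1 p)
    (Gam i o0 o0 p) (Gam i o0 o1 p) (Gam i o1 o0 p) (Gam i o1 o1 p) (Sh i o0 p) (Sh i o1 p).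

Definition metric_mx p : 'M[C]_4 := gram_mx (-1) (G o0 o0 p) (G o0 o1 p) (G o1 o0 p) (G o1 o1 p) 1.

Lemma connection_mx_smooth i : smooth_mx (cdom c) (connection_mx i).
Proof.
apply: (@mx4_smooth _ _ _ [:: [:: fun=> 0; fun=> (i == o0)%:R; fun=> (i == o1)%:R; fun=> 0];
    [:: G i o0; Gam i o0 o0; Gam i o0 o1; h i o0]; [:: G i o1; Gam i o1 o0; Gam i o1 o1; h i o1];
    [:: fun=> 0; fun p => - Sh i o0 p; fun p => - Sh i o1 p; fun=> 0]] oc).
have sN k : smooth_fun (cdom c) (fun p => - Sh i k p) by apply: smooth_funN => //; exact: shape_smooth.
apply: ord4_ind; apply: ord4_ind => /=; lazymatch goal with
  | |- smooth_fun _ (metric_coef _ _ _ _) => exact: metric_smooth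
  | |- smooth_fun _ (second_coef _ _ _ _ _) => exact: second_smooth
  | |- smooth_fun _ (christoffel _ _ _ _ _) => exact: christoffel_smooth
  | |- smooth_fun _ (fun p => - _) => exact: sN
  | _ => exact: smooth_fun_cst end.
Qed.

Lemma metric_mx_smooth : smooth_mx (cdom c) metric_mx.
Proof.
apply: (@mx4_smooth _ _ _ [:: [:: fun=> -1; fun=> 0; fun=> 0; fun=> 0]; [:: fun=> 0; G o0 o0; G o0 o1; fun=> 0];
    [:: fun=> 0; G o1 o0; G o1 o1; fun=> 0]; [:: fun=> 0; fun=> 0; fun=> 0; fun=> 1]] oc).
apply: ord4_ind; apply: ord4_ind => /=; lazymatch goal with
  | |- smooth_fun _ (metric_coef _ _ _ _) => exact: metric_smooth
  | _ => exact: smooth_fun_cst end.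
Qed.

Lemma cpartN i f p : cdom c p -> smooth_fun (cdom c) f -> cpart c i (fun q => - f q) p = - cpart c i f p.
Proof.
move=> cp sf; have /eqP := cpartD i Ac cp cp sf (smooth_funN oc sf).
have -> : (fun q => f q + - f q) = fun=> 0 by apply/funext => q; rewrite subrr.
by rewrite cpart_cst eq_sym addrC addr_eq0 => /eqP.
Qed.

Lemma mpart_connection i j p : cdom c p -> mpart c j (connection_mx i) p =
  structure_mx 0 0 (cpart c j (G i o0) p) (cpart c j (G i o1) p) (cpart c j (h i o0) p) (cpart c j (h i o1) p)
    (cpart c j (Gam i o0 o0) p) (cpart c j (Gam i o0 o1) p) (cpart c j (Gam i o1 o0) p) (cpart c j (Gam i o1 o1) p)
    (cpart c j (Sh i o0) p) (cpart c j (Sh i o1) p).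
Proof.
move=> cp; apply: (etrans (mpart_mx4 c j [:: [:: fun=> 0; fun=> (i == o0)%:R; fun=> (i == o1)%:R; fun=> 0];
    [:: G i o0; Gam i o0 o0; Gam i o0 o1; h i o0]; [:: G i o1; Gam i o1 o0; Gam i o1 o1; h i o1];
    [:: fun=> 0; fun p => - Sh i o0 p; fun p => - Sh i o1 p; fun=> 0]] p)).
have eN k : cpart c j (fun q => - Sh i k q) p = - cpart c j (Sh i k) p.
  by apply: cpartN => //; exact: shape_smooth.
by rewrite [map _ _]/=; rewrite -> !cpart_cst, (eN o0), (eN o1).
Qed.

(** The Gram matrix is parallel: this is compatibility of the connection in the
    tangent block, and a cancellation in the other entries. *)
Lemma mpart_metric j p : cdom c p -> mpart c j metric_mx p =
  connection_mx j p *m metric_mx p + metric_mx p *m (connection_mx j p)^T.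
Proof.
move=> cp.
have d k l : G k l p = (k == o0)%:R * G o0 l p + (k == o1)%:R * G o1 l p.
  by move: k; apply: ord2_ind; rewrite ?mul1r ?mul0r ?addr0 ?add0r.
apply: (etrans _ (esym (gram_derivative (Gam j o0 o0 p) (Gam j o0 o1 p) (Gam j o1 o0 p) (Gam j o1 o1 p)
  (d j o0) (d j o1) (metric_sym o1 o0 p) (second_coefE g Psi j o0 Ac cp) (second_coefE g Psi j o1 Ac cp)))).
apply: (etrans (mpart_mx4 c j [:: [:: fun=> -1; fun=> 0; fun=> 0; fun=> 0]; [:: fun=> 0; G o0 o0; G o0 o1; fun=> 0];
    [:: fun=> 0; G o1 o0; G o1 o1; fun=> 0]; [:: fun=> 0; fun=> 0; fun=> 0; fun=> 1]] p)).
rewrite [map _ _]/=; rewrite -> !cpart_cst.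
by rewrite -> (metric_compat j o0 o0 cp), (metric_compat j o0 o1 cp), (metric_compat j o1 o0 cp), (metric_compat j o1 o1 cp).
Qed.

Definition curvature_mx p : 'M[C]_4 :=
  mpart c o0 (connection_mx o1) p + connection_mx o1 p *m connection_mx o0 p
  - mpart c o1 (connection_mx o0) p - connection_mx o0 p *m connection_mx o1 p.

Definition gram_det p : C := G o0 o0 p * G o1 o1 p - G o0 o1 p ^+ 2.
Definition second_det p : C := h o0 o0 p * h o1 o1 p - h o0 o1 p ^+ 2.
Definition gauss_equation p :=
  form g p (riemann nabla (E o0) (E o1) (E o0) p) (E o1 p) = gram_det p - second_det p.

Lemma curvature_gram p : cdom c p ->
  curvature_mx p *m metric_mx p + (curvature_mx p *m metric_mx p)^T = 0.
Proof.
move=> cp.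
have sN := metric_mx_smooth; have sB := connection_mx_smooth.
have sBt i := smooth_mx_tr oc (sB i).
have sBN i := smooth_mxM oc (sB i) sN; have sNB i := smooth_mxM oc sN (sBt i).
have DN i j : mpart c i (mpart c j metric_mx) p =
    (mpart c i (connection_mx j) p *m metric_mx p +
     connection_mx j p *m (connection_mx i p *m metric_mx p + metric_mx p *m (connection_mx i p)^T)) +
    ((connection_mx i p *m metric_mx p + metric_mx p *m (connection_mx i p)^T) *m (connection_mx j p)^T +
     metric_mx p *m (mpart c i (connection_mx j) p)^T).
  rewrite -(mpart_metric i cp).
  rewrite -(mpart_tr c i (connection_mx j) p).
  rewrite -(mpartM i oc Ac cp cp (sB j) sN) -(mpartM i oc Ac cp cp sN (sBt j)).
  rewrite -(mpartD i Ac cp cp (sBN j) (sNB j)).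
  apply: mpart_near => //; apply: filterS (dom_near cp) => q cq; exact: mpart_metric.
have := mpart_schwarz o0 o1 oc Ac cp cp sN; rewrite (DN o0 o1) (DN o1 o0) => H.
have NT : (metric_mx p)^T = metric_mx p by apply: gram_mx_tr; exact: metric_sym.
exact: (@flat_antisymmetric _ _ (connection_mx o0 p) (connection_mx o1 p) (mpart c o0 (connection_mx o1) p)
  (mpart c o1 (connection_mx o0) p) _ (curvature_mx p) (erefl _) NT H).
Qed.

Lemma riemann_coord l p : cdom c p ->
  tact p (riemann nabla (E o0) (E o1) (E o0) p) (coord c l) =
  cpart c o0 (Gam o1 o0 l) p + (Gam o1 o0 o0 p * Gam o0 o0 l p + Gam o1 o0 o1 p * Gam o0 o1 l p) -
  (cpart c o1 (Gam o0 o0 l) p + (Gam o0 o0 o0 p * Gam o1 o0 l p + Gam o0 o0 o1 p * Gam o1 o1 l p)).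
Proof.
move=> cp; rewrite /riemann.
have -> : nabla (bracket (E o0) (E o1)) (E o0) p = 0.
  have s0 := smooth_fun_cst (S := S) (0 : C) oc.
  have : nabla (bracket (E o0) (E o1)) (E o0) p = nabla (fun q => 0 *: E o0 q) (E o0) p.
    apply: (nabla_local hnabla oc cp) => //.
    - apply: smooth_field_eq (smooth_fieldZ oc s0 (sE o0)) => // q cq.
      by rewrite (bracket_cfield o0 o1 Ac cq) scale0r.
    - exact: smooth_fieldZ.
    - by move=> q cq; rewrite (bracket_cfield o0 o1 Ac cq) scale0r.
  by move=> ->; rewrite (nablaZl hnabla oc s0 (sE o0) (sE o0) cp) scale0r.
have sn i j : smooth_field (cdom c) (nabla (E i) (E j)) by exact: (nabla_smooth hnabla).
rewrite subr0 tactD -scaleN1r tactZ mulN1r.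
by congr (_ - _); apply: nabla_coord.
Qed.

Lemma codazzi_coord l p : cdom c p ->
  tact p (ext_nabla nabla Psi (E o0) (E o1) p) (coord c l) =
  cpart c o0 (Sh o1 l) p + (Sh o1 o0 p * Gam o0 o0 l p + Sh o1 o1 p * Gam o0 o1 l p) -
  (cpart c o1 (Sh o0 l) p + (Sh o0 o0 p * Gam o1 o0 l p + Sh o0 o1 p * Gam o1 o1 l p)).
Proof.
move=> cp; rewrite /ext_nabla.
have -> : homf Psi (bracket (E o0) (E o1)) p = 0 by rewrite /homf (bracket_cfield o0 o1 Ac cp) mulmx0.
have sn j : smooth_field (cdom c) (homf Psi (E j)) by exact: hPsi.
rewrite subr0 tactD -scaleN1r tactZ mulN1r.
by congr (_ - _); apply: nabla_coord.
Qed.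

(** The first row vanishes by the symmetry of the Christoffel symbols, of g and
    of h; the last one is the exterior derivative of Psi, and the remaining
    entry is the defect of the Gauss equation. *)
Lemma curvature_mx_entries p : cdom c p ->
  [/\ forall b, curvature_mx p k0 b = 0,
      curvature_mx p k3 k1 = - tact p (ext_nabla nabla Psi (E o0) (E o1) p) (coord c o0),
      curvature_mx p k3 k2 = - tact p (ext_nabla nabla Psi (E o0) (E o1) p) (coord c o1) &
      (curvature_mx p *m metric_mx p) k1 k2 =
        form g p (riemann nabla (E o0) (E o1) (E o0) p) (E o1 p) - (gram_det p - second_det p)].
Proof.
move=> cp; rewrite (codazzi_coord o0 cp) (codazzi_coord o1 cp).
rewrite (form_cfield _ o1 cp) (riemann_coord o0 cp) (riemann_coord o1 cp).
rewrite /curvature_mx (mpart_connection o1 o0 cp) (mpart_connection o0 o1 cp).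
have [e1 e2 _ _] := curvature_entries (G o0 o0 p) (G o0 o1 p) (G o1 o0 p) (G o1 o1 p)
  (h o0 o0 p) (h o0 o1 p) (h o1 o0 p) (h o1 o1 p)
  (Gam o0 o0 o0 p) (Gam o0 o0 o1 p) (Gam o0 o1 o0 p) (Gam o0 o1 o1 p)
  (Gam o1 o0 o0 p) (Gam o1 o0 o1 p) (Gam o1 o1 o0 p) (Gam o1 o1 o1 p)
  (Sh o0 o0 p) (Sh o0 o1 p) (Sh o1 o0 p) (Sh o1 o1 p)
  (cpart c o0 (G o1 o0) p) (cpart c o0 (G o1 o1) p) (cpart c o0 (h o1 o0) p) (cpart c o0 (h o1 o1) p)
  (cpart c o0 (Gam o1 o0 o0) p) (cpart c o0 (Gam o1 o0 o1) p) (cpart c o0 (Gam o1 o1 o0) p)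
  (cpart c o0 (Gam o1 o1 o1) p) (cpart c o0 (Sh o1 o0) p) (cpart c o0 (Sh o1 o1) p)
  (cpart c o1 (G o0 o0) p) (cpart c o1 (G o0 o1) p) (cpart c o1 (h o0 o0) p) (cpart c o1 (h o0 o1) p)
  (cpart c o1 (Gam o0 o0 o0) p) (cpart c o1 (Gam o0 o0 o1) p) (cpart c o1 (Gam o0 o1 o0) p)
  (cpart c o1 (Gam o0 o1 o1) p) (cpart c o1 (Sh o0 o0) p) (cpart c o1 (Sh o0 o1) p).
split; [|exact: e1|exact: e2|].
  by apply: curvature_row0; [exact: metric_sym|exact: second_sym|exact: christoffel_sym|exact: christoffel_sym].
by apply: curvature_gauss; [exact: metric_sym|exact: second_sym|exact: second_coefE|exact: second_coefE].
Qed.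

(** A degenerate coordinate Gram matrix would give a vector orthogonal to both
    coordinate fields. *)
Lemma gram_det_neq0 p : cdom c p -> gram_det p != 0.
Proof.
move=> cp; apply/eqP => D0; have [_ _ nd] := hg.
have zero v : tact p v (coord c o0) * G o0 o0 p + tact p v (coord c o1) * G o1 o0 p = 0 ->
    tact p v (coord c o0) * G o0 o1 p + tact p v (coord c o1) * G o1 o1 p = 0 -> v = 0.
  move=> z0 z1; apply: (nd p) => w.
  have -> : form g p v w = form g p v (tact p w (coord c o0) *: E o0 p + tact p w (coord c o1) *: E o1 p).
    by apply: (f_equal (form g p v)); exact: cfield_expand2.
  by rewrite -> formDr, !formZr, (form_cfield v o0 cp), (form_cfield v o1 cp), z0, z1; rewrite !mulr0 addr0.
have crd a b : tact p (a *: E o0 p + b *: E o1 p) (coord c o0) = a /\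
    tact p (a *: E o0 p + b *: E o1 p) (coord c o1) = b.
  rewrite -> !tactD; rewrite -> !tactZ.
  rewrite -> (tact_cfield_coord o0 o0 Ac cp), (tact_cfield_coord o0 o1 Ac cp),
    (tact_cfield_coord o1 o0 Ac cp), (tact_cfield_coord o1 o1 Ac cp).
  by rewrite !mulr1 !mulr0 addr0 add0r.
have sG := metric_sym o1 o0 p; rewrite /gram_det in D0.
have vz a b : a * G o0 o0 p + b * G o1 o0 p = 0 -> a * G o0 o1 p + b * G o1 o1 p = 0 -> a = 0 /\ b = 0.
  move=> z0 z1; have [c0 c1] := crd a b.
  have z : a *: E o0 p + b *: E o1 p = 0 by apply: zero; rewrite c0 c1.
  by split; [apply: (etrans (esym c0))|apply: (etrans (esym c1))]; rewrite -> z; exact: tact0.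
have [g11 g01] : G o1 o1 p = 0 /\ - G o0 o1 p = 0.
  by apply: vz; [rewrite sG -D0|]; move: (G o0 o0 p) (G o0 o1 p) (G o1 o1 p) => *; ring.
have [_ g00] : G o0 o1 p = 0 /\ - G o0 o0 p = 0.
  apply: vz; rewrite ?sG; last by rewrite -[RHS]oppr0 -D0; move: (G o0 o0 p) (G o0 o1 p) (G o1 o1 p) => *; ring.
  by move: (G o0 o0 p) (G o0 o1 p) (G o1 o1 p) => *; ring.
have [] := vz 1 0; rewrite ?mul1r ?mul0r ?addr0.
- by apply/eqP; rewrite -oppr_eq0 g00.
- by apply/eqP; rewrite -oppr_eq0 g01.
by move/eqP; rewrite oner_eq0.
Qed.

Lemma tact_coord_eq0 p v : cdom c p -> tact p v (coord c o0) = 0 -> tact p v (coord c o1) = 0 -> v = 0.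
Proof. by move=> cp v0 v1; rewrite (cfield_expand2 v Ac cp) v0 v1 !scale0r addr0. Qed.

(** Since F N is antisymmetric, the vanishing of the entries computed above is
    all that F = 0 requires. *)
Lemma flatP p : cdom c p -> curvature_mx p = 0 <->
  ext_nabla nabla Psi (E o0) (E o1) p = 0 /\ gauss_equation p.
Proof.
move=> cp; have [F0 F1 F2 F3] := curvature_mx_entries cp.
have uN : metric_mx p \in unitmx.
  by apply: gram_mx_unit; [exact: metric_sym|exact: gram_det_neq0].
split=> [Z|[cod gauss]].
  rewrite Z mul0mx !mxE in F1 F2 F3; split.
    by apply: (tact_coord_eq0 cp); apply/eqP; rewrite -oppr_eq0 -?F1 -?F2.
  by apply/eqP; rewrite -subr_eq0 -F3.
rewrite cod !tact0 !oppr0 in F1 F2; rewrite gauss subrr in F3.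
exact: (gram_antisymmetric_0 uN (curvature_gram cp) F0 F1 F2 F3).
Qed.

Lemma shape_det p : cdom c p -> \det (Psi p) = Sh o0 o0 p * Sh o1 o1 p - Sh o0 o1 p * Sh o1 o0 p.
Proof.
move=> cp; pose s : 'M[C]_2 := \matrix_(k, j) Sh j k p.
pose t : 'M[C]_2 := \matrix_(k, j) tact p (delta_mx j 0) (coord c k).
have sE' k j : s k j = Sh j k p by exact: mxE.
have -> : \det (Psi p) = \det s.
  apply: (det_frame (t := t) (e := fun j => E j p)) => j.
    apply: (etrans (cfield_expand2 _ Ac cp)); apply: f_equal2; apply: (f_equal (fun a => a *: _)); exact/esym/mxE.
  apply: (etrans (cfield_expand2 _ Ac cp)); apply: f_equal2; apply: (f_equal (fun a => a *: _)); exact/esym/sE'.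
apply: (etrans (det2 _)); rewrite -> !sE'; by rewrite -> (mulrC (Sh o0 o1 p)).
Qed.

(** The matrix of h is the product of those of Psi and g. *)
Lemma second_detE p : cdom c p -> second_det p = \det (Psi p) * gram_det p.
Proof.
move=> cp; rewrite /second_det /gram_det (shape_det cp) expr2 {2}(second_sym o0 o1 p).
rewrite -> (second_coefE g Psi o0 o0 Ac cp), (second_coefE g Psi o0 o1 Ac cp),
  (second_coefE g Psi o1 o0 Ac cp), (second_coefE g Psi o1 o1 Ac cp), (metric_sym o1 o0 p).
move: (G o0 o0 p) (G o0 o1 p) (G o1 o1 p) (Sh o0 o0 p) (Sh o0 o1 p) (Sh o1 o0 p) (Sh o1 o1 p) => *; ring.
Qed.

Lemma cfield_basis p : cdom c p -> basis_of {: 'cV[C]_2} [:: E o0 p; E o1 p].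
Proof.
move=> cp; rewrite basisEdim dimvf /dim /= andbT.
apply/subvP => v _; rewrite (cfield_expand2 v Ac cp).
by apply: memvD; apply: memvZ; apply: memv_span; rewrite !inE eqxx ?orbT.
Qed.

Lemma gaussP (K : S -> C) p : curvature g nabla K -> cdom c p ->
  gauss_equation p <-> K p = -1 + \det (Psi p).
Proof.
move=> hK cp; have D0 := gram_det_neq0 cp.
have KE := hK _ _ _ oc (sE o0) (sE o1) p cp (cfield_basis cp).
have KD : K p * gram_det p = - form g p (riemann nabla (E o0) (E o1) (E o0) p) (E o1 p).
  by rewrite KE; exact: divfK.
rewrite /gauss_equation (second_detE cp); split=> [H|H].
  apply: (mulIf D0); rewrite KD H; move: (\det _) (gram_det p) => *; ring.
apply: oppr_inj; rewrite -KD H; move: (\det _) (gram_det p) => *; ring.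
Qed.

End Structure.

Section Integrability.
Variables (R : realType) (S : surface R) (g Psi : S -> 'M[R[i]]_2).
Variable nabla : field S -> field S -> field S.
Local Notation C := R[i].
Hypothesis hg : complex_metric g.
Hypothesis hnabla : levi_civita g nabla.
Hypothesis hPsi : bundle_hom Psi.
Hypothesis hadj : self_adjoint g Psi.

(** The exterior derivative of Psi is the antisymmetric part of a tensor, hence
    determined by its value on the pair of coordinate fields. *)
Lemma codazziP : codazzi nabla Psi <-> forall c p, atlas c -> cdom c p ->
  ext_nabla nabla Psi (cfield c o0) (cfield c o1) p = 0.
Proof.
split=> [cod c p Ac cp|cod U X Y oU sX sY p Up].
  exact: (cod _ _ _ (@cdom_open _ _ c) (cfield_smooth o0 Ac) (cfield_smooth o1 Ac) p cp).
have [_ tf _] := hnabla.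
have ext Z W V : open V -> smooth_field V Z -> smooth_field V W -> V p ->
    ext_nabla nabla Psi Z W p = nablaPsi Psi nabla Z W p - nablaPsi Psi nabla W Z p.
  move=> oV sZ sW Vp; rewrite /ext_nabla /nablaPsi /homf -(tf _ _ _ oV sZ sW _ Vp).
  rewrite mulmxBr; move: (nabla _ _ _) (nabla _ _ _) (_ *m _) (_ *m _) => a b c d.
  by apply/matrixP => i j; rewrite !mxE; ring.
move: (chart_at p) (atlas_chart_at p) (cdom_chart_at p) => c Ac cp.
have oc := @cdom_open _ _ c.
have := cod c p Ac cp; rewrite -> (ext _ _ _ oc (cfield_smooth o0 Ac) (cfield_smooth o1 Ac) cp).
move/eqP; rewrite subr_eq0 => /eqP E01.
rewrite (ext _ _ _ oU sX sY Up).
have tP := nablaPsi_tensorial hnabla hPsi.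
rewrite -> (tensorial_expand tP oU (@subsetT _ _) sX sY Up Ac cp).
rewrite -> (tensorial_expand tP oU (@subsetT _ _) sY sX Up Ac cp), E01.
generalize (nablaPsi Psi nabla (cfield c o0) (cfield c o0) p) (nablaPsi Psi nabla (cfield c o1) (cfield c o0) p)
  (nablaPsi Psi nabla (cfield c o1) (cfield c o1) p) => a b d.
move: (tact p (X p) _) (tact p (X p) _) (tact p (Y p) _) (tact p (Y p) _) => *.
apply/matrixP => i j; rewrite !mxE; ring.
Qed.

Definition integrable := forall c p, atlas c -> cdom c p -> curvature_mx g Psi nabla c p = 0.

(** The two equations of the theorem are together the flatness of the linear
    system. *)
Lemma integrableP K : curvature g nabla K ->
  integrable <-> codazzi nabla Psi /\ (forall p, K p = -1 + \det (Psi p)).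
Proof.
move=> hK; split=> [F|[/codazziP cod gauss] c p Ac cp]; last first.
  by apply/(flatP hg hnabla hPsi hadj Ac cp); split; [exact: cod|exact/(gaussP hg hadj Ac hK cp)].
split; first by apply/codazziP => c p Ac cp; have /(flatP hg hnabla hPsi hadj Ac cp) [] := F c p Ac cp.
move=> p; have Ac := atlas_chart_at p; have cp := cdom_chart_at p.
by have /(flatP hg hnabla hPsi hadj Ac cp) [_ /(gaussP hg hadj Ac hK cp)] := F _ p Ac cp.
Qed.

End Integrability.

(** * Pauli matrices and rotations *)

Local Notation t0 := (@Ordinal 3 0 isT).
Local Notation t1 := (@Ordinal 3 1 isT).
Local Notation t2 := (@Ordinal 3 2 isT).

Lemma ord3_ind (P : 'I_3 -> Prop) : P t0 -> P t1 -> P t2 -> forall a, P a.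
Proof.
move=> P0 P1 P2 [[|[|[|//]]] H]; [move: P0|move: P1|move: P2]; congr P; exact: val_inj.
Qed.

Lemma sum3 (T : nmodType) (F : 'I_3 -> T) : \sum_(a < 3) F a = F t0 + F t1 + F t2.
Proof.
rewrite !big_ord_recr big_ord0 /= add0r; congr (F _ + F _ + F _); exact: val_inj.
Qed.

Lemma det3 (K : comPzRingType) (f : nat -> nat -> K) : \det (\matrix_(i < 3, j < 3) f i j) =
  f 0%N 0%N * (f 1%N 1%N * f 2%N 2%N - f 1%N 2%N * f 2%N 1%N) -
  f 0%N 1%N * (f 1%N 0%N * f 2%N 2%N - f 1%N 2%N * f 2%N 0%N) +
  f 0%N 2%N * (f 1%N 0%N * f 2%N 1%N - f 1%N 1%N * f 2%N 0%N).
Proof.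
rewrite (expand_det_row _ t0) sum3 /cofactor !det2 !mxE /=.
rewrite ?add0n ?addn0 ?expr0 ?expr1 ?sqrrN ?expr1n; ring.
Qed.

Lemma det4 (K : comPzRingType) (f : nat -> nat -> K) :
  let minor a b c := f 1%N a * (f 2%N b * f 3%N c - f 2%N c * f 3%N b) -
    f 1%N b * (f 2%N a * f 3%N c - f 2%N c * f 3%N a) + f 1%N c * (f 2%N a * f 3%N b - f 2%N b * f 3%N a) in
  \det (\matrix_(i < 4, j < 4) f i j) =
  f 0%N 0%N * minor 1%N 2%N 3%N - f 0%N 1%N * minor 0%N 2%N 3%N +
  f 0%N 2%N * minor 0%N 1%N 3%N - f 0%N 3%N * minor 0%N 1%N 2%N.
Proof.
rewrite (expand_det_row _ k0) sum4 /cofactor.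
have col j : row' k0 (col' j (\matrix_(i < 4, j < 4) f i j)) = \matrix_(i < 3, l < 3) f i.+1 (bump j l).
  by apply/matrixP => a b; rewrite !mxE.
rewrite !col !(det3 (fun a b => f a.+1 (bump _ b))) !mxE /=.
rewrite ?expr0 ?expr1 ?expr2; ring.
Qed.

Section Pauli.
Variables (K : fieldType) (im : K).
Hypothesis im2 : im * im = -1.
Hypothesis two_neq0 : 2%:R != 0 :> K.

Definition m2 (a b c d : K) : 'M[K]_2 :=
  \matrix_(i, j) (if i == 0 then if j == 0 then a else b else if j == 0 then c else d).

Lemma m2E (M : 'M[K]_2) : M = m2 (M o0 o0) (M o0 o1) (M o1 o0) (M o1 o1).
Proof. by apply/matrixP; apply: ord2_ind; apply: ord2_ind; rewrite mxE. Qed.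

Lemma m2_mul a b c d a' b' c' d' : m2 a b c d *m m2 a' b' c' d' =
  m2 (a * a' + b * c') (a * b' + b * d') (c * a' + d * c') (c * b' + d * d').
Proof. by apply/matrixP; apply: ord2_ind; apply: ord2_ind; rewrite !mxE sum_ord2 !mxE. Qed.

Lemma m2_add a b c d a' b' c' d' : m2 a b c d + m2 a' b' c' d' = m2 (a + a') (b + b') (c + c') (d + d').
Proof. by apply/matrixP; apply: ord2_ind; apply: ord2_ind; rewrite !mxE. Qed.

Lemma m2_scale x a b c d : x *: m2 a b c d = m2 (x * a) (x * b) (x * c) (x * d).
Proof. by apply/matrixP; apply: ord2_ind; apply: ord2_ind; rewrite !mxE. Qed.

Lemma m2_tr a b c d : \tr (m2 a b c d) = a + d.
Proof. by rewrite /mxtrace sum_ord2 !mxE. Qed.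

Lemma m2_det a b c d : \det (m2 a b c d) = a * d - b * c.
Proof. by rewrite det2 !mxE. Qed.

Lemma m2_1 : 1%:M = m2 1 0 0 1.
Proof. by apply/matrixP; apply: ord2_ind; apply: ord2_ind; rewrite !mxE. Qed.

Definition sigma_mx (k : 'I_3) : 'M[K]_2 :=
  match val k with 0%N => m2 1 0 0 (-1) | 1%N => m2 0 1 1 0 | _ => m2 0 (- im) im 0 end.

Definition row4 (a b c d : K) : 'rV[K]_4 := \row_j nth 0 [:: a; b; c; d] j.

(** Coordinates in the basis of the identity and the Pauli matrices, in which
    the quadratic form -det is diagonal with matrix Qmx. *)
Definition vec (M : 'M[K]_2) : 'rV[K]_4 :=
  row4 ((M o0 o0 + M o1 o1) / 2%:R) ((M o0 o0 - M o1 o1) / 2%:R)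
       ((M o0 o1 + M o1 o0) / 2%:R) (im * (M o0 o1 - M o1 o0) / 2%:R).

Definition mat (v : 'rV[K]_4) : 'M[K]_2 :=
  m2 (v 0 k0 + v 0 k1) (v 0 k2 - im * v 0 k3) (v 0 k2 + im * v 0 k3) (v 0 k0 - v 0 k1).

Lemma vecK M : mat (vec M) = M.
Proof.
rewrite [RHS]m2E /mat !mxE /=; congr m2; try by field.
  by field: im2.
by field: im2.
Qed.

Lemma matK v : vec (mat v) = v.
Proof.
apply/rowP; apply: ord4_ind; rewrite !mxE /=; try by field.
by field: im2.
Qed.

(** The polarisation of -det. It extends the metric of SL(2) to all matrices of
    size 2. *)
Definition qm (M N : 'M[K]_2) : K := 2%:R^-1 * (\tr (M *m N) - \tr M * \tr N).

Definition Qmx : 'M[K]_4 := gram_mx (-1) 1 0 0 1 1.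

Lemma row4_form (u v : 'rV[K]_4) : (u *m Qmx *m v^T) 0 0 =
  - (u 0 k0 * v 0 k0) + u 0 k1 * v 0 k1 + u 0 k2 * v 0 k2 + u 0 k3 * v 0 k3.
Proof. rewrite !mxE !sum4 !mxE !sum4 !mxE /=; ring. Qed.

Lemma qm_mat u v : qm (mat u) (mat v) = (u *m Qmx *m v^T) 0 0.
Proof.
rewrite row4_form /qm /mat m2_mul !m2_tr.
by field: im2.
Qed.

Lemma qmC M N : qm M N = qm N M.
Proof. by rewrite /qm mxtrace_mulC (mulrC (\tr M)). Qed.

Lemma qm_det M : qm M M = - \det M.
Proof. by rewrite (m2E M) /qm m2_mul !m2_tr m2_det; field. Qed.

Lemma qm_mul A M N : qm (A *m M) (A *m N) = \det A * qm M N.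
Proof. by rewrite (m2E A) (m2E M) (m2E N) /qm !m2_mul !m2_tr m2_det; field. Qed.

Lemma qm_traceless M N : \tr M = 0 -> qm M N = 2%:R^-1 * \tr (M *m N).
Proof. by move=> M0; rewrite /qm M0 mul0r subr0. Qed.

Lemma unit_det1 (A : 'M[K]_2) : \det A = 1 -> A \in unitmx.
Proof. by move=> D; rewrite unitmxE D unitr1. Qed.

(** Translation to the identity by A multiplies the form by det A = 1, and at
    the identity orthogonality to 1 means being traceless. *)
Lemma tangent_qm A M : \det A = 1 -> \tr (invmx A *m M) = 0 <-> qm A M = 0.
Proof.
move=> D; have uA := unit_det1 D.
have -> : qm A M = - (2%:R^-1 * \tr (invmx A *m M)).
  rewrite -[in LHS](mulKVmx uA M) -{1}[A]mulmx1 qm_mul D mul1r /qm mul1mx mxtrace1.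
  by field.
split=> [->|/eqP]; first by rewrite mulr0 oppr0.
by rewrite oppr_eq0 mulf_eq0 invr_eq0 (negPf two_neq0) => /eqP.
Qed.

Lemma sl_form_qm A M N : \det A = 1 -> \tr (invmx A *m M) = 0 ->
  2%:R^-1 * \tr ((invmx A *m M) *m (invmx A *m N)) = qm M N.
Proof.
move=> D M0; have uA := unit_det1 D; rewrite -(qm_traceless _ M0) qm_mul det_inv D invr1 mul1r //.
Qed.

(** Left multiplication by mat u, acting on rows of coordinates. *)
Definition leftmx (u : 'rV[K]_4) : 'M[K]_4 :=
  let a := u 0 k0 in let b := u 0 k1 in let c := u 0 k2 in let d := u 0 k3 in
  mx4 [:: [:: a; b; c; d]; [:: b; a; im * d; - (im * c)];
          [:: c; - (im * d); a; im * b]; [:: d; im * c; - (im * b); a]].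

Lemma mat_mul u v : mat u *m mat v = mat (v *m leftmx u).
Proof.
rewrite /mat m2_mul !mxE !sum4 !mxE /=.
by congr m2; field: im2.
Qed.

Lemma det_leftmx u : \det (leftmx u) = \det (mat u) ^+ 2.
Proof.
by rewrite m2_det (det4 (fun i j => nth 0 (nth [::] _ i) j)) /=; field: im2.
Qed.

Lemma matD u v : mat (u + v) = mat u + mat v.
Proof. by rewrite /mat m2_add !mxE; congr m2; ring. Qed.

Lemma matZ a v : mat (a *: v) = a *: mat v.
Proof. by rewrite /mat m2_scale !mxE; congr m2; ring. Qed.

(** Left multiplication by A has determinant (det A)^2 = 1 on matrices.
    Translated to the identity, the first row becomes the coordinates of the
    identity matrix; expansion along it leaves the coordinates of the traceless
    parts, which define the left-hand side. *)
Lemma omega_det (A M1 M2 M3 : 'M[K]_2) : \det A = 1 ->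
  \det (\matrix_(k < 3, l < 3) (2%:R^-1 * \tr (invmx A *m nth 0 [:: M1; M2; M3] l *m sigma_mx k))) =
  \det (\matrix_(i < 4, j < 4) (nth 0 [:: vec A; vec M1; vec M2; vec M3] i) 0 j).
Proof.
move=> D; have uA := unit_det1 D; pose X (M : 'M[K]_2) := invmx A *m M.
pose c1 (M : 'M[K]_2) := (M o0 o0 - M o1 o1) / 2%:R.
pose c2 (M : 'M[K]_2) := (M o0 o1 + M o1 o0) / 2%:R.
pose c3 (M : 'M[K]_2) := im * (M o0 o1 - M o1 o0) / 2%:R.
pose c0 (M : 'M[K]_2) := (M o0 o0 + M o1 o1) / 2%:R.
have vX M : vec M = vec (X M) *m leftmx (vec A) by rewrite -[LHS]matK -[RHS]matK -mat_mul !vecK mulKVmx.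
have v1 : vec A = row4 1 0 0 0 *m leftmx (vec A).
  by apply/rowP; apply: ord4_ind; rewrite !mxE sum4 !mxE /=; ring.
pose r := [:: [:: 1; 0; 0; 0]; [:: c0 (X M1); c1 (X M1); c2 (X M1); c3 (X M1)];
  [:: c0 (X M2); c1 (X M2); c2 (X M2); c3 (X M2)]; [:: c0 (X M3); c1 (X M3); c2 (X M3); c3 (X M3)]].
have -> : \matrix_(i < 4, j < 4) (nth 0 [:: vec A; vec M1; vec M2; vec M3] i) 0 j =
    mx4 r *m leftmx (vec A).
  have rE i v : row i (mx4 r) = v -> (mx4 r *m leftmx (vec A)) i = (v *m leftmx (vec A)) 0.
    by move=> <-; apply/funext => j; rewrite -row_mul [RHS]mxE.
  have xE : [/\ row k1 (mx4 r) = vec (X M1), row k2 (mx4 r) = vec (X M2) & row k3 (mx4 r) = vec (X M3)].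
    by split; apply/rowP; apply: ord4_ind; rewrite [LHS]mxE [LHS]mxE [RHS]mxE.
  have [x1 x2 x3] := xE.
  apply/matrixP => i j; rewrite [LHS]mxE; move: i; apply: ord4_ind => /=.
  - rewrite {1}v1 (rE k0 (row4 1 0 0 0)) //.
    by apply/rowP; apply: ord4_ind; rewrite [LHS]mxE [LHS]mxE [RHS]mxE.
  - by rewrite (rE _ _ x1) -vX.
  - by rewrite (rE _ _ x2) -vX.
  - by rewrite (rE _ _ x3) -vX.
rewrite det_mulmx det_leftmx vecK D expr1n mulr1 (det4 (fun i j => nth 0 (nth [::] r i) j)) /=.
have tc M : [/\ 2%:R^-1 * \tr (M *m sigma_mx t0) = c1 M, 2%:R^-1 * \tr (M *m sigma_mx t1) = c2 M &
    2%:R^-1 * \tr (M *m sigma_mx t2) = c3 M].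
  rewrite (m2E M); move: (M o0 o0) (M o0 o1) (M o1 o0) (M o1 o1) => a b c d.
  by rewrite /c1 /c2 /c3 /sigma_mx /= !m2_mul !m2_tr !mxE /=; split; field.
pose s := [:: [:: c1 (X M1); c1 (X M2); c1 (X M3)]; [:: c2 (X M1); c2 (X M2); c2 (X M3)];
  [:: c3 (X M1); c3 (X M2); c3 (X M3)]].
have -> : \matrix_(k < 3, l < 3) (2%:R^-1 * \tr (invmx A *m nth 0 [:: M1; M2; M3] l *m sigma_mx k)) =
    \matrix_(k < 3, l < 3) nth 0 (nth [::] s k) l.
  apply/matrixP => k l; rewrite !mxE; move: l k.
  by apply: ord3_ind; apply: ord3_ind => /=; rewrite /X; have [] := tc (X M1); have [] := tc (X M2); have [] := tc (X M3).
rewrite (det3 (fun i j => nth 0 (nth [::] s i) j)) /=; ring.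
Qed.

Hypothesis sqrtK : forall x : K, exists y, y * y = x.

(** Completion of the square, every element being a square. *)
Lemma symmetric_factor (G : 'M[K]_2) : G o0 o1 = G o1 o0 -> \det G != 0 -> exists T : 'M[K]_2, G = T *m T^T.
Proof.
move=> sym; rewrite det2 sym => D0.
have m2_T a b c d : (m2 a b c d)^T = m2 a c b d.
  by apply/matrixP; apply: ord2_ind; apply: ord2_ind; rewrite !mxE.
have [[a aa] [d dd]] := (sqrtK (G o0 o0), sqrtK (G o1 o1)).
rewrite (m2E G) sym; move: (G o0 o0) (G o1 o0) (G o1 o1) aa dd D0 => x y z aa dd D0.
have [x0|x0] := eqVneq x 0; last first.
  have a0 : a != 0 by apply: contra_neq x0 => a0; rewrite -aa a0 mulr0.
  have [e ee] := sqrtK ((x * z - y * y) / x).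
  exists (m2 a 0 (y / a) e); rewrite m2_T m2_mul; congr m2; try by field.
    by rewrite mul0r addr0.
  by rewrite ee -aa; field.
have [z0|z0] := eqVneq z 0; last first.
  have d0 : d != 0 by apply: contra_neq z0 => d0; rewrite -dd d0 mulr0.
  have [e ee] := sqrtK ((x * z - y * y) / z).
  exists (m2 e (y / d) 0 d); rewrite m2_T m2_mul; congr m2; try by field.
    by rewrite ee -dd; field.
  by rewrite mul0r add0r.
(* If both basis vectors are isotropic: the rows (1, i) and (y / 2) (1, -i) are
   isotropic as well, with product y. *)
exists (m2 1 im (y / 2%:R) (- (im * y / 2%:R))); rewrite m2_T m2_mul x0 z0.
by congr m2; field: im2.
Qed.

(** The adjugate of W is its inverse, which is its transpose. *)
Lemma rotation_cofactor (f : nat -> nat -> K) (W := \matrix_(i < 3, j < 3) f i j) :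
  W *m W^T = 1%:M -> \det W = 1 -> forall i j, cofactor W i j = f i j.
Proof.
move=> WW D i j; have uW : W \in unitmx by rewrite unitmxE D unitr1.
have : \adj W = W^T.
  by rewrite -[LHS](mulKmx uW) mul_mx_adj D -WW mulKmx.
by move/matrixP/(_ j i); rewrite !mxE.
Qed.

Lemma mulmx_lin2 (X A B C : 'M[K]_2) a b :
  X *m (a *: A + b *: B) *m C = a *: (X *m A *m C) + b *: (X *m B *m C).
Proof. by rewrite mulmxDr mulmxDl -!scalemxAr -!scalemxAl. Qed.

Definition pauli_relations (W0 W1 W2 : 'M[K]_2) :=
  [/\ W0 *m W0 = 1%:M, W1 *m W1 = 1%:M & W2 *m W2 = 1%:M] /\
  [/\ W0 *m W1 = im *: W2, W1 *m W2 = im *: W0 & W2 *m W0 = im *: W1] /\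
  [/\ W1 *m W0 = - im *: W2, W2 *m W1 = - im *: W0 & W0 *m W2 = - im *: W1].

Lemma sigma_relations : pauli_relations (sigma_mx t0) (sigma_mx t1) (sigma_mx t2).
Proof.
by rewrite /pauli_relations /sigma_mx /= !m2_mul !m2_scale m2_1;
  split; [|split]; split; congr m2; ring: im2.
Qed.

(** Multiplication by W0 on the left and by P0 on the right permute the four
    terms of the average M in the same way. *)
Lemma intertwine_one (W0 W1 W2 P0 P1 P2 X M : 'M[K]_2) :
  W0 *m W0 = 1%:M -> W0 *m W1 = im *: W2 -> W0 *m W2 = - im *: W1 ->
  P0 *m P0 = 1%:M -> P1 *m P0 = - im *: P2 -> P2 *m P0 = im *: P1 ->
  M = X + W0 *m X *m P0 + W1 *m X *m P1 + W2 *m X *m P2 -> W0 *m M = M *m P0.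
Proof.
move=> w00 w01 w02 p00 p10 p20 ->; rewrite !mulmxDr !mulmxDl !mulmxA w00 w01 w02 mul1mx.
rewrite -![_ *m _ *m P0]mulmxA p00 p10 p20 !mulmx1 -!scalemxAl -!scalemxAr.
move: (W2 *m X *m P1) (W1 *m X *m P2) (W0 *m X) (X *m P0) => a b c d.
by apply/matrixP => i j; rewrite !mxE; ring.
Qed.

(** If det M = 0, then M kills its adjugate A. As every X is a combination of
    the identity and Pauli matrices, which can be moved across M, also M X A =
    0; for elementary X the entries of M X A include the squares of those of M
    up to sign, so M = 0. *)
Lemma intertwiner_inverse (W0 W1 W2 M : 'M[K]_2) : M != 0 ->
  W0 *m M = M *m sigma_mx t0 -> W1 *m M = M *m sigma_mx t1 -> W2 *m M = M *m sigma_mx t2 -> \det M != 0.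
Proof.
move=> M0 e0 e1 e2; apply/eqP => D.
pose A := m2 (M o1 o1) (- M o0 o1) (- M o1 o0) (M o0 o0).
have MA : M *m A = 0.
  rewrite {1}(m2E M) m2_mul; rewrite (m2E M) m2_det in D.
  by apply/matrixP; apply: ord2_ind; apply: ord2_ind; rewrite !mxE /=; try ring; rewrite -D; ring.
have MX X : M *m X *m A = 0.
  have h Y W : W *m M = M *m Y -> M *m Y *m A = 0 by move=> <-; rewrite -mulmxA MA mulmx0.
  rewrite -[X]vecK; move: (vec X) => v.
  have -> : mat v = v 0 k0 *: 1%:M + v 0 k1 *: sigma_mx t0 + (v 0 k2 *: sigma_mx t1 + v 0 k3 *: sigma_mx t2).
    by rewrite /sigma_mx /= m2_1 !m2_scale !m2_add; congr m2; ring.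
  rewrite mulmxDr mulmxDl !mulmx_lin2 mulmx1 MA (h _ _ e0) (h _ _ e1) (h _ _ e2).
  by rewrite !scaler0 !addr0.
have ME := m2E M; rewrite {}/A in MA MX; move: (M o0 o0) (M o0 o1) (M o1 o0) (M o1 o1) ME MX => p q r s ME MX.
have := MX (m2 0 1 0 0); have := MX (m2 0 0 1 0).
rewrite ME !m2_mul => /matrixP H1 /matrixP H2.
have := H2 o0 o1; have := H2 o1 o0; have := H1 o0 o1; have := H1 o1 o0; rewrite !mxE /=.
rewrite !mulr0 !mulr1 !add0r !addr0 ?mul0r ?add0r ?addr0 ?mulrN => /eqP; rewrite mulf_eq0 orbb => /eqP s0.
move/eqP; rewrite oppr_eq0 mulf_eq0 orbb => /eqP q0.
move/eqP; rewrite oppr_eq0 mulf_eq0 orbb => /eqP r0.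
move/eqP; rewrite mulf_eq0 orbb => /eqP p0.
move/eqP: M0; apply; rewrite ME p0 q0 r0 s0.
by apply/matrixP; apply: ord2_ind; apply: ord2_ind; rewrite !mxE.
Qed.

(** Averaging any X as above gives an intertwiner between the two triples. Not
    all averages vanish, since the trace of the averaging operator is 4; a
    non-zero one is invertible, and is normalised by a square root of its
    determinant. *)
Lemma spin_rotation (W0 W1 W2 : 'M[K]_2) : pauli_relations W0 W1 W2 -> exists P, \det P = 1 /\
  [/\ W0 *m P = P *m sigma_mx t0, W1 *m P = P *m sigma_mx t1 & W2 *m P = P *m sigma_mx t2].
Proof.
move=> [[w00 w11 w22] [[w01 w12 w20] [w10 w21 w02]]].
have [[s00 s11 s22] [[s01 s12 s20] [s10 s21 s02]]] := sigma_relations.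
pose M (X : 'M[K]_2) : 'M[K]_2 := X + W0 *m X *m sigma_mx t0 + W1 *m X *m sigma_mx t1 + W2 *m X *m sigma_mx t2.
have M0 X : W0 *m M X = M X *m sigma_mx t0 by exact: (intertwine_one w00 w01 w02 s00 s10 s20 erefl).
have M1 X : W1 *m M X = M X *m sigma_mx t1.
  apply: (intertwine_one (X := X) w11 w12 w10 s11 s21 s01).
  by rewrite /M; apply/matrixP => i j; rewrite !mxE; ring.
have M2 X : W2 *m M X = M X *m sigma_mx t2.
  apply: (intertwine_one (X := X) w22 w20 w21 s22 s02 s12).
  by rewrite /M; apply/matrixP => i j; rewrite !mxE; ring.
have [X MX0] : exists X, M X != 0.
  apply: contrapT => /forallNP Z.
  have Z' X : M X = 0 by apply/eqP/negPn/negP; exact: Z.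
  (* The trace of X |-> M X. *)
  have T : M (m2 1 0 0 0) o0 o0 + M (m2 0 1 0 0) o0 o1 + M (m2 0 0 1 0) o1 o0 + M (m2 0 0 0 1) o1 o1 = 2%:R * 2%:R.
    rewrite /M (m2E W0) (m2E W1) (m2E W2) /sigma_mx /= !m2_mul !m2_add !mxE /=; ring.
  by move: T; rewrite !Z' !mxE !addr0 => /eqP; rewrite eq_sym mulf_eq0 orbb (negPf two_neq0).
have D0 := intertwiner_inverse MX0 (M0 X) (M1 X) (M2 X).
have [d dd] := sqrtK (\det (M X)).
have d0 : d != 0 by apply: contra_neq D0 => d0; rewrite -dd d0 mulr0.
exists (d^-1 *: M X); split; first by rewrite detZ -dd; field.
by rewrite -!scalemxAl -!scalemxAr (M0 X) (M1 X) (M2 X).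
Qed.

Lemma leftmx_form u : leftmx u *m Qmx *m (leftmx u)^T = \det (mat u) *: Qmx.
Proof.
rewrite m2_det; apply/matrixP => i j; rewrite !mxE sum4 !mxE !sum4 !mxE.
by move: i j; apply: ord4_ind; apply: ord4_ind => /=; ring: im2.
Qed.

(** The image of the Pauli triple under a rotation: the squares come from the
    scalar products of the rows of W, and the other products from their vector
    products, which are given by cofactors. *)
Lemma rotation_relations (f : nat -> nat -> K) (W := \matrix_(i < 3, j < 3) f i j)
  (w := fun k => mat (row4 0 (f k 0%N) (f k 1%N) (f k 2%N))) :
  W *m W^T = 1%:M -> \det W = 1 -> pauli_relations (w 0%N) (w 1%N) (w 2%N).
Proof.
move=> WW D; have cof := rotation_cofactor WW D.
have dot (i j : 'I_3) : f i 0%N * f j 0%N + f i 1%N * f j 1%N + f i 2%N * f j 2%N = (i == j)%:R.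
  by have /matrixP/(_ i j) := WW; rewrite !mxE sum3 !mxE.
have mul (k l m : 'I_3) e (a : K) : (k == l)%:R = e ->
    f k 1%N * f l 2%N - f k 2%N * f l 1%N = a * f m 0%N -> f k 2%N * f l 0%N - f k 0%N * f l 2%N = a * f m 1%N ->
    f k 0%N * f l 1%N - f k 1%N * f l 0%N = a * f m 2%N -> w k *m w l = mat (row4 e 0 0 0) + (im * a) *: w m.
  move=> kl c0 c1 c2; rewrite mat_mul -matZ -matD; congr mat.
  apply/rowP; apply: ord4_ind; rewrite !mxE ?sum4 !mxE /=.
  - by rewrite -kl -dot; ring.
  - by rewrite -mulrA -c0; ring.
  - by rewrite -mulrA -c1; ring.
  - by rewrite -mulrA -c2; ring.
have C (i j : 'I_3) : (-1) ^+ (i + j) * (f (bump i 0) (bump j 0) * f (bump i 1) (bump j 1) -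
    f (bump i 0) (bump j 1) * f (bump i 1) (bump j 0)) = f i j.
  by rewrite -cof /cofactor det2 !mxE.
have mat0 a : mat (row4 0 0 0 0) + (im * 1) *: a = im *: a /\ mat (row4 0 0 0 0) + (im * -1) *: a = - im *: a.
  have -> : mat (row4 0 0 0 0) = 0.
    by apply/matrixP; apply: ord2_ind; apply: ord2_ind; rewrite !mxE /=; ring.
  by rewrite !add0r mulr1 mulrN1.
have mat1 (k : 'I_3) : mat (row4 1 0 0 0) + (im * 0) *: w k = 1%:M.
  by rewrite mulr0 scale0r addr0 m2_1 /mat !mxE /=; congr m2; ring.
have sq (k : 'I_3) : w k *m w k = 1%:M.
  by rewrite (mul k k k 1 0) ?mat1 ?eqxx // mul0r; ring.
split; [|split]; split; try exact: (sq t0); try exact: (sq t1); try exact: (sq t2).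
- apply: (etrans (mul t0 t1 t2 0 (1) _ _ _ _)) => //; last exact: (mat0 _).1;
  by rewrite -?(C t2 t0) -?(C t2 t1) -?(C t2 t2) /=; ring.
- apply: (etrans (mul t1 t2 t0 0 (1) _ _ _ _)) => //; last exact: (mat0 _).1;
  by rewrite -?(C t0 t0) -?(C t0 t1) -?(C t0 t2) /=; ring.
- apply: (etrans (mul t2 t0 t1 0 (1) _ _ _ _)) => //; last exact: (mat0 _).1;
  by rewrite -?(C t1 t0) -?(C t1 t1) -?(C t1 t2) /=; ring.
- apply: (etrans (mul t1 t0 t2 0 (-1) _ _ _ _)) => //; last exact: (mat0 _).2;
  by rewrite -?(C t2 t0) -?(C t2 t1) -?(C t2 t2) /=; ring.
- apply: (etrans (mul t2 t1 t0 0 (-1) _ _ _ _)) => //; last exact: (mat0 _).2;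
  by rewrite -?(C t0 t0) -?(C t0 t1) -?(C t0 t2) /=; ring.
- apply: (etrans (mul t0 t2 t1 0 (-1) _ _ _ _)) => //; last exact: (mat0 _).2;
  by rewrite -?(C t1 t0) -?(C t1 t1) -?(C t1 t2) /=; ring.
Qed.

(** The image U of the identity matrix has determinant 1. Composition with left
    multiplication by the inverse of U gives an isometry that fixes the
    identity, that is, a rotation of the traceless matrices; this is
    conjugation by the matrix P of the spin representation. *)
Theorem so4_spin (L : 'M[K]_4) : L *m Qmx *m L^T = Qmx -> \det L = 1 ->
  exists A B : 'M[K]_2, [/\ \det A = 1, \det B = 1 & forall M, mat (vec M *m L) = A *m M *m invmx B].
Proof.
move=> LQ DL; pose u := row k0 L; pose U := mat u.
have DU : \det U = 1.
  apply: oppr_inj; rewrite -qm_det qm_mat.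
  have -> : u *m Qmx *m u^T = row k0 (L *m Qmx *m L^T) *m (delta_mx 0 k0)^T.
    by rewrite !row_mul /u -!mulmxA -trmx_mul -rowE.
  by rewrite LQ mxE sum4 !mxE /=; ring.
have uL : leftmx u \in unitmx by rewrite unitmxE det_leftmx DU expr1n unitr1.
have [N LN] : exists N, L = N *m leftmx u by exists (L *m invmx (leftmx u)); rewrite mulmxKV.
have NQ : N *m Qmx *m N^T = Qmx.
  have E := leftmx_form u; rewrite DU scale1r in E.
  have -> : N *m Qmx *m N^T = N *m (leftmx u *m Qmx *m (leftmx u)^T) *m N^T by rewrite E.
  by apply: (etrans _ LQ); rewrite LN trmx_mul !mulmxA.
have N0 : row k0 N = row4 1 0 0 0.
  rewrite -[LHS](mulmxK uL) -row_mul -LN -/u.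
  have uE : u = row4 1 0 0 0 *m leftmx u.
    by apply/rowP; apply: ord4_ind; rewrite [RHS]mxE sum4 !mxE /=; ring.
  by rewrite {1}uE mulmxK.
have N00 j : N k0 j = (j == k0)%:R.
  by have /rowP/(_ j) := N0; rewrite !mxE => ->; move: j; apply: ord4_ind.
have form i j : - (N i k0 * N j k0) + N i k1 * N j k1 + N i k2 * N j k2 + N i k3 * N j k3 = Qmx i j.
  by have /matrixP/(_ i j) := NQ => <-; rewrite mxE sum4 !mxE !sum4 !mxE /=; ring.
have Ni0 i : N i k0 = (i == k0)%:R.
  by have := form k0 i; rewrite !N00 /=; move: i; apply: ord4_ind; rewrite ?N00 // mxE /= => H;
    apply: oppr_inj; rewrite oppr0 -[RHS]H; ring.
pose h (i j : nat) := N (inord i) (inord j); pose f i j := h i.+1 j.+1.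
have hE (i j : 'I_4) : h i j = N i j by rewrite /h !inord_val.
have DW : \det (\matrix_(i < 3, j < 3) f i j) = 1.
  have DN : \det N = 1 by move: DL; rewrite LN det_mulmx det_leftmx DU expr1n mulr1.
  have NE : N = \matrix_(i < 4, j < 4) h i j by apply/matrixP => i j; rewrite mxE hE.
  rewrite -DN NE det4 det3 /f (hE k0 k0) (hE k0 k1) (hE k0 k2) (hE k0 k3) !N00 /=; ring.
have WW : (\matrix_(i < 3, j < 3) f i j) *m (\matrix_(i < 3, j < 3) f i j)^T = 1%:M.
  have F (i j : 'I_3) (i' j' : 'I_4) : i' = i.+1 :> nat -> j' = j.+1 :> nat -> i' != k0 -> Qmx i' j' = (i == j)%:R ->
      \sum_(k < 3) f i k * f j k = (i == j)%:R.
    move=> ei ej i0 <-; rewrite sum3 /f -ei -ej (hE _ k1) (hE _ k2) (hE _ k3) (hE _ k1) (hE _ k2) (hE _ k3).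
    by rewrite -form Ni0 (negPf i0) /=; ring.
  apply/matrixP => i j; rewrite !mxE; under eq_bigr do rewrite !mxE; move: i j.
  apply: ord3_ind; apply: ord3_ind;
   [apply: (F _ _ k1 k1)|apply: (F _ _ k1 k2)|apply: (F _ _ k1 k3)|
    apply: (F _ _ k2 k1)|apply: (F _ _ k2 k2)|apply: (F _ _ k2 k3)|
    apply: (F _ _ k3 k1)|apply: (F _ _ k3 k2)|apply: (F _ _ k3 k3)] => //; by rewrite mxE.
have [P [DP [P0 P1 P2]]] := spin_rotation (rotation_relations WW DW).
have uP := unit_det1 DP.
exists (U *m P), P; split => //; first by rewrite det_mulmx DU DP mulr1.
move=> M; rewrite LN mulmxA -mat_mul -/U -!mulmxA; congr (_ *m _).
rewrite mulmxA -{2}[M]vecK; move: (vec M) => v {M}.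
apply: (can_inj (mulmxK uP)); rewrite mulmxKV //.
have -> : mat v = v 0 k0 *: 1%:M + v 0 k1 *: sigma_mx t0 + (v 0 k2 *: sigma_mx t1 + v 0 k3 *: sigma_mx t2).
  by rewrite /sigma_mx /= m2_1 !m2_scale !m2_add; congr m2; ring.
have vN : v *m N = v 0 k0 *: row4 1 0 0 0 + v 0 k1 *: row4 0 (f 0%N 0%N) (f 0%N 1%N) (f 0%N 2%N) +
    (v 0 k2 *: row4 0 (f 1%N 0%N) (f 1%N 1%N) (f 1%N 2%N) + v 0 k3 *: row4 0 (f 2%N 0%N) (f 2%N 1%N) (f 2%N 2%N)).
  apply/rowP; apply: ord4_ind; rewrite [LHS]mxE sum4 !mxE /= /f
    ?(hE k1 k1) ?(hE k1 k2) ?(hE k1 k3) ?(hE k2 k1) ?(hE k2 k2) ?(hE k2 k3) ?(hE k3 k1) ?(hE k3 k2) ?(hE k3 k3)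
    ?Ni0 ?N00 /=; ring.
have mat1 : mat (row4 1 0 0 0) = 1%:M by rewrite m2_1 /mat !mxE /=; congr m2; ring.
rewrite vN !matD !matZ mat1 !mulmxDl !mulmxDr -!scalemxAl -!scalemxAr mulmx1 mul1mx.
by rewrite -P0 -P1 -P2.
Qed.

End Pauli.

(** * Jets of solutions *)

Lemma structure_mul (K : comPzRingType) (d0 d1 g0 g1 h0 h1 t00 t01 t10 t11 s0 s1 : K) (J : 'M[K]_4) b
  (D := structure_mx d0 d1 g0 g1 h0 h1 t00 t01 t10 t11 s0 s1 *m J) :
  [/\ D k0 b = d0 * J k1 b + d1 * J k2 b,
      D k1 b = t00 * J k1 b + t01 * J k2 b + (h0 * J k3 b + g0 * J k0 b),
      D k2 b = t10 * J k1 b + t11 * J k2 b + (h1 * J k3 b + g1 * J k0 b) &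
      D k3 b = - (s0 * J k1 b + s1 * J k2 b)].
Proof. by split; rewrite /D mxE sum4 !mxE /=; ring. Qed.

Lemma gram_mul (K : comPzRingType) (u g00 g01 g10 g11 w : K) (J : 'M[K]_4) b
  (D := gram_mx u g00 g01 g10 g11 w *m J) :
  [/\ D k0 b = u * J k0 b, D k1 b = g00 * J k1 b + g01 * J k2 b,
      D k2 b = g10 * J k1 b + g11 * J k2 b & D k3 b = w * J k3 b].
Proof. by split; rewrite /D mxE sum4 !mxE /=; ring. Qed.

(** Gram matrices transform by congruence under changes of coordinates. *)
Lemma gram_congr (K : comPzRingType) (u g00 g01 g10 g11 w x00 x01 x10 x11 : K) :
  gram_mx 1 x00 x01 x10 x11 1 *m gram_mx u g00 g01 g10 g11 w *m (gram_mx 1 x00 x01 x10 x11 1)^T =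
  gram_mx u (x00 * x00 * g00 + x00 * x01 * g01 + x01 * x00 * g10 + x01 * x01 * g11)
            (x00 * x10 * g00 + x00 * x11 * g01 + x01 * x10 * g10 + x01 * x11 * g11)
            (x10 * x00 * g00 + x10 * x01 * g01 + x11 * x00 * g10 + x11 * x01 * g11)
            (x10 * x10 * g00 + x10 * x11 * g01 + x11 * x10 * g10 + x11 * x11 * g11) w.
Proof.
apply/matrixP => a b; rewrite !mxE sum4 !mxE !sum4 !mxE.
by move: a b; apply: ord4_ind; apply: ord4_ind => /=; ring.
Qed.

Lemma gram_mulmx (K : comPzRingType) (x00 x01 x10 x11 y00 y01 y10 y11 : K) :
  gram_mx 1 x00 x01 x10 x11 1 *m gram_mx 1 y00 y01 y10 y11 1 =
  gram_mx 1 (x00 * y00 + x01 * y10) (x00 * y01 + x01 * y11) (x10 * y00 + x11 * y10) (x10 * y01 + x11 * y11) 1.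
Proof.
apply/matrixP => a b; rewrite !mxE sum4 !mxE.
by move: a b; apply: ord4_ind; apply: ord4_ind => /=; ring.
Qed.

Lemma gram_mx1 (K : pzRingType) : gram_mx 1 1 0 0 1 1 = 1%:M :> 'M[K]_4.
Proof. by apply/matrixP; apply: ord4_ind; apply: ord4_ind; rewrite !mxE. Qed.

Lemma gram_eq (K : pzRingType) (u w a b c d a' b' c' d' : K) : a = a' -> b = b' -> c = c' -> d = d' ->
  gram_mx u a b c d w = gram_mx u a' b' c' d' w.
Proof. by move=> -> -> -> ->. Qed.

Lemma invmx_mul (K : fieldType) n (T J : 'M[K]_n) : T \in unitmx -> J \in unitmx ->
  invmx (T *m J) = invmx J *m invmx T.
Proof.
move=> uT uJ; have uu : T *m J \in unitmx by rewrite unitmx_mul uT uJ.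
by rewrite -[RHS](mulmxK uu) !mulmxA (mulmxKV uT) mulVmx // mul1mx.
Qed.

Lemma invmx_congr (K : fieldType) n (T J N : 'M[K]_n) : T \in unitmx -> J \in unitmx ->
  invmx (T *m J) *m (T *m N *m T^T) *m (invmx (T *m J))^T = invmx J *m (N *m (invmx J)^T).
Proof.
move=> uT uJ; rewrite (invmx_mul uT uJ) trmx_mul !trmx_inv.
have uTt : T^T \in unitmx by rewrite unitmx_tr.
by rewrite !mulmxA (mulmxKV uT) (mulmxK uTt).
Qed.

Section Inverse.
Variables (R : realType) (S : surface R).
Local Notation C := R[i].

Lemma smooth_mx_inv (U : set S) m (M : S -> 'M[C]_m) : open U -> smooth_mx U M ->
  (forall p, U p -> M p \in unitmx) -> smooth_mx U (fun p => invmx (M p)).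
Proof.
move=> oU sM uM a b; apply/smooth_funP => c Ac.
apply: (smoothMx_inv (chart_img_open (c := c) oU) (smooth_mx_chart Ac sM)).
by move=> x /chart_imgP[_ Ux]; exact: uM.
Qed.

Lemma mpart_inv (U : set S) c i m (M : S -> 'M[C]_m) p : open U -> atlas c -> U p -> cdom c p ->
  smooth_mx U M -> (forall p, U p -> M p \in unitmx) ->
  mpart c i (fun p => invmx (M p)) p = - (invmx (M p) *m mpart c i M p *m invmx (M p)).
Proof.
move=> oU Ac Up cp sM uM; have Dx := chart_img_mem Up cp.
have cx : (cmap c @` cdom c) (cmap c p) by exists p.
have := dM_inv i (chart_img_open (c := c) oU) Dx (smooth_mx_chart Ac sM).
rewrite (dM_mpart i _ cx) (dM_mpart i (fun p => invmx (M p)) cx) !cmapK //; apply.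
by move=> x /chart_imgP[_ Ux]; exact: uM.
Qed.

End Inverse.

Section Jets.
Variables (R : realType) (S : surface R) (g Psi : S -> 'M[R[i]]_2).
Variable nabla : field S -> field S -> field S.
Local Notation C := R[i].
Hypothesis hg : complex_metric g.
Hypothesis hnabla : levi_civita g nabla.
Hypothesis hPsi : bundle_hom Psi.
Hypothesis hadj : self_adjoint g Psi.
Implicit Types (c d : chart R S) (p q : S) (U W : set S) (i j k : 'I_2) (f n : S -> 'rV[C]_4).
Local Notation connection_mx := (connection_mx g Psi nabla).
Local Notation metric_mx := (metric_mx g).

(** Column b is the unknown of the linear system for the b-th coordinates of f
    and n. *)
Definition jet c f n p : 'M[C]_4 :=
  \matrix_(a, b) (nth 0 [:: f p; mpart c o0 f p; mpart c o1 f p; n p] a) 0 b.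

Definition solution_mx W f n := forall b, solution g Psi nabla W (fun q => f q 0 b) (fun q => n q 0 b).

Lemma jet_row c f n p b : [/\ jet c f n p k0 b = f p 0 b, jet c f n p k1 b = mpart c o0 f p 0 b,
  jet c f n p k2 b = mpart c o1 f p 0 b & jet c f n p k3 b = n p 0 b].
Proof. by split; rewrite mxE. Qed.

Lemma solution_smooth W f n : solution_mx W f n -> smooth_mx W f /\ smooth_mx W n.
Proof.
by move=> sol; split=> a b; have [sf sn _] := sol b; [move: sf|move: sn]; rewrite (ord1 a).
Qed.

Lemma jet_smooth W c f n : open W -> atlas c -> smooth_mx W f -> smooth_mx W n ->
  smooth_mx (W `&` cdom c) (jet c f n).
Proof.
move=> oW Ac sf sn a b; have oU := openIdom c oW.
have sub (h : S -> 'rV[C]_4) : smooth_mx W h -> smooth_mx (W `&` cdom c) h.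
  by move=> sh a' b'; apply: smooth_fun_sub (sh a' b') => q [].
have e (h : S -> C) : (forall q, jet c f n q a b = h q) -> smooth_fun (W `&` cdom c) h ->
    smooth_fun (W `&` cdom c) (fun q => jet c f n q a b).
  by move=> E sh; apply: smooth_fun_eq sh.
move: a e; apply: ord4_ind => e.
- by apply: (e (fun q => f q 0 b)) => [q|]; [have [] := jet_row c f n q b|exact: sub].
- by apply: (e (fun q => mpart c o0 f q 0 b)) => [q|]; [have [] := jet_row c f n q b|exact: mpart_smooth].
- by apply: (e (fun q => mpart c o1 f q 0 b)) => [q|]; [have [] := jet_row c f n q b|exact: mpart_smooth].
- by apply: (e (fun q => n q 0 b)) => [q|]; [have [] := jet_row c f n q b|exact: sub].
Qed.

(** The Gauss-Weingarten system, row by row. *)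
Lemma mpart_jet W c f n i p : open W -> solution_mx W f n -> atlas c -> W p -> cdom c p ->
  mpart c i (jet c f n) p = connection_mx c i p *m jet c f n p.
Proof.
move=> oW sol Ac Wp cp; apply/matrixP => a b; apply: (etrans (mpartE _ _ _ _ _ _)).
have [H1 H2] := solution_chart oW (sol b) Ac Wp cp.
have M k : cpart c k (fun q => f q 0 b) p = mpart c k f p 0 b by exact/esym/mpartE.
have [J0 J1 J2 J3] := jet_row c f n p b.
have [E0 E1 E2 E3] := structure_mul (i == o0)%:R (i == o1)%:R (metric_coef g c i o0 p) (metric_coef g c i o1 p)
  (second_coef g Psi c i o0 p) (second_coef g Psi c i o1 p)
  (christoffel nabla c i o0 o0 p) (christoffel nabla c i o0 o1 p) (christoffel nabla c i o1 o0 p)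
  (christoffel nabla c i o1 o1 p) (shape_coef Psi c i o0 p) (shape_coef Psi c i o1 p) (jet c f n p) b.
rewrite J0 J1 J2 J3 in E0 E1 E2 E3.
have HH j : cpart c i (fun q => mpart c j f q 0 b) p = cpart c i (cpart c j (fun q => f q 0 b)) p.
  by congr (cpart c i _ p); apply/funext => q; exact: mpartE.
have F a' (h : S -> C) : (forall q, jet c f n q a' b = h q) -> (fun q => jet c f n q a' b) = h.
  by move=> E; apply/funext.
move: a; apply: ord4_ind.
- apply: (etrans _ (esym E0)).
  rewrite (F _ (fun q => f q 0 b)) => [|q]; last by have [] := jet_row c f n q b.
  apply: (etrans (M i)); clear; move: i; apply: ord2_ind.
    by have [-> ->] : (o0 == o0)%:R = 1 :> C /\ (o0 == o1)%:R = 0 :> C by []; rewrite mul1r mul0r addr0.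
  by have [-> ->] : (o1 == o0)%:R = 0 :> C /\ (o1 == o1)%:R = 1 :> C by []; rewrite mul1r mul0r add0r.
- apply: (etrans _ (esym E1)).
  rewrite (F _ (fun q => mpart c o0 f q 0 b)) => [|q]; last by have [] := jet_row c f n q b.
  by apply: (etrans (HH o0)); have A := H1 i o0; rewrite -> (M o0), (M o1) in A.
- apply: (etrans _ (esym E2)).
  rewrite (F _ (fun q => mpart c o1 f q 0 b)) => [|q]; last by have [] := jet_row c f n q b.
  by apply: (etrans (HH o1)); have A := H1 i o1; rewrite -> (M o0), (M o1) in A.
- apply: (etrans _ (esym E3)).
  rewrite (F _ (fun q => n q 0 b)) => [|q]; last by have [] := jet_row c f n q b.
  by have A := H2 i; rewrite -> (M o0), (M o1) in A.
Qed.

(** Conversely, the first row of the system says that the two middle rows of a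
    matrix solution M are the partial derivatives of its first row. *)
Lemma solution_of_mx W c (M : S -> 'M[C]_4) f n : open W -> atlas c -> W `<=` cdom c -> smooth_mx W M ->
  (forall i p, W p -> mpart c i M p = connection_mx c i p *m M p) ->
  (forall p b, W p -> f p 0 b = M p k0 b) -> (forall p b, W p -> n p 0 b = M p k3 b) ->
  solution_mx W f n /\ forall p, W p -> jet c f n p = M p.
Proof.
move=> oW Ac Wc sM eqM fM nM.
have near0 p b : W p -> \near p, f p 0 b = M p k0 b.
  by move=> Wp; have : nbhs p W by [exact: open_nbhs_nbhs]; apply: filterS => q; exact: fM.
have near3 p b : W p -> \near p, n p 0 b = M p k3 b.
  by move=> Wp; have : nbhs p W by [exact: open_nbhs_nbhs]; apply: filterS => q; exact: nM.
have E i p b : W p -> [/\ cpart c i (fun q => M q k0 b) p = (i == o0)%:R * M p k1 b + (i == o1)%:R * M p k2 b,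
    cpart c i (fun q => M q k1 b) p = christoffel nabla c i o0 o0 p * M p k1 b + christoffel nabla c i o0 o1 p * M p k2 b +
      (second_coef g Psi c i o0 p * M p k3 b + metric_coef g c i o0 p * M p k0 b),
    cpart c i (fun q => M q k2 b) p = christoffel nabla c i o1 o0 p * M p k1 b + christoffel nabla c i o1 o1 p * M p k2 b +
      (second_coef g Psi c i o1 p * M p k3 b + metric_coef g c i o1 p * M p k0 b) &
    cpart c i (fun q => M q k3 b) p = - (shape_coef Psi c i o0 p * M p k1 b + shape_coef Psi c i o1 p * M p k2 b)].
  move=> Wp; have H a : cpart c i (fun q => M q a b) p = (connection_mx c i p *m M p) a b.
    by rewrite -(eqM i p Wp); exact/esym/mpartE.
  by have [E0 E1 E2 E3] := structure_mul (i == o0)%:R (i == o1)%:R (metric_coef g c i o0 p) (metric_coef g c i o1 p)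
    (second_coef g Psi c i o0 p) (second_coef g Psi c i o1 p)
    (christoffel nabla c i o0 o0 p) (christoffel nabla c i o0 o1 p) (christoffel nabla c i o1 o0 p)
    (christoffel nabla c i o1 o1 p) (shape_coef Psi c i o0 p) (shape_coef Psi c i o1 p) (M p) b;
    split; [exact: (etrans (H k0) E0)|exact: (etrans (H k1) E1)|exact: (etrans (H k2) E2)|exact: (etrans (H k3) E3)].
have D0 p b : W p -> cpart c o0 (fun q => f q 0 b) p = M p k1 b.
  move=> Wp; apply: (etrans (cpart_near o0 (Wc _ Wp) (near0 p b Wp))).
  have [E0 _ _ _] := E o0 p b Wp; apply: (etrans E0).
  by have [-> ->] : (o0 == o0)%:R = 1 :> C /\ (o0 == o1)%:R = 0 :> C by []; rewrite mul1r mul0r addr0.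
have D1 p b : W p -> cpart c o1 (fun q => f q 0 b) p = M p k2 b.
  move=> Wp; apply: (etrans (cpart_near o1 (Wc _ Wp) (near0 p b Wp))).
  have [E0 _ _ _] := E o1 p b Wp; apply: (etrans E0).
  by have [-> ->] : (o1 == o0)%:R = 0 :> C /\ (o1 == o1)%:R = 1 :> C by []; rewrite mul1r mul0r add0r.
have nearD (Q : S -> Prop) p : (forall q, W q -> Q q) -> W p -> \near p, Q p.
  by move=> H Wp; have : nbhs p W by [exact: open_nbhs_nbhs]; apply: filterS => q; exact: H.
split=> [b|p Wp]; last first.
  have x a : forall b, jet c f n p a b = M p a b; last by apply/matrixP => a b; exact: x.
  move: a; apply: ord4_ind => b; have [J0 J1 J2 J3] := jet_row c f n p b.
  - by apply: (etrans J0); exact: fM.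
  - by apply: (etrans J1); apply: (etrans (mpartE _ _ _ _ _ _)); exact: D0.
  - by apply: (etrans J2); apply: (etrans (mpartE _ _ _ _ _ _)); exact: D1.
  - by apply: (etrans J3); exact: nM.
apply: (chart_solution_solution hnabla oW Ac Wc).
- by apply: smooth_fun_eq (sM k0 b) => // p; exact: fM.
- by apply: smooth_fun_eq (sM k3 b) => // p; exact: nM.
move=> p Wp; have cp := Wc _ Wp; have F0 := D0 p b Wp; have F1 := D1 p b Wp.
have G0 := fM p b Wp; have G3 := nM p b Wp.
split=> [i j|i]; have [E0 E1 E2 E3] := E i p b Wp; rewrite -> F0, F1.
  rewrite -> G0, G3; move: j; apply: ord2_ind.
    apply: (etrans _ E1); apply: cpart_near => //; apply: nearD Wp => q Wq; exact: D0.
  apply: (etrans _ E2); apply: cpart_near => //; apply: nearD Wp => q Wq; exact: D1.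
by apply: (etrans _ E3); apply: cpart_near => //; exact: near3.
Qed.

(** The derivative of J^-1 J' vanishes when both solve the same linear system. *)
Lemma ratio_const W c m (B : 'I_2 -> S -> 'M[C]_m) (J J' : S -> 'M[C]_m) p :
  open W -> atlas c -> W `<=` cdom c -> W p -> smooth_mx W J -> smooth_mx W J' ->
  (forall q, W q -> J q \in unitmx) ->
  (forall i q, W q -> mpart c i J q = B i q *m J q) ->
  (forall i q, W q -> mpart c i J' q = B i q *m J' q) ->
  \forall q \near p, invmx (J q) *m J' q = invmx (J p) *m J' p.
Proof.
move=> oW Ac Wc Wp sJ sJ' uJ EJ EJ'; have cp := Wc _ Wp.
have oD := chart_img_open (c := c) oW; have Dx := chart_img_mem Wp cp.
have [r r0 br] : exists2 r : R, 0 < r & ball (cmap c p) r `<=` chart_img c W.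
  by have /nbhs_ballP[r /= r0 br] : nbhs (cmap c p) (chart_img c W) by [exact: open_nbhs_nbhs]; exists r.
pose F x := invmx (J (cinv c x)) *m J' (cinv c x).
have sJc := smooth_mx_chart Ac sJ; have sJc' := smooth_mx_chart Ac sJ'.
have uJc x : chart_img c W x -> J (cinv c x) \in unitmx by move=> /chart_imgP[_ /uJ].
have sI := smoothMx_inv oD sJc uJc; have sF := smoothMxM oD sI sJc'.
have dF y i : chart_img c W y -> dM i F y = 0.
  move=> Dy; have /chart_imgP[cy Wy] := Dy.
  rewrite /F (dMM i oD Dy sI sJc') (dM_inv i oD Dy sJc uJc).
  rewrite (dM_mpart i J cy) (dM_mpart i J' cy) (EJ i _ Wy) (EJ' i _ Wy).
  rewrite mulNmx !mulmxA (mulmxK (uJ _ Wy)); exact: addNr.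
have bF y i : `|y - cmap c p| < r -> dM i F y = 0.
  by move=> yr; apply: dF; apply: br; rewrite -ball_normE /= distrC.
have sFb : smoothMx (ball (cmap c p) r) F by move=> a b; apply: smoothC_sub (sF a b).
have N1 : nbhs p (cmap c @^-1` ball (cmap c p) r) by apply: (cmap_cont cp); exact: nbhsx_ballx.
have N2 : nbhs p W by exact: open_nbhs_nbhs.
apply: filterS2 N1 N2 => q bq Wq.
have := dM0_const sFb bF (y := cmap c q).
rewrite /F (cmapK cp) (cmapK (Wc _ Wq)); apply.
by move: bq; rewrite /= -ball_normE /= distrC.
Qed.

(** The Jacobian matrix of the transition map, acting on the two rows of
    derivatives. *)
Definition change_mx d c p : 'M[C]_4 :=
  gram_mx 1 (cpart d o0 (coord c o0) p) (cpart d o0 (coord c o1) p)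
            (cpart d o1 (coord c o0) p) (cpart d o1 (coord c o1) p) 1.

Lemma cpart_change2 c d i (h : S -> C) p U : atlas c -> atlas d -> open U -> U p -> smooth_fun U h ->
  cdom c p -> cdom d p -> cpart d i h p =
  cpart d i (coord c o0) p * cpart c o0 h p + cpart d i (coord c o1) p * cpart c o1 h p.
Proof.
move=> Ac Ad oU Up sh cp dp; apply: (etrans (cpart_change i Ad Ac oU Up sh dp cp)).
by apply: (etrans (sum_ord2 _)); apply: f_equal2; apply: (f_equal (fun z => z * _)); exact/esym/cpart_coord.
Qed.

Lemma change_mx_unit c d p : atlas c -> atlas d -> cdom c p -> cdom d p -> change_mx d c p \in unitmx.
Proof.
move=> Ac Ad cp dp.
have : change_mx d c p *m change_mx c d p = 1%:M; last by case/mulmx1_unit.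
apply: (etrans (gram_mulmx _ _ _ _ _ _ _ _)).
have E i k : cpart d i (coord c o0) p * cpart c o0 (coord d k) p + cpart d i (coord c o1) p * cpart c o1 (coord d k) p =
    (i == k)%:R.
  rewrite -(cpart_own i k dp); apply: esym.
  exact: (cpart_change2 i Ac Ad (@cdom_open _ _ d) dp (coord_smooth k Ad) cp dp).
apply: (etrans (gram_eq _ _ (E o0 o0) (E o0 o1) (E o1 o0) (E o1 o1))); exact: gram_mx1.
Qed.

Lemma jet_change W c d f n p : atlas c -> atlas d -> open W -> W p -> smooth_mx W f -> cdom c p -> cdom d p ->
  jet d f n p = change_mx d c p *m jet c f n p.
Proof.
move=> Ac Ad oW Wp sf cp dp.
have E a b : jet d f n p a b = (change_mx d c p *m jet c f n p) a b; last by apply/matrixP => a b; exact: E.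
have [G0 G1 G2 G3] := gram_mul 1 (cpart d o0 (coord c o0) p) (cpart d o0 (coord c o1) p)
            (cpart d o1 (coord c o0) p) (cpart d o1 (coord c o1) p) 1 (jet c f n p) b.
have [J0 J1 J2 J3] := jet_row c f n p b; have [D0 D1 D2 D3] := jet_row d f n p b.
have M i : mpart d i f p 0 b = cpart d i (coord c o0) p * mpart c o0 f p 0 b + cpart d i (coord c o1) p * mpart c o1 f p 0 b.
  apply: (etrans (mpartE _ _ _ _ _ _)).
  apply: (etrans (cpart_change2 i Ac Ad oW Wp (sf 0 b) cp dp)).
  by apply: f_equal2; apply: f_equal; exact/esym/mpartE.
move: a; apply: ord4_ind.
- by apply: (etrans _ (esym G0)); rewrite mul1r J0 D0.
- by apply: (etrans _ (esym G1)); rewrite J1 J2 D1; exact: M.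
- by apply: (etrans _ (esym G2)); rewrite J1 J2 D2; exact: M.
- by apply: (etrans _ (esym G3)); rewrite mul1r J3 D3.
Qed.

Lemma metric_change c d p : atlas c -> atlas d -> cdom c p -> cdom d p ->
  metric_mx d p = change_mx d c p *m metric_mx c p *m (change_mx d c p)^T.
Proof.
move=> Ac Ad cp dp; apply: (etrans _ (esym (gram_congr _ _ _ _ _ _ _ _ _ _))).
have t i k : tact p (cfield d i p) (coord c k) = cpart d i (coord c k) p.
  exact: (tact_cfield i Ad dp (@cdom_open _ _ c) cp (coord_smooth k Ac)).
have E i j : metric_coef g d i j p =
    cpart d i (coord c o0) p * cpart d j (coord c o0) p * metric_coef g c o0 o0 p +
    cpart d i (coord c o0) p * cpart d j (coord c o1) p * metric_coef g c o0 o1 p +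
    cpart d i (coord c o1) p * cpart d j (coord c o0) p * metric_coef g c o1 o0 p +
    cpart d i (coord c o1) p * cpart d j (coord c o1) p * metric_coef g c o1 o1 p.
  apply: (etrans (metric_expand g _ _ Ac cp)).
  by rewrite -> (t i o0), (t i o1), (t j o0), (t j o1).
exact: (gram_eq _ _ (E o0 o0) (E o0 o1) (E o1 o0) (E o1 o1)).
Qed.

(** The jet in the chart that names tangent vectors at q: a basis of the space
    of matrices that moves with q and is defined on the whole surface. *)
Definition frame f n q : 'M[C]_4 := jet (chart_at q) f n q.

Lemma frame_jet W c f n q : atlas c -> open W -> W q -> smooth_mx W f -> cdom c q ->
  frame f n q = change_mx (chart_at q) c q *m jet c f n q.
Proof.
by move=> Ac oW Wq sf cq; apply: (jet_change n Ac (atlas_chart_at q) oW Wq sf cq (cdom_chart_at q)).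
Qed.

Lemma frame_unit W c f n q : atlas c -> open W -> W q -> smooth_mx W f -> cdom c q ->
  (frame f n q \in unitmx) = (jet c f n q \in unitmx).
Proof.
move=> Ac oW Wq sf cq; rewrite (frame_jet n Ac oW Wq sf cq) unitmx_mul.
by rewrite (change_mx_unit Ac (atlas_chart_at q) cq (cdom_chart_at q)).
Qed.

(** The ratio is that of the jets in one chart near p, as the change of chart
    cancels. *)
Lemma frame_ratio W W' f n f' n' p : open W -> open W' -> W p -> W' p ->
  solution_mx W f n -> solution_mx W' f' n' -> (forall q, W q -> frame f n q \in unitmx) ->
  \forall q \near p, invmx (frame f n q) *m frame f' n' q = invmx (frame f n p) *m frame f' n' p.
Proof.
move=> oW oW' Wp W'p sol sol' u; set c := chart_at p.
have Ac : atlas c := atlas_chart_at p; have cp : cdom c p := cdom_chart_at p.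
pose D := (W `&` W') `&` cdom c; have oD : open D by apply: openIdom; exact: openI.
have Dp : D p by [].
have [sf sn] := solution_smooth sol; have [sf' sn'] := solution_smooth sol'.
have sub m l (h : S -> 'M[C]_(m, l)) V : smooth_mx V h -> D `<=` V -> smooth_mx D h.
  by move=> sh DV a b; apply: smooth_fun_sub (sh a b).
have uD q : D q -> jet c f n q \in unitmx.
  by move=> [[Wq _] cq]; rewrite -(frame_unit n Ac oW Wq sf cq); exact: u.
have R0 : \forall q \near p, invmx (jet c f n q) *m jet c f' n' q = invmx (jet c f n p) *m jet c f' n' p.
  apply: (ratio_const (W := D) oD Ac _ Dp _ _ uD (B := connection_mx c)).
  - by move=> q [].
  - by apply: sub (jet_smooth oW Ac sf sn) _ => q [[]].
  - by apply: sub (jet_smooth oW' Ac sf' sn') _ => q [[]].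
  - by move=> i q [[Wq _] cq]; exact: (mpart_jet i oW sol Ac Wq cq).
  - by move=> i q [[_ Wq] cq]; exact: (mpart_jet i oW' sol' Ac Wq cq).
have E q : D q -> invmx (frame f n q) *m frame f' n' q = invmx (jet c f n q) *m jet c f' n' q.
  move=> Dq; have [[Wq W'q] cq] := Dq.
  rewrite (frame_jet n Ac oW Wq sf cq) (frame_jet n' Ac oW' W'q sf' cq).
  have uT := change_mx_unit Ac (atlas_chart_at q) cq (cdom_chart_at q).
  rewrite (invmx_mul uT (uD q Dq)).
  by rewrite !mulmxA (mulmxKV uT).
have N1 : nbhs p D by exact: open_nbhs_nbhs.
by apply: filterS2 R0 N1 => q Rq Dq; rewrite (E _ Dq) (E _ Dp).
Qed.

Definition frame_gram f n q : 'M[C]_4 :=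
  invmx (frame f n q) *m metric_mx (chart_at q) q *m (invmx (frame f n q))^T.

(** As the metric matrix N is parallel, N J^-T satisfies the same linear system
    as the jet J. *)
Lemma frame_gram_const W f n p : open W -> W p -> solution_mx W f n ->
  (forall q, W q -> frame f n q \in unitmx) -> \forall q \near p, frame_gram f n q = frame_gram f n p.
Proof.
move=> oW Wp sol u; set c := chart_at p.
have Ac : atlas c := atlas_chart_at p; have cp : cdom c p := cdom_chart_at p.
pose D := W `&` cdom c; have oD : open D by apply: openIdom.
have Dp : D p by [].
have [sf sn] := solution_smooth sol.
have uD q : D q -> jet c f n q \in unitmx.
  by move=> [Wq cq]; rewrite -(frame_unit n Ac oW Wq sf cq); exact: u.
have sJ : smooth_mx D (jet c f n) := jet_smooth oW Ac sf sn.
have sI := smooth_mx_inv oD sJ uD; have sIt := smooth_mx_tr oD sI.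
have sG : smooth_mx D (metric_mx c).
  by move=> a b; apply: smooth_fun_sub (metric_mx_smooth hg Ac a b) => q [].
pose J' q := metric_mx c q *m (invmx (jet c f n q))^T.
have EJ i q : D q -> mpart c i (jet c f n) q = connection_mx c i q *m jet c f n q.
  by move=> [Wq cq]; exact: (mpart_jet i oW sol Ac Wq cq).
have R0 : \forall q \near p, invmx (jet c f n q) *m J' q = invmx (jet c f n p) *m J' p.
  have Dc : D `<=` cdom c by move=> q [].
  apply: (ratio_const (W := D) oD Ac Dc Dp sJ _ uD EJ); first exact: smooth_mxM.
  move=> i q Dq; have [Wq cq] := Dq.
  rewrite /J' (mpartM i oD Ac Dq cq sG sIt) (mpart_tr c i (fun q => invmx (jet c f n q))).
  rewrite (mpart_inv i oD Ac Dq cq sJ uD) (EJ i q Dq) (mpart_metric Psi hg hnabla Ac i cq).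
  have -> : - (invmx (jet c f n q) *m (connection_mx c i q *m jet c f n q) *m invmx (jet c f n q)) =
      - (invmx (jet c f n q) *m connection_mx c i q) by rewrite mulmxA mulmxK // uD.
  have trN (A : 'M[C]_4) : (- A)^T = - A^T by apply/matrixP => a b; rewrite !mxE.
  by rewrite trN trmx_mul mulmxN mulmxDl !mulmxA; exact: addrK.
have E q : D q -> frame_gram f n q = invmx (jet c f n q) *m J' q.
  move=> Dq; have [Wq cq] := Dq; rewrite /frame_gram (frame_jet n Ac oW Wq sf cq).
  rewrite (metric_change Ac (atlas_chart_at q) cq (cdom_chart_at q)) /J'.
  have uT := change_mx_unit Ac (atlas_chart_at q) cq (cdom_chart_at q).
  exact: (invmx_congr _ uT (uD q Dq)).
have N1 : nbhs p D by exact: open_nbhs_nbhs.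
by apply: filterS2 R0 N1 => q Rq Dq; rewrite (E _ Dq) (E _ Dp).
Qed.

Lemma solution_near f n : (forall p, exists2 W, open W & W p /\ solution_mx W f n) -> solution_mx setT f n.
Proof.
move=> H b; split.
- by apply: smooth_fun_loc => p _; have [W oW [Wp sol]] := H p; exists W => //; have [] := sol b.
- by apply: smooth_fun_loc => p _; have [W oW [Wp sol]] := H p; exists W => //; have [] := sol b.
move=> U X Y oU _ sX sY p Up; have [W oW [Wp sol]] := H p; have [_ _ P] := sol b.
apply: (P (U `&` W)) => //.
- exact: openI.
- by apply: smooth_field_sub sX => q [].
- by apply: smooth_field_sub sY => q [].
Qed.

End Jets.

(** * Global solutions *)

Section ChartBalls.
Variables (R : realType) (S : surface R).
Implicit Types (c : chart R S) (p q : S).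

Definition chart_ball c (x : 'cV[R]_2) (r : R) : set S := cdom c `&` cmap c @^-1` ball x r.

Lemma chart_ball_open c x r : open (chart_ball c x r).
Proof.
rewrite openE => q [cq bq]; rewrite /interior.
have N1 : nbhs q (cdom c) by apply: open_nbhs_nbhs; split=> //; exact: cdom_open.
have N2 : nbhs q (cmap c @^-1` ball x r).
  by apply: (cmap_cont cq); apply: open_nbhs_nbhs; split=> //; exact: ball_open.
by apply: filterS2 N1 N2.
Qed.

Lemma ball_segment (x y z : 'cV[R]_2) (r s : R) : 0 <= s <= 1 ->
  ball x r y -> ball x r z -> ball x r (y + s *: (z - y)).
Proof.
move=> /andP[s0 s1]; rewrite -ball_normE /= => xy xz.
have -> : x - (y + s *: (z - y)) = (1 - s) *: (x - y) + s *: (x - z).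
  by apply/matrixP => i j; rewrite !mxE; ring.
apply: (le_lt_trans (ler_normD _ _)); rewrite !normrZ (ger0_norm s0).
have s1' : 0 <= 1 - s by rewrite subr_ge0.
rewrite (ger0_norm s1').
have [s_eq0|s_neq0] := eqVneq s 0; first by rewrite s_eq0 subr0 mul1r mul0r addr0.
have s_gt0 : 0 < s by rewrite lt_neqAle eq_sym s_neq0.
have : (1 - s) * `|x - y| <= (1 - s) * r by apply: ler_wpM2l => //; exact: ltW.
have : s * `|x - z| < s * r by rewrite ltr_pM2l.
lra.
Qed.

(** Segments of the ball in the chart. *)
Lemma chart_ball_path c x r q q' : ball x r `<=` cmap c @` cdom c ->
  chart_ball c x r q -> chart_ball c x r q' ->
  exists2 h : R -> S, is_path h q q' & forall t, chart_ball c x r (h t).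
Proof.
move=> bc [cq bq] [cq' bq'].
pose y t := cmap c q + clamp01 t *: (cmap c q' - cmap c q).
have by_ t : ball x r (y t).
  by apply: ball_segment => //; have := clamp01_itv t; rewrite in_itv.
exists (fun t => cinv c (y t)) => [|t]; last first.
  have cy := bc _ (by_ t); split; first exact: cinv_dom.
  by rewrite /= cinvK.
split.
- move=> t; apply: (@continuous_comp _ _ _ y (cinv c)); last exact: (cinv_cont (bc _ (by_ t))).
  rewrite /y; apply: cvgD; first exact: cvg_cst.
  apply: cvgZr_tmp; exact: clamp01_continuous.
- by move=> t t0; rewrite /y clamp01_le0 // scale0r addr0 cmapK.
- by move=> t t1; rewrite /y clamp01_ge1 // scale1r addrC subrK cmapK.
Qed.

End ChartBalls.

Lemma change_mul (R : realType) (S : surface R) (c d : chart R S) p (M : 'M[R[i]]_4) b :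
  (change_mx d c p *m M) k0 b = M k0 b /\ (change_mx d c p *m M) k3 b = M k3 b.
Proof.
have [E0 _ _ E3] := gram_mul 1 (cpart d o0 (coord c o0) p) (cpart d o0 (coord c o1) p)
            (cpart d o1 (coord c o0) p) (cpart d o1 (coord c o1) p) 1 M b.
by split; [apply: (etrans E0)|apply: (etrans E3)]; exact: mul1r.
Qed.

Section Frames.
Variables (R : realType) (S : surface R) (g Psi : S -> 'M[R[i]]_2).
Variable nabla : field S -> field S -> field S.
Local Notation C := R[i].
Hypothesis hg : complex_metric g.
Hypothesis hnabla : levi_civita g nabla.
Hypothesis hPsi : bundle_hom Psi.
Hypothesis hadj : self_adjoint g Psi.
Hypothesis flat : integrable g Psi nabla.
Implicit Types (c : chart R S) (p q : S) (f n : S -> 'rV[C]_4).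
Local Notation solution_mx := (solution_mx g Psi nabla).

Lemma det_near_neq0 m (U : set 'cV[R]_2) (F : 'cV[R]_2 -> 'M[C]_m) x : open U -> U x -> smoothMx U F ->
  F x = 1%:M -> \forall y \near x, F y \in unitmx.
Proof.
move=> oU Ux sF Fx; have [sr _] := smoothC_det oU sF.
have dr := sr [::] x Ux; have cr := differentiable_continuous dr.
have : \forall y \near x, 0 < complex.Re (\det (F y)).
  by apply: (cvgr_gt (complex.Re (\det (F x))) cr); rewrite Fx det1 /=.
apply: filterS => y y0; rewrite unitmxE unitfE.
by apply: contraTneq y0 => ->; rewrite ltxx.
Qed.

(** Flatness is the integrability condition of the linear system, so it has a
    fundamental matrix near p. *)
Lemma local_frame p : exists z : R * (S -> 'rV[C]_4) * (S -> 'rV[C]_4), let c := chart_at p in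
  (0 < z.1.1 /\ ball (cmap c p) z.1.1 `<=` cmap c @` cdom c) /\
  let W := chart_ball c (cmap c p) z.1.1 in
  solution_mx W z.1.2 z.2 /\ forall q, W q -> jet c z.1.2 z.2 q \in unitmx.
Proof.
set c := chart_at p; have Ac : atlas c := atlas_chart_at p; have cp : cdom c p := cdom_chart_at p.
have oc := @cdom_open _ _ c.
have oD := chart_img_open (c := c) oc; have Dx := chart_img_mem cp cp.
pose B i x := connection_mx g Psi nabla c i (cinv c x).
have sB i : smoothMx (chart_img c (cdom c)) (B i).
  exact: smooth_mx_chart Ac (connection_mx_smooth hg hnabla hPsi Ac i).
have E0 : (0 : 'I_2) = o0 by exact: val_inj.
have E1 : (1 : 'I_2) = o1 by exact: val_inj.
have fB x : chart_img c (cdom c) x -> dM 0 (B 1) x + B 1 x *m B 0 x = dM 1 (B 0) x + B 0 x *m B 1 x.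
  rewrite E0 E1 => /chart_imgP[cx dx].
  have /eqP := flat Ac dx; rewrite /curvature_mx -addrA -opprD subr_eq0 => /eqP.
  by rewrite /B (dM_mpart o0 _ cx) (dM_mpart o1 _ cx).
have [r r0 [br [Th [Th1 sTh dTh]]]] := frobenius oD Dx sB fB.
have ob : open (ball (cmap c p) r) by exact: ball_open.
have := det_near_neq0 ob (ballxx _ r0) sTh Th1.
have Nb : nbhs (cmap c p) (ball (cmap c p) r) by exact: nbhsx_ballx.
move=> Nu; have /nbhs_ballP[r' /= r'0 br'] :
  nbhs (cmap c p) (ball (cmap c p) r `&` [set y | Th y \in unitmx]) by exact: filterI.
have bc : ball (cmap c p) r' `<=` cmap c @` cdom c.
  by move=> x /br'[/br /chart_imgP[]].
pose W := chart_ball c (cmap c p) r'; have oW : open W by exact: chart_ball_open.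
have Wc : W `<=` cdom c by move=> q [].
pose M q := Th (cmap c q).
have sM : smooth_mx W M.
  move=> a b; apply: (smooth_fun_chart Ac oW Wc).
  apply: (smoothC_eq (G := fun x => Th x a b)); first exact: chart_img_open.
    by move=> x /chart_imgP[cx _]; rewrite /in_chart /M cinvK.
  by apply: smoothC_sub (sTh a b) => x /chart_imgP[cx [_]]; rewrite /= cinvK // => /br'[].
have eM i q : W q -> mpart c i M q = connection_mx g Psi nabla c i q *m M q.
  move=> [cq bq]; have cx : (cmap c @` cdom c) (cmap c q) by exists q.
  have := dM_mpart i M cx; rewrite cmapK // => <-.
  have [bq' _] := br' _ bq.
  have := dTh i _ bq'; rewrite /B cmapK // => <-.
  by apply: dM_near; apply: filterS (img_near cq) => x cx'; rewrite /M cinvK.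
pose f q := row k0 (M q); pose n q := row k3 (M q).
exists (r', f, n); split=> //.
have [sol J] := solution_of_mx hnabla oW Ac Wc sM eM (f := f) (n := n) (fun q b _ => mxE _ _ _ _) (fun q b _ => mxE _ _ _ _).
split=> // q Wq; rewrite J // /M; have [_ bq] := Wq; by have [] := br' _ bq.
Qed.

Hypothesis sc : simply_connected S.

(** The local frames have locally constant ratios, so that monodromy applies; a
    parallel frame is locally a constant combination of solutions, hence a
    solution. *)
Theorem global_frame p0 (J0 : 'M[C]_4) : J0 \in unitmx -> exists f n,
  [/\ solution_mx setT f n, frame f n p0 = J0 & forall q, frame f n q \in unitmx].
Proof.
move=> uJ0.
have [z Hz] := choice local_frame.
pose W p := chart_ball (chart_at p) (cmap (chart_at p) p) (z p).1.1.
have oW p : open (W p) by exact: chart_ball_open.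
have sol p : solution_mx (W p) (z p).1.2 (z p).2 by have [_ []] := Hz p.
pose th p q := frame (z p).1.2 (z p).2 q.
have sm p := solution_smooth (sol p).
have Wc p q : W p q -> cdom (chart_at p) q by case.
have uth p q : W p q -> th p q \in unitmx.
  move=> Wq; rewrite /th (frame_unit _ (atlas_chart_at p) (oW p) Wq (sm p).1 (Wc _ _ Wq)).
  by have [_ [_ H]] := Hz p; exact: H.
have cov p : exists p', W p' p.
  exists p; split; first exact: cdom_chart_at.
  by have [[r0 _] _] := Hz p; exact: ballxx.
have compat a b q : W a q -> W b q ->
    \forall q' \near q, invmx (th a q') *m th b q' = invmx (th a q) *m th b q.
  by move=> aq bq; apply: (frame_ratio (oW a) (oW b) aq bq (sol a) (sol b) (uth a)).
have lpc a q : W a q -> \forall q' \near q, exists2 h : R -> S, is_path h q q' & forall t, W a (h t).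
  move=> aq; have N : nbhs q (W a) by exact: open_nbhs_nbhs.
  apply: filterS N => q' aq'; have [[_ bc] _] := Hz a; exact: chart_ball_path.
have [Phi Phi0 par] := parallel_frame oW cov uth compat (simply_connected_path sc)
  (simply_connected_null sc) lpc p0 J0.
pose f q := row k0 (Phi q); pose n q := row k3 (Phi q).
have loc q : exists2 V, open V & V q /\ solution_mx V f n /\ forall q', V q' -> frame f n q' = Phi q'.
  have [p Wq N0] := par q; pose A := invmx (th p q) *m Phi q; pose c := chart_at p.
  have Ac : atlas c := atlas_chart_at p.
  have N1 : nbhs q (W p) by exact: open_nbhs_nbhs.
  have [V [oV Vq] VP] : exists2 V : set S, open_nbhs q V & V `<=` [set q' | W p q' /\ Phi q' = th p q' *m A].
    have : nbhs q [set q' | W p q' /\ Phi q' = th p q' *m A].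
      apply: filterS2 N0 N1 => q' E Wq' /=; split=> //.
      by rewrite /A -E (mulKVmx (uth _ _ Wq')).
    by rewrite nbhsE => -[V oV VP]; exists V.
  exists V => //; split => //.
  pose M q' := jet c (z p).1.2 (z p).2 q' *m A.
  have PM q' : V q' -> Phi q' = change_mx (chart_at q') c q' *m M q'.
    move=> /VP[Wq' ->]; rewrite /th (frame_jet _ Ac (oW p) Wq' (sm p).1 (Wc _ _ Wq')).
    by rewrite /M mulmxA.
  have Vc : V `<=` cdom c by move=> q' /VP[/Wc].
  have VW : V `<=` W p by move=> q' /VP[].
  have sJ : smooth_mx V (jet c (z p).1.2 (z p).2).
    move=> a b; apply: smooth_fun_sub (jet_smooth (oW p) Ac (sm p).1 (sm p).2 a b) => q' Vq'.
    by split; [exact: VW|exact: Vc].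
  have sA : smooth_mx V (fun=> A) by move=> a b; exact: smooth_fun_cst.
  have sM : smooth_mx V M by exact: smooth_mxM.
  have eM i q' : V q' -> mpart c i M q' = connection_mx g Psi nabla c i q' *m M q'.
    move=> Vq'; rewrite /M (mpartM i oV Ac Vq' (Vc _ Vq') sJ sA) mpart_cst mulmx0 addr0.
    by rewrite (mpart_jet i (oW p) (sol p) Ac (VW _ Vq') (Vc _ Vq')) mulmxA.
  have rowP0 q' b : V q' -> f q' 0 b = M q' k0 b.
    by move=> Vq'; rewrite mxE PM //; have [] := change_mul c (chart_at q') q' (M q') b.
  have rowP3 q' b : V q' -> n q' 0 b = M q' k3 b.
    by move=> Vq'; rewrite mxE PM //; have [] := change_mul c (chart_at q') q' (M q') b.
  have [solV J] := solution_of_mx hnabla oV Ac Vc sM eM rowP0 rowP3; split=> // q' Vq'.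
  have [sf sn] := solution_smooth solV.
  by rewrite (frame_jet n Ac oV Vq' sf (Vc _ Vq')) J // PM.
have solT : solution_mx setT f n.
  by apply: solution_near => q; have [V oV [Vq [solV _]]] := loc q; exists V.
have FE q : frame f n q = Phi q by have [V oV [Vq [_ H]]] := loc q; exact: H.
exists f, n; split=> // [|q]; first by rewrite FE.
rewrite FE; have : (Phi p0 \in unitmx) = (Phi q \in unitmx).
  apply: (locally_constant (A := setT) (F := fun q => Phi q \in unitmx)) => //; first exact: surface_connected.
  move=> x _; have [p Wx N0] := par x.
  have N1 : nbhs x (W p) by exact: open_nbhs_nbhs.
  apply: filterS2 N0 N1 => y E Wy; have := congr1 (fun M : 'M[C]_4 => M \in unitmx) E.
  by rewrite !unitmx_mul !unitmx_inv (uth _ _ Wy) (uth _ _ Wx).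
by rewrite Phi0 uJ0 => <-.
Qed.

End Frames.

(** * Moving frames and immersions *)

Section Rows.

Lemma row4_mul (F : fieldType) (a b c d : F) (J : 'M[F]_4) j :
  (row4 a b c d *m J) 0 j = a * J k0 j + b * J k1 j + c * J k2 j + d * J k3 j.
Proof. by rewrite mxE sum4 !mxE. Qed.

Lemma row4_gram (F : fieldType) (u g00 g01 g10 g11 w a b c d a' b' c' d' : F) :
  (row4 a b c d *m gram_mx u g00 g01 g10 g11 w *m (row4 a' b' c' d')^T) 0 0 =
  u * a * a' + (b * b' * g00 + b * c' * g01 + c * b' * g10 + c * c' * g11) + w * d * d'.
Proof. by rewrite !mxE !sum4 !mxE !sum4 !mxE /=; ring. Qed.

Lemma row4_qm (F : fieldType) (im : F) (x y : 'rV[F]_4) (J N : 'M[F]_4) :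
  im * im = -1 -> 2%:R != 0 :> F -> J *m Qmx F *m J^T = N ->
  qm (mat im (x *m J)) (mat im (y *m J)) = (x *m N *m y^T) 0 0.
Proof. by move=> i2 n2 <-; rewrite qm_mat // trmx_mul !mulmxA. Qed.

Lemma gram_det_mul (F : comPzRingType) (a b c d : F) : \det (gram_mx 1 a b c d 1) = a * d - b * c.
Proof. by rewrite (det4 (fun i j => nth 0 (nth [::] _ i) j)) /=; ring. Qed.

Lemma gram_det_metric (F : comPzRingType) (a b c d : F) : \det (gram_mx (-1) a b c d 1) = - (a * d - b * c).
Proof. by rewrite (det4 (fun i j => nth 0 (nth [::] _ i) j)) /=; ring. Qed.

Lemma rows4_mul (F : fieldType) (a b c d : F) (J : 'M[F]_4) :
  \matrix_(i < 4, j < 4) (nth 0 [:: row4 1 0 0 0 *m J; row4 0 a b 0 *m J; row4 0 c d 0 *m J; row4 0 0 0 1 *m J] i) 0 j =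
  gram_mx 1 a b c d 1 *m J.
Proof.
apply/matrixP => i j; rewrite [LHS]mxE [RHS]mxE sum4 !mxE.
by move: i; apply: ord4_ind => /=; rewrite row4_mul.
Qed.

Lemma form_symmetric (F : fieldType) (N : 'M[F]_4) (x y : 'rV[F]_4) : N^T = N ->
  (x *m N *m y^T) 0 0 = (y *m N *m x^T) 0 0.
Proof.
move=> NT; have -> : y *m N *m x^T = (x *m N *m y^T)^T by rewrite !trmx_mul trmxK NT mulmxA.
by rewrite [RHS]mxE.
Qed.

Lemma form_linear (F : fieldType) (N : 'M[F]_4) (x y z : 'rV[F]_4) (a b : F) :
  (x *m N *m (a *: y + b *: z)^T) 0 0 = a * (x *m N *m y^T) 0 0 + b * (x *m N *m z^T) 0 0.
Proof.
have -> : (a *: y + b *: z)^T = a *: y^T + b *: z^T by apply/matrixP => i j; rewrite !mxE.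
rewrite mulmxDr -!scalemxAr.
by move: (x *m N *m y^T) (x *m N *m z^T) => P Q; rewrite !mxE.
Qed.

Lemma congr_cancel (F : fieldType) m (T J Q N : 'M[F]_m) : T \in unitmx ->
  T *m J *m Q *m (T *m J)^T = T *m N *m T^T -> J *m Q *m J^T = N.
Proof.
move=> uT; have uTt : T^T \in unitmx by rewrite unitmx_tr.
rewrite trmx_mul -!mulmxA => /(can_inj (mulKmx uT)).
by rewrite !mulmxA => /(can_inj (mulmxK uTt)).
Qed.

(** The matrix P measures the failure of J to solve the system with matrix B;
    the hypothesis is that the derivative of J Q J^T = N is the one of a
    parallel N. *)
Lemma defect_antisymmetric (F : fieldType) m (J Q N B dJ : 'M[F]_m) (P := (dJ - B *m J) *m (Q *m J^T)) :
  Q^T = Q -> J *m Q *m J^T = N -> dJ *m Q *m J^T + J *m Q *m dJ^T = B *m N + N *m B^T -> P + P^T = 0.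
Proof.
move=> QT <-; rewrite /P trmx_mul trmx_mul trmxK QT.
have -> : (dJ - B *m J)^T = dJ^T - J^T *m B^T by rewrite -trmx_mul; apply/matrixP => i j; rewrite !mxE.
rewrite !mulmxBl !mulmxBr !mulmxA => /eqP; rewrite -subr_eq0 => /eqP <-.
move: (dJ *m Q *m J^T) (J *m Q *m dJ^T) (B *m J *m Q *m J^T) (J *m Q *m J^T *m B^T) => a b c d.
by apply/matrixP => i j; rewrite !mxE; ring.
Qed.

Lemma rows_form (F : fieldType) m (M G : 'M[F]_m) k l : (row k M *m G *m (row l M)^T) 0 0 = (M *m G *m M^T) k l.
Proof.
rewrite -row_mul [LHS]mxE [RHS]mxE; apply: eq_bigr => j _.
by congr (_ * _); [rewrite [LHS]mxE|rewrite [LHS]mxE [LHS]mxE [RHS]mxE].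
Qed.

Lemma matrix_of_rows (F : fieldType) (r : 'I_4 -> 'rV[F]_4) (M N : 'M[F]_4) : (forall a, r a = delta_mx 0 a) ->
  (forall a b, (r a *m M *m (r b)^T) 0 0 = (r a *m N *m (r b)^T) 0 0) -> M = N.
Proof.
move=> rE H; have E (L : 'M[F]_4) a b : (r a *m L *m (r b)^T) 0 0 = L a b.
  by rewrite !rE -rowE trmx_delta -colE !mxE.
by apply/matrixP => a b; rewrite -(E M) -(E N).
Qed.

(** Antisymmetry leaves one entry in the tangent block of each matrix, and the
    symmetry identifies it with a diagonal entry of the other matrix. This is
    the argument that proves the uniqueness of the Levi-Civita connection. *)
Lemma antisymmetric_pair_0 (F : numFieldType) (S0 S1 : 'M[F]_4) : S0 + S0^T = 0 -> S1 + S1^T = 0 ->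
  (forall b, S0 k0 b = 0) -> (forall b, S1 k0 b = 0) -> (forall b, S0 k3 b = 0) -> (forall b, S1 k3 b = 0) ->
  (forall b, S0 k2 b = S1 k1 b) -> S0 = 0 /\ S1 = 0.
Proof.
move=> A0 A1 z0 z1 n0 n1 sym.
have anti (M : 'M[F]_4) : M + M^T = 0 -> forall a b, M b a = - M a b.
  move=> MT a b; have /matrixP/(_ b a) := MT; rewrite !mxE => /eqP; rewrite addr_eq0 => /eqP -> //.
have diag (M : 'M[F]_4) : M + M^T = 0 -> forall a, M a a = 0.
  by move=> MT a; have := anti M MT a a; move/eqP; rewrite -addr_eq0 -mulr2n mulrn_eq0 /= => /eqP.
split; apply: antisymmetric4_0 => //.
  by rewrite (anti _ A0 k2 k1) sym (diag _ A1) oppr0.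
by rewrite -sym (diag _ A0).
Qed.

End Rows.

Section Gauss.
Variables (R : realType) (S : surface R).
Local Notation C := R[i].
Local Notation mat := (mat ('i : C)).
Local Notation vec := (vec ('i : C)).

Lemma i_sqr : 'i * 'i = -1 :> C. Proof. by rewrite -expr2 sqr_i. Qed.
Lemma two_neq0 : 2%:R != 0 :> C. Proof. by rewrite pnatr_eq0. Qed.
Lemma sqrt_exists (x : C) : exists y, y * y = x.
Proof. by exists (sqrtc x); rewrite -expr2 sqr_sqrtc. Qed.

Lemma tactZ_fun U p v (a : C) (h : S -> C) : open U -> U p -> smooth_fun U h ->
  tact p v (fun q => a * h q) = a * tact p v h.
Proof.
move=> oU Up sh; rewrite (tactM_fun v oU Up (smooth_fun_cst a oU) sh) tact_cst mul0r add0r //.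
Qed.

Definition tact_row p (v : 'cV[C]_2) (f : S -> 'rV[C]_4) : 'rV[C]_4 := \row_b tact p v (fun q => f q 0 b).

Lemma dmap_mat U f p v : open U -> U p -> smooth_mx U f ->
  dmap (fun q => mat (f q)) p v = mat (tact_row p v f).
Proof.
move=> oU Up sf; pose s b : smooth_fun U (fun q => f q 0 b) := sf 0 b.
have e (h h' : S -> C) : (forall q, h q = h' q) -> tact p v h = tact p v h'.
  by move=> H; congr (tact p v _); apply/funext.
have x i j : dmap (fun q => mat (f q)) p v i j = mat (tact_row p v f) i j; last by apply/matrixP => i j; exact: x.
have E i' j' : dmap (fun q => mat (f q)) p v i' j' = tact p v (fun q => mat (f q) i' j') by exact: mxE.
have T b : tact_row p v f 0 b = tact p v (fun q => f q 0 b) by exact: mxE.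
apply: (etrans (E i j)); move: i j; apply: ord2_ind; apply: ord2_ind.
- apply: (etrans (e _ (fun q => f q 0 k0 + f q 0 k1) _)) => [q|]; first exact: mxE.
  apply: (etrans (tactD_fun v Up (s k0) (s k1))); apply: (etrans _ (esym (mxE _ _ _ _))).
  by rewrite /= -!T.
- apply: (etrans (e _ (fun q => f q 0 k2 + (- 'i) * f q 0 k3) _)) => [q|].
    by apply: (etrans (mxE _ _ _ _)); rewrite /= mulNr.
  apply: (etrans (tactD_fun v Up (s k2) (smooth_funM oU (smooth_fun_cst (- 'i) oU) (s k3)))).
  apply: (etrans _ (esym (mxE _ _ _ _))); rewrite /=.
  by rewrite (tactZ_fun _ _ oU Up (s k3)) -!T mulNr.
- apply: (etrans (e _ (fun q => f q 0 k2 + 'i * f q 0 k3) _)) => [q|]; first exact: mxE.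
  apply: (etrans (tactD_fun v Up (s k2) (smooth_funM oU (smooth_fun_cst 'i oU) (s k3)))).
  apply: (etrans _ (esym (mxE _ _ _ _))); rewrite /=.
  by rewrite (tactZ_fun _ _ oU Up (s k3)) -!T.
- apply: (etrans (e _ (fun q => f q 0 k0 + -1 * f q 0 k1) _)) => [q|].
    by apply: (etrans (mxE _ _ _ _)); rewrite /= mulN1r.
  apply: (etrans (tactD_fun v Up (s k0) (smooth_funM oU (smooth_fun_cst (-1) oU) (s k1)))).
  apply: (etrans _ (esym (mxE _ _ _ _))); rewrite /=.
  by rewrite (tactZ_fun _ _ oU Up (s k1)) -!T mulN1r.
Qed.

Lemma tact_row_frame p v f n : tact_row p v f = row4 0 (v o0 0) (v o1 0) 0 *m frame f n p.
Proof.
have x b : tact_row p v f 0 b = (row4 0 (v o0 0) (v o1 0) 0 *m frame f n p) 0 b; last by apply/rowP => b; exact: x.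
have [J0 J1 J2 J3] := jet_row (chart_at p) f n p b.
apply: (etrans (mxE _ _ _ _)); apply: (etrans _ (esym (row4_mul _ _ _ _ _ _))).
rewrite !mul0r add0r addr0.
apply: (etrans (tact_def _ _ _)); apply: (etrans (sum_ord2 _)).
apply: f_equal2; apply: f_equal.
  exact: (etrans (esym (mpartE _ _ _ _ _ _)) (esym J1)).
exact: (etrans (esym (mpartE _ _ _ _ _ _)) (esym J2)).
Qed.

Lemma frame_position (p : S) f n : f p = row4 1 0 0 0 *m frame f n p.
Proof.
apply/rowP => b; have [J0 J1 J2 J3] := jet_row (chart_at p) f n p b.
apply: (etrans _ (esym (row4_mul _ _ _ _ _ _))); rewrite mul1r !mul0r !addr0; exact: esym J0.
Qed.

Lemma frame_normal (p : S) f n : n p = row4 0 0 0 1 *m frame f n p.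
Proof.
apply/rowP => b; have [J0 J1 J2 J3] := jet_row (chart_at p) f n p b.
apply: (etrans _ (esym (row4_mul _ _ _ _ _ _))); rewrite mul1r !mul0r !add0r; exact: esym J3.
Qed.

End Gauss.

Section Converse.
Variables (R : realType) (S : surface R) (g Psi eta : S -> 'M[R[i]]_2).
Variable nabla : field S -> field S -> field S.
Local Notation C := R[i].
Hypothesis hg : complex_metric g.
Hypothesis hnabla : levi_civita g nabla.
Hypothesis hPsi : bundle_hom Psi.
Hypothesis hadj : self_adjoint g Psi.
Hypothesis heta : area_form g eta.
Local Notation mat := (mat ('i : C)).
Local Notation vec := (vec ('i : C)).
Local Notation solution_mx := (solution_mx g Psi nabla).
Implicit Types (f n : S -> 'rV[C]_4) (p q : S).

Lemma cfield_own p j : cfield (chart_at p) j p = delta_mx j 0.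
Proof.
apply/colP => k; rewrite !mxE eqxx andbT.
apply: (etrans (cpart_own j k (cdom_chart_at p))); by rewrite eq_sym.
Qed.

Lemma metric_own p i j : metric_coef g (chart_at p) i j p = g p i j.
Proof.
rewrite /metric_coef !cfield_own form_entries !mxE.
by move: i j; apply: ord2_ind; apply: ord2_ind; rewrite /= ?mul1r ?mulr1 ?mul0r ?addr0 ?add0r.
Qed.

Definition moving_frame f n := forall p, frame f n p *m Qmx C *m (frame f n p)^T = metric_mx g (chart_at p) p.

Definition tangent_row (v : 'cV[C]_2) : 'rV[C]_4 := row4 0 (v o0 0) (v o1 0) 0.
Local Notation position_row := (row4 1 0 0 0 : 'rV[C]_4).
Local Notation normal_row := (row4 0 0 0 1 : 'rV[C]_4).

Lemma metric_rows p v w (N := metric_mx g (chart_at p) p) :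
  [/\ (position_row *m N *m position_row^T) 0 0 = -1, (position_row *m N *m (tangent_row v)^T) 0 0 = 0 &
      (position_row *m N *m normal_row^T) 0 0 = 0] /\
  [/\ (tangent_row v *m N *m (tangent_row w)^T) 0 0 = form g p v w,
      (normal_row *m N *m (tangent_row v)^T) 0 0 = 0 & (normal_row *m N *m normal_row^T) 0 0 = 1].
Proof.
split; split; apply: (etrans (row4_gram _ _ _ _ _ _ _ _ _ _ _ _ _ _)); last 2 first.
- by move: (metric_coef _ _ _ _ _) (metric_coef _ _ _ _ _) (metric_coef _ _ _ _ _) (metric_coef _ _ _ _ _) => *; ring.
- by move: (metric_coef _ _ _ _ _) (metric_coef _ _ _ _ _) (metric_coef _ _ _ _ _) (metric_coef _ _ _ _ _) => *; ring.
- by move: (metric_coef _ _ _ _ _) (metric_coef _ _ _ _ _) (metric_coef _ _ _ _ _) (metric_coef _ _ _ _ _) => *; ring.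
- by move: (metric_coef _ _ _ _ _) (metric_coef _ _ _ _ _) (metric_coef _ _ _ _ _) (metric_coef _ _ _ _ _) => *; ring.
- by move: (metric_coef _ _ _ _ _) (metric_coef _ _ _ _ _) (metric_coef _ _ _ _ _) (metric_coef _ _ _ _ _) => *; ring.
rewrite -> !metric_own, form_entries.
move: (g p _ _) (g p _ _) (g p _ _) (g p _ _) => *; ring.
Qed.

(** The relations contained in moving_frame, for the matrices themselves
    instead of their coordinates. *)
Definition adapted (sigma nu : S -> 'M[C]_2) := forall p v w,
  [/\ qm (sigma p) (sigma p) = -1, qm (sigma p) (dmap sigma p v) = 0 & qm (sigma p) (nu p) = 0] /\
  [/\ qm (dmap sigma p v) (dmap sigma p w) = form g p v w, qm (nu p) (dmap sigma p v) = 0 & qm (nu p) (nu p) = 1].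

Lemma dmap_frame f n p v : smooth_mx setT f -> dmap (fun q => mat (f q)) p v = mat (tangent_row v *m frame f n p).
Proof.
move=> sf; apply: (etrans (dmap_mat v openT (I : setT p) sf)).
by congr mat; exact: tact_row_frame.
Qed.

Lemma moving_frame_adapted f n : smooth_mx setT f -> moving_frame f n ->
  adapted (fun q => mat (f q)) (fun q => mat (n q)).
Proof.
move=> sf mf p v w; rewrite !(dmap_frame n _ _ sf) (frame_position p f n) (frame_normal p f n).
have E x y := row4_qm x y (i_sqr R) (two_neq0 R) (mf p).
have [[a b c] [d e h]] := metric_rows p v w.
split; split; [exact: (etrans (E _ _) a)|exact: (etrans (E _ _) b)|exact: (etrans (E _ _) c)|
  exact: (etrans (E _ _) d)|exact: (etrans (E _ _) e)|exact: (etrans (E _ _) h)].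
Qed.

Lemma adapted_moving_frame f n : smooth_mx setT f -> adapted (fun q => mat (f q)) (fun q => mat (n q)) ->
  moving_frame f n.
Proof.
move=> sf ad p; set N := metric_mx g (chart_at p) p; set J := frame f n p.
pose e k : 'cV[C]_2 := delta_mx k 0.
pose r (a : 'I_4) := nth 0 [:: position_row; tangent_row (e o0); tangent_row (e o1); normal_row] a.
have rE a : r a = delta_mx 0 a.
  by apply/rowP => b; move: a b; apply: ord4_ind; apply: ord4_ind; rewrite !mxE.
have NT : N^T = N by apply: gram_mx_tr; exact: (metric_sym hg).
have QT : (Qmx C)^T = Qmx C by exact: gram_mx_tr.
apply: (matrix_of_rows rE) => a b.
have E x y : (x *m (J *m Qmx C *m J^T) *m y^T) 0 0 = qm (mat (x *m J)) (mat (y *m J)).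
  exact: esym (row4_qm x y (i_sqr R) (two_neq0 R) erefl).
apply: (etrans (E _ _)).
have A v w := ad p v w; have M v w := metric_rows p v w.
have tE v : mat (tangent_row v *m J) = dmap (fun q => mat (f q)) p v by exact/esym/dmap_frame.
have pE : mat (position_row *m J) = mat (f p) by congr mat; exact/esym/frame_position.
have nE : mat (normal_row *m J) = mat (n p) by congr mat; exact/esym/frame_normal.
have pp : qm (mat (position_row *m J)) (mat (position_row *m J)) = (position_row *m N *m position_row^T) 0 0.
  by rewrite pE; have [[x _ _] _] := A 0 0; have [[y _ _] _] := M 0 0; exact: (etrans x (esym y)).
have pt v : qm (mat (position_row *m J)) (mat (tangent_row v *m J)) = (position_row *m N *m (tangent_row v)^T) 0 0.
  by rewrite pE tE; have [[_ x _] _] := A v 0; have [[_ y _] _] := M v 0; exact: (etrans x (esym y)).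
have pn : qm (mat (position_row *m J)) (mat (normal_row *m J)) = (position_row *m N *m normal_row^T) 0 0.
  by rewrite pE nE; have [[_ _ x] _] := A 0 0; have [[_ _ y] _] := M 0 0; exact: (etrans x (esym y)).
have tt v w : qm (mat (tangent_row v *m J)) (mat (tangent_row w *m J)) = (tangent_row v *m N *m (tangent_row w)^T) 0 0.
  by rewrite !tE; have [_ [x _ _]] := A v w; have [_ [y _ _]] := M v w; exact: (etrans x (esym y)).
have nt v : qm (mat (normal_row *m J)) (mat (tangent_row v *m J)) = (normal_row *m N *m (tangent_row v)^T) 0 0.
  by rewrite tE nE; have [_ [_ x _]] := A v 0; have [_ [_ y _]] := M v 0; exact: (etrans x (esym y)).
have nn : qm (mat (normal_row *m J)) (mat (normal_row *m J)) = (normal_row *m N *m normal_row^T) 0 0.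
  by rewrite nE; have [_ [_ _ x]] := A 0 0; have [_ [_ _ y]] := M 0 0; exact: (etrans x (esym y)).
have sw x y : qm (mat (y *m J)) (mat (x *m J)) = (y *m N *m x^T) 0 0 ->
    qm (mat (x *m J)) (mat (y *m J)) = (x *m N *m y^T) 0 0.
  by move=> H; apply: (etrans (qmC _ _)); apply: (etrans H); exact: (form_symmetric _ _ NT).
move: a b; apply: ord4_ind; apply: ord4_ind; rewrite /r /=.
- exact: pp. - exact: pt. - exact: pt. - exact: pn.
- by apply: sw; exact: pt. - exact: tt. - exact: tt. - by apply: sw; exact: nt.
- by apply: sw; exact: pt. - exact: tt. - exact: tt. - by apply: sw; exact: nt.
- by apply: sw; exact: pn. - exact: nt. - exact: nt. - exact: nn.
Qed.

Lemma sl2_facts (A M N : 'M[C]_2) : \det A = 1 -> [/\ tangent_SL2 A M <-> qm A M = 0 &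
  (tangent_SL2 A M -> sl_form A M N = qm M N)].
Proof.
move=> D; split; first exact: (tangent_qm (two_neq0 R)).
by move=> T; exact: (sl_form_qm (two_neq0 R)).
Qed.

Lemma eta_form p v w : form eta p v w = (v o0 0 * w o1 0 - v o1 0 * w o0 0) * eta p o0 o1.
Proof.
have [_ alt _] := heta.
have e00 := alt p (delta_mx o0 0); have e11 := alt p (delta_mx o1 0).
have e01 := alt p (\col_i 1); rewrite !form_entries !mxE /= in e00 e11 e01.
rewrite ?mul1r ?mulr1 ?mul0r ?addr0 ?add0r in e00 e11 e01.
rewrite form_entries e00 e11.
have e10 : eta p o1 o0 = - eta p o0 o1.
  by apply/eqP; rewrite -addr_eq0 addrC; apply/eqP; rewrite -[RHS]e01 e00 e11 add0r addr0.
rewrite e10; move: (eta p o0 o1) (v _ _) (v _ _) (w _ _) (w _ _) => *; ring.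
Qed.

(** Both sides are the determinant of position, two tangent vectors and normal,
    whose coordinate rows are combinations of those of the frame. *)
Lemma omega_frame f n p v w : smooth_mx setT f -> \det (mat (f p)) = 1 ->
  omega0 (mat (f p)) (dmap (fun q => mat (f q)) p v) (dmap (fun q => mat (f q)) p w) (mat (n p)) =
  (v o0 0 * w o1 0 - v o1 0 * w o0 0) * \det (frame f n p).
Proof.
move=> sf D; have vK := matK (i_sqr R) (two_neq0 R).
apply: (etrans (omega_det (i_sqr R) (two_neq0 R) _ _ _ D)).
rewrite (dmap_frame n p v sf) (dmap_frame n p w sf) !vK {1}(frame_position p f n) (frame_normal p f n).
rewrite rows4_mul det_mulmx; congr (_ * _); exact: gram_det_mul.
Qed.

Lemma tact_solution W (f n : S -> C) p v : open W -> solution g Psi nabla W f n -> W p ->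
  tact p v n = - tact p (Psi p *m v) f.
Proof.
move=> oW sol Wp; have Ac := atlas_chart_at p; have cp := cdom_chart_at p.
have [sf sn _] := sol; have [_ H] := solution_chart oW sol Ac Wp cp.
rewrite (tactE2 v Ac cp oW Wp sn) (tactE2 (Psi p *m v) Ac cp oW Wp sf).
rewrite -> (H o0), (H o1), (shape_expand Psi o0 v Ac cp), (shape_expand Psi o1 v Ac cp).
move: (tact _ _ _) (tact _ _ _) (shape_coef _ _ _ _ _) (shape_coef _ _ _ _ _) (shape_coef _ _ _ _ _)
 (shape_coef _ _ _ _ _) (cpart _ _ _ _) (cpart _ _ _ _) => *; ring.
Qed.

Lemma mat_smooth f : smooth_mx setT f -> smooth_map (fun q => mat (f q)).
Proof.
move=> sf; pose s b : smooth_fun setT (fun q => f q 0 b) := sf 0 b.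
have oT : open [set: S] := openT.
have e (h h' : S -> C) : (forall q, h q = h' q) -> smooth_fun setT h' -> smooth_fun setT h.
  by move=> H sh; apply: smooth_fun_eq sh.
apply: ord2_ind; apply: ord2_ind.
- by apply: (e _ (fun q => f q 0 k0 + f q 0 k1)) => [q|]; [exact: mxE|exact: smooth_funD].
- apply: (e _ (fun q => f q 0 k2 + - ('i * f q 0 k3))) => [q|]; first exact: mxE.
  by apply: smooth_funD => //; apply: smooth_funN => //; apply: smooth_funM => //; exact: smooth_fun_cst.
- apply: (e _ (fun q => f q 0 k2 + 'i * f q 0 k3)) => [q|]; first exact: mxE.
  by apply: smooth_funD => //; apply: smooth_funM => //; exact: smooth_fun_cst.
- apply: (e _ (fun q => f q 0 k0 + - f q 0 k1)) => [q|]; first exact: mxE.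
  by apply: smooth_funD => //; exact: smooth_funN.
Qed.

Lemma map_real_inj (v : 'cV[R]_2) : map_mx (real_complex R) v = 0 -> v = 0.
Proof.
move/colP => H; apply/colP => i; have := H i; rewrite !mxE => /eqP.
by rewrite -(rmorph0 (real_complex R)) => /eqP /complexI.
Qed.

(** The Gram matrix says that the determinant is 1, that the immersion is
    isometric and that n is a unit normal; the Weingarten equation identifies
    the shape operator, and the determinant of the frame the side of the
    normal. *)
Theorem immersion_of_solution f n : solution_mx setT f n -> moving_frame f n ->
  (forall p, \det (frame f n p) = eta p o0 o1) ->
  isometric_immersion g (fun p => mat (f p)) /\ shape_operator g eta (fun p => mat (f p)) Psi.
Proof.
move=> sol mf or; have [sf sn] := solution_smooth sol; have ad := moving_frame_adapted sf mf.
have D p : \det (mat (f p)) = 1.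
  have [[x _ _] _] := ad p 0 0; apply: oppr_inj; rewrite -x.
  exact/esym/(qm_det (two_neq0 R)).
have tg p v : tangent_SL2 (mat (f p)) (dmap (fun q => mat (f q)) p v).
  by have [T _] := sl2_facts (dmap (fun q => mat (f q)) p v) 0 (D p); apply/T; have [[_ x _] _] := ad p v 0.
have tn p : tangent_SL2 (mat (f p)) (mat (n p)).
  by have [T _] := sl2_facts (mat (n p)) 0 (D p); apply/T; have [[_ _ x] _] := ad p 0 0.
have isom p v w : sl_form (mat (f p)) (dmap (fun q => mat (f q)) p v) (dmap (fun q => mat (f q)) p w) = form g p v w.
  have [_ E] := sl2_facts (dmap (fun q => mat (f q)) p v) (dmap (fun q => mat (f q)) p w) (D p).
  by rewrite (E (tg p v)); have [_ [x _ _]] := ad p v w.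
split.
  split=> //; split=> [||p v dv]; [exact: mat_smooth|exact: D|].
  apply: map_real_inj; have [_ _ nd] := hg; apply: (nd p) => w; rewrite -isom dv.
  by rewrite /sl_form mulmx0 mul0mx mxtrace0 mulr0.
exists (fun p => mat (n p)); split; last first.
  move=> p v; have -> : - dmap (fun q => mat (f q)) p (Psi p *m v) = mat (- tact_row p (Psi p *m v) f).
    rewrite (dmap_mat _ openT (I : setT p) sf) -scaleN1r -[in RHS]scaleN1r; exact/esym/matZ.
  apply: (etrans (dmap_mat v openT (I : setT p) sn)); congr mat.
  apply/rowP => b; apply: (etrans (mxE _ _ _ _)).
  apply: (etrans (tact_solution v openT (sol b) (I : setT p))); rewrite !mxE //.
split.
  split=> [|//|p|p v]; first exact: mat_smooth.
    have [_ E] := sl2_facts (mat (n p)) (mat (n p)) (D p); rewrite (E (tn p)).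
    by have [_ [_ _ x]] := ad p 0 0.
  have [_ E] := sl2_facts (mat (n p)) (dmap (fun q => mat (f q)) p v) (D p); rewrite (E (tn p)).
  by have [_ [_ x _]] := ad p v 0.
move=> p v w _ evw; rewrite (omega_frame n v w sf (D p)) or -eta_form //.
Qed.

Lemma vec_smooth (M : S -> 'M[C]_2) : smooth_map M -> smooth_mx setT (fun q => vec (M q)).
Proof.
move=> sM a; rewrite (ord1 a); have oT : open [set: S] := openT.
have e (h h' : S -> C) : (forall q, h q = h' q) -> smooth_fun setT h' -> smooth_fun setT h.
  by move=> H sh; apply: smooth_fun_eq sh.
have h (u v : S -> C) (x y : C) : smooth_fun setT u -> smooth_fun setT v ->
    smooth_fun setT (fun q => x * u q + y * v q).
  by move=> su sv; apply: smooth_funD => //; apply: smooth_funM => //; exact: smooth_fun_cst.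
apply: ord4_ind.
- apply: (e _ _ _ (h _ _ (2%:R^-1) (2%:R^-1) (sM o0 o0) (sM o1 o1))) => q; apply: (etrans (mxE _ _ _ _)) => /=.
  by move: (M q o0 o0) (M q o1 o1) => x y; ring.
- apply: (e _ _ _ (h _ _ (2%:R^-1) (- 2%:R^-1) (sM o0 o0) (sM o1 o1))) => q; apply: (etrans (mxE _ _ _ _)) => /=.
  by move: (M q o0 o0) (M q o1 o1) => x y; ring.
- apply: (e _ _ _ (h _ _ (2%:R^-1) (2%:R^-1) (sM o0 o1) (sM o1 o0))) => q; apply: (etrans (mxE _ _ _ _)) => /=.
  by move: (M q o0 o1) (M q o1 o0) => x y; ring.
- apply: (e _ _ _ (h _ _ ('i / 2%:R) (- ('i / 2%:R)) (sM o0 o1) (sM o1 o0))) => q; apply: (etrans (mxE _ _ _ _)) => /=.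
  by move: ('i : C) (M q o0 o1) (M q o1 o0) => z x y; ring.
Qed.

Lemma gram_factor p : exists T : 'M[C]_2, g p = T *m T^T /\ T \in unitmx.
Proof.
have Ac := atlas_chart_at p; have cp := cdom_chart_at p.
have sym : g p o0 o1 = g p o1 o0 by rewrite -!metric_own; exact: (metric_sym hg).
have D0 : \det (g p) != 0.
  have := gram_det_neq0 hg Ac cp; rewrite /gram_det; rewrite -> !metric_own.
  by rewrite det2 -sym expr2.
have [T GT] := symmetric_factor (i_sqr R) (two_neq0 R) (@sqrt_exists R) sym D0; exists T; split=> //.
by move: D0; rewrite GT det_mulmx mulf_eq0 negb_or unitmxE unitfE => /andP[].
Qed.

(** The rows of the inverse of a factor T of g = T T^T, exchanged if the sign
    of eta requires it. *)
Lemma oriented_basis p : exists v w, orthonormal g p v w /\ form eta p v w = 1.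
Proof.
have [T [GT uT]] := gram_factor p; pose M := invmx T.
have MG : M *m g p *m M^T = 1%:M.
  by rewrite GT /M trmx_inv !mulmxA mulVmx // mul1mx mulmxV // unitmx_tr.
pose v k : 'cV[C]_2 := (row k M)^T.
have vE k l : form g p (v k) (v l) = (k == l)%:R.
  by rewrite form_mx /v trmxK rows_form MG mxE.
have ov : orthonormal g p (v o0) (v o1) by split; rewrite vE.
have ow : orthonormal g p (v o1) (v o0) by split; rewrite vE.
have [_ _ pm] := heta; have [e|e] := pm p _ _ ov; first by exists (v o0), (v o1).
exists (v o1), (v o0); split=> //; apply: oppr_inj; rewrite -e !eta_form.
move: (eta p o0 o1) (v o0 o0 0) (v o0 o1 0) (v o1 o0 0) (v o1 o1 0) => *; ring.
Qed.

(** Evaluated on an oriented orthonormal basis, both sides become the inverse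
    of the square of its determinant. *)
Lemma eta_sqr p : eta p o0 o1 ^+ 2 = \det (g p).
Proof.
have [v [w [[vv ww vw] e]]] := oriented_basis p.
have sym : g p o1 o0 = g p o0 o1 by rewrite -!metric_own; exact: (metric_sym hg).
have wv : form g p w v = 0 by have [_ sg _] := hg; rewrite sg.
rewrite eta_form in e; rewrite !form_entries sym in vv ww vw wv; rewrite det2 sym.
have d : (v o0 0 * w o1 0 - v o1 0 * w o0 0) ^+ 2 * (g p o0 o0 * g p o1 o1 - g p o0 o1 * g p o0 o1) = 1.
  rewrite -[RHS]mulr1 -{1}vv -{1}ww -[LHS]addr0 -(mulr0 0) -{1}vw -{1}wv.
  move: (g p o0 o0) (g p o0 o1) (g p o1 o1) (v o0 0) (v o1 0) (w o0 0) (w o1 0) => *; ring.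
have n0 : v o0 0 * w o1 0 - v o1 0 * w o0 0 != 0.
  by apply/eqP => z; move: e; rewrite z mul0r => /eqP; rewrite eq_sym oner_eq0.
have n2 : (v o0 0 * w o1 0 - v o1 0 * w o0 0) ^+ 2 != 0 by rewrite expf_neq0.
by apply: (mulfI n2); rewrite d -exprMn e expr1n.
Qed.

(** Take determinants in the Gram relation. *)
Lemma frame_det_sqr f n p : moving_frame f n -> \det (frame f n p) ^+ 2 = \det (g p).
Proof.
move=> mf; have sym : g p o1 o0 = g p o0 o1 by rewrite -!metric_own; exact: (metric_sym hg).
have := congr1 determinant (mf p); rewrite !det_mulmx det_tr /Qmx /metric_mx !gram_det_metric.
rewrite -> !metric_own; rewrite det2 mulr1 mulr0 subr0 => H.
apply: oppr_inj; rewrite -[RHS]H; move: (\det (frame f n p)) => x; ring.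
Qed.

Lemma frame_unit_moving f n p : moving_frame f n -> frame f n p \in unitmx.
Proof.
move=> mf; have [T [GT uT]] := gram_factor p.
have D0 : \det (frame f n p) ^+ 2 != 0.
  by rewrite frame_det_sqr // GT det_mulmx det_tr mulf_neq0 // -unitfE -unitmxE.
by rewrite unitmxE unitfE; apply: contra_neq D0 => ->; rewrite expr0n.
Qed.

(** Differentiation of det f = 1. *)
Lemma position_tangent f p v : smooth_mx setT f -> (forall q, \det (mat (f q)) = 1) ->
  qm (mat (f p)) (dmap (fun q => mat (f q)) p v) = 0.
Proof.
move=> sf D; have oT : open [set: S] := openT; pose c := chart_at p.
have Ac : atlas c := atlas_chart_at p; have cp : cdom c p := cdom_chart_at p.
have QT : (Qmx C)^T = Qmx C by exact: gram_mx_tr.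
have sQ : smooth_mx setT (fun _ : S => Qmx C) by move=> a b; exact: smooth_fun_cst.
have sft := smooth_mx_tr oT sf; have sfQ := smooth_mxM oT sf sQ.
have H : (fun q => f q *m Qmx C *m (f q)^T) = fun=> (- 1%:M : 'M[C]_1).
  apply/funext => q; apply/matrixP => a b; rewrite !ord1 [RHS]mxE [in RHS]mxE /= mulr1n.
  by rewrite -(qm_mat (i_sqr R) (two_neq0 R)) qm_det ?D ?two_neq0.
have Z i : (f p *m Qmx C *m (mpart c i f p)^T) 0 0 = 0.
  have := mpartM i oT Ac (I : setT p) cp sfQ sft.
  rewrite H mpart_cst (mpartM i oT Ac (I : setT p) cp sf sQ) mpart_cst mulmx0 addr0.
  rewrite (mpart_tr c i f p) => /matrixP/(_ 0 0).
  rewrite mxE [RHS]mxE (form_symmetric _ _ QT) -mulr2n => /esym/eqP.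
  by rewrite mulrn_eq0 /= => /eqP.
have E : tact_row p v f = v o0 0 *: mpart c o0 f p + v o1 0 *: mpart c o1 f p.
  apply/rowP => b; apply: (etrans (mxE _ _ _ _)); apply: (etrans (tact_def _ _ _)).
  apply: (etrans (sum_ord2 _)); apply: (etrans _ (esym (mxE _ _ _ _))).
  apply: f_equal2; apply: (etrans _ (esym (mxE _ _ _ _))); apply: f_equal; exact/esym/mpartE.
rewrite (dmap_mat v oT (I : setT p) sf) (qm_mat (i_sqr R) (two_neq0 R)) E.
apply: (etrans (form_linear _ _ _ _ _ _)).
have X (a b x y : C) : x = 0 -> y = 0 -> a * x + b * y = 0 by move=> -> ->; rewrite !mulr0 addr0.
exact: (X _ _ _ _ (Z o0) (Z o1)).
Qed.

Lemma adapted_of_immersion f n : smooth_mx setT f ->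
  isometric_immersion g (fun p => mat (f p)) -> normal_field (fun p => mat (f p)) (fun p => mat (n p)) ->
  adapted (fun p => mat (f p)) (fun p => mat (n p)).
Proof.
move=> sf [[_ D _] iso] [_ tn nn nd] p v w.
have pt u := position_tangent p u sf D.
have tg u : tangent_SL2 (mat (f p)) (dmap (fun q => mat (f q)) p u).
  by have [T _] := sl2_facts (dmap (fun q => mat (f q)) p u) 0 (D p); apply/T; exact: pt.
have sl M N : tangent_SL2 (mat (f p)) M -> sl_form (mat (f p)) M N = qm M N.
  by move=> T; have [_] := sl2_facts M N (D p); exact.
split; split.
- by rewrite qm_det ?D ?two_neq0.
- exact: pt.
- by have [T _] := sl2_facts (mat (n p)) 0 (D p); apply/T; exact: tn.
- by rewrite -sl.
- by rewrite -sl.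
- by rewrite -sl.
Qed.

Lemma jet_gram c f n p : smooth_mx setT f -> moving_frame f n -> atlas c -> cdom c p ->
  jet c f n p *m Qmx C *m (jet c f n p)^T = metric_mx g c p.
Proof.
move=> sf mf Ac cp; have := mf p.
rewrite (frame_jet n Ac openT (I : setT p) sf cp) (metric_change g Ac (atlas_chart_at p) cp (cdom_chart_at p)).
have uT := change_mx_unit Ac (atlas_chart_at p) cp (cdom_chart_at p).
exact: (congr_cancel uT).
Qed.

Lemma jet_unit c f n p : smooth_mx setT f -> moving_frame f n -> atlas c -> cdom c p -> jet c f n p \in unitmx.
Proof.
move=> sf mf Ac cp; rewrite -(frame_unit n Ac openT (I : setT p) sf cp); exact: frame_unit_moving.
Qed.

Lemma shape_rows f n p v : smooth_mx setT f -> smooth_mx setT n ->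
  dmap (fun q => mat (n q)) p v = - dmap (fun q => mat (f q)) p (Psi p *m v) ->
  forall b, tact p v (fun q => n q 0 b) = - tact p (Psi p *m v) (fun q => f q 0 b).
Proof.
move=> sf sn; rewrite (dmap_mat v openT (I : setT p) sn) (dmap_mat _ openT (I : setT p) sf).
rewrite -scaleN1r -matZ => H b.
have : tact_row p v n = -1 *: tact_row p (Psi p *m v) f.
  by rewrite -[LHS](matK (i_sqr R) (two_neq0 R)) -[RHS](matK (i_sqr R) (two_neq0 R)) H.
move/rowP/(_ b); rewrite [RHS]mxE mulN1r [RHS](f_equal -%R (mxE _ _ _ _)) => <-; exact/esym/mxE.
Qed.

(** The Gauss formula for the immersion. The defects of the jet in the two
    directions, multiplied by Q J^T, are antisymmetric because the Gram matrix
    is parallel. Their first rows vanish by the definition of the jet, their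
    last rows by that of the shape operator, and by the symmetry of second
    derivatives and of the coefficients the third row of the first is the
    second row of the second. *)
Lemma jet_equation c f n i p : smooth_mx setT f -> smooth_mx setT n -> moving_frame f n ->
  (forall p v, dmap (fun q => mat (n q)) p v = - dmap (fun q => mat (f q)) p (Psi p *m v)) ->
  atlas c -> cdom c p -> mpart c i (jet c f n) p = connection_mx g Psi nabla c i p *m jet c f n p.
Proof.
move=> sf sn mf sh Ac cp; have oT : open [set: S] := openT; have oc := @cdom_open _ _ c.
have sJ : smooth_mx (cdom c) (jet c f n).
  by move=> a b; have := jet_smooth oT Ac sf sn a b; rewrite setTI.
have sQ : smooth_mx (cdom c) (fun _ : S => Qmx C) by move=> a b; exact: smooth_fun_cst.
have sJQ := smooth_mxM oc sJ sQ; have sJt := smooth_mx_tr oc sJ.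
pose D k := mpart c k (jet c f n) p - connection_mx g Psi nabla c k p *m jet c f n p.
pose P k := D k *m (Qmx C *m (jet c f n p)^T).
have JQJ := jet_gram sf mf Ac.
have anti k : P k + (P k)^T = 0.
  have : mpart c k (fun q => jet c f n q *m Qmx C *m (jet c f n q)^T) p = mpart c k (metric_mx g c) p.
    by apply: mpart_near => //; apply: filterS (dom_near cp) => q cq; exact: JQJ.
  rewrite (mpartM k oc Ac cp cp sJQ sJt) (mpartM k oc Ac cp cp sJ sQ) mpart_cst mulmx0 addr0.
  rewrite (mpart_tr c k (jet c f n)) (mpart_metric Psi hg hnabla Ac k cp).
  exact: (defect_antisymmetric (gram_mx_tr _ _ _ _ (erefl _)) (JQJ p cp)).
have [J0 J1 J2 J3] : [/\ forall b, jet c f n p k0 b = f p 0 b, forall b, jet c f n p k1 b = mpart c o0 f p 0 b,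
  forall b, jet c f n p k2 b = mpart c o1 f p 0 b & forall b, jet c f n p k3 b = n p 0 b].
  by split=> b; have [] := jet_row c f n p b.
have B k b := structure_mul (k == o0)%:R (k == o1)%:R (metric_coef g c k o0 p) (metric_coef g c k o1 p)
  (second_coef g Psi c k o0 p) (second_coef g Psi c k o1 p)
  (christoffel nabla c k o0 o0 p) (christoffel nabla c k o0 o1 p) (christoffel nabla c k o1 o0 p)
  (christoffel nabla c k o1 o1 p) (shape_coef Psi c k o0 p) (shape_coef Psi c k o1 p) (jet c f n p) b.
have dJ k a b (h : S -> C) : (forall q, jet c f n q a b = h q) -> mpart c k (jet c f n) p a b = cpart c k h p.
  by move=> E; apply: (etrans (mpartE _ _ _ _ _ _)); congr (cpart c k _ p); apply/funext.
have DE k a b : D k a b = mpart c k (jet c f n) p a b - (connection_mx g Psi nabla c k p *m jet c f n p) a b.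
  by apply: (etrans (mxE _ _ _ _)); apply: f_equal; exact: mxE.
have sub0 (x y : C) : x = y -> x - y = 0 by move=> ->; rewrite subrr.
have fb b : smooth_fun setT (fun q => f q 0 b) := sf 0 b.
have nb b : smooth_fun setT (fun q => n q 0 b) := sn 0 b.
have F k b : mpart c k f p 0 b = cpart c k (fun q => f q 0 b) p by exact: mpartE.
have D0 k b : D k k0 b = 0.
  have [E0 _ _ _] := B k b; apply: (etrans (DE k k0 b)); apply: sub0.
  apply: (etrans (dJ k k0 b (fun q => f q 0 b) _)) => [q|]; first by have [] := jet_row c f n q b.
  apply: (etrans _ (esym E0)); rewrite J1 J2; apply: (etrans (esym (F k b))); clear; move: k; apply: ord2_ind.
    by have [-> ->] : (o0 == o0)%:R = 1 :> C /\ (o0 == o1)%:R = 0 :> C by []; rewrite mul1r mul0r addr0.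
  by have [-> ->] : (o1 == o0)%:R = 0 :> C /\ (o1 == o1)%:R = 1 :> C by []; rewrite mul1r mul0r add0r.
have D3 k b : D k k3 b = 0.
  have [_ _ _ E3] := B k b; apply: (etrans (DE k k3 b)); apply: sub0.
  apply: (etrans (dJ k k3 b (fun q => n q 0 b) _)) => [q|]; first by have [] := jet_row c f n q b.
  apply: (etrans _ (esym E3)); rewrite J1 J2; apply: (etrans (esym (tact_cfield k Ac cp oT (I : setT p) (nb b)))).
  apply: (etrans (shape_rows sf sn (sh p _) b)); apply: f_equal.
  apply: (etrans (tactE2 _ Ac cp oT (I : setT p) (fb b))).
  by apply: f_equal2; apply: f_equal; exact/esym/F.
have D2 b : D o0 k2 b = D o1 k1 b.
  have [_ _ E2 _] := B o0 b; have [_ E1 _ _] := B o1 b.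
  apply: (etrans (DE o0 k2 b)); apply: (etrans _ (esym (DE o1 k1 b))); apply: f_equal2.
    apply: (etrans (dJ o0 k2 b (fun q => mpart c o1 f q 0 b) _)) => [q|]; first by have [] := jet_row c f n q b.
    apply: (etrans _ (esym (dJ o1 k1 b (fun q => mpart c o0 f q 0 b) _))) => [|q]; last by have [] := jet_row c f n q b.
    have X k : (fun q => mpart c k f q 0 b) = cpart c k (fun q => f q 0 b) by apply/funext => q; exact: mpartE.
    rewrite -> (X o0), (X o1); exact: (cpart_cpart o0 o1 Ac cp oT (I : setT p) (fb b)).
  apply: f_equal; apply: (etrans E2); apply: (etrans _ (esym E1)).
  rewrite -> (christoffel_sym hnabla Ac o0 o1 o0 cp), (christoffel_sym hnabla Ac o0 o1 o1 cp).
  apply: f_equal; apply: f_equal2; apply: (f_equal (fun t => t * _)).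
    exact: (second_sym hg hadj c o0 o1 p).
  exact: (metric_sym hg c o0 o1 p).
have rowP k a : (forall b, D k a b = 0) -> forall b, P k a b = 0.
  move=> z b; apply: (etrans (mxE _ _ _ _)); apply: big1 => l _.
  by apply: (etrans (f_equal (fun t => t * _) (z l))); exact: mul0r.
have [P0 P1] : P o0 = 0 /\ P o1 = 0.
  apply: antisymmetric_pair_0; try exact: anti; try (by apply: rowP => b; exact: D0);
    try (by apply: rowP => b; exact: D3).
  move=> b; apply: (etrans (mxE _ _ _ _)); apply: (etrans _ (esym (mxE _ _ _ _))); apply: eq_bigr => l _.
  by apply: (f_equal (fun t => t * _)); exact: D2.
have PZ : P i = 0 by move: i; apply: ord2_ind.
have uJ := jet_unit sf mf Ac cp.
have uQJ : Qmx C *m (jet c f n p)^T \in unitmx.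
  by rewrite unitmx_mul unitmx_tr uJ andbT; apply: gram_mx_unit => //; rewrite mulr1 expr0n subr0 oner_eq0.
have DZ : D i = 0 by rewrite -[LHS](mulmxK uQJ) -/(P i) PZ mul0mx.
by apply/eqP; rewrite -subr_eq0; apply/eqP.
Qed.

(** The jets of an immersion are invertible solutions of the linear system,
    which is therefore flat. *)
Theorem solution_of_immersion (sigma : S -> 'M[C]_2) :
  isometric_immersion g sigma -> shape_operator g eta sigma Psi ->
  exists f n, [/\ solution_mx setT f n, moving_frame f n, integrable g Psi nabla,
    forall p, \det (frame f n p) = eta p o0 o1 & forall p, sigma p = mat (f p)].
Proof.
move=> iso [nu [[nor or] sh]].
have vk := vecK (i_sqr R) (two_neq0 R).
pose f q := vec (sigma q); pose n q := vec (nu q).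
have sE : sigma = fun q => mat (f q) by apply/funext => q; rewrite /f vk.
have nE : nu = fun q => mat (n q) by apply/funext => q; rewrite /n vk.
have sf : smooth_mx setT f by apply: vec_smooth; have [[]] := iso.
have sn : smooth_mx setT n by apply: vec_smooth; have [] := nor.
clearbody f n; subst sigma nu.
have ad := adapted_of_immersion sf iso nor; have mf := adapted_moving_frame sf ad.
have JE c i p : atlas c -> cdom c p -> mpart c i (jet c f n) p = connection_mx g Psi nabla c i p *m jet c f n p.
  exact: jet_equation.
have oT : open [set: S] := openT.
have sJ c : atlas c -> smooth_mx (cdom c) (jet c f n).
  by move=> Ac a b; have := jet_smooth oT Ac sf sn a b; rewrite setTI.
exists f, n; split=> //.
- apply: solution_near => p; exists (cdom (chart_at p)); first exact: cdom_open.
  split; first exact: cdom_chart_at.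
  have Ac := atlas_chart_at p.
  have x0 q b : cdom (chart_at p) q -> f q 0 b = jet (chart_at p) f n q k0 b.
    by move=> _; have [e _ _ _] := jet_row (chart_at p) f n q b; exact: esym e.
  have x3 q b : cdom (chart_at p) q -> n q 0 b = jet (chart_at p) f n q k3 b.
    by move=> _; have [_ _ _ e] := jet_row (chart_at p) f n q b; exact: esym e.
  by have [sol _] := solution_of_mx hnabla (@cdom_open _ _ (chart_at p)) Ac (fun q => id) (sJ _ Ac)
    (fun i q cq => JE _ i q Ac cq) x0 x3.
- move=> c p Ac cp; have oc := @cdom_open _ _ c.
  have sB i : smooth_mx (cdom c) (connection_mx g Psi nabla c i) := connection_mx_smooth hg hnabla hPsi Ac i.
  have second i j : mpart c i (mpart c j (jet c f n)) p = mpart c i (connection_mx g Psi nabla c j) p *m jet c f n p +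
      connection_mx g Psi nabla c j p *m (connection_mx g Psi nabla c i p *m jet c f n p).
    have near_eq : \near p, mpart c j (jet c f n) p = connection_mx g Psi nabla c j p *m jet c f n p.
      by apply: filterS (dom_near cp) => q cq; exact: JE.
    apply: (etrans (mpart_near i cp near_eq)); apply: (etrans (mpartM i oc Ac cp cp (sB j) (sJ c Ac))).
    by apply: f_equal; apply: f_equal; exact: JE.
  apply: (flat_of_frame (jet_unit sf mf Ac cp)).
  apply: (etrans (esym (second o0 o1))); apply: (etrans _ (second o1 o0)).
  exact: (mpart_schwarz o0 o1 oc Ac cp cp (sJ c Ac)).
move=> p; have [v [w [ov e]]] := oriented_basis p.
have D : \det (mat (f p)) = 1 by have [[_ D _] _] := iso; exact: D.
have := or p v w ov e; rewrite (omega_frame n v w sf D); move: e; rewrite eta_form => e o.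
have n0 : v o0 0 * w o1 0 - v o1 0 * w o0 0 != 0.
  by apply/eqP => z; move: e; rewrite z mul0r => /eqP; rewrite eq_sym oner_eq0.
by apply: (mulfI n0); rewrite e.
Qed.

End Converse.

(** * Orientation, existence and uniqueness *)

Lemma gram_inverse (F : fieldType) m (J Q N : 'M[F]_m) : J \in unitmx ->
  invmx J *m N *m (invmx J)^T = Q <-> J *m Q *m J^T = N.
Proof.
move=> uJ; have uJt : J^T \in unitmx by rewrite unitmx_tr.
rewrite trmx_inv; split=> <-; first by rewrite !mulmxA (mulmxV uJ) mul1mx (mulmxKV uJt).
by rewrite !mulmxA (mulVmx uJ) mul1mx (mulmxK uJt).
Qed.

Lemma smooth_neq0_near (R : realType) (S : surface R) (U : set S) (h : S -> R[i]) p :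
  open U -> U p -> smooth_fun U h -> h p != 0 -> \forall q \near p, h q != 0.
Proof.
move=> oU Up sh h0; set c := chart_at p; have Ac : atlas c := atlas_chart_at p.
have cp : cdom c p := cdom_chart_at p.
have [sr si] := sh c Ac; have Dx := chart_img_mem Up cp.
have cr := differentiable_continuous (sr [::] _ Dx).
have ci := differentiable_continuous (si [::] _ Dx).
have near_p (P : R[i] -> Prop) : (\forall x \near cmap c p, P (h (cinv c x))) -> \forall q \near p, P (h q).
  move=> H; have N : nbhs p (cmap c @^-1` [set x | P (h (cinv c x))]) by apply: (cmap_cont cp); exact: H.
  by apply: filterS2 N (dom_near cp) => q /= Pq cq; rewrite cmapK in Pq.
apply: (near_p (fun z => z != 0)); move: h0 => /eqP h0.
have [r0|r0] := eqVneq (complex.Re (h p)) 0; last first.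
  have : \forall x \near cmap c p, complex.Re (h (cinv c x)) != 0.
    by apply: (cvgr_neq0 _ cr); rewrite /= cmapK.
  by apply: filterS => x; apply: contra_neq => ->.
have i0 : complex.Im (h p) != 0.
  apply/eqP => i0; apply: h0; move: r0 i0; case: (h p) => a b /= -> -> //.
have : \forall x \near cmap c p, complex.Im (h (cinv c x)) != 0.
  by apply: (cvgr_neq0 _ ci); rewrite /= cmapK.
by apply: filterS => x; apply: contra_neq => ->.
Qed.

Section Orientation.
Variables (R : realType) (S : surface R) (g Psi eta : S -> 'M[R[i]]_2).
Variable nabla : field S -> field S -> field S.
Local Notation C := R[i].
Hypothesis hg : complex_metric g.
Hypothesis hnabla : levi_civita g nabla.
Hypothesis hPsi : bundle_hom Psi.
Hypothesis hadj : self_adjoint g Psi.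
Hypothesis heta : area_form g eta.
Local Notation mat := (mat ('i : C)).
Local Notation vec := (vec ('i : C)).
Local Notation solution_mx := (solution_mx g Psi nabla).
Implicit Types (f n : S -> 'rV[C]_4) (p q : S).

(** The determinant of the frame is eta up to sign, since both have square det
    g. In a chart both are smooth and non-zero, so their sum or their
    difference stays non-zero near p and the sign cannot change. *)
Lemma orientation_near f n p : smooth_mx setT f -> smooth_mx setT n -> moving_frame g f n ->
  \forall q \near p, (\det (frame f n q) == eta q o0 o1) = (\det (frame f n p) == eta p o0 o1).
Proof.
move=> sf sn mf; set c := chart_at p; have Ac : atlas c := atlas_chart_at p.
have cp : cdom c p := cdom_chart_at p; have oc := @cdom_open _ _ c; have oT : open [set: S] := openT.
pose A q := \det (jet c f n q); pose B q := form eta q (cfield c o0 q) (cfield c o1 q).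
have sA : smooth_fun (cdom c) A.
  have sJ : smooth_mx (cdom c) (jet c f n).
    by move=> a b; have := jet_smooth oT Ac sf sn a b; rewrite setTI.
  by apply/smooth_funP => d Ad; exact: (smoothC_det (chart_img_open (c := d) oc) (smooth_mx_chart Ad sJ)).
have sB : smooth_fun (cdom c) B.
  by have [se _ _] := heta; exact: (se _ _ _ oc (cfield_smooth o0 Ac) (cfield_smooth o1 Ac)).
have AB q : cdom c q -> exists2 t : C, t != 0 & A q = t * \det (frame f n q) /\ B q = t * eta q o0 o1.
  move=> cq; pose d := chart_at q; have Ad : atlas d := atlas_chart_at q; have dq : cdom d q := cdom_chart_at q.
  exists (\det (change_mx c d q)).
    by have := change_mx_unit Ad Ac dq cq; rewrite unitmxE unitfE.
  split; first by rewrite /A (jet_change n Ad Ac oT (I : setT q) sf dq cq) det_mulmx.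
  rewrite /B (eta_form heta); congr (_ * _); apply: (etrans _ (esym (gram_det_mul _ _ _ _))).
  have E j k : cfield c j q k 0 = cpart c j (coord d k) q by exact: mxE.
  by rewrite !E; move: (cpart _ _ _ _) (cpart _ _ _ _) (cpart _ _ _ _) (cpart _ _ _ _) => *; ring.
have eqAB q : cdom c q -> (\det (frame f n q) == eta q o0 o1) = (A q == B q).
  move=> cq; have [t t0 [-> ->]] := AB q cq.
  by rewrite (inj_eq (mulfI t0)).
have sq q : cdom c q -> A q ^+ 2 = B q ^+ 2 /\ B q != 0.
  move=> cq; have [t t0 [-> ->]] := AB q cq.
  rewrite !exprMn (frame_det_sqr hg q mf) (eta_sqr hg heta); split=> //.
  rewrite mulf_neq0 //; apply/eqP => e0; have := frame_unit_moving hg q mf.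
  rewrite unitmxE unitfE -sqrf_eq0 (frame_det_sqr hg q mf) -(eta_sqr hg heta) e0.
  by rewrite expr0n eqxx.
have pm q : cdom c q -> A q = B q \/ A q = - B q.
  by move=> cq; have [/eqP] := sq q cq; rewrite eqf_sqr => /orP[/eqP ? _|/eqP ? _]; [left|right].
have [_ B0] := sq p cp.
have [e|e] := pm p cp.
  have N : \forall q \near p, A q + B q != 0.
    apply: (smooth_neq0_near oc cp); first exact: smooth_funD.
    by rewrite e -mulr2n mulrn_eq0.
  apply: filterS2 N (dom_near cp) => q AB0 cq; rewrite (eqAB q cq) (eqAB p cp) e eqxx.
  have [->|eq] := pm q cq; first by rewrite eqxx.
  by move: AB0; rewrite eq addNr eqxx.
have N : \forall q \near p, A q + - B q != 0.
  apply: (smooth_neq0_near oc cp); first by apply: smooth_funD => //; exact: smooth_funN.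
  by rewrite e -opprD oppr_eq0 -mulr2n mulrn_eq0.
apply: filterS2 N (dom_near cp) => q AB0 cq; rewrite (eqAB q cq) (eqAB p cp) e.
have -> : (A q == B q) = false by apply/negP => /eqP eq; move: AB0; rewrite eq subrr eqxx.
by rewrite eq_sym -addr_eq0 -mulr2n mulrn_eq0 /= (negPf B0).
Qed.

Lemma orientation_const f n p0 : smooth_mx setT f -> smooth_mx setT n -> moving_frame g f n ->
  \det (frame f n p0) = eta p0 o0 o1 -> forall p, \det (frame f n p) = eta p o0 o1.
Proof.
move=> sf sn mf e0 p; apply/eqP.
rewrite -(locally_constant (A := setT) (F := fun q => \det (frame f n q) == eta q o0 o1) _ _ (I : setT p0) I).
- by rewrite e0.
- exact: surface_connected.
- by move=> x _; exact: orientation_near.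
Qed.

(** A factor of g is a tangent block with the required Gram matrix; composition
    with a reflection corrects the sign of its determinant. *)
Lemma initial_frame p : exists2 J : 'M[C]_4, J *m Qmx C *m J^T = metric_mx g (chart_at p) p & \det J = eta p o0 o1.
Proof.
have [T0 [GT0 _]] := gram_factor hg p.
have [T GT DT] : exists2 T : 'M[C]_2, g p = T *m T^T & \det T = eta p o0 o1.
  have : \det T0 ^+ 2 = eta p o0 o1 ^+ 2 by rewrite (eta_sqr hg heta) GT0 det_mulmx det_tr expr2.
  move/eqP; rewrite eqf_sqr => /orP[/eqP e|/eqP e]; first by exists T0.
  pose r : 'M[C]_2 := m2 1 0 0 (-1).
  have rr : r *m r^T = 1%:M.
    have -> : r^T = r by apply/matrixP; apply: ord2_ind; apply: ord2_ind; rewrite !mxE.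
    by rewrite m2_mul m2_1; congr m2; ring.
  exists (T0 *m r); first by rewrite trmx_mul mulmxA -(mulmxA T0) rr mulmx1.
  by rewrite det_mulmx m2_det e; ring.
have gE i j : metric_coef g (chart_at p) i j p = \sum_k T i k * T j k.
  by rewrite metric_own GT mxE; apply: eq_bigr => k _; rewrite [in LHS]mxE.
exists (gram_mx 1 (T o0 o0) (T o0 o1) (T o1 o0) (T o1 o1) 1).
  apply: (etrans (gram_congr _ _ _ _ _ _ _ _ _ _)).
  apply: gram_eq; rewrite gE sum_ord2; move: (T o0 o0) (T o0 o1) (T o1 o0) (T o1 o1) => *; ring.
by rewrite gram_det_mul -DT det2.
Qed.

Hypothesis sc : simply_connected S.

(** The global solution with a suitable initial frame keeps its Gram matrix and
    its orientation. *)
Theorem exists_immersion : integrable g Psi nabla -> exists sigma : S -> 'M[C]_2,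
  isometric_immersion g sigma /\ shape_operator g eta sigma Psi.
Proof.
move=> flat; have [p0 _] := surface_nonempty S.
have [J0 J0Q DJ0] := initial_frame p0.
have uJ0 : J0 \in unitmx.
  have [T [GT uT]] := gram_factor hg p0.
  rewrite unitmxE unitfE DJ0 -sqrf_eq0 (eta_sqr hg heta) GT det_mulmx det_tr.
  by rewrite mulf_neq0 // -unitfE -unitmxE.
have [f [n [sol F0 u]]] := global_frame hg hnabla hPsi flat sc p0 uJ0.
have [sf sn] := solution_smooth sol.
have gq q : frame_gram g f n q = Qmx C.
  have -> : frame_gram g f n q = frame_gram g f n p0.
    apply: (locally_constant (A := setT)) => //; first exact: surface_connected.
    by move=> x _; exact: (frame_gram_const hg hnabla openT (I : setT x) sol (fun q _ => u q)).
  by rewrite /frame_gram F0; apply/(gram_inverse _ _ uJ0).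
have mf : moving_frame g f n.
  by move=> q; apply/(gram_inverse _ _ (u q)); exact: gq.
exists (fun q => mat (f q)); apply: (immersion_of_solution hg heta sol mf).
by apply: (orientation_const sf sn mf (p0 := p0)); rewrite F0.
Qed.

(** The frames of two immersions differ by a constant matrix, which preserves
    the form and the orientation and so is the action of a pair (A, B). *)
Theorem unique_immersion (sigma sigma' : S -> 'M[C]_2) :
  isometric_immersion g sigma -> shape_operator g eta sigma Psi ->
  isometric_immersion g sigma' -> shape_operator g eta sigma' Psi ->
  exists A B : 'M[C]_2, [/\ SL2 A, SL2 B & forall p, sigma' p = A *m sigma p *m invmx B].
Proof.
move=> iso sh iso' sh'; have [p0 _] := surface_nonempty S.
have [f [n [sol mf _ or sE]]] := solution_of_immersion hg hnabla hPsi hadj heta iso sh.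
have [f' [n' [sol' mf' _ or' sE']]] := solution_of_immersion hg hnabla hPsi hadj heta iso' sh'.
have u q := frame_unit_moving hg q mf.
pose L q := invmx (frame f n q) *m frame f' n' q.
have LC q : L q = L p0.
  apply: (locally_constant (A := setT)) => //; first exact: surface_connected.
  by move=> x _; exact: (frame_ratio openT openT (I : setT x) (I : setT x) sol sol' (fun q _ => u q)).
have JL q : frame f' n' q = frame f n q *m L p0 by rewrite -(LC q) /L mulKVmx.
have LQ : L p0 *m Qmx C *m (L p0)^T = Qmx C.
  have := mf' p0; rewrite JL -(mf p0) => H; exact: (congr_cancel (u p0) H).
have DL : \det (L p0) = 1.
  have := or' p0; rewrite JL det_mulmx or => /eqP; rewrite -subr_eq0 -{2}[eta p0 o0 o1]mulr1 -mulrBr.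
  rewrite mulf_eq0 subr_eq0 => /orP[/eqP e|/eqP //].
  by have := u p0; rewrite unitmxE unitfE or e eqxx.
have [A [B [DA DB AB]]] := so4_spin (i_sqr R) (two_neq0 R) (@sqrt_exists R) LQ DL.
exists A, B; split=> // p; rewrite sE' sE -AB (matK (i_sqr R) (two_neq0 R)); congr mat.
by rewrite (frame_position p f' n') JL mulmxA -frame_position.
Qed.

End Orientation.

Theorem corollary6p4p3 (R : realType) (S : surface R)
    (g Psi eta : S -> 'M[R[i]]_2) (nabla : field S -> field S -> field S)
    (K : S -> R[i])
    (hS : simply_connected S)
    (hg : complex_metric g)
    (hnabla : levi_civita g nabla)
    (hK : curvature g nabla K)
    (hPsi : bundle_hom Psi)
    (hadj : self_adjoint g Psi)
    (heta : area_form g eta) :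
  ((codazzi nabla Psi /\ (forall p : S, K p = -1 + \det (Psi p))) <->
   (exists sigma : S -> 'M[R[i]]_2,
      isometric_immersion g sigma /\ shape_operator g eta sigma Psi)) /\
  (forall sigma sigma' : S -> 'M[R[i]]_2,
     isometric_immersion g sigma -> shape_operator g eta sigma Psi ->
     isometric_immersion g sigma' -> shape_operator g eta sigma' Psi ->
     exists A B : 'M[R[i]]_2,
       [/\ SL2 A, SL2 B & forall p : S, sigma' p = A *m sigma p *m invmx B]).
Proof.
split; last by move=> sigma sigma'; exact: (unique_immersion hg hnabla hPsi hadj heta).
split=> [/(integrableP hg hnabla hPsi hadj hK)|[sigma [iso sh]]].
  exact: (exists_immersion hg hnabla hPsi heta hS).
apply/(integrableP hg hnabla hPsi hadj hK).
by have [f [n [_ _ flat _ _]]] := solution_of_immersion hg hnabla hPsi hadj heta iso sh.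
Qed.
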